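(* Suppose $1\le p,q<\infty$ and let $g\in L^2(\mathbb{R}^l)$ be such that $G(g)=\{e^{2\pi i n\cdot x}g(x-m)\}_{(m,n)\in\mathbb{Z}^{2l}}$ is a Riesz basis for $L^2(\mathbb{R}^l)$. Let $\tau=\frac1p+\frac1q$. Then there is a constant $C>0$ depending only on the Riesz basis bounds of $G(g)$ such that for any $1\le k\le l$ and any $2\le T<\infty$ the following inequalities hold. (i) If $\tau<1$, then $$\frac{C(1-2^{\tau-1})}{1-\tau}\,T^{1-\tau}\ \le\ \int_{\mathbb{R}^l}\min(|x_k|^p,T)|g(x)|^2\,dx+\int_{\mathbb{R}^l}\min(|\xi_k|^q,T)|\widehat g(\xi)|^2\,d\xi .$$ (ii) If $\tau=1$, then $$C\log(T)\ \le\ \int_{\mathbb{R}^l}\min(|x_k|^p,T)|g(x)|^2\,dx+\int_{\mathbb{R}^l}\min(|\xi_k|^q,T)|\widehat g(\xi)|^2\,d\xi .$$ (iii) If $\tau>1$, then $$\frac{C}{\tau-1}\ \le\ \int_{\mathbb{R}^l}|x_k|^p|g(x)|^2\,dx+\int_{\mathbb{R}^l}|\xi_k|^q|\widehat g(\xi)|^2\,d\xi .$$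
   Context: $\widehat g$ denotes the Fourier transform on $L^2(\mathbb{R}^l)$, normalized as $\widehat g(\xi)=\int_{\mathbb{R}^l}g(x)e^{-2\pi i x\cdot\xi}\,dx$ for $g\in L^1\cap L^2$. Riesz basis bounds of a Riesz basis $\{h_n\}$ of a Hilbert space $\mathcal{H}$ are constants $0<A\le B<\infty$ with $A\sum_n|c_n|^2\le\|\sum_nc_nh_n\|_{\mathcal H}^2\le B\sum_n|c_n|^2$ for all square-summable scalar sequences $(c_n)$. *)

(* Defs.v *)
From HB Require Import structures.
From mathcomp Require Export all_boot all_order all_algebra finmap.
From mathcomp Require Export all_classical all_reals all_analysis complex.

Set Implicit Arguments.
Unset Strict Implicit.
Unset Printing Implicit Defensive.

Export Order.TTheory GRing.Theory Num.Theory.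
Export numFieldNormedType.Exports.

Local Open Scope classical_set_scope.
Local Open Scope ereal_scope.
Local Open Scope ring_scope.

(* R^l, with the product of the Borel sigma-algebras; every class of a.e. equal
   Lebesgue measurable functions has a representative measurable for it. *)
Notation Rspace R l := (l.-tuple (measurableTypeR R)).

Section tuple_lebesgue.
Context {R : realType}.

Definition cons_pair l (p : measurableTypeR R * Rspace R l) : Rspace R l.+1 :=
  [tuple of p.1 :: p.2].

Definition uncons_pair l (x : Rspace R l.+1) : measurableTypeR R * Rspace R l :=
  (thead x, [tuple of behead x]).

Lemma measurable_cons_pair l : measurable_fun setT (@cons_pair l).
Proof. exact: (measurable_cons measurable_fst measurable_snd). Qed.

Lemma measurable_uncons_pair l : measurable_fun setT (@uncons_pair l).
Proof.
apply: measurable_fun_pair; first exact: measurable_tnth.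
exact: measurable_behead.
Qed.

Lemma cons_pairK l : cancel (@cons_pair l) (@uncons_pair l).
Proof. by case=> a x; congr pair => //; apply: val_inj. Qed.

Lemma uncons_pairK l : cancel (@uncons_pair l) (@cons_pair l).
Proof. by move=> x; rewrite [RHS]tuple_eta. Qed.

Section pushforward_cons.
Variables (l : nat) (mu : {sigma_finite_measure set (Rspace R l) -> \bar R}).

Definition lebesgue_cons : set (Rspace R l.+1) -> \bar R :=
  pushforward (lebesgue_measure \x mu)%E (@cons_pair l).

Let lebesgue_cons0 : lebesgue_cons set0 = 0%E.
Proof. by rewrite /lebesgue_cons /pushforward preimage_set0 measure0. Qed.

Let lebesgue_cons_ge0 A : (0 <= lebesgue_cons A)%E.
Proof. exact: (@measure_ge0 _ _ _ (lebesgue_measure \x mu)%E). Qed.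

Let lebesgue_cons_sigma_additive : semi_sigma_additive lebesgue_cons.
Proof.
have mP A : measurable A -> measurable (@cons_pair l @^-1` A).
  by move=> mA; rewrite -[X in measurable X]setTI; exact: measurable_cons_pair.
move=> F mF tF mUF; rewrite /lebesgue_cons /pushforward preimage_bigcup.
apply: measure_semi_sigma_additive.
- by move=> n; exact: mP.
- apply/trivIsetP => /= i j _ _ ij; rewrite -preimage_setI.
  by move/trivIsetP : tF => /(_ _ _ _ _ ij) ->//; rewrite preimage_set0.
- by rewrite -preimage_bigcup; exact: mP.
Qed.

HB.instance Definition _ := isMeasure.Build _ _ _ lebesgue_cons
  lebesgue_cons0 lebesgue_cons_ge0 lebesgue_cons_sigma_additive.

Let lebesgue_cons_sigma_finite : sigma_finite setT lebesgue_cons.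
Proof.
have /sigma_finiteP[F [TF ndF Foo]] := sigma_finiteT (@lebesgue_measure R).
have /sigma_finiteP[G [TG ndG Goo]] := sigma_finiteT mu.
exists (fun n => @uncons_pair l @^-1` (F n `*` G n)).
  apply/esym; rewrite -subTset => x _.
  have [n _ Fn] : (\bigcup_n F n) (uncons_pair x).1 by rewrite -TF.
  have [k _ Gk] : (\bigcup_n G n) (uncons_pair x).2 by rewrite -TG.
  exists (maxn n k) => //; split => /=.
  - by move: Fn; exact/subsetPset/ndF/leq_maxl.
  - by move: Gk; exact/subsetPset/ndG/leq_maxr.
move=> k; have [mF Fk] := Foo k; have [mG Gk] := Goo k; split.
  rewrite -[X in measurable X]setTI.
  by apply: measurable_uncons_pair => //; exact: measurableX.
rewrite /lebesgue_cons /pushforward -comp_preimage.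
rewrite (_ : _ \o _ = id) ?preimage_id; last first.
  by apply/funext => x /=; rewrite cons_pairK.
by rewrite product_measure1E// lte_mul_pinfty// ge0_fin_numE.
Qed.

HB.instance Definition _ := Measure_isSigmaFinite.Build _ _ _ lebesgue_cons
  lebesgue_cons_sigma_finite.

End pushforward_cons.

Fixpoint lebesgue_tuple l : {sigma_finite_measure set (Rspace R l) -> \bar R} :=
  match l with
  | 0 => \d_([tuple] : Rspace R 0)
  | l'.+1 => lebesgue_cons (lebesgue_tuple l')
  end.

End tuple_lebesgue.

Notation normc := (@ComplexField.Normc.normc _).

Section complex_L2.
Context d (T : measurableType d) (R : realType).
Variable mu : {measure set T -> \bar R}.

Definition cmeasurable (f : T -> R[i]) :=
  measurable_fun setT (fun x => complex.Re (f x)) /\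
  measurable_fun setT (fun x => complex.Im (f x)).

Definition cintegral (f : T -> R[i]) : R[i] :=
  Complex (Rintegral mu setT (fun x => complex.Re (f x)))
          (Rintegral mu setT (fun x => complex.Im (f x))).

Definition L1fun (f : T -> R[i]) :=
  cmeasurable f /\ (\int[mu]_x (normc (f x))%:E < +oo)%E.

Definition L2sqnorm (f : T -> R[i]) : \bar R :=
  (\int[mu]_x (normc (f x) ^+ 2)%:E)%E.

Definition L2fun (f : T -> R[i]) := cmeasurable f /\ (L2sqnorm f < +oo)%E.

Definition L2sqdist (f g : T -> R[i]) : \bar R := L2sqnorm (fun x => f x - g x).

Section families.
Context (I : choiceType).
Implicit Types (h : I -> T -> R[i]) (c : I -> R[i]).

Definition lincomb h (F : {fset I}) c : T -> R[i] :=
  fun x => \sum_(i <- F) c i * h i x.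

Definition sqsum c : \bar R := (\esum_(i in [set: I]) (normc (c i) ^+ 2)%:E)%E.

(* Unconditional convergence in L^2: the index set carries no ordering. *)
Definition L2_has_sum h c (s : T -> R[i]) :=
  forall e : R, 0 < e -> exists F0 : {fset I}, forall F : {fset I},
    (F0 `<=` F)%fset -> (L2sqdist (lincomb h F c) s < e%:E)%E.

Definition L2_complete h :=
  forall f, L2fun f -> forall e : R, 0 < e -> exists (F : {fset I}) c,
    (L2sqdist (lincomb h F c) f < e%:E)%E.

(* A and B need not be the optimal bounds. *)
Definition L2_riesz_basis h (A B : R) :=
  [/\ forall i, L2fun (h i), L2_complete h, 0 < A, A <= B &
    forall c, (sqsum c < +oo)%E ->
      exists2 s, L2fun s /\ L2_has_sum h c s &
        (A%:E * sqsum c <= L2sqnorm s <= B%:E * sqsum c)%E].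

End families.
End complex_L2.

Section gabor_fourier.
Context {R : realType} {l : nat}.
Implicit Types (x xi : Rspace R l) (f g h : Rspace R l -> R[i]).

Definition cexpi (t : R) : R[i] := Complex (cos t) (sin t).

Definition tdot x xi : R := \sum_(i < l) (tnth x i : R) * (tnth xi i : R).

Definition tsub x xi : Rspace R l :=
  [tuple ((tnth x i : R) - (tnth xi i : R)) | i < l].

Definition tint (m : l.-tuple int) : Rspace R l :=
  [tuple ((tnth m i)%:~R : R) | i < l].

Definition gabor g (mn : l.-tuple int * l.-tuple int) : Rspace R l -> R[i] :=
  fun x => cexpi (2 * pi * tdot (tint mn.2) x) * g (tsub x (tint mn.1)).

Definition fourier f : Rspace R l -> R[i] :=
  fun xi => cintegral (lebesgue_tuple l)
    (fun x => f x * cexpi (- (2 * pi * tdot x xi))).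

(* [h] represents the Fourier transform of the class of [g] in L^2: the graph
   of the L^2 transform is the closure in L^2 x L^2 of the graph of the
   integral transform on the intersection of L^1 and L^2. *)
Definition L2_fourier g h :=
  [/\ L2fun (lebesgue_tuple l) g, L2fun (lebesgue_tuple l) h &
    exists u : nat -> Rspace R l -> R[i],
    [/\ forall n, L1fun (lebesgue_tuple l) (u n) /\
                  L2fun (lebesgue_tuple l) (u n),
        L2sqdist (lebesgue_tuple l) (u n) g @[n --> \oo] --> 0%E &
        L2sqdist (lebesgue_tuple l) (fourier (u n)) h @[n --> \oo] --> 0%E]].

End gabor_fourier.

(* Main.v *)
(* The heart is a quantitative Balian-Low inequality: for Q, P >= 1,
     int_{|x_k| >= Q} |g|^2 + int_{|xi_k| >= P} |ghat|^2 >= c / (Q P),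
   with c depending on the Riesz bounds only.  Truncate and smooth g: a Fourier
   multiplier in xi_k at frequency about P, and a cut-off in x_k at about Q.
   The Zak transform of the result is quasi-periodic and varies slowly on a grid
   of about Q P points per cell, so a winding number argument forces a near zero
   at some point of every such grid.  The lower Riesz bound, localized by
   trigonometric approximation of indicator functions to the corresponding sets,
   forbids near zeros of the Zak transform of g itself; hence the smoothing error
   is at least c / (Q P), and Plancherel bounds this error by the two tails.
   The theorem follows by inserting Q = 2^(j/p), P = 2^(j/q) and summing
   2^j c 2^(-j tau) over the dyadic scales j. *)

(* The Zak transform of an L^2 function is defined only almost everywhere, while a winding number
   needs values at points. Each base point (x, y) therefore carries its own array, indexed by K
   translations of step 1/K in x_k and L of step 1/L in y_k, and null sets are discarded for
   finitely many grid points at a time. All lattice sums become finite after a truncation whose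
   error is sent to 0 last. The near zero depends on the base point; the K L sets of base points,
   one for each grid point, cover the cube, and this union costs the factor K L, comparable to Q P:
   that is where 1/(Q P) comes from. Smoothing makes the array vary slowly because the upper Riesz
   bound makes the Zak transform bounded. This needs kernels whose l^1 norm is bounded independently
   of the scale, which excludes Dirichlet kernels and leads to those of de la Vallee-Poussin.
   Smoothing in y_k does not commute with the quasi-periodic phase; the defect is a first moment of
   the kernel, small once the cut-off in x_k is wide. *)
From HB Require Import structures.
Require Import Defs.
From mathcomp Require Import all_boot all_order all_algebra.
From mathcomp Require Import all_classical all_reals all_analysis complex.
From mathcomp Require Import measurable_realfun zify ring lra.
Import Order.TTheory GRing.Theory Num.Theory.
Import numFieldNormedType.Exports.

Set Implicit Arguments.
Unset Strict Implicit.
Unset Printing Implicit Defensive.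

Local Open Scope ring_scope.

(** * Complex numbers, characters and their orthogonality *)

Section complex_numbers.
Context {R : realType}.
Implicit Types (z w : R[i]) (t : R).

(** Squared moduli are polynomials in the two coordinates, which brings most pointwise estimates
    within reach of [ring] and [nra]. *)
Definition nsq z : R := normc z ^+ 2.

Lemma nsqE z : nsq z = complex.Re z ^+ 2 + complex.Im z ^+ 2.
Proof. by case: z => a b; rewrite /nsq /= sqr_sqrtr// addr_ge0// sqr_ge0. Qed.

Lemma nsq_ge0 z : 0 <= nsq z. Proof. exact: sqr_ge0. Qed.

Lemma nsq0 : nsq 0 = 0. Proof. by rewrite nsqE /= !expr0n addr0. Qed.

Lemma nsq1 : nsq 1 = 1. Proof. by rewrite nsqE /= expr0n expr1n addr0. Qed.

Lemma nsqM z w : nsq (z * w) = nsq z * nsq w.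
Proof. by case: z => a b; case: w => c d; rewrite !nsqE /=; ring. Qed.

Lemma nsqN z : nsq (- z) = nsq z.
Proof. by case: z => a b; rewrite !nsqE /= !sqrrN. Qed.

Lemma nsqV z : nsq z^-1 = (nsq z)^-1.
Proof.
have [->|z0] := eqVneq z 0; first by rewrite invr0 nsq0 invr0.
have h : nsq z * nsq z^-1 = 1 by rewrite -nsqM divff// nsq1.
have n0 : nsq z != 0.
  by apply/eqP => n0; move: h; rewrite n0 mul0r => /esym/eqP; rewrite oner_eq0.
by apply: (mulfI n0); rewrite h divff.
Qed.

Lemma nsq_real (r : R) : nsq r%:C%C = r ^+ 2.
Proof. by rewrite nsqE /= expr0n addr0. Qed.

Lemma nsq_conj z : nsq z^*%C = nsq z.
Proof. by case: z => a b; rewrite !nsqE /= sqrrN. Qed.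

Lemma nsq_mulconj z : z * z^*%C = (nsq z)%:C%C.
Proof. by case: z => a b; rewrite nsqE; simpc; congr Complex => /=; ring. Qed.

Lemma nsqD z w : nsq (z + w) = nsq z + nsq w + 2 * complex.Re (z * w^*%C).
Proof. by case: z => a b; case: w => c d; rewrite !nsqE /=; ring. Qed.

Lemma nsqB z w : nsq (z - w) = nsq z + nsq w - 2 * complex.Re (z * w^*%C).
Proof. by case: z => a b; case: w => c d; rewrite !nsqE /=; ring. Qed.

Lemma nsqD_le z w : nsq (z + w) <= 2 * nsq z + 2 * nsq w.
Proof.
case: z => a b; case: w => c d; rewrite !nsqE /=.
have := sqr_ge0 (a - c); have := sqr_ge0 (b - d); nra.
Qed.

Lemma nsqB_le z w : nsq (z - w) <= 2 * nsq z + 2 * nsq w.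
Proof. by rewrite -(nsqN w); exact: nsqD_le. Qed.

(** Cauchy-Schwarz against the constant 1; the induction step is the weighted arithmetic-geometric
    inequality [h], with the length of the tail as weight. *)
Lemma nsq_sum_le (I : eqType) (s : seq I) (f : I -> R[i]) :
  nsq (\sum_(i <- s) f i) <= (size s)%:R * \sum_(i <- s) nsq (f i).
Proof.
elim: s => [|a s IH]; first by rewrite !big_nil nsq0 mulr0.
rewrite !big_cons /= nsqD.
set S := \sum_(i <- s) f i in IH *; set Q := \sum_(i <- s) nsq (f i) in IH *.
have h n (z w : R[i]) : 2 * n%:R * complex.Re (z * w^*%C) <=
    n%:R ^+ 2 * nsq z + nsq w.
  case: z => p q; case: w => u v; rewrite !nsqE /=.
  have := sqr_ge0 (n%:R * p - u); have := sqr_ge0 (n%:R * q - v); nra.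
have [s0|s0] := eqVneq s [::].
  by rewrite /S /Q s0 !big_nil nsq0 conjc0 mulr0 /=; nra.
have n0 : 0 < (size s)%:R :> R by rewrite ltr0n lt0n size_eq0.
have := h (size s) (f a) S; rewrite -natr1.
have := nsq_ge0 (f a); set n := (size s)%:R in n0 IH *.
move=> fa0 hh; rewrite -(ler_pM2l n0); nra.
Qed.

Lemma normc_sum_le (I : eqType) (s : seq I) (f : I -> R[i]) :
  normc (\sum_(i <- s) f i) <= \sum_(i <- s) normc (f i).
Proof.
elim: s => [|a s IH]; first by rewrite !big_nil ComplexField.Normc.normc0.
rewrite !big_cons (le_trans (le_normcD _ _))// lerD2l//.
Qed.

Lemma normc_ge0 z : 0 <= normc z.
Proof. by case: z => a b; exact: sqrtr_ge0. Qed.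

Lemma normc_le z (b : R) : 0 <= b -> (normc z <= b) = (nsq z <= b ^+ 2).
Proof.
by move=> b0; rewrite /nsq ler_pXn2r// nnegrE; exact: normc_ge0.
Qed.

Lemma normc_nsq1 z : nsq z = 1 -> normc z = 1.
Proof.
move=> h; apply/eqP; rewrite -(@eqrXn2 _ 2)//; first by rewrite -/(nsq z) h expr1n.
exact: normc_ge0.
Qed.

Lemma conjcM z w : (z * w)^*%C = z^*%C * w^*%C.
Proof. exact: rmorphM. Qed.

Lemma conjc_sum (I : eqType) (s : seq I) (f : I -> R[i]) :
  (\sum_(i <- s) f i)^*%C = \sum_(i <- s) (f i)^*%C.
Proof. exact: rmorph_sum. Qed.

Definition ee t : R[i] := cexpi (2 * pi * t).

Lemma cexpiD (s t : R) : cexpi (s + t) = cexpi s * cexpi t.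
Proof. by rewrite /cexpi cosD sinD; simpc; congr Complex; ring. Qed.

Lemma eeD (s t : R) : ee (s + t) = ee s * ee t.
Proof. by rewrite /ee mulrDr cexpiD. Qed.

Lemma ee0 : ee 0 = 1. Proof. by rewrite /ee mulr0 /cexpi cos0 sin0. Qed.

Lemma nsq_ee t : nsq (ee t) = 1. Proof. by rewrite nsqE /= cos2Dsin2. Qed.

Lemma normc_ee t : normc (ee t) = 1. Proof. exact/normc_nsq1/nsq_ee. Qed.

Lemma eeN t : ee (- t) = (ee t)^*%C.
Proof. by rewrite /ee mulrN /cexpi cosN sinN. Qed.

Lemma ee_nat (n : nat) : ee n%:R = 1.
Proof.
elim: n => [|n IH]; first exact: ee0.
rewrite -natr1 eeD IH mul1r /ee mulr1 mulr_natl.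
by rewrite /cexpi cos2pi sin2pi.
Qed.

Lemma ee_int (n : int) : ee n%:~R = 1.
Proof.
case: n => n; first exact: ee_nat.
by rewrite NegzE mulrNz eeN ee_nat conjc1.
Qed.

Lemma ee_sum (I : eqType) (s : seq I) (f : I -> R) :
  ee (\sum_(i <- s) f i) = \prod_(i <- s) ee (f i).
Proof.
elim: s => [|a s IH]; first by rewrite !big_nil ee0.
by rewrite !big_cons eeD IH.
Qed.

Lemma eeX t (n : nat) : ee t ^+ n = ee (n%:R * t).
Proof.
elim: n => [|n IH]; first by rewrite mul0r ee0.
by rewrite exprS IH -eeD -natr1 mulrDl mul1r addrC.
Qed.

Lemma nsq_ee_sub1 t : nsq (ee t - 1) = 2 - 2 * cos (2 * pi * t).
Proof.
rewrite nsqE /=; have := cos2Dsin2 (2 * pi * t).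
by rewrite subr0; nra.
Qed.

Lemma ler_sin_id (x : R) : 0 <= x -> sin x <= x.
Proof.
move=> x0; have [->|xn0] := eqVneq x 0; first by rewrite sin0.
have xp : 0 < x by rewrite lt_neqAle eq_sym xn0.
have [c _] := @MVT _ (@sin R) cos 0 x xp (fun y _ => is_derive_sin y)
  (continuous_subspaceT (@continuous_sin R)).
rewrite sin0 !subr0 => ->; rewrite ler_piMl//; exact: cos_le1.
Qed.

Lemma ler_norm_sin (x : R) : sin x ^+ 2 <= x ^+ 2.
Proof.
have h (y : R) : 0 <= y -> sin y ^+ 2 <= y ^+ 2.
  move=> y0; rewrite -(real_normK (num_real (sin y))) ler_pXn2r ?nnegrE//.
  rewrite ler_norml ler_sin_id// andbT.
  have [y1|y1] := leP y pi.
    by rewrite (@le_trans _ _ 0) ?oppr_le0// sin_ge0_pi// y0.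
  rewrite (le_trans _ (sin_geN1 _))// lerN2; apply: ltW; apply: le_lt_trans y1.
  by apply: le_trans (pi_ge2 _); rewrite ler1n.
have [x0|x0] := leP 0 x; first exact: h.
by rewrite -sqrrN -sinN -(sqrrN x) h// oppr_ge0 ltW.
Qed.

Lemma nsq_ee_sub1_le t : nsq (ee t - 1) <= (2 * pi * t) ^+ 2.
Proof.
rewrite nsq_ee_sub1.
have -> : 2 * pi * t = (pi * t) *+ 2 by rewrite mulr2n; ring.
rewrite cos_mulr2n; have := ler_norm_sin (pi * t); rewrite sin2cos2; nra.
Qed.

(** From $|e(t) - 1|^2 = 4 \sin^2(\pi t)$, writing e(t) for [ee t]. *)
Lemma ee_neq1 t : 0 < t < 1 -> ee t != 1.
Proof.
move=> /andP[t0 t1]; apply/eqP => h.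
have : nsq (ee t - 1) = 0 by rewrite h subrr nsq0.
rewrite nsq_ee_sub1.
have -> : 2 * pi * t = (pi * t) *+ 2 by rewrite mulr2n; ring.
rewrite cos_mulr2n; have := cos2Dsin2 (pi * t) => h1 h2.
have : 0 < sin (pi * t).
  by apply: sin_gt0_pi; rewrite mulr_gt0 ?pi_gt0//= gtr_pMr ?pi_gt0.
by nra.
Qed.


(** Orthogonality of the characters of Z/N: a geometric sum whose ratio z satisfies z^N = 1.
    Reducing d modulo N writes z as e(t) with 0 <= t < 1, so that [ee_neq1] separates the two
    cases. *)
Lemma sum_ee_period (N : nat) (d : int) : (0 < N)%N ->
  \sum_(j < N) ee (d%:~R * (j%:R / N%:R)) =
  (if (N%:Z %| d)%Z then N%:R else 0) :> R[i].
Proof.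
move=> N0; have NR : (0 : R) < N%:R by rewrite ltr0n.
have NRn : (N%:R : R) != 0 by rewrite gt_eqF.
set z : R[i] := ee (d%:~R / N%:R).
have -> : \sum_(j < N) ee (d%:~R * (j%:R / N%:R)) = \sum_(j < N) z ^+ j.
  by apply: eq_bigr => j _; rewrite /z eeX; congr ee; ring.
have zE : z = ee ((d %% N%:Z)%Z%:~R / N%:R).
  rewrite /z {1}(divz_eq d N%:Z) rmorphD rmorphM /= mulrDl eeD.
  by rewrite mulfK// ee_int mul1r.
have d_ge0 : 0 <= (d %% N%:Z)%Z by rewrite modz_ge0// eqz_nat -lt0n.
have dN : (d %% N%:Z)%Z < N%:Z by rewrite ltz_pmod// ltz_nat.
case: ifPn => [/dvdz_mod0P d0|/dvdz_mod0P/eqP d0].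
  have -> : z = 1 by rewrite zE d0 mul0r ee0.
  under eq_bigr do rewrite expr1n.
  by rewrite sumr_const card_ord.
have zN : z ^+ N = 1 by rewrite /z eeX mulrC divfK// ee_int.
have z1 : z != 1.
  have dp : 0 < (d %% N%:Z)%Z by rewrite lt_neqAle eq_sym d0.
  rewrite zE; apply: ee_neq1; rewrite divr_gt0 ?ltr0z//=.
  by rewrite ltr_pdivrMr// mul1r -[ltRHS]/((N%:Z)%:~R) ltr_int.
have := subrX1 z N; rewrite zN subrr => /esym/eqP.
by rewrite mulf_eq0 subr_eq0 (negbTE z1) /= => /eqP.
Qed.

Lemma Re_sum (I : eqType) (s : seq I) (f : I -> R[i]) :
  complex.Re (\sum_(i <- s) f i) = \sum_(i <- s) complex.Re (f i).
Proof.
elim: s => [|a s IH]; first by rewrite !big_nil.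
by rewrite !big_cons -IH; case: (f a); case: (\sum_(i <- s) f i).
Qed.

End complex_numbers.

(** * Lattice points, boxes and the discrete Parseval identity *)

Section lattice.
Context {R : realType} {l : nat}.
Local Notation Z := (l.-tuple int).
Implicit Types (m n b : Z) (x y : Rspace R l).

Definition tadd x y : Rspace R l :=
  [tuple ((tnth x i : R) + (tnth y i : R)) | i < l].
Definition topp x : Rspace R l := [tuple (- (tnth x i : R)) | i < l].
Definition zadd m n : Z := [tuple tnth m i + tnth n i | i < l].
Definition zopp m : Z := [tuple - tnth m i | i < l].
Definition zsub m n : Z := [tuple tnth m i - tnth n i | i < l].

Lemma tuple_ext (T : Type) (u v : l.-tuple T) :
  (forall i, tnth u i = tnth v i) -> u = v.
Proof. exact: eq_from_tnth. Qed.

Lemma tdotDl (x x' y : Rspace R l) : tdot (tadd x x') y = tdot x y + tdot x' y.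
Proof.
by rewrite /tdot -big_split; apply: eq_bigr => i _; rewrite tnth_mktuple mulrDl.
Qed.

Lemma tdotDr (x y y' : Rspace R l) : tdot x (tadd y y') = tdot x y + tdot x y'.
Proof.
by rewrite /tdot -big_split; apply: eq_bigr => i _; rewrite tnth_mktuple mulrDr.
Qed.

Lemma tdotBl (x x' y : Rspace R l) : tdot (tsub x x') y = tdot x y - tdot x' y.
Proof.
rewrite /tdot -sumrN -big_split; apply: eq_bigr => i _.
by rewrite tnth_mktuple mulrBl.
Qed.

Lemma tdotC (x y : Rspace R l) : tdot x y = tdot y x.
Proof. by apply: eq_bigr => i _; rewrite mulrC. Qed.

Lemma tdot_int m n : exists k : int, tdot (tint m) (tint n) = k%:~R :> R.
Proof.
exists (\sum_(i < l) tnth m i * tnth n i).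
rewrite /tdot rmorph_sum; apply: eq_bigr => i _.
by rewrite !tnth_mktuple rmorphM.
Qed.

Lemma ee_tdot_int m n : ee (tdot (tint m) (tint n : Rspace R l)) = 1.
Proof. by have [k ->] := tdot_int m n; rewrite ee_int. Qed.

Lemma tint_add m n : tint (zadd m n) = tadd (tint m) (tint n).
Proof. by apply: tuple_ext => i; rewrite !tnth_mktuple rmorphD. Qed.

Lemma tint_sub m n : tint (zsub m n) = tsub (tint m) (tint n) :> Rspace R l.
Proof. by apply: tuple_ext => i; rewrite !tnth_mktuple rmorphB. Qed.

Lemma tsubE x y : tsub x y = tadd x (topp y).
Proof. by apply: tuple_ext => i; rewrite !tnth_mktuple. Qed.

Lemma taddA x y z : tadd x (tadd y z) = tadd (tadd x y) z.
Proof. by apply: tuple_ext => i; rewrite !tnth_mktuple addrA. Qed.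

Lemma taddC x y : tadd x y = tadd y x.
Proof. by apply: tuple_ext => i; rewrite !tnth_mktuple addrC. Qed.

Lemma taddK x y : tadd (tadd x y) (topp y) = x.
Proof. by apply: tuple_ext => i; rewrite !tnth_mktuple addrK. Qed.

Lemma zsubK m n : zadd (zsub m n) n = m.
Proof. by apply: tuple_ext => i; rewrite !tnth_mktuple subrK. Qed.

Lemma zaddK m n : zsub (zadd m n) n = m.
Proof. by apply: tuple_ext => i; rewrite !tnth_mktuple addrK. Qed.

Lemma zsubKK m n : zsub m (zsub m n) = n.
Proof. by apply: tuple_ext => i; rewrite !tnth_mktuple opprB addrC subrK. Qed.

Lemma zaddC m n : zadd m n = zadd n m.
Proof. by apply: tuple_ext => i; rewrite !tnth_mktuple addrC. Qed.

Definition zbox (o : int) (N : nat) : seq Z :=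
  [seq [tuple (o + (f i : nat)%:Z) | i < l] | f : {ffun 'I_l -> 'I_N}].

Lemma mem_zbox o N m :
  (m \in zbox o N) = [forall i, (o <= tnth m i < o + N%:Z)].
Proof.
apply/mapP/forallP => [[f _ ->] i|h].
  by rewrite tnth_mktuple lerDl ltrD2l ltz_nat ltn_ord.
have h' i : (`|(tnth m i - o)%R|%N < N)%N.
  have /andP[h1 h2] := h i.
  by rewrite -ltz_nat gez0_abs ?subr_ge0// ltrBlDl.
exists [ffun i => Ordinal (h' i)]; first by rewrite mem_enum.
apply: tuple_ext => i; rewrite tnth_mktuple ffunE /=.
by have /andP[h1 h2] := h i; rewrite gez0_abs ?subr_ge0// addrC subrK.
Qed.

Lemma zbox_uniq o N : uniq (zbox o N).
Proof.
rewrite map_inj_uniq ?enum_uniq// => f g /(congr1 (fun t => tnth t)) h.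
apply/ffunP => i; apply/val_inj; move: (congr1 (fun t => t i) h) => /=.
by rewrite !tnth_mktuple => /addrI [].
Qed.

Lemma size_zbox o N : size (zbox o N) = (N ^ l)%N.
Proof. by rewrite size_map -cardE card_ffun !card_ord. Qed.

(** Two index lists may differ off the support of the summand; this is how boxes are exchanged after
    a translation of the lattice. *)
Lemma eq_big_supp (V : nmodType) (T : eqType) (s1 s2 : seq T) (f : T -> V) :
  uniq s1 -> uniq s2 ->
  (forall t, f t != 0 -> (t \in s1) = (t \in s2)) ->
  \sum_(t <- s1) f t = \sum_(t <- s2) f t.
Proof.
move=> u1 u2 h.
have aux (s : seq T) : \sum_(t <- s) f t = \sum_(t <- [seq t <- s | f t != 0]) f t.
  rewrite big_filter [LHS](bigID (fun t => f t != 0))/= [X in _ + X]big1 ?addr0//.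
  by move=> t /negPn/eqP.
rewrite aux [RHS]aux; apply: perm_big; apply: uniq_perm; rewrite ?filter_uniq//.
by move=> t; rewrite !mem_filter; case: (boolP (f t != 0)) => //= /h ->.
Qed.

(** The frequency grid dual to a window of side N. *)
Definition ypt (N : nat) (f : {ffun 'I_l -> 'I_N}) : Rspace R l :=
  [tuple (((f i : nat)%:R : R) / N%:R) | i < l].

Lemma sum_ee_ypt (N : nat) m : (0 < N)%N ->
  (forall i, - N%:Z < tnth m i < N%:Z) ->
  \sum_(f : {ffun 'I_l -> 'I_N}) ee (tdot (tint m) (ypt f)) =
  (if m == [tuple (0 : int) | i < l] then (N ^ l)%:R else 0) :> R[i].
Proof.
move=> N0 hm.
under eq_bigr do rewrite /tdot ee_sum.
rewrite (eq_bigr (fun f : {ffun 'I_l -> 'I_N} =>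
   \prod_(i < l) (ee ((tnth m i)%:~R * ((f i)%:R / N%:R)) : R[i]))); last first.
  by move=> f _; apply: eq_bigr => i _; rewrite !tnth_mktuple.
rewrite -(bigA_distr_bigA (fun (i : 'I_l) (j : 'I_N) =>
  ee ((tnth m i)%:~R * (j%:R / N%:R)) : R[i])) /=.
under eq_bigr => i _.
  rewrite sum_ee_period//.
  have -> : (N%:Z %| tnth m i)%Z = (tnth m i == 0).
    apply/idP/eqP => [|->]; last exact: dvdz0.
    case/dvdzP => q hq; have := hm i; rewrite hq; case: q {hq} => [[|q]|q]; lia.
  over.
case: eqP => [->|/eqP m0].
  under eq_bigr do rewrite tnth_mktuple eqxx.
  by rewrite prodr_const card_ord natrX.
have [i hi] : exists i, tnth m i != 0.
  apply/existsP; apply: contraNT m0; rewrite negb_exists => /forallP h.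
  by apply/eqP/tuple_ext => i; rewrite tnth_mktuple; apply/eqP; rewrite -[_ == _]negbK h.
by rewrite (bigD1 i)//= (negbTE hi) mul0r.
Qed.

Lemma nsq_sumE (T : eqType) (s : seq T) (f : T -> R[i]) :
  (nsq (\sum_(t <- s) f t))%:C%C = \sum_(t <- s) \sum_(u <- s) f t * (f u)^*%C.
Proof.
rewrite -nsq_mulconj rmorph_sum mulr_suml; apply: eq_bigr => t _.
by rewrite mulr_sumr.
Qed.

(** Differences of frequencies lie strictly between -N and N, so distinct frequencies remain
    distinct modulo N and the cross terms vanish when summed over the grid. *)
Lemma finite_parseval (N : nat) (s : seq Z) (d : Z -> R[i]) : (0 < N)%N ->
  uniq s ->
  (forall m n, m \in s -> n \in s -> forall i, - N%:Z < tnth m i - tnth n i < N%:Z) ->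
  \sum_(f : {ffun 'I_l -> 'I_N}) nsq (\sum_(n <- s) d n * ee (tdot (tint n) (ypt f)))
  = (N ^ l)%:R * \sum_(n <- s) nsq (d n).
Proof.
move=> N0 us hs; apply: complexI; rewrite rmorph_sum rmorphM /= rmorph_nat.
under eq_bigr do rewrite nsq_sumE.
rewrite exchange_big /= rmorph_sum mulr_sumr.
rewrite big_seq [RHS]big_seq; apply: eq_bigr => m ms.
rewrite exchange_big /= (bigD1_seq m)//=.
have -> : \sum_(f : {ffun 'I_l -> 'I_N}) d m * ee (tdot (tint m) (ypt f)) * (d m * ee (tdot (tint m) (ypt f)))^*%C
    = (N ^ l)%:R * (nsq (d m))%:C%C :> R[i].
  under eq_bigr do rewrite nsq_mulconj nsqM nsq_ee mulr1.
  by rewrite sumr_const card_ffun !card_ord mulr_natl.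
rewrite big_seq_cond big1 ?addr0// => n /andP[ns nm].
under eq_bigr => f _.
  have -> : d m * ee (tdot (tint m) (ypt f)) * (d n * ee (tdot (tint n) (ypt f)))^*%C
     = d m * (d n)^*%C * ee (tdot (tint (zsub m n)) (ypt f)).
    by rewrite conjcM -eeN tint_sub tdotBl eeD; ring.
  over.
rewrite -mulr_sumr sum_ee_ypt//; last by move=> i; rewrite tnth_mktuple hs.
case: eqP => [h|]; last by rewrite mulr0.
case/eqP: nm; apply: tuple_ext => i; apply/esym/eqP; rewrite -subr_eq0.
by move: (congr1 (fun t => tnth t i) h); rewrite !tnth_mktuple => ->.
Qed.

End lattice.

(** * Winding numbers of quasi-periodic arrays *)

Section winding.
Context {R : realType}.
Implicit Types (z w : R[i]) (t : R).

(** An argument with values in (-pi/2, pi/2), correct on the right half-plane only; the ratios of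
    neighbouring array entries all lie there. *)
Definition carg z : R := atan (complex.Im z / complex.Re z).

Lemma carg_bound z : - (pi / 2) < carg z < pi / 2.
Proof. by rewrite atan_gtNpi2 atan_ltpi2. Qed.

Lemma cargP z : 0 < complex.Re z -> z = (normc z)%:C%C * cexpi (carg z).
Proof.
case: z => a b /= a0; rewrite /carg /=; set x := b / a.
have bE : b = x * a by rewrite /x divfK// gt_eqF.
have cx : 0 < cos (atan x) by apply: cos_gt0_pihalf; rewrite atan_gtNpi2 atan_ltpi2.
have sx : sin (atan x) = x * cos (atan x).
  by have := atanK x; rewrite /tan => {2}<-; rewrite divfK// gt_eqF.
have ab : Num.sqrt (a ^+ 2 + b ^+ 2) = a / cos (atan x).
  rewrite cos_atan invrK (_ : a ^+ 2 + b ^+ 2 = a ^+ 2 * (1 + x ^+ 2)); last first.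
    by rewrite bE; ring.
  by rewrite sqrtrM ?sqr_ge0// sqrtr_sqr gtr0_norm.
rewrite ab /cexpi; simpc; congr Complex; first by rewrite divfK// gt_eqF.
by rewrite sx mulrCA divfK ?gt_eqF.
Qed.

Lemma cexpi_eq1 t : `|t| < 2 * pi -> cexpi t = 1 -> t = 0.
Proof.
move=> tpi; have pi2 : 0 < 2 * pi :> R by rewrite mulr_gt0 ?pi_gt0.
have h (s : R) : 0 < s < 2 * pi -> cexpi s != 1.
  move=> /andP[s0 s1].
  rewrite (_ : cexpi s = ee (s / (2 * pi))).
    by apply: ee_neq1; rewrite divr_gt0//= ltr_pdivrMr// mul1r.
  by rewrite /ee mulrC divfK// gt_eqF.
move=> et; apply/eqP; apply: contraT => t0.
have [tp|tn] := ltP 0 t.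
  by move: (h t); rewrite et eqxx tp /=; apply; rewrite -(gtr0_norm tp).
have tn' : t < 0 by rewrite lt_neqAle t0.
have := h (- t); rewrite oppr_gt0 tn' -{1}(ltr0_norm tn') tpi => /(_ isT).
have -> : cexpi (- t) = (cexpi t)^*%C by rewrite /cexpi cosN sinN.
by rewrite et conjc1 eqxx.
Qed.

(** Uniqueness of polar coordinates; it turns an identity between products of ratios into an
    identity between sums of phases, with no multiple of 2 pi left over. *)
Lemma cexpi_uniq (a b s t : R) : 0 < a -> 0 < b -> `|s - t| < 2 * pi ->
  a%:C%C * cexpi s = b%:C%C * cexpi t -> s = t.
Proof.
move=> a0 b0 st h.
have n1 (u : R) : nsq (cexpi u) = 1 by rewrite nsqE /= cos2Dsin2.
have ab : a = b.
  have := congr1 nsq h; rewrite !nsqM !nsq_real !n1 !mulr1 => /eqP.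
  by rewrite eqrXn2 ?ltW// => /eqP.
have c0 : cexpi t != 0.
  by apply/eqP => c0; have := n1 t; rewrite c0 nsq0 => /esym/eqP; rewrite oner_eq0.
have a0' : a%:C%C != 0 :> R[i] by rewrite eq_complex /= gt_eqF.
have {}h : cexpi s = cexpi t by apply: (mulfI a0'); rewrite h ab.
apply/eqP; rewrite -subr_eq0; apply/eqP/cexpi_eq1 => //.
by apply: (mulIf c0); rewrite -cexpiD subrK mul1r.
Qed.

(** The ratio lies in the open unit disc around 1, hence in the right half-plane. *)
Lemma ratio_Re_gt0 z w : nsq (w - z) < nsq z -> 0 < complex.Re (w / z).
Proof.
move=> h; have z0 : z != 0.
  by apply/eqP => z0; move: h; rewrite z0 nsq0 ltNge nsq_ge0.
have : nsq (w / z - 1) < 1.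
  rewrite -(divff z0) -mulrBl nsqM nsqV ltr_pdivrMr ?mul1r//.
  exact: le_lt_trans (nsq_ge0 _) h.
by case: (w / z) => a b; rewrite nsqE /= subr0; nra.
Qed.

(* The sum of the phase increments of [F i] along j vanishes on every cell, so
   it does not depend on i, while quasi-periodicity shifts it by 2 pi. *)
Lemma quasiperiodic_jump (K L : nat) (F : nat -> nat -> R[i]) (y : R) :
  (2 < L)%N ->
  (forall i, (i <= K)%N -> F i L = F i 0%N) ->
  (forall j, (j <= L)%N -> F K j = ee (y + j%:R / L%:R) * F 0%N j) ->
  (forall i j, (i < K)%N -> (j <= L)%N -> nsq (F i.+1 j - F i j) < nsq (F i j)) ->
  (forall i j, (i <= K)%N -> (j < L)%N -> nsq (F i j.+1 - F i j) < nsq (F i j)) ->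
  False.
Proof.
move=> L2 FL FK dx dy.
pose a i j := carg (F i.+1 j / F i j).
pose b i j := carg (F i j.+1 / F i j).
have ratio z w : nsq (w - z) < nsq z ->
    [/\ z != 0, 0 < normc (w / z) & w = (normc (w / z))%:C%C * cexpi (carg (w / z)) * z].
  move=> h; have z0 : z != 0.
    by apply/eqP => z0; move: h; rewrite z0 nsq0 ltNge nsq_ge0.
  have r0 := ratio_Re_gt0 h; split => //.
  - rewrite lt_neqAle normc_ge0 andbT eq_sym; apply/eqP => /ComplexField.Normc.eq0_normc e.
    by move: r0; rewrite e ltxx.
  - by rewrite -cargP// divfK.
(* Both sides are phases of the same quotient across the cell. Each is a sum of two increments below
   pi/2 in modulus, so they differ by less than 2 pi and must agree. *)
have cell i j : (i < K)%N -> (j < L)%N -> a i j + b i.+1 j = b i j + a i j.+1.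
  move=> iK jL.
  have [z0 p1 e1] := ratio _ _ (dx i j iK (ltnW jL)).
  have [_ p2 e2] := ratio _ _ (dy i.+1 j iK jL).
  have [_ p3 e3] := ratio _ _ (dy i j (ltnW iK) jL).
  have [_ p4 e4] := ratio _ _ (dx i j.+1 iK jL).
  apply: (@cexpi_uniq (normc (F i.+1 j / F i j) * normc (F i.+1 j.+1 / F i.+1 j))
    (normc (F i j.+1 / F i j) * normc (F i.+1 j.+1 / F i j.+1))); rewrite ?mulr_gt0//.
    have := carg_bound (F i.+1 j / F i j); have := carg_bound (F i.+1 j.+1 / F i.+1 j).
    have := carg_bound (F i j.+1 / F i j); have := carg_bound (F i.+1 j.+1 / F i j.+1).
    by rewrite -/(a i j) -/(b i.+1 j) -/(b i j) -/(a i j.+1) ltr_norml; lra.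
  apply: (mulIf z0); rewrite !cexpiD !rmorphM /=.
  transitivity (F i.+1 j.+1).
    by rewrite [RHS]e2 -/(b i.+1 j) [X in _ = _ * X]e1 -/(a i j); ring.
  by rewrite [LHS]e4 -/(a i j.+1) [X in _ * X = _]e3 -/(b i j); ring.
pose S i := \sum_(j < L) b i j.
have S1 i : (i < K)%N -> S i.+1 = S i.
  move=> iK; apply/eqP; rewrite -subr_eq0 -sumrB.
  rewrite (eq_bigr (fun j : 'I_L => a i j.+1 - a i j)); last first.
    by move=> j _; have := cell i j iK (ltn_ord j); lra.
  rewrite -(big_mkord xpredT (fun j => a i j.+1 - a i j)) telescope_sumr//.
  by rewrite /a FL// ?FL ?subrr// ltnW.
have SK i : (i <= K)%N -> S i = S 0%N.
  by elim: i => // i IH iK; rewrite S1// IH// ltnW.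
have LR : (0 : R) < L%:R by rewrite ltr0n; lia.
(* Quasi-periodicity determines the increment modulo 2 pi. The two values of [b] differ by less than
   pi, and L > 2 keeps the shift 2 pi / L below pi, so the equality is exact. *)
have bK j : (j < L)%N -> b K j = b 0%N j + 2 * pi / L%:R.
  move=> jL.
  have [z0 p1 e1] := ratio _ _ (dy 0%N j (leq0n _) jL).
  have [zK p2 e2] := ratio _ _ (dy K j (leqnn _) jL).
  apply: (cexpi_uniq p2 p1).
    have := carg_bound (F K j.+1 / F K j); have := carg_bound (F 0%N j.+1 / F 0%N j).
    rewrite -/(b K j) -/(b 0%N j) ltr_norml.
    have : 2 * pi / L%:R < pi :> R.
      rewrite ltr_pdivrMr// mulrC ltr_pM2l ?pi_gt0//.
      by rewrite -[2]/(2%:R) ltr_nat.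
    have : 0 < 2 * pi / L%:R :> R by rewrite divr_gt0// mulr_gt0 ?pi_gt0.
    by have := @pi_gt0 R; lra.
  apply: (mulIf zK); rewrite -e2 FK// [X in _ * X = _]e1 (FK j); last exact: ltnW.
  have -> : ee (y + j.+1%:R / L%:R) = ee (y + j%:R / L%:R) * cexpi (2 * pi / L%:R).
    rewrite (_ : y + j.+1%:R / L%:R = (y + j%:R / L%:R) + L%:R^-1).
      by rewrite eeD.
    by rewrite -(natr1 j); ring.
  by rewrite cexpiD -/(b 0%N j); ring.
have := SK K (leqnn _); rewrite /S.
rewrite (eq_bigr (fun j : 'I_L => b 0%N j + 2 * pi / L%:R)); last by move=> j _; rewrite bK.
rewrite big_split /= sumr_const card_ord -[_ *+ L]mulr_natr divfK ?gt_eqF//.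
by have := @pi_gt0 R; lra.
Qed.

End winding.

(** * De la Vallee-Poussin kernels *)

Section kernel.
Context {R : realType}.

Lemma parseval1 (N : nat) (s : seq int) (d : int -> R[i]) : (0 < N)%N -> uniq s ->
  (forall m n, m \in s -> n \in s -> (N%:Z %| m - n)%Z -> m = n) ->
  \sum_(j < N) nsq (\sum_(n <- s) d n * ee (n%:~R * (j%:R / N%:R)))
  = N%:R * \sum_(n <- s) nsq (d n).
Proof.
move=> N0 us hs; apply: complexI; rewrite rmorph_sum rmorphM /= rmorph_nat.
under eq_bigr do rewrite nsq_sumE.
rewrite exchange_big /= rmorph_sum mulr_sumr.
rewrite big_seq [RHS]big_seq; apply: eq_bigr => m ms.
rewrite exchange_big /= (bigD1_seq m)//=.
have -> : \sum_(j < N) d m * ee (m%:~R * (j%:R / N%:R)) * (d m * ee (m%:~R * (j%:R / N%:R)))^*%C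
    = N%:R * (nsq (d m))%:C%C :> R[i].
  under eq_bigr do rewrite nsq_mulconj nsqM nsq_ee mulr1.
  by rewrite sumr_const card_ord mulr_natl.
rewrite big_seq_cond big1 ?addr0// => n /andP[ns nm].
under eq_bigr => j _.
  have -> : d m * ee (m%:~R * (j%:R / N%:R)) * (d n * ee (n%:~R * (j%:R / N%:R)))^*%C
     = d m * (d n)^*%C * ee ((m - n)%:~R * (j%:R / N%:R)).
    by rewrite conjcM -eeN rmorphB /= mulrBl eeD; ring.
  over.
rewrite -mulr_sumr sum_ee_period//; case: ifP => [h|_]; last by rewrite mulr0.
by move: nm; rewrite (hs m n ms ns h) eqxx.
Qed.

(** At most N consecutive frequencies are pairwise incongruent modulo N. *)
Lemma parseval1_ord (N n : nat) (o : int) (d : nat -> R[i]) : (0 < N)%N -> (n <= N)%N ->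
  \sum_(j < N) nsq (\sum_(r < n) d r * ee ((r%:Z + o)%:~R * (j%:R / N%:R)))
  = N%:R * \sum_(r < n) nsq (d r).
Proof.
move=> N0 nN.
pose s := [seq (r%:Z + o)%R | r <- iota 0 n].
pose d' (m : int) := d `|(m - o)%R|%N.
have E (V : nmodType) (f : int -> nat -> V) : \sum_(m <- s) f m `|(m - o)%R|%N = \sum_(r < n) f (r%:Z + o) r.
  rewrite -[RHS](big_mkord xpredT (fun r => f (r%:Z + o) r)) /index_iota subn0 big_map.
  apply: eq_bigr => r _.
  by rewrite addrK.
rewrite -(E _ (fun m r => nsq (d r))) -(@parseval1 N s d')//.
- apply: eq_bigr => j _; congr nsq.
  by rewrite -(E _ (fun m r => d r * ee (m%:~R * (j%:R / N%:R)))).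
- by rewrite map_inj_uniq ?iota_uniq// => u v /addIr [].
- move=> m m' /mapP[u]; rewrite mem_iota => /andP[_ un] -> /mapP[v].
  rewrite mem_iota => /andP[_ vn] ->.
  case/dvdzP => q hq; congr (_ + _); move: hq; case: q => [[|q]|q]; nia.
Qed.

Section vallee_poussin.
Variables (M N : nat).
Hypotheses (M0 : (0 < M)%N) (MN : (3 * M <= N)%N).

Let N0 : (0 < N)%N. Proof. lia. Qed.
Let MR : (0 : R) < M%:R. Proof. by rewrite ltr0n. Qed.
Let NR : (0 : R) < N%:R. Proof. by rewrite ltr0n. Qed.

Definition vpD (n : nat) (o : int) (j : int) : R[i] :=
  \sum_(r < n) ee ((r%:Z + o)%:~R * (j%:~R / N%:R)).

(* De la Vallee-Poussin kernel on Z/N: a product of Dirichlet kernels, so that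
   its l^1 norm is O(N) and its variation O(M), uniformly in N. *)
Definition vp (j : int) : R[i] :=
  (M%:R^-1)%:C%C * vpD (3 * M) (- M%:Z) j * (vpD M 0 j)^*%C.

Lemma vpD_parseval n o : (n <= N)%N -> \sum_(j < N) nsq (vpD n o j%:Z) = N%:R * n%:R.
Proof.
move=> nN; have := @parseval1_ord N n o (fun=> 1) N0 nN.
rewrite sumr_const card_ord nsq1 -[1 *+ n]/(n%:R) => <-.
by apply: eq_bigr => j _; congr nsq; apply: eq_bigr => r _; rewrite mul1r.
Qed.

(** A unit step multiplies the coefficient of the frequency m by e(m/N) - 1, of modulus at most 2 pi
    B / N; the rest is Parseval. *)
Lemma vpD_var n o (B : nat) : (n <= N)%N -> (forall r, (r < n)%N -> `|r%:Z + o| <= B%:Z) ->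
  \sum_(j < N) nsq (vpD n o (j%:Z + 1) - vpD n o j%:Z) <=
  N%:R * n%:R * (2 * pi * B%:R / N%:R) ^+ 2.
Proof.
move=> nN hB.
pose d r : R[i] := ee ((r%:Z + o)%:~R / N%:R) - 1.
have := @parseval1_ord N n o d N0 nN.
rewrite (eq_bigr (fun j : 'I_N => nsq (vpD n o (j%:Z + 1) - vpD n o j%:Z))); last first.
  move=> j _; congr nsq; rewrite /vpD -sumrB; apply: eq_bigr => r _.
  rewrite /d mulrBl mul1r -eeD; congr (ee _ - _).
  by rewrite rmorphD /=; ring.
move=> ->; rewrite -mulrA ler_wpM2l//.
have sc (x : R) : n%:R * x = \sum_(r < n) x by rewrite sumr_const card_ord mulr_natl.
rewrite sc ler_sum// => r _.
apply: le_trans (nsq_ee_sub1_le _) _.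
rewrite -[leLHS]real_normK ?num_real// ler_sqr ?nnegrE ?normr_ge0//; last first.
  by rewrite divr_ge0// !mulr_ge0// pi_ge0.
rewrite !normrM normfV (ger0_norm (pi_ge0 R)) ger0_norm// (ger0_norm (ler0n _ N)).
rewrite -!mulrA ler_wpM2l// ler_wpM2l ?pi_ge0// ler_wpM2r ?invr_ge0//.
by rewrite -intr_norm -[leRHS]/((B%:Z)%:~R) ler_int hB.
Qed.

Lemma vpD_periodic n o j : vpD n o (j + N%:Z) = vpD n o j.
Proof.
have h : (j + N%:Z)%:~R / N%:R = j%:~R / N%:R + 1 :> R.
  rewrite rmorphD /= mulrDl; congr (_ + _); rewrite divff// gt_eqF//.
apply: eq_bigr => r _; rewrite h mulrDr mulr1.
by rewrite eeD ee_int mulr1.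
Qed.

Lemma vp_periodic j : vp (j + N%:Z) = vp j.
Proof. by rewrite /vp !vpD_periodic. Qed.

Lemma normc_vp_le j (c : R) : 0 < c ->
  normc (vp j) <= M%:R^-1 * (c^-1 * nsq (vpD (3 * M) (- M%:Z) j) + c * nsq (vpD M 0 j)) / 2.
Proof.
move=> c0; rewrite /vp !ComplexField.Normc.normcM /nsq.
have -> : normc (M%:R^-1)%:C%C = M%:R^-1 :> R.
  by rewrite /= expr0n addr0 sqrtr_sqr ger0_norm// invr_ge0.
have -> : normc (vpD M 0 j)^*%C = normc (vpD M 0 j).
  by case: (vpD M 0 j) => a b /=; rewrite sqrrN.
rewrite -!mulrA ler_wpM2l ?invr_ge0// mulrA.
set u := normc _; set v := normc _.
have := sqr_ge0 (u - c * v); have : 0 < c^-1 by rewrite invr_gt0.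
have : c * c^-1 = 1 by rewrite divff// gt_eqF.
set c' := c^-1 => cc c'0 h; have : 0 <= c' * (u - c * v) ^+ 2 by rewrite mulr_ge0// ltW.
have -> : c' * (u - c * v) ^+ 2 = c' * u ^+ 2 - 2 * (c * c') * (u * v) + (c * c') * c * v ^+ 2 by ring.
rewrite cc; lra.
Qed.

(** The arithmetic-geometric inequality and Parseval for both factors give M^(-1) (3MN + MN) / 2 =
    2N, without the logarithm of a single Dirichlet kernel. *)
Lemma vp_l1 : \sum_(j < N) normc (vp j%:Z) <= 2 * N%:R.
Proof.
apply: le_trans.
  by apply: ler_sum => j _; exact: (normc_vp_le j%:Z ltr01).
under eq_bigr do rewrite invr1 !mul1r -mulrA mulrC -mulrA.
rewrite -mulr_suml big_split /= !vpD_parseval//; last by lia.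
rewrite natrM le_eqVlt; apply/orP; left; apply/eqP; field.
by rewrite gt_eqF.
Qed.

Lemma normc_vp j : normc (vp j) <= 3 * M%:R.
Proof.
have hD n o : normc (vpD n o j) <= n%:R.
  apply: le_trans (normc_sum_le _ _) _.
  under eq_bigr do rewrite normc_ee.
  by rewrite sumr_const card_ord.
rewrite /vp !ComplexField.Normc.normcM.
have -> : normc (M%:R^-1)%:C%C = M%:R^-1 :> R.
  by rewrite /= expr0n addr0 sqrtr_sqr ger0_norm// invr_ge0.
have -> : normc (vpD M 0 j)^*%C = normc (vpD M 0 j).
  by case: (vpD M 0 j) => a b /=; rewrite sqrrN.
apply: (@le_trans _ _ (M%:R^-1 * (3 * M)%:R * M%:R)).
  by rewrite ler_pM ?mulr_ge0 ?normc_ge0 ?invr_ge0// ler_wpM2l ?invr_ge0.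
by rewrite natrM [M%:R^-1 * _]mulrC -!mulrA mulVf ?mulr1// gt_eqF.
Qed.

Lemma vp_var : \sum_(j < N) normc (vp (j%:Z + 1) - vp j%:Z) <= 80 * M%:R.
Proof.
pose a j := vpD (3 * M) (- M%:Z) j; pose b j := vpD M 0 j.
(* Both factors have frequencies of modulus at most 2M, so by [vpD_var] a unit step costs the factor
   c in l^2. The product rule with this weight gives at most 5cN, and pi < 4 turns 5cN = 20 pi M
   into 80M. *)
pose c : R := 4 * pi * M%:R / N%:R.
have c0 : 0 < c by rewrite divr_gt0// !mulr_gt0 ?pi_gt0.
have amgm (u v : R) : 0 <= u -> 0 <= v -> u * v <= (c^-1 * u ^+ 2 + c * v ^+ 2) / 2.
  move=> u0 v0.
  have := sqr_ge0 (u - c * v); have : 0 < c^-1 by rewrite invr_gt0.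
  have : c * c^-1 = 1 by rewrite divff// gt_eqF.
  set c' := c^-1 => cc c'0 h; have : 0 <= c' * (u - c * v) ^+ 2 by rewrite mulr_ge0// ltW.
  have -> : c' * (u - c * v) ^+ 2 = c' * u ^+ 2 - 2 * (c * c') * (u * v) + (c * c') * c * v ^+ 2 by ring.
  rewrite cc; lra.
have pw j : normc (vp (j + 1) - vp j) <= M%:R^-1 *
   ((c^-1 * nsq (a (j + 1) - a j) + c * nsq (b (j + 1))) / 2 +
    (c^-1 * nsq (b (j + 1) - b j) + c * nsq (a j)) / 2).
  have -> : vp (j + 1) - vp j = (M%:R^-1)%:C%C *
      ((a (j + 1) - a j) * (b (j + 1))^*%C + a j * (b (j + 1) - b j)^*%C).
    rewrite (_ : (b (j + 1) - b j)^*%C = (b (j + 1))^*%C - (b j)^*%C); last exact: rmorphB.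
    by rewrite /vp -/(a _) -/(b _) -/(a _) -/(b _); ring.
  rewrite ComplexField.Normc.normcM.
  have -> : normc (M%:R^-1)%:C%C = M%:R^-1 :> R.
    by rewrite /= expr0n addr0 sqrtr_sqr ger0_norm// invr_ge0.
  have nconj (z : R[i]) : normc z^*%C = normc z by case: z => u v /=; rewrite sqrrN.
  rewrite ler_wpM2l ?invr_ge0// (le_trans (le_normcD _ _))//.
  rewrite !ComplexField.Normc.normcM !nconj lerD ?amgm ?normc_ge0//.
  by rewrite mulrC amgm ?normc_ge0.
apply: le_trans; first by apply: ler_sum => j _; exact: (pw j%:Z).
rewrite -mulr_sumr big_split /= -!mulr_suml !big_split /= -!mulr_sumr.
have shiftb : \sum_(j < N) nsq (b (j%:Z + 1)) = \sum_(j < N) nsq (b j%:Z).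
  have -> : \sum_(j < N) nsq (b (j%:Z + 1)) = \sum_(j < N) nsq (b j.+1%:Z).
    by apply: eq_bigr => j _; rewrite -addn1 PoszD.
  move: vpD_periodic N0; case: (N) => // N' per _; rewrite big_ord_recr [RHS]big_ord_recl /=.
  by rewrite addrC; congr (_ + _); rewrite /b -{1}(add0r (N'.+1%:Z)) per.
rewrite shiftb.
have ea : \sum_(j < N) nsq (a j%:Z) = N%:R * (3 * M%:R) by rewrite vpD_parseval// natrM.
have eb : \sum_(j < N) nsq (b j%:Z) = N%:R * M%:R by rewrite vpD_parseval//; lia.
have da : \sum_(j < N) nsq (a (j%:Z + 1) - a j%:Z) <= N%:R * (3 * M%:R) * c ^+ 2.
  have := @vpD_var (3 * M)%N (- M%:Z) (2 * M)%N MN; rewrite !natrM => h.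
  apply: le_trans (h _) _; first by move=> r rM; lia.
  by rewrite le_eqVlt /c; apply/orP; left; apply/eqP; ring.
have db : \sum_(j < N) nsq (b (j%:Z + 1) - b j%:Z) <= N%:R * M%:R * c ^+ 2.
  have := @vpD_var M 0 (2 * M)%N; rewrite natrM => h.
  apply: le_trans (h _ _) _; [lia|by move=> r rM; lia|].
  by rewrite le_eqVlt /c; apply/orP; left; apply/eqP; ring.
rewrite ea eb.
set Da := \sum_(j < N) nsq (a (j%:Z + 1) - a j%:Z) in da *.
set Db := \sum_(j < N) nsq (b (j%:Z + 1) - b j%:Z) in db *.
have cD x : x <= N%:R * (3 * M%:R) * c ^+ 2 -> c^-1 * x <= N%:R * (3 * M%:R) * c.
  have cc : c * c^-1 = 1 by rewrite divff// gt_eqF.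
  move=> h; rewrite -(ler_pM2l c0) (mulrA c c^-1) cc mul1r; apply: le_trans h _.
  by rewrite le_eqVlt; apply/orP; left; apply/eqP; ring.
have h1 := cD _ da.
have h2 : c^-1 * Db <= N%:R * (3 * M%:R) * c.
  apply: cD; apply: le_trans db _; rewrite ler_wpM2r ?sqr_ge0// ler_wpM2l//.
  by rewrite ler_peMl// ler1n.
have cN : c * N%:R <= 16 * M%:R.
  rewrite /c divfK ?gt_eqF// ler_wpM2r// (_ : 16 = 4 * 4) ?ler_wpM2l//; last by ring.
  by have := @pihalf_lt2 R; rewrite ltr_pdivrMr//; lra.
rewrite mulrC ler_pdivrMr//.
have M1 : 0 <= M%:R :> R by [].
have : c * (N%:R * M%:R) <= 16 * M%:R * M%:R by rewrite mulrA ler_wpM2r.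
lra.
Qed.

(** The kernel concentrates near 0: times e(j/N) - 1, the short Dirichlet factor telescopes to
    e(Mj/N) - 1, of modulus at most 2. With weight c this yields M^(-1) (3MNc + 4N/c) / 2, and 1/c
    <= cM by hypothesis. *)
Lemma vp_moment (c : R) : 0 < c -> (1 <= c ^+ 2 * M%:R) ->
  \sum_(j < N) normc (vp j%:Z) * normc (ee (j%:R / N%:R) - 1) <= 4 * c * N%:R.
Proof.
move=> c0 cM.
have pw (j : 'I_N) : normc (vp j%:Z) * normc (ee (j%:R / N%:R) - 1) <=
    M%:R^-1 * (c * nsq (vpD (3 * M) (- M%:Z) j%:Z) + c^-1 * 4) / 2.
  rewrite /vp !ComplexField.Normc.normcM.
  have -> : normc (M%:R^-1)%:C%C = M%:R^-1 :> R.
    by rewrite /= expr0n addr0 sqrtr_sqr ger0_norm// invr_ge0.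
  have -> : normc (vpD M 0 j%:Z)^*%C = normc (vpD M 0 j%:Z).
    by case: (vpD M 0 j%:Z) => a b /=; rewrite sqrrN.
  rewrite -!mulrA ler_wpM2l ?invr_ge0// -ComplexField.Normc.normcM.
  have -> : vpD M 0 j%:Z * (ee (j%:R / N%:R) - 1) = ee (M%:R * (j%:R / N%:R)) - 1.
    rewrite -(eeX (j%:R / N%:R) M) subrX1 mulrC; congr (_ * _); apply: eq_bigr => r _.
    by rewrite eeX addr0.
  set v := _ - 1; set u := vpD _ _ _.
  have v4 : nsq v <= 4.
    apply: le_trans (nsqB_le _ _) _; rewrite nsq_ee nsq1; lra.
  have := sqr_ge0 (c * normc u - normc v); have : 0 < c^-1 by rewrite invr_gt0.
  have : c * c^-1 = 1 by rewrite divff// gt_eqF.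
  set c' := c^-1 => cc c'0 h.
  have : 0 <= c' * (c * normc u - normc v) ^+ 2 by rewrite mulr_ge0// ltW.
  have -> : c' * (c * normc u - normc v) ^+ 2 =
    (c * c') * c * nsq u - 2 * (c * c') * (normc u * normc v) + c' * nsq v by rewrite /nsq; ring.
  have : c' * nsq v <= c' * 4 by rewrite ler_pM2l.
  rewrite cc; lra.
apply: le_trans; first by apply: ler_sum => j _; exact: (pw j).
rewrite -mulr_suml -mulr_sumr big_split /= -mulr_sumr vpD_parseval//.
rewrite sumr_const card_ord -[c^-1 * 4 *+ N]mulr_natl natrM -mulrA mulrC ler_pdivrMr//.
have cc : c * c^-1 = 1 by rewrite divff// gt_eqF.
have : c^-1 <= c * M%:R.
  by rewrite -(ler_pM2l c0) cc mulrA -expr2.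
set c' := c^-1 => h.
have : N%:R * c' <= N%:R * (c * M%:R) by rewrite ler_wpM2l.
have : 0 <= N%:R * (c * M%:R) by rewrite !mulr_ge0// ltW.
lra.
Qed.

Definition vpmult (m : int) : R[i] :=
  (N%:R^-1)%:C%C * \sum_(j < N) vp j%:Z * ee (- (j%:R * m%:~R / N%:R)).

(** The transform of a product of Dirichlet kernels is a convolution of indicators of two intervals,
    hence a trapezoid. It is 1 for |m| <= M since m + r' then stays in [-M, 2M) for every r' < M; 3M
    <= N excludes wrap-around. *)
Lemma vpmultP (m : int) : exists2 p : R, vpmult m = p%:C%C &
  [/\ 0 <= p, p <= 1 & `|m| <= M%:Z -> p = 1].
Proof.
pose c (r' : 'I_M) : R := \sum_(r < 3 * M) ((N%:Z %| (r%:Z - M%:Z) - r'%:Z - m)%Z)%:R.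
have c01 r' : 0 <= c r' <= 1.
  rewrite /c sumr_ge0//=.
  case: (pickP (fun r : 'I_(3 * M) => (N%:Z %| (r%:Z - M%:Z) - r'%:Z - m)%Z)) => [r hr|h].
    rewrite (bigD1 r)//= hr big1 ?addr0// => u ur; apply/eqP; rewrite pnatr_eq0 eqb0.
    apply: contraNN ur => hu; apply/eqP/val_inj => /=.
    case/dvdzP: hu => q1 h1; case/dvdzP: hr => q2 h2.
    have e : u%:Z - r%:Z = (q1 - q2) * N%:Z by rewrite mulrBl; lia.
    move: e; set q := q1 - q2.
    have := ltn_ord u; have := ltn_ord r; case: q => [[|q]|q]; nia.
  by rewrite big1// => r _; rewrite h.
exists (M%:R^-1 * \sum_(r' < M) c r').
  rewrite /vpmult /vp; under eq_bigr => j _.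
    rewrite /vpD conjc_sum -!mulrA mulr_suml mulr_sumr.
    under eq_bigr => r _.
      rewrite mulr_suml mulr_sumr mulr_sumr.
      under eq_bigr => r' _.
        rewrite -eeN -!eeD.
        have -> : (r%:Z - M%:Z)%:~R * (j%:~R / N%:R) + (- ((r'%:Z + 0)%:~R * (j%:~R / N%:R)) -
            j%:R * (m%:~R / N%:R)) = (r%:Z - M%:Z - r'%:Z - m)%:~R * (j%:R / N%:R) :> R.
          by rewrite addr0 !rmorphB /=; ring.
        over.
      over.
    over.
  rewrite exchange_big /=; under eq_bigr do rewrite exchange_big /=.
  rewrite exchange_big /= mulr_sumr rmorphM /= rmorph_sum mulr_sumr /=; apply: eq_bigr => r' _.
  rewrite /c rmorph_sum !mulr_sumr; apply: eq_bigr => r _.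
  rewrite -mulr_sumr sum_ee_period// mulrCA; congr (_ * _).
  case: ifP => _; last by rewrite mulr0 rmorph0.
  by rewrite -(rmorph_nat (real_complex R) N) -rmorphM /= mulVf ?gt_eqF.
split.
- by rewrite mulr_ge0 ?invr_ge0// sumr_ge0// => r' _; case/andP: (c01 r').
- rewrite mulrC ler_pdivrMr// mul1r -[M in leRHS]card_ord -sumr_const ler_sum// => r' _.
  by case/andP: (c01 r').
- move=> mM; rewrite (eq_bigr (fun=> 1)).
    by rewrite sumr_const card_ord mulVf// gt_eqF.
  move=> r' _; apply/eqP; rewrite eq_le; case/andP: (c01 r') => _ -> /=.
  have hr : (`|(r'%:Z + m + M%:Z)%R| < 3 * M)%N by have := ltn_ord r'; lia.
  rewrite /c (bigD1 (Ordinal hr))//= (_ : (N%:Z %| _)%Z = true); last first.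
    by rewrite (_ : _ - m = 0) ?dvdz0//; have := ltn_ord r'; lia.
  by rewrite lerDl sumr_ge0.
Qed.

End vallee_poussin.

Lemma sum_periodic (N s : nat) (f : int -> R) : (s < N)%N -> (forall j, f (j + N%:Z) = f j) ->
  \sum_(i < N) f (s%:Z - i%:Z) = \sum_(j < N) f j%:Z.
Proof.
move=> sN fper.
have step t : \sum_(i < N) f (t + 1 - i%:Z) = \sum_(i < N) f (t - i%:Z).
  case: N sN fper => // N _ fper; rewrite big_ord_recl [RHS]big_ord_recr /= addrC.
  congr (_ + _).
    by rewrite -[RHS]fper -addn1 PoszD; congr f; ring.
  by apply: eq_bigr => i _; rewrite /bump add1n -addn1 PoszD; congr f; ring.
have all0 (k : nat) : \sum_(i < N) f (k%:Z - i%:Z) = \sum_(i < N) f (- i%:Z).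
  elim: k => [|k IH]; first by apply: eq_bigr => i _; rewrite add0r.
  by rewrite -addn1 PoszD step.
rewrite all0 -(all0 N.-1) (reindex_inj rev_ord_inj) /=; apply: eq_bigr => i _.
by congr f; have := ltn_ord i; lia.
Qed.

(** The chord |e(t) - 1| increases with the distance from t to the integers; the reflection t -> 1 -
    t reduces to t <= 1/2, where the cosine is monotone. *)
Lemma nsq_ee_sub1_ge (d t : R) : 0 < d -> d <= 1 / 2 -> d <= t <= 1 - d ->
  nsq (ee d - 1) <= nsq (ee t - 1).
Proof.
move=> d0 d2.
wlog t2 : t / t <= 1 / 2.
  move=> h /andP[dt td]; have [t2|t2] := lerP t (1 / 2); first by apply: h => //; rewrite dt.
  have := h (1 - t); rewrite (_ : nsq (ee (1 - t) - 1) = nsq (ee t - 1)).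
    apply; [lra|]; by apply/andP; split; lra.
  have e1 : ee 1 = 1 :> R[i] by rewrite -[1]/(1%:R) ee_nat.
  rewrite eeD e1 mul1r eeN -(nsq_conj (ee t - 1)); congr nsq.
  by case: (ee t) => a b; simpc.
move=> /andP[dt _]; rewrite !nsq_ee_sub1 lerD2l lerN2 ler_pM2l//.
move: dt; rewrite le_eqVlt => /predU1P[->//|dt]; apply: ltW.
rewrite ltr_cos ?in_itv /=.
- by rewrite ltr_pM2l// mulr_gt0// pi_gt0.
- apply/andP; split; first by rewrite !mulr_ge0 ?pi_ge0//; lra.
  by rewrite mulrAC ler_piMl ?pi_ge0//; lra.
- apply/andP; split; first by rewrite !mulr_ge0 ?pi_ge0//; lra.
  by rewrite mulrAC ler_piMl ?pi_ge0//; lra.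
Qed.

(* The Fejer average over s, s' < N turns the multiplier of the kernel [vp],
   which is only real on the grid, into a mean of squares at every real xi. *)
Definition fvp (M N K : nat) (xi : R) : R[i] :=
  \sum_(s < N) \sum_(s' < N) ((N%:R ^- 2)%:C%C * vp M N (s%:Z - s'%:Z)) *
    ee (- ((s%:R - s'%:R) * (xi / K%:R))).

(** Expanding [vp] into its frequencies n turns the double sum over s, s' into squared moduli of
    geometric sums: values of a Fejer kernel at n/N - xi/K. *)
Lemma fvpP (M N K : nat) (xi : R) : (0 < M)%N -> (3 * M <= N)%N ->
  fvp M N K xi = ((N%:R ^- 2 * M%:R^-1) * \sum_(r' < M) \sum_(r < 3 * M)
    nsq (\sum_(s < N) ee (s%:R * ((r%:R - M%:R - r'%:R) / N%:R - xi / K%:R))))%:C%C.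
Proof.
move=> M0 MN.
pose t (r' : 'I_M) (r : 'I_(3 * M)) : R := (r%:R - M%:R - r'%:R) / N%:R - xi / K%:R.
pose c : R[i] := (N%:R ^- 2 * M%:R^-1)%:C%C.
have E (s s' : 'I_N) : (N%:R ^- 2)%:C%C * vp M N (s%:Z - s'%:Z) *
    ee (- ((s%:R - s'%:R) * (xi / K%:R))) =
    c * \sum_(r' < M) \sum_(r < 3 * M) ee (s%:R * t r' r) * (ee (s'%:R * t r' r))^*%C.
  have -> : c = (N%:R ^- 2)%:C%C * (M%:R^-1)%:C%C by exact: rmorphM.
  rewrite /vp /vpD conjc_sum.
  set A := \sum_(r < 3 * M) _; set B := \sum_(r < M) (ee _)^*%C.
  transitivity ((N%:R ^- 2)%:C%C * (M%:R^-1)%:C%C *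
    ((B * A) * ee (- ((s%:R - s'%:R) * (xi / K%:R))))); first by ring.
  rewrite /B !mulr_suml; congr (_ * _); apply: eq_bigr => r' _.
  rewrite /A mulr_sumr mulr_suml; apply: eq_bigr => r _; rewrite -!eeN -!eeD; congr ee.
  by rewrite /t !rmorphD !rmorphN /= addr0; ring.
rewrite /fvp; under eq_bigr do (under eq_bigr do rewrite E; rewrite -mulr_sumr).
rewrite -mulr_sumr [RHS]rmorphM /= -/c rmorph_sum; congr (_ * _).
under eq_bigr do rewrite exchange_big.
rewrite exchange_big /=; apply: eq_bigr => r' _; rewrite rmorph_sum.
under eq_bigr do rewrite exchange_big.
by rewrite exchange_big /=; apply: eq_bigr => r _; rewrite /= nsq_sumE.
Qed.

(** For fixed r' the squared moduli over a full period of r add up to N^2 by Parseval. Thus 1 - p is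
    the same sum over the complementary residues, which is visibly nonnegative and easy to bound. *)
Lemma fvp_split (M N K : nat) (xi : R) : (0 < M)%N -> (3 * M <= N)%N ->
  exists2 p : R, fvp M N K xi = p%:C%C & 0 <= p /\
  1 - p = (N%:R ^- 2 * M%:R^-1) * \sum_(r' < M) \sum_(3 * M <= r < N)
    nsq (\sum_(s < N) ee (s%:R * ((r%:R - M%:R - r'%:R) / N%:R - xi / K%:R))).
Proof.
move=> M0 MN; exists (N%:R ^- 2 * M%:R^-1 * \sum_(r' < M) \sum_(r < 3 * M)
    nsq (\sum_(s < N) ee (s%:R * ((r%:R - M%:R - r'%:R) / N%:R - xi / K%:R)))).
  exact: fvpP.
have N0 : (0 < N)%N by lia.
have c0 : 0 <= N%:R ^- 2 * M%:R^-1 :> R by rewrite mulr_ge0 ?invr_ge0// exprn_ge0.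
split.
  by rewrite mulr_ge0// sumr_ge0// => r' _; rewrite sumr_ge0// => r _; exact: nsq_ge0.
apply/eqP; rewrite subr_eq -mulrDr -big_split /=; apply/eqP.
have full (r' : 'I_M) : \sum_(3 * M <= r < N)
    nsq (\sum_(s < N) ee (s%:R * ((r%:R - M%:R - r'%:R) / N%:R - xi / K%:R))) +
   \sum_(r < 3 * M)
    nsq (\sum_(s < N) ee (s%:R * ((r%:R - M%:R - r'%:R) / N%:R - xi / K%:R))) = N%:R ^+ 2.
  rewrite addrC -(big_mkord xpredT (fun r => nsq (\sum_(s < N)
    ee (s%:R * ((r%:R - M%:R - r'%:R) / N%:R - xi / K%:R))))) -big_cat_nat//= big_mkord.
  have := @parseval1_ord N N 0 (fun s => ee (s%:R * ((- M%:R - r'%:R) / N%:R - xi / K%:R))) N0 (leqnn _).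
  under [in RHS]eq_bigr do rewrite nsq_ee.
  rewrite sumr_const card_ord -[1 *+ N]/(N%:R) -expr2 => <-.
  apply: eq_bigr => r _; congr nsq; apply: eq_bigr => s _; rewrite -eeD; congr ee.
  by rewrite addr0 /=; ring.
under eq_bigr do rewrite full.
rewrite sumr_const card_ord -[_ *+ M]mulr_natl; field.
by rewrite !pnatr_eq0 -!lt0n M0.
Qed.

Let ler_sub_nat (a j c : nat) : (3 * a <= j)%N -> (c < a)%N ->
  a%:R <= j%:R - a%:R - c%:R :> R.
Proof. by move=> ??; rewrite lerBrDr lerBrDr -!natrD ler_nat; lia. Qed.

(** Multiplying M and N by the same p keeps the trapezoid in xi but narrows the Fejer kernel. For
    |xi| <= r the complementary frequencies stay at distance d = (m0 - r)/K from xi/K modulo 1, so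
    their contribution tends to 0 as p grows. *)
Lemma fvp_exists (K m0 : nat) (r eta : R) : r < m0%:R -> (0 < m0)%N ->
  (3 * m0 <= K)%N -> 0 < eta -> exists2 p : nat, (0 < p)%N & forall xi : R,
  exists2 q : R, fvp (m0 * p) (K * p) K xi = q%:C%C &
   [/\ 0 <= q, q <= 1 & `|xi| <= r -> 1 - q <= eta].
Proof.
move=> rm0 m00 mK eta0.
have K0 : (0 < K)%N by lia.
have KR : (0 : R) < K%:R by rewrite ltr0n.
have [r0|r0] := ltP r 0.
  exists 1%N => // xi; have [|//|q -> [q0 q1]] := @fvp_split (m0 * 1) (K * 1) K xi; try lia.
  exists q => //; split => //.
    rewrite -subr_ge0 q1 mulr_ge0//.
    by rewrite sumr_ge0// => r' _; rewrite sumr_ge0// => s _; exact: nsq_ge0.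
  by move=> xr; have := normr_ge0 xi; lra.
pose d : R := (m0%:R - r) / K%:R.
have m0K : 3 * m0%:R <= K%:R :> R by rewrite -natrM ler_nat.
have d0 : 0 < d by rewrite divr_gt0// subr_gt0.
have d2 : d <= 1 / 2 by rewrite ler_pdivrMr//; lra.
pose k := nsq (ee d - 1).
have k0 : 0 < k.
  rewrite lt_neqAle nsq_ge0 andbT eq_sym; apply/eqP => h.
  have : ee d != 1 by apply: ee_neq1; rewrite d0 /=; lra.
  apply/negP; rewrite negbK -subr_eq0; move: h; rewrite /k nsqE.
  case: (ee d - 1) => a b /= h; rewrite eq_complex /=.
  by move/eqP: h; rewrite paddr_eq0 ?sqr_ge0// !sqrf_eq0.
(* Each complementary term is at most 4/k, there are at most M N of them, and the weight is 1/(N^2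
   M); so 1 - q <= 4/(k N) with N = K p. *)
pose p := (Num.truncn (4 / (k * eta))).+1.
have hp : 4 / (k * eta) < p%:R by exact: truncnS_gt.
exists p => // xi.
have [||q -> [q0 q1]] := @fvp_split (m0 * p) (K * p) K xi.
- by rewrite muln_gt0 m00.
- by rewrite mulnA leq_mul2r mK orbT.
set M := (m0 * p)%N in q1 *; set N := (K * p)%N in q1 *.
exists q => //.
have pR : (0 : R) < p%:R by rewrite ltr0n.
have NR : (0 : R) < N%:R by rewrite /N natrM mulr_gt0.
have MR : (0 : R) < M%:R by rewrite /M natrM mulr_gt0// ltr0n.
split => //.
  rewrite -subr_ge0 q1 mulr_ge0//.
  by rewrite sumr_ge0// => r' _; rewrite sumr_ge0// => s _; exact: nsq_ge0.
move=> xr; rewrite q1.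
have key (r' : 'I_M) (j : nat) : (3 * M <= j < N)%N ->
   nsq (\sum_(s < N) ee (s%:R * ((j%:R - M%:R - r'%:R) / N%:R - xi / K%:R))) <= 4 / k.
  move=> /andP[Mj jN]; set t := _ - xi / K%:R.
  have t1 : d <= t <= 1 - d.
    have hj1 : M%:R <= j%:R - M%:R - r'%:R :> R.
      exact: (ler_sub_nat Mj (ltn_ord r')).
    have hj2 : j%:R - M%:R - r'%:R <= N%:R - M%:R :> R.
      have jN' : j%:R <= N%:R :> R by rewrite ler_nat ltnW.
      have : 0 <= r'%:R :> R by [].
      lra.
    have MNE : M%:R / N%:R = m0%:R / K%:R :> R.
      by rewrite /M /N !natrM; field; rewrite !gt_eqF.
    have a1 : m0%:R / K%:R <= (j%:R - M%:R - r'%:R) / N%:R :> R by rewrite -MNE ler_pM2r ?invr_gt0.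
    have a2 : (j%:R - M%:R - r'%:R) / N%:R <= 1 - m0%:R / K%:R :> R.
      by rewrite -MNE ler_pdivrMr// mulrBl mul1r divfK ?gt_eqF.
    have : `|xi / K%:R| <= r / K%:R by rewrite normrM normfV (gtr0_norm KR) ler_pM2r ?invr_gt0.
    by rewrite ler_norml /t /d mulrBl; lra.
  rewrite ler_pdivlMr//; apply: (@le_trans _ _ (nsq (\sum_(s < N) ee (s%:R * t)) * nsq (ee t - 1))).
    by rewrite ler_wpM2l ?nsq_ge0//; exact: nsq_ee_sub1_ge.
  rewrite -nsqM (_ : _ * _ = ee t ^+ N - 1).
    by rewrite eeX; apply: le_trans (nsqB_le _ _) _; rewrite nsq_ee nsq1; lra.
  rewrite subrX1 mulrC; congr (_ * _); apply: eq_bigr => s _; exact/esym/eeX.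
apply: (@le_trans _ _ (N%:R ^- 2 * M%:R^-1 * (M%:R * (N%:R * (4 / k))))).
  rewrite ler_wpM2l//.
  have sc (x : R) (n : nat) : n%:R * x = \sum_(i < n) x by rewrite sumr_const card_ord mulr_natl.
  rewrite [leRHS]sc ler_sum// => r' _.
  apply: (@le_trans _ _ (\sum_(3 * M <= j < N) 4 / k)).
    by rewrite big_nat_cond [leRHS]big_nat_cond ler_sum// => j /andP[/(key r')].
  rewrite sumr_const_nat -[_ *+ (N - _)]mulr_natl.
  by rewrite ler_wpM2r ?ler_nat ?leq_subr// divr_ge0// nsq_ge0.
have -> : N%:R ^- 2 * M%:R^-1 * (M%:R * (N%:R * (4 / k))) = 4 / (k * N%:R).
  by field; rewrite !gt_eqF.
rewrite ler_pdivrMr ?(mulr_gt0 k0)//.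
move: hp; rewrite ltr_pdivrMr ?(mulr_gt0 k0)// => hp.
apply: le_trans (ltW hp) _; rewrite mulrC (mulrC k) -mulrA ler_wpM2l ?(ltW eta0)//.
by rewrite ler_wpM2l ?(ltW k0)// /N natrM ler_peMl ?ler1n// ltW.
Qed.

End kernel.

Local Open Scope classical_set_scope.
Local Open Scope ring_scope.

(** * Lebesgue measure on tuples *)

Section real_integral.
Context d (T : measurableType d) (R : realType) (mu : {measure set T -> \bar R}).
Implicit Types (f g : T -> R) (D : set T).

Lemma ge0_intZ D c f : measurable D -> 0 <= c -> measurable_fun D f -> (forall x, 0 <= f x) ->
  (\int[mu]_(x in D) (c * f x)%:E = c%:E * \int[mu]_(x in D) (f x)%:E)%E.
Proof.
move=> mD c0 mf f0; under eq_integral do rewrite EFinM.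
rewrite ge0_integralZl//; first exact/measurable_EFinP.
by move=> x _; rewrite lee_fin.
Qed.

Lemma ge0_intD D f g : measurable D -> measurable_fun D f -> measurable_fun D g ->
  (forall x, 0 <= f x) -> (forall x, 0 <= g x) ->
  (\int[mu]_(x in D) (f x + g x)%:E = \int[mu]_(x in D) (f x)%:E + \int[mu]_(x in D) (g x)%:E)%E.
Proof.
move=> mD mf mg f0 g0; under eq_integral do rewrite EFinD.
by rewrite ge0_integralD// => [x _||x _|]; rewrite ?lee_fin//; exact/measurable_EFinP.
Qed.

Lemma ge0_int_sum (I : eqType) (s : seq I) D (f : I -> T -> R) : measurable D ->
  (forall i, measurable_fun D (f i)) -> (forall i x, 0 <= f i x) ->
  (\int[mu]_(x in D) (\sum_(i <- s) f i x)%R%:E = \sum_(i <- s) \int[mu]_(x in D) (f i x)%:E)%E.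
Proof.
move=> mD mf f0; under eq_integral do rewrite -sumEFin.
rewrite ge0_integral_sum// => [i|i x _]; last by rewrite lee_fin.
exact/measurable_EFinP.
Qed.

Lemma ge0_int_le D f g : measurable D -> measurable_fun D f -> measurable_fun D g ->
  (forall x, 0 <= f x) -> (forall x, D x -> f x <= g x) ->
  (\int[mu]_(x in D) (f x)%:E <= \int[mu]_(x in D) (g x)%:E)%E.
Proof.
move=> mD mf mg f0 fg.
have le0 x : D x -> (0 <= (g x)%:E)%E by move=> Dx; rewrite lee_fin (le_trans (f0 x))// fg.
apply: ge0_le_integral => //; try exact/measurable_EFinP.
- by move=> x _; rewrite lee_fin.
Qed.

Lemma int_ge0 D f : (forall x, 0 <= f x) -> (0 <= \int[mu]_(x in D) (f x)%:E)%E.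
Proof. by move=> f0; apply: integral_ge0 => x _; rewrite lee_fin. Qed.

End real_integral.

Section tuple_integral.
Context {R : realType}.
Local Notation leb := (@lebesgue_measure R).
Local Open Scope ereal_scope.

Lemma measurable_fun_addr (s : R) :
  measurable_fun setT (fun t : measurableTypeR R => (t + s)%R : measurableTypeR R).
Proof. exact: measurable_funD. Qed.

(** Uniqueness of Lebesgue measure: the pushforward by a translation agrees with it on the intervals
    ]a, b]. *)
Lemma lebesgue_measure_shift (s : R) (A : set (measurableTypeR R)) : measurable A ->
  leb ((fun t : measurableTypeR R => (t + s)%R) @^-1` A) = leb A.
Proof.
move=> mA.
pose mix := isMeasurableFun.Build _ _ _ _ _ (measurable_fun_addr s).
pose phi : {mfun measurableTypeR R >-> measurableTypeR R} :=
  HB.pack (fun t : measurableTypeR R => (t + s)%R : measurableTypeR R) mix.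
have -> : leb ((fun t : measurableTypeR R => (t + s)%R) @^-1` A) =
  pushforward leb phi A by [].
apply/esym/lebesgue_measure_unique => //= _ [[a b]] _ <-.
rewrite /pushforward /=.
have -> : phi @^-1` `]a, b] = `](a - s)%R, (b - s)%R]%classic.
  by apply/seteqP; split => x /=; rewrite !in_itv/= ltrBlDr lerBrDr.
rewrite !lebesgue_measure_itv/= !lte_fin ltrD2r; case: ifP => // _.
by rewrite -!EFinB; congr EFin; ring.
Qed.

Lemma integral_shift (s : R) (f : measurableTypeR R -> \bar R) :
  measurable_fun setT f -> (forall x, 0 <= f x) ->
  \int[leb]_t f (t + s)%R = \int[leb]_t f t.
Proof.
move=> mf f0.
have := @ge0_integral_pushforward _ _ _ _ R _ (measurable_fun_addr s) leb
  setT f measurableT mf (fun y _ => f0 y).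
rewrite preimage_setT => <-.
apply: eq_measure_integral => [|mphi A mA _]; first exact: measurable_fun_addr.
exact: lebesgue_measure_shift.
Qed.

Lemma integral_lebesgue_tupleS l (f : Rspace R l.+1 -> \bar R) :
  measurable_fun setT f -> (forall x, 0 <= f x) ->
  \int[lebesgue_tuple l.+1]_x f x =
  \int[leb]_t \int[lebesgue_tuple l]_x f (cons_pair (t, x)).
Proof.
move=> mf f0.
have := @ge0_integral_pushforward _ _ _ _ R _ (@measurable_cons_pair R l)
  (leb \x lebesgue_tuple l) setT f measurableT mf (fun y _ => f0 y).
rewrite preimage_setT => h.
transitivity (\int[leb \x lebesgue_tuple l]_x (f \o @cons_pair R l) x).
  rewrite -h; apply: eq_measure_integral => [|mphi A mA _] //.
  exact: measurable_cons_pair.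
rewrite fubini_tonelli1//; first exact: measurableT_comp (@measurable_cons_pair R l).
by move=> x; exact: f0.
Qed.

Lemma measurable_tadd l (s : Rspace R l) : measurable_fun setT (fun x => tadd x s).
Proof.
apply/measurable_fun_tnthP => i /=.
rewrite (_ : _ \o _ = fun x : Rspace R l => ((tnth x i : R) + (tnth s i : R))%R); last first.
  by apply/funext => x /=; rewrite tnth_mktuple.
apply: (@measurableT_comp _ _ _ _ _ _ (fun t : measurableTypeR R => (t + (tnth s i : R))%R)).
  exact: measurable_fun_addr.
exact: measurable_tnth.
Qed.

Lemma cons_pair_tadd l (t : R) (x : Rspace R l) (s : Rspace R l.+1) :
  tadd (cons_pair (t, x)) s =
  cons_pair ((t + (thead s : R))%R, tadd x [tuple of behead s]).
Proof.
apply: tuple_ext => i; rewrite tnth_mktuple.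
case: (unliftP ord0 i) => [j ->|->].
  rewrite !tnthS tnth_mktuple; congr (_ + _)%R.
  rewrite !(tnth_nth 0%R) /= nth_behead.
  by congr (nth _ _ _); rewrite /= /bump add1n.
by rewrite !tnth0.
Qed.

(** Induction on the dimension, Tonelli splitting off the first coordinate. *)
Lemma integral_tadd l (s : Rspace R l) (f : Rspace R l -> \bar R) :
  measurable_fun setT f -> (forall x, 0 <= f x) ->
  \int[lebesgue_tuple l]_x f (tadd x s) = \int[lebesgue_tuple l]_x f x.
Proof.
elim: l s f => [|l IH] s f mf f0.
  by apply: eq_integral => x _; congr f; rewrite [LHS]tuple0 [RHS]tuple0.
rewrite integral_lebesgue_tupleS//; last first.
  exact: (measurableT_comp mf (measurable_tadd s)).
rewrite (integral_lebesgue_tupleS mf f0).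
have mfc t : measurable_fun setT (fun x => f (cons_pair (t, x))).
  apply: (measurableT_comp mf); apply: (measurableT_comp (@measurable_cons_pair R l)).
  exact: measurable_pair1.
under eq_integral => t _.
  under eq_integral do rewrite cons_pair_tadd.
  rewrite (IH _ (fun x => f (cons_pair ((t + (thead s : R))%R, x))))//.
  over.
apply: (integral_shift _ (f := fun t => \int[lebesgue_tuple l]_x f (cons_pair (t, x)))).
  apply: (@measurable_fun_fubini_tonelli_F _ _ _ _ _ (lebesgue_tuple l)
    (fun z => f (cons_pair z))) => //.
  exact: (measurableT_comp mf (@measurable_cons_pair R l)).
by move=> x; apply: integral_ge0.
Qed.

Lemma integral_tadd_set l (s : Rspace R l) (D : set (Rspace R l)) (f : Rspace R l -> \bar R) :
  measurable D -> measurable_fun setT f -> (forall x, 0 <= f x) ->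
  \int[lebesgue_tuple l]_(x in (fun x => tadd x s) @^-1` D) f (tadd x s) =
  \int[lebesgue_tuple l]_(x in D) f x.
Proof.
move=> mD mf f0; rewrite [RHS]integral_mkcond [LHS]integral_mkcond.
rewrite -(integral_tadd s (f := f \_ D)).
- by apply: eq_integral => x _; rewrite !patchE; congr (if _ then _ else _).
- by apply/(measurable_restrictT _ _).1 => //; exact: measurable_funS mf.
- by move=> x; rewrite patchE; case: ifP.
Qed.


Definition tfloor l (x : Rspace R l) : l.-tuple int :=
  [tuple Num.floor (tnth x i : R) | i < l].

Definition tfrac l (x : Rspace R l) : Rspace R l := tsub x (tint (tfloor x)).

Definition cube l : set (Rspace R l) := [set x | forall i, (0 <= (tnth x i : R) < 1)%R].

Definition cell l (b : l.-tuple int) : set (Rspace R l) := [set x | tfloor x = b].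

Lemma tfloor_add l (x : Rspace R l) b : tfloor (tadd x (tint b)) = zadd (tfloor x) b.
Proof.
apply: tuple_ext => i; rewrite !tnth_mktuple floorDrz ?floorK//.
by rewrite intrKfloor.
Qed.

Lemma frac_add l (x : Rspace R l) b : tfrac (tadd x (tint b)) = tfrac x.
Proof.
rewrite /tfrac tfloor_add; apply: tuple_ext => i.
by rewrite !tnth_mktuple rmorphD /=; ring.
Qed.

Lemma tfloor_cube l (x : Rspace R l) : cube x -> tfloor x = [tuple (0 : int) | _ < l].
Proof.
by move=> cx; apply: tuple_ext => i; rewrite !tnth_mktuple; apply/eqP; rewrite floor_eq.
Qed.

Lemma frac_id l (x : Rspace R l) : cube x -> tfrac x = x.
Proof.
move=> cx; rewrite /tfrac tfloor_cube//; apply: tuple_ext => i.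
by rewrite !tnth_mktuple subr0.
Qed.

Lemma frac_cube l (x : Rspace R l) : cube (tfrac x).
Proof.
move=> i; rewrite !tnth_mktuple subr_ge0 ltrBlDr addrC; apply/andP; split.
  exact: ge_floor.
by have := floorD1_gt (tnth x i : R); rewrite rmorphD.
Qed.

Lemma frac_floor l (x : Rspace R l) : tadd (tfrac x) (tint (tfloor x)) = x.
Proof. by apply: tuple_ext => i; rewrite !tnth_mktuple subrK. Qed.

Lemma cell_cube l (b : l.-tuple int) (x : Rspace R l) :
  cell b (tadd x (tint b)) <-> cube x.
Proof.
rewrite /cell /= tfloor_add; split => [h|cx].
  have h0 : tfloor x = [tuple (0 : int) | _ < l].
    apply: tuple_ext => i; move: (congr1 (fun t => tnth t i) h).
    rewrite !tnth_mktuple => hi; apply: (addIr (tnth b i)).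
    by rewrite hi add0r.
  have -> : x = tfrac x.
    by rewrite -[LHS]frac_floor h0; apply: tuple_ext => i; rewrite !tnth_mktuple addr0.
  exact: frac_cube.
by apply: tuple_ext => i; rewrite tfloor_cube// !tnth_mktuple add0r.
Qed.

Lemma measurable_tnthR l (i : 'I_l) : measurable_fun setT (fun x : Rspace R l => (tnth x i : R)).
Proof. exact: measurable_tnth. Qed.

Lemma measurable_floorR : measurable_fun setT (fun t : R => (Num.floor t)%:~R : R).
Proof.
apply: nondecreasing_measurable => // s t st; rewrite ler_int; exact: le_floor.
Qed.

Lemma measurable_frac l : measurable_fun setT (@tfrac l).
Proof.
apply/measurable_fun_tnthP => i /=.
rewrite (_ : _ \o _ = fun x : Rspace R l =>
   ((tnth x i : R) - (Num.floor (tnth x i : R))%:~R)%R); last first.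
  by apply/funext => x /=; rewrite !tnth_mktuple.
apply: measurable_funB; first exact: measurable_tnthR.
apply: (measurableT_comp measurable_floorR); exact: measurable_tnthR.
Qed.

Lemma measurable_cube l : measurable (@cube l).
Proof.
have -> : @cube l = \bigcap_(i in [set: 'I_l])
    ((fun x : Rspace R l => (tnth x i : R)) @^-1` `[0%R, 1%R[).
  apply/seteqP; split => x /= h i; first by move=> _ /=; rewrite in_itv /=; exact: h.
  by have := h i I; rewrite /= in_itv.
apply: fin_bigcap_measurable; first exact: finite_finset.
move=> i _; rewrite -[X in measurable X]setTI; exact: measurable_tnthR.
Qed.

Lemma measurable_cell l (b : l.-tuple int) : measurable (@cell l b).
Proof.
have -> : @cell l b = \bigcap_(i in [set: 'I_l])
    ((fun x : Rspace R l => (Num.floor (tnth x i : R))%:~R : R) @^-1` [set (tnth b i)%:~R]).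
  apply/seteqP; split => x /= h.
    by move=> i _ /=; rewrite -h tnth_mktuple.
  apply: tuple_ext => i; rewrite tnth_mktuple; apply: (@intr_inj R).
  exact: (h i I).
apply: fin_bigcap_measurable; first exact: finite_finset.
move=> i _; rewrite -[X in measurable X]setTI.
have := measurableT_comp measurable_floorR (@measurable_tnthR l i).
by apply.
Qed.

(* The lattice is enumerated by [pickle]; [pickle_inv] skips unused codes. *)
Definition zser l (f : l.-tuple int -> \bar R) : \bar R :=
  \sum_(n <oo) oapp f 0 (pickle_inv n).

Lemma integral_tiling l (f : Rspace R l -> \bar R) :
  measurable_fun setT f -> (forall x, 0 <= f x) ->
  \int[lebesgue_tuple l]_x f x =
  zser (fun b => \int[lebesgue_tuple l]_(x in @cube l) f (tadd x (tint b))).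
Proof.
move=> mf f0.
pose F n : set (Rspace R l) := oapp (@cell l) set0 (pickle_inv n).
have FT : \bigcup_n F n = setT.
  apply/seteqP; split => // x _; exists (pickle (tfloor x)) => //.
  by rewrite /F pickleK_inv /=.
rewrite -FT ge0_integral_bigcup//; last 3 first.
- by move=> n; rewrite /F; case: pickle_inv => //= b; exact: measurable_cell.
- by rewrite FT.
- apply/trivIsetP => i j _ _ ij; apply/seteqP; split => // x [].
  rewrite /F; case Ei : (pickle_inv i : option (l.-tuple int)) => [a|]//=.
  case Ej : (pickle_inv j : option (l.-tuple int)) => [b|]//=.
  move=> xa xb; have ab : a = b by rewrite -[LHS](xa : tfloor x = a).
  move: ij; rewrite -(pickle_invK (T := l.-tuple int) i) -(pickle_invK (T := l.-tuple int) j) Ei Ej /= ab eqxx//.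
apply: eq_eseriesr => n _; rewrite /F; case: pickle_inv => [b|] /=; last first.
  by rewrite integral_set0.
rewrite -(integral_tadd_set (tint b) (measurable_cell b) mf f0).
suff -> : (fun x => tadd x (tint b)) @^-1` cell b = @cube l by [].
by apply/seteqP; split => x /=; [move/cell_cube|move=> ?; apply/cell_cube].
Qed.

Lemma zser_eq l (f g : l.-tuple int -> \bar R) : f =1 g -> zser f = zser g.
Proof. by move=> fg; apply: eq_eseriesr => n _; case: pickle_inv => //=. Qed.

Lemma zser_esum l (f : l.-tuple int -> \bar R) : (forall b, 0 <= f b) ->
  zser f = \esum_(b in [set: l.-tuple int]) f b.
Proof.
move=> f0.
rewrite /zser nneseries_esum; last by move=> n _; case: pickle_inv => //=.
rewrite [LHS](_ : _ = \esum_(n in [set n | pickle_inv n != None :> option (l.-tuple int)])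
   oapp f 0 (pickle_inv n)).
  rewrite (@reindex_esum _ _ _ [set: l.-tuple int] _ (@pickle _)).
    by apply: eq_esum => b _; rewrite pickleK_inv.
  split.
  - by move=> b _ /=; rewrite pickleK_inv.
  - by move=> a b _ _ /(congr1 (@pickle_inv (l.-tuple int))); rewrite !pickleK_inv => -[].
  - move=> n /=; have := pickle_invK (T := l.-tuple int) n; case: pickle_inv => //= b <- _; by exists b.
rewrite esum_mkcond [RHS]esum_mkcond; apply: eq_esum => n _.
rewrite ifT ?inE//; have [//|h] := boolP (n \in [set n | pickle_inv n != None]).
by move: h; rewrite notin_setE /= => /negP; rewrite negbK => /eqP ->.
Qed.


Lemma zser_single l (f : l.-tuple int -> \bar R) b0 : (forall b, 0 <= f b) ->
  (forall b, b != b0 -> f b = 0) -> zser f = f b0.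
Proof.
move=> f0 h; rewrite zser_esum// -[RHS](@esum_set1 _ _ b0)// [RHS]esum_mkcond.
apply: eq_esum => b _; case: ifPn => //; rewrite notin_setE /= => /eqP; exact: h.
Qed.

Lemma zser_integral l (D : set (Rspace R l)) (f : l.-tuple int -> Rspace R l -> \bar R) :
  measurable D -> (forall b, measurable_fun D (f b)) -> (forall b x, 0 <= f b x) ->
  \int[lebesgue_tuple l]_(x in D) zser (f ^~ x) =
  zser (fun b => \int[lebesgue_tuple l]_(x in D) f b x).
Proof.
move=> mD mf f0; rewrite /zser.
under eq_integral => x _.
  rewrite (@eq_eseriesr _ _ (fun n => oapp (fun b => f b) (fun=> 0) (pickle_inv n) x)); last first.
    by move=> n _; case: pickle_inv.
  over.
rewrite integral_nneseries//; last 2 first.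
- by move=> n; case: pickle_inv => //= b; exact: mf.
- by move=> n x _; case: pickle_inv => //=.
apply: eq_eseriesr => n _; case: pickle_inv => //=; exact: integral0.
Qed.

(** A translate of the cube is again a fundamental domain: after tiling, exactly one lattice
    translate [b0] of each point falls into it, and the series has a single nonzero term. *)
Lemma integral_cube_shift l (s : Rspace R l) (f : Rspace R l -> \bar R) :
  measurable_fun setT f -> (forall x, 0 <= f x) ->
  (forall x b, f (tadd x (tint b)) = f x) ->
  \int[lebesgue_tuple l]_(x in @cube l) f (tadd x s) =
  \int[lebesgue_tuple l]_(x in @cube l) f x.
Proof.
move=> mf f0 fper.
pose D : set (Rspace R l) := (fun x => tadd x (topp s)) @^-1` @cube l.
have mD : measurable D.
  rewrite -[D]setTI; apply: measurable_tadd => //; exact: measurable_cube.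
have -> : @cube l = (fun x => tadd x s) @^-1` D.
  by apply/seteqP; split => x; rewrite /D /= taddK.
rewrite integral_tadd_set// [LHS]integral_mkcond.
have mfD : measurable_fun setT (f \_ D).
  by apply/(measurable_restrictT _ _).1 => //; exact: measurable_funS mf.
have fD0 x : 0 <= (f \_ D) x by rewrite patchE; case: ifP.
have -> : (fun x => tadd x s) @^-1` D = @cube l.
  by apply/seteqP; split => x; rewrite /D /= taddK.
rewrite integral_tiling// -zser_integral//; last 2 first.
- exact: measurable_cube.
- move=> b; apply: measurable_funS (measurableT_comp mfD (measurable_tadd _)) => //.
apply: eq_integral => x _.
pose b0 := zopp (tfloor (tadd x (topp s))).
have inD b : D (tadd x (tint b)) <-> b = b0.
  have -> : D (tadd x (tint b)) = cube (tadd (tadd x (topp s)) (tint b)).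
    by congr cube; apply: tuple_ext => i; rewrite !tnth_mktuple addrAC.
  split => [h|->].
    have := tfloor_cube h; rewrite tfloor_add => h0.
    apply: tuple_ext => i; move: (congr1 (fun t => tnth t i) h0).
    by rewrite !tnth_mktuple => /eqP; rewrite addrC addr_eq0 => /eqP.
  rewrite (_ : tadd _ _ = tfrac (tadd x (topp s))); first exact: frac_cube.
  by apply: tuple_ext => i; rewrite !tnth_mktuple rmorphN.
rewrite (zser_single (b0 := b0))//.
  by rewrite patchE ifT// inE; apply/inD.
move=> b bb0; rewrite patchE ifF//; apply/negbTE; rewrite notin_setE => /inD.
exact/eqP.
Qed.

End tuple_integral.

(** * Measurability of complex-valued functions *)

Section cmeasurability.
Context d (T : measurableType d) (R : realType).
Implicit Types (f g : T -> R[i]).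

Lemma cmeas_cst (c : R[i]) : cmeasurable (fun _ : T => c).
Proof. by split; exact: measurable_cst. Qed.

Lemma cmeasD f g : cmeasurable f -> cmeasurable g -> cmeasurable (fun x => f x + g x).
Proof.
move=> [f1 f2] [g1 g2]; split.
  rewrite (_ : (fun x => _) = (fun x => complex.Re (f x) + complex.Re (g x))).
    exact: measurable_funD.
  by apply/funext => x; case: (f x); case: (g x).
rewrite (_ : (fun x => _) = (fun x => complex.Im (f x) + complex.Im (g x))).
  exact: measurable_funD.
by apply/funext => x; case: (f x); case: (g x).
Qed.

Lemma cmeasM f g : cmeasurable f -> cmeasurable g -> cmeasurable (fun x => f x * g x).
Proof.
move=> [f1 f2] [g1 g2]; split.
  rewrite (_ : (fun x => _) = (fun x => complex.Re (f x) * complex.Re (g x) -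
    complex.Im (f x) * complex.Im (g x))).
    by apply: measurable_funB; apply: measurable_funM.
  by apply/funext => x; case: (f x) => a b; case: (g x) => a' b'; simpc.
rewrite (_ : (fun x => _) = (fun x => complex.Re (f x) * complex.Im (g x) +
    complex.Im (f x) * complex.Re (g x))).
  by apply: measurable_funD; apply: measurable_funM.
by apply/funext => x; case: (f x) => a b; case: (g x) => a' b'; simpc; rewrite /=.
Qed.

Lemma cmeasN f : cmeasurable f -> cmeasurable (fun x => - f x).
Proof.
move=> mf; rewrite (_ : (fun x => _) = (fun x => (-1) * f x)).
  by apply: cmeasM => //; exact: cmeas_cst.
by apply/funext => x; rewrite mulN1r.
Qed.

Lemma cmeasB f g : cmeasurable f -> cmeasurable g -> cmeasurable (fun x => f x - g x).
Proof. by move=> mf mg; apply: cmeasD => //; exact: cmeasN. Qed.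

Lemma cmeas_sum (I : eqType) (s : seq I) (F : I -> T -> R[i]) :
  (forall i, cmeasurable (F i)) -> cmeasurable (fun x => \sum_(i <- s) F i x).
Proof.
move=> mF; elim: s => [|a s IH].
  rewrite (_ : (fun x => _) = (fun=> 0)); first exact: cmeas_cst.
  by apply/funext => x; rewrite big_nil.
rewrite (_ : (fun x => _) = (fun x => F a x + \sum_(i <- s) F i x)).
  exact: cmeasD.
by apply/funext => x; rewrite big_cons.
Qed.

Lemma cmeas_cexpi (h : T -> R) : measurable_fun setT h -> cmeasurable (fun x => cexpi (h x)).
Proof.
move=> mh; split => /=; apply: (measurableT_comp _ mh); apply: continuous_measurable_fun.
  exact: continuous_cos.
exact: continuous_sin.
Qed.

Lemma cmeas_ee (h : T -> R) : measurable_fun setT h -> cmeasurable (fun x => ee (h x)).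
Proof. by move=> mh; apply: cmeas_cexpi; exact: measurable_funM. Qed.

Lemma cmeas_real (h : T -> R) : measurable_fun setT h -> cmeasurable (fun x => (h x)%:C%C).
Proof. by move=> mh; split => //=; exact: measurable_cst. Qed.

Lemma measurable_nsq f : cmeasurable f -> measurable_fun setT (fun x => nsq (f x)).
Proof.
move=> [f1 f2]; under eq_fun do rewrite nsqE.
by apply: measurable_funD; exact: measurable_funX.
Qed.

Lemma emeasurable_nsq f : cmeasurable f -> measurable_fun setT (fun x => (nsq (f x))%:E).
Proof. by move=> mf; apply/measurable_EFinP; exact: measurable_nsq. Qed.

End cmeasurability.

Lemma cmeas_comp d1 d2 (T1 : measurableType d1) (T2 : measurableType d2) (R : realType)
  (f : T2 -> R[i]) (h : T1 -> T2) :
  cmeasurable f -> measurable_fun setT h -> cmeasurable (fun x => f (h x)).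
Proof. by move=> [f1 f2] mh; split; [exact: (measurableT_comp f1)|exact: (measurableT_comp f2)]. Qed.

(** * Orthogonality of characters on the unit cube *)

Section cube_parseval.
Context {R : realType} {l : nat}.
Local Notation Z := (l.-tuple int).

Lemma measurable_tdotl (y : Rspace R l) : measurable_fun setT (fun x : Rspace R l => tdot y x).
Proof.
apply: measurable_sum => i; apply: measurable_funM => //; exact: measurable_tnthR.
Qed.

Lemma measurable_tsub_int (m : Z) :
  measurable_fun setT (fun x : Rspace R l => tsub x (tint m)).
Proof.
rewrite (_ : (fun x => _) = (fun x => tadd x (topp (tint m)))); first exact: measurable_tadd.
by apply/funext => x; rewrite tsubE.
Qed.

Lemma cmeas_ee_tdot (y : Rspace R l) : cmeasurable (fun x : Rspace R l => ee (tdot y x)).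
Proof. apply: cmeas_ee; exact: measurable_tdotl. Qed.

Lemma seq_bound (s : seq Z) : exists N : nat, (0 < N)%N /\
  forall m n, m \in s -> n \in s -> forall i, - N%:Z < tnth m i - tnth n i < N%:Z.
Proof.
pose M := (\sum_(m <- s) \sum_(i < l) `|tnth m i|%N)%N.
have hM m i : m \in s -> (`|tnth m i| <= M)%N.
  move=> ms; rewrite /M (big_rem m)//= (bigD1 i)//=.
  by rewrite -addnA leq_addr.
exists M.*2.+1; split => // m n ms ns i.
have := hM m i ms; have := hM n i ns; lia.
Qed.

(** No exponential is integrated: by periodicity the integral is unchanged under the N^l shifts
    [ypt], and averaging over them makes the integrand constant by [finite_parseval]. *)
Lemma cube_parseval (s : seq Z) (d : Z -> R[i]) : uniq s ->
  (\int[lebesgue_tuple l]_(x in @cube R l)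
     (nsq (\sum_(n <- s) d n * ee (tdot (tint n) x)))%:E =
   (\sum_(n <- s) nsq (d n))%:E * lebesgue_tuple l (@cube R l))%E.
Proof.
move=> us; have [N [N0 hN]] := seq_bound s.
pose phi (x : Rspace R l) := nsq (\sum_(n <- s) d n * ee (tdot (tint n) x)).
have mphi : measurable_fun setT phi.
  apply: measurable_nsq; apply: cmeas_sum => n; apply: cmeasM; first exact: cmeas_cst.
  exact: cmeas_ee_tdot.
have phi_shift y x : phi (tadd x y) =
    nsq (\sum_(n <- s) (d n * ee (tdot (tint n) x)) * ee (tdot (tint n) y)).
  by congr nsq; apply: eq_bigr => n _; rewrite tdotDr eeD mulrA.
have phiper x b : phi (tadd x (tint b)) = phi x.
  rewrite phi_shift; congr nsq; apply: eq_bigr => n _.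
  by rewrite ee_tdot_int mulr1.
have phi0 x : (0 <= (phi x)%:E)%E by rewrite lee_fin; exact: nsq_ge0.
have mphiE : measurable_fun setT (EFin \o phi) by exact/measurable_EFinP.
have avg : (\sum_(f : {ffun 'I_l -> 'I_N})
    \int[lebesgue_tuple l]_(x in @cube R l) (phi (tadd x (ypt f)))%:E =
    (N ^ l)%:R%:E * ((\sum_(n <- s) nsq (d n))%:E * lebesgue_tuple l (@cube R l)))%E.
  rewrite -ge0_integral_sum//; last 2 first.
  - exact: measurable_cube.
  - move=> f; apply: measurable_funS (measurableT_comp mphiE (measurable_tadd _)) => //.
  rewrite -integral_cst; last exact: measurable_cube.
  rewrite -ge0_integralZl_EFin//; last 2 first.
  - exact: measurable_cube.
  - by move=> x _ /=; rewrite lee_fin sumr_ge0// => n _; exact: nsq_ge0.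
  apply: eq_integral => x _; rewrite sumEFin -EFinM; congr EFin.
  under eq_bigr do rewrite phi_shift.
  rewrite finite_parseval//; congr (_ * _); apply: eq_bigr => n _.
  by rewrite nsqM nsq_ee mulr1.
have sumc : (\sum_(f : {ffun 'I_l -> 'I_N})
    \int[lebesgue_tuple l]_(x in @cube R l) (phi (tadd x (ypt f)))%:E =
    (N ^ l)%:R%:E * \int[lebesgue_tuple l]_(x in @cube R l) (phi x)%:E)%E.
  have cs y := @integral_cube_shift R l y _ mphiE phi0 (fun x b => congr1 EFin (phiper x b)).
  under eq_bigr do rewrite cs.
  by rewrite sumr_const card_ffun !card_ord mule_natl.
have NR : ((N ^ l)%:R : R) != 0 by rewrite pnatr_eq0 -lt0n expn_gt0 N0.
have := congr1 (fun z => (((N ^ l)%:R : R)^-1)%:E * z)%E (etrans (esym sumc) avg).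
by rewrite !(muleA ((N ^ l)%:R^-1)%:E) -EFinM mulVf// !mul1e.
Qed.

End cube_parseval.

Lemma lebesgue_cube (R : realType) l : lebesgue_tuple l (@cube R l) = 1%E.
Proof.
elim: l => [|l IH].
  by rewrite /= diracE mem_set// => -[].
rewrite /= /lebesgue_cons /pushforward.
have -> : @cons_pair R l @^-1` @cube R l.+1 = `[0, 1[%classic `*` @cube R l.
  apply/seteqP; split => -[t x] /=.
    move=> h; split; first by have := h ord0; rewrite tnth0 in_itv.
    move=> i; have := h (lift ord0 i); rewrite tnthS; exact.
  move=> [t01 hx] i; case: (unliftP ord0 i) => [j ->|->]; last first.
    by rewrite tnth0; move: t01; rewrite in_itv.
  rewrite tnthS; exact: hx.
rewrite product_measure1E//; last exact: measurable_cube.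
rewrite -[RHS]mule1; congr (_ * _)%E => //.
have := lebesgue_measure_itv (`[0, 1[ : interval R).
by rewrite /= lte_fin ltr01 -EFinD subr0.
Qed.

(** * Density of trigonometric polynomials *)

Section step_polynomials.
Context {R : realType}.

Lemma bernoulli_ge (u : R) (M : nat) : u <= 1 -> 1 - M%:R * u <= (1 - u) ^+ M.
Proof.
move=> u1; have [u2|u2] := leP (-1) (- u).
  elim: M => [|M IH]; first by rewrite mul0r subr0 expr0.
  rewrite exprS -natr1.
  have h : (1 - u) * (1 - M%:R * u) <= (1 - u) * (1 - u) ^+ M.
    by rewrite ler_wpM2l// subr_ge0.
  apply: le_trans h; have : 0 <= M%:R * u ^+ 2 by rewrite mulr_ge0// sqr_ge0.
  nra.
lra.
Qed.

Lemma cvg_nX (r : R) : 0 <= r < 1 -> (n%:R * r ^+ n) @[n --> \oo] --> (0 : R).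
Proof.
move=> /andP[r0 r1]; have [->|rn0] := eqVneq r 0.
  apply: (@cvg_trans _ ((fun=> 0 : R) @ \oo)); last exact: cvg_cst.
  apply: near_eq_cvg; near=> n; rewrite expr0n.
  have -> : (n == 0%N) = false by apply/negbTE; rewrite -lt0n; near: n; exact: nbhs_infty_gt.
  by rewrite mulr0.
have rp : 0 < r by rewrite lt_neqAle eq_sym rn0.
(* Bernoulli for 1/s = 1 + d gives n d <= s^(-n), hence n r^n = n s^(2n) <= s^n / d, a geometric
   bound. *)
pose s := Num.sqrt r.
have s0 : 0 < s by rewrite sqrtr_gt0.
have ss : s ^+ 2 = r by rewrite sqr_sqrtr.
have s1 : s < 1 by rewrite -(@ltr_pXn2r _ 2)// ?nnegrE ?ltW// ss expr1n.
pose d := s^-1 - 1.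
have d0 : 0 < d by rewrite subr_gt0 invf_gt1.
have bnd n : n%:R * r ^+ n <= d^-1 * s ^+ n.
  have := @bernoulli_ge (- d) n; rewrite opprK addrCA subrr addr0 => h.
  have {}h : 1 + n%:R * d <= s^-1 ^+ n by rewrite -mulrN opprK in h; apply: h; lra.
  have sn : 0 < s ^+ n by rewrite exprn_gt0.
  rewrite -ss exprAC expr2 mulrA ler_pM2r//.
  have {}h : (1 + n%:R * d) * s ^+ n <= 1.
    have sn1 : s^-1 ^+ n * s ^+ n = 1 by rewrite -exprMn mulVf ?expr1n ?gt_eqF.
    by rewrite -[leRHS]sn1 ler_pM2r.
  rewrite -(ler_pM2l d0) divff ?gt_eqF//; lra.
apply: (@squeeze_cvgr _ _ _ _ (fun=> 0) (fun n => d^-1 * s ^+ n)).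
- by near=> n; rewrite mulr_ge0 ?exprn_ge0//= bnd.
- exact: cvg_cst.
- rewrite -[X in _ --> X](mulr0 d^-1); apply: cvgM; first exact: cvg_cst.
  by apply: cvg_expr; rewrite gtr0_norm.
Unshelve. all: by end_near. Qed.

(* Since (1 - h^n)^(n k^n) is about exp(-n (k h)^n), this tends to 1 when
   k h < 1 and to 0 when k h >= 1. *)
Definition stepX (k n : nat) (h : R) : R := (1 - h ^+ n) ^+ (n * k ^ n).

Lemma stepX01 k n (h : R) : 0 <= h <= 1 -> 0 <= stepX k n h <= 1.
Proof.
move=> /andP[h0 h1]; have u0 : 0 <= h ^+ n by rewrite exprn_ge0.
have u1 : h ^+ n <= 1 by rewrite exprn_ile1.
by rewrite exprn_ge0 ?subr_ge0//= exprn_ile1 ?subr_ge0// gerBl.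
Qed.

(** Put u = h^n. If k h < 1, Bernoulli bounds the power below by 1 - n (k h)^n. Otherwise (1 - u)(1
    + u) <= 1, and Bernoulli for the powers of 1 + u bounds it above by 1/(n + 1). *)
Lemma cvg_stepX k (h : R) : 0 <= h <= 1 ->
  (stepX k n h) @[n --> \oo] --> (((k%:R * h < 1)%R)%:R : R).
Proof.
move=> /andP[h0 h1].
have u0 n : 0 <= h ^+ n by rewrite exprn_ge0.
have u1 n : h ^+ n <= 1 by rewrite exprn_ile1.
have Mu n : (n * k ^ n)%:R * h ^+ n = n%:R * (k%:R * h) ^+ n.
  by rewrite natrM natrX exprMn mulrA.
have q01 n := @stepX01 k n h (introT andP (conj h0 h1)).
have [kh|kh] := ltP (k%:R * h) 1.
  have kh0 : 0 <= k%:R * h < 1 by rewrite mulr_ge0.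
  apply: (@squeeze_cvgr _ _ _ _ (fun n => 1 - n%:R * (k%:R * h) ^+ n) (fun=> 1)).
  - by near=> n; rewrite -Mu bernoulli_ge//=; case/andP: (q01 n).
  - rewrite -[X in _ --> X]subr0; apply: cvgB; [exact: cvg_cst|exact: cvg_nX].
  - exact: cvg_cst.
apply: (@squeeze_cvgr _ _ _ _ (fun=> 0) (fun n => n.+1%:R^-1)).
- near=> n; case/andP: (q01 n) => -> _ /=.
  rewrite -[leRHS]mul1r ler_pdivlMr//.
  have : stepX k n h * (1 + h ^+ n) ^+ (n * k ^ n) <= 1.
    rewrite /stepX -exprMn exprn_ile1//.
      by rewrite mulr_ge0 ?subr_ge0 ?addr_ge0.
    by have := sqr_ge0 (h ^+ n); nra.
  apply: le_trans; rewrite ler_wpM2l//; first by case/andP: (q01 n).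
  have := @bernoulli_ge (- h ^+ n) (n * k ^ n); rewrite mulrN !opprK Mu => hh.
  have : n%:R <= n%:R * (k%:R * h) ^+ n by rewrite ler_peMr// exprn_ege1.
  by rewrite -natr1 => a; rewrite addrC (le_trans _ (hh _)) ?lerD2l//; have := u0 n; lra.
- exact: cvg_cst.
- exact: cvg_harmonic.
Unshelve. all: by end_near. Qed.

(* A translate of sin^2, scaled so that k * arc k a t < 1 exactly on 0 < t < a. *)
Definition arc (k : nat) (a t : R) : R :=
  (k%:R * sin (pi * a / 2) ^+ 2)^-1 * ((1 - cos (2 * pi * t - pi * a)) / 2).

(** The inequality k arc < 1 says sin^2(pi t - pi a/2) < sin^2(pi a/2), and the difference of the
    two squares is sin(pi t) sin(pi a - pi t), whose sign on [0, 1) is known. Taking k large keeps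
    [arc] below 1. *)
Lemma arcP (a : R) : 0 < a <= 1 -> exists k : nat,
  (forall t, 0 <= arc k a t <= 1) /\
  (forall t : R, 0 <= t < 1 -> (k%:R * arc k a t < 1) = (0 < t < a)).
Proof.
move=> /andP[a0 a1].
pose s := sin (pi * a / 2) ^+ 2.
have pa : 0 < pi * a / 2 <= pi / 2.
  by rewrite divr_gt0 ?mulr_gt0 ?pi_gt0//= ler_pM2r// ler_piMr ?pi_ge0.
have s0 : 0 < s.
  rewrite exprn_gt0//; apply: sin_gt0_pi; case/andP: pa => -> h /=.
  by apply: le_lt_trans h _; have := @pi_gt0 R; lra.
pose k := (Num.truncn s^-1).+1.
have ks : 1 < k%:R * s by rewrite -ltr_pdivrMr// div1r; exact: truncnS_gt.
have ks0 : 0 < k%:R * s by apply: lt_trans ks.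
exists k; split => [t|t /andP[t0 t1]].
  have := cos_le1 (2 * pi * t - pi * a); have := cos_geN1 (2 * pi * t - pi * a).
  rewrite /arc -/s; set c := cos _ => c1 c2; apply/andP; split.
    by apply: mulr_ge0; [rewrite invr_ge0 ltW|lra].
  by rewrite mulrC ler_pdivrMr// mul1r; lra.
have -> : k%:R * arc k a t = ((1 - cos (2 * pi * t - pi * a)) / 2) / s.
  by rewrite /arc -/s; field; rewrite gt_eqF//= ?gt_eqF// pnatr_eq0.
rewrite ltr_pdivrMr// mul1r.
have -> : 2 * pi * t - pi * a = (pi * t - pi * a / 2) *+ 2 by rewrite -mulr_natr; field.
rewrite cos_mulr2n.
have -> : (1 - (cos (pi * t - pi * a / 2) ^+ 2 *+ 2 - 1)) / 2 = sin (pi * t - pi * a / 2) ^+ 2.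
  by rewrite sin2cos2; lra.
have key : s - sin (pi * t - pi * a / 2) ^+ 2 = sin (pi * t) * sin (pi * a - pi * t).
  rewrite /s; set x := pi * a / 2; set y := pi * t - x.
  have -> : pi * t = x + y by rewrite /y; ring.
  have -> : pi * a - (x + y) = x - y by rewrite /x; field.
  rewrite [sin (x + y)]sinD [sin (x - y)]sinB; have := cos2Dsin2 x; have := cos2Dsin2 y => hy hx.
  have -> : (sin x * cos y + cos x * sin y) * (sin x * cos y - cos x * sin y) =
    sin x ^+ 2 * cos y ^+ 2 - cos x ^+ 2 * sin y ^+ 2 by ring.
  rewrite !cos2sin2; ring.
rewrite -subr_gt0 key.
apply/idP/idP => [h|/andP[tp ta]]; last first.
  rewrite mulr_gt0// sin_gt0_pi//.
    by rewrite mulr_gt0 ?pi_gt0//= gtr_pMr ?pi_gt0.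
  rewrite -mulrBr mulr_gt0 ?pi_gt0 ?subr_gt0//= gtr_pMr ?pi_gt0//; lra.
have st0 : 0 <= sin (pi * t).
  by apply: sin_ge0_pi; rewrite mulr_ge0 ?pi_ge0//= ger_pMr ?pi_gt0// ltW.
have [t0'|] := eqVneq t 0; first by move: h; rewrite t0' mulr0 sin0 mul0r ltxx.
move=> tn0; rewrite lt_neqAle eq_sym tn0 t0 /=; rewrite ltNge; apply/negP => ta.
have : 0 <= sin (pi * t - pi * a).
  apply: sin_ge0_pi; rewrite -mulrBr mulr_ge0 ?pi_ge0 ?subr_ge0//= ger_pMr ?pi_gt0//; lra.
rewrite -opprB sinN; nra.
Qed.

End step_polynomials.

Section dominated.
Context d (T : measurableType d) (R : realType) (mu : {measure set T -> \bar R}).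

Lemma dominated_small (h : nat -> T -> R) (W : T -> R) :
  (forall n, measurable_fun setT (h n)) -> (forall n x, 0 <= h n x <= W x) ->
  measurable_fun setT W -> (\int[mu]_x (W x)%:E < +oo)%E ->
  (forall x, h n x @[n --> \oo] --> (0 : R)) ->
  forall e : R, 0 < e -> exists N, forall n, (N <= n)%N -> (\int[mu]_x (h n x)%:E < e%:E)%E.
Proof.
move=> mh hW mW iW h0 e e0.
have W0 x : 0 <= W x by case/andP: (hW 0%N x) => a b; exact: le_trans a b.
have iW' : mu.-integrable setT (EFin \o W).
  apply/integrableP; split; first exact/measurable_EFinP.
  by under eq_integral do rewrite gee0_abs ?lee_fin//.
have mhE n : measurable_fun setT (EFin \o h n) by exact/measurable_EFinP.
have hc x : (EFin \o h n) x @[n --> \oo] --> 0%E.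
  by apply: cvg_EFin; [exact: nearW|exact: h0].
have hb n x : (`|(EFin \o h n) x| <= (EFin \o W) x)%E.
  by rewrite /= lee_fin; case/andP: (hW n x) => a b; rewrite ger0_norm.
have := @dominated_cvg _ _ _ mu setT measurableT (fun n => EFin \o h n) (cst 0%E)
  (EFin \o W) mhE (fun x _ => hc x) (fun x _ => isT) iW' (fun n x _ => hb n x).
rewrite integral0 => /fine_cvgP[fin /cvgrPdist_lt/(_ e e0)] cv.
near \oo => N0.
have [N _ HN] : \forall n \near \oo, (\int[mu]_x (h n x)%:E < e%:E)%E.
  near=> n.
  have fn : (\int[mu]_x (h n x)%:E)%E \is a fin_num by near: n.
  rewrite -(fineK fn) lte_fin.
  have : `|0 - fine (\int[mu]_x (h n x)%:E)%E| < e by near: n.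
  by rewrite sub0r normrN; apply: le_lt_trans; exact: ler_norm.
by exists N => n Nn; exact: HN.
Unshelve. all: by end_near. Qed.

End dominated.

Section trigonometric_polynomials.
Context {R : realType} {l : nat}.
Local Notation Z := (l.-tuple int).
Local Notation V := (Rspace R l).

(** Frequencies may repeat in the list, so sums and products need no bookkeeping;
    [merge_frequencies] collects them when orthogonality is used. *)
Definition trig (p : V -> R) := exists s : seq (Z * R[i]),
  forall x, (p x)%:C%C = \sum_(t <- s) t.2 * ee (tdot (tint t.1) x).

Lemma eq_trig p q : p =1 q -> trig p -> trig q.
Proof. by move=> pq [s hs]; exists s => x; rewrite -pq. Qed.

Lemma tdot0 (x : V) : tdot (tint [tuple (0 : int) | _ < l]) x = 0.
Proof. by rewrite /tdot big1// => i _; rewrite !tnth_mktuple mul0r. Qed.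

Lemma trig_cst (c : R) : trig (fun=> c).
Proof.
exists [:: ([tuple (0 : int) | _ < l], c%:C%C)] => x.
by rewrite big_seq1 /= tdot0 ee0 mulr1.
Qed.

Lemma trigD p q : trig p -> trig q -> trig (fun x => p x + q x).
Proof.
by move=> [s hs] [s' hs']; exists (s ++ s') => x; rewrite rmorphD /= hs hs' big_cat.
Qed.

Lemma trigM p q : trig p -> trig q -> trig (fun x => p x * q x).
Proof.
move=> [s hs] [s' hs'].
exists [seq (zadd t.1 u.1, t.2 * u.2) | t <- s, u <- s'] => x.
rewrite rmorphM /= hs hs' big_allpairs_dep mulr_suml; apply: eq_bigr => t _.
rewrite mulr_sumr; apply: eq_bigr => u _ /=.
by rewrite tint_add tdotDl eeD; ring.
Qed.

Lemma trigN p : trig p -> trig (fun x => - p x).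
Proof.
move=> tp; apply: (eq_trig _ (trigM (trig_cst (-1)) tp)) => x; exact: mulN1r.
Qed.

Lemma trigX p n : trig p -> trig (fun x => p x ^+ n).
Proof.
move=> tp; elim: n => [|n IH]; first exact: (trig_cst 1).
by apply: (eq_trig _ (trigM tp IH)) => x; rewrite exprS.
Qed.

Lemma trig_cos (n : Z) (th : R) : trig (fun x => cos (2 * pi * tdot (tint n) x + th)).
Proof.
exists [:: (n, 2^-1 * cexpi th); (zopp n, 2^-1 * cexpi (- th))] => x.
rewrite big_cons big_seq1 /=.
have -> : tdot (tint (zopp n)) x = - tdot (tint n) x.
  by rewrite /tdot -sumrN; apply: eq_bigr => i _; rewrite !tnth_mktuple rmorphN mulNr.
set u := 2 * pi * tdot (tint n) x.
have -> : 2^-1 * cexpi th * ee (tdot (tint n) x) = 2^-1 * cexpi (u + th).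
  by rewrite cexpiD /ee -/u; ring.
have -> : 2^-1 * cexpi (- th) * ee (- tdot (tint n) x) = 2^-1 * cexpi (- (u + th)).
  by rewrite opprD cexpiD /ee mulrN -/u; ring.
set y := u + th; rewrite -mulrDr.
have -> : cexpi y + cexpi (- y) = 2 * (cos y)%:C%C.
  rewrite mulr_natl mulr2n /cexpi cosN sinN; apply/eqP.
  by rewrite eq_complex /= subrr addr0 !eqxx.
by rewrite mulKf// pnatr_eq0.
Qed.

Lemma trig_bounded p : trig p -> exists2 b, 0 <= b & forall x, `|p x| <= b.
Proof.
move=> [s hs]; exists (\sum_(t <- s) normc t.2).
  by rewrite sumr_ge0// => t _; exact: normc_ge0.
move=> x; have -> : `|p x| = normc (p x)%:C%C.
  by rewrite /= expr0n addr0 sqrtr_sqr.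
rewrite hs (le_trans (normc_sum_le _ _))// ler_sum// => t _.
by rewrite ComplexField.Normc.normcM normc_ee mulr1.
Qed.

Lemma trig_measurable p : trig p -> measurable_fun setT p.
Proof.
move=> [s hs].
rewrite (_ : p = fun x => complex.Re (\sum_(t <- s) t.2 * ee (tdot (tint t.1) x))).
  by apply: (proj1 (cmeas_sum _ _)) => t; apply: cmeasM; [exact: cmeas_cst|exact: cmeas_ee_tdot].
by apply/funext => x; rewrite -hs.
Qed.

Lemma merge_frequencies (s : seq (Z * R[i])) : exists s' : seq Z, exists d : Z -> R[i], uniq s' /\
  forall x : V, \sum_(t <- s) t.2 * ee (tdot (tint t.1) x) = \sum_(n <- s') d n * ee (tdot (tint n) x).
Proof.
exists (undup [seq t.1 | t <- s]).
exists (fun n => \sum_(t <- s | t.1 == n) t.2); split; first exact: undup_uniq.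
move=> x.
under [RHS]eq_bigr => n _.
  rewrite mulr_suml (eq_bigr (fun t : Z * R[i] => t.2 * ee (tdot (tint t.1) x))); last first.
    by move=> t /eqP ->.
  over.
rewrite [RHS](exchange_big_dep xpredT)//= big_seq [RHS]big_seq; apply: eq_bigr => t ts.
rewrite (big_rem t.1)/=; last by rewrite mem_undup map_f.
rewrite eqxx big_seq_cond big1 ?addr0// => n /andP[nr /eqP tn].
move: nr; rewrite -tn mem_rem_uniq ?undup_uniq// inE /= eqxx//.
Qed.

Lemma trig_uniq p : trig p -> exists s : seq Z, exists d : Z -> R[i], uniq s /\
  forall x, (p x)%:C%C = \sum_(n <- s) d n * ee (tdot (tint n) x).
Proof.
move=> [s hs]; have [s' [d [us' h]]] := merge_frequencies s; exists s', d; split => // x.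
by rewrite hs h.
Qed.

Section density.
Variable w : V -> R.
Hypotheses (mw : measurable_fun setT w) (w0 : forall x, 0 <= w x).
Hypothesis iw : (\int[lebesgue_tuple l]_x (w x)%:E < +oo)%E.

(** The closure of the trigonometric polynomials in L^2(w dx). The weight lives on the whole space
    because it will contain |f|^2 for a finite combination f of translates of g. *)
Definition trig_approx (f : V -> R) := measurable_fun setT f /\
  forall e, 0 < e -> exists p, trig p /\
    (\int[lebesgue_tuple l]_x ((f x - p x) ^+ 2 * w x)%:E < e%:E)%E.

Let m_sqw (f g : V -> R) : measurable_fun setT f -> measurable_fun setT g ->
  measurable_fun setT (fun x => ((f x - g x) ^+ 2 * w x)%:E).
Proof.
move=> mf mg; apply/measurable_EFinP; apply: measurable_funM => //.
by apply: measurable_funX; exact: measurable_funB.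
Qed.

Let sqw_le (f g h : V -> R) (a b : \bar R) : measurable_fun setT f -> measurable_fun setT g ->
  measurable_fun setT h ->
  (\int[lebesgue_tuple l]_x ((f x - g x) ^+ 2 * w x)%:E <= a)%E ->
  (\int[lebesgue_tuple l]_x ((g x - h x) ^+ 2 * w x)%:E <= b)%E ->
  (\int[lebesgue_tuple l]_x ((f x - h x) ^+ 2 * w x)%:E <= 2%:E * a + 2%:E * b)%E.
Proof.
move=> mf mg mh ha hb.
apply: (@le_trans _ _ (2%:E * \int[lebesgue_tuple l]_x ((f x - g x) ^+ 2 * w x)%:E +
  2%:E * \int[lebesgue_tuple l]_x ((g x - h x) ^+ 2 * w x)%:E)%E); last first.
  by apply: leeD; apply: lee_wpmul2l.
have mfg (u v : V -> R) : measurable_fun setT u -> measurable_fun setT v ->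
    measurable_fun setT (fun x => (u x - v x) ^+ 2 * w x).
  by move=> mu mv; apply/measurable_EFinP; exact: m_sqw.
have sq0 (u v : V -> R) x : 0 <= (u x - v x) ^+ 2 * w x by rewrite mulr_ge0// sqr_ge0.
rewrite -!ge0_intZ//; try exact: mfg.
rewrite -ge0_intD//; try by [apply: measurable_funM => //; exact: mfg | move=> x; rewrite mulr_ge0].
apply: ge0_int_le => //; first exact: mfg.
  by apply: measurable_funD; apply: measurable_funM => //; exact: mfg.
move=> x _.
have : (f x - h x) ^+ 2 <= 2 * (f x - g x) ^+ 2 + 2 * (g x - h x) ^+ 2.
  by have := sqr_ge0 (f x - g x - (g x - h x)); nra.
by move=> /(ler_wpM2r (w0 x)); lra.
Qed.

Lemma approx_close (f : V -> R) : measurable_fun setT f ->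
  (forall e, 0 < e -> exists g, trig_approx g /\
    (\int[lebesgue_tuple l]_x ((f x - g x) ^+ 2 * w x)%:E < e%:E)%E) -> trig_approx f.
Proof.
move=> mf h; split => // e e0.
have e4 : 0 < e / 8 by rewrite divr_gt0.
have [g [[mg ag] hg]] := h _ e4.
have [p [tp hp]] := ag _ e4; exists p; split => //.
apply: le_lt_trans (sqw_le mf mg (trig_measurable tp) (ltW hg) (ltW hp)) _.
by rewrite -!EFinM -EFinD lte_fin; lra.
Qed.

Lemma approx_trig p : trig p -> trig_approx p.
Proof.
move=> tp; split; first exact: trig_measurable.
move=> e e0; exists p; split => //.
under eq_integral do rewrite subrr expr0n mul0r.
by rewrite integral0 lte_fin.
Qed.

Lemma approxB f g : trig_approx f -> trig_approx g -> trig_approx (fun x => f x - g x).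
Proof.
move=> [mf af] [mg ag]; split; first exact: measurable_funB.
move=> e e0; have e4 : 0 < e / 8 by rewrite divr_gt0.
have [p [tp hp]] := af _ e4; have [q [tq hq]] := ag _ e4.
exists (fun x => p x - q x); split; first by apply: trigD => //; exact: trigN.
have mp := trig_measurable tp; have mq := trig_measurable tq.
have h1 : (\int[lebesgue_tuple l]_x (((f x - g x) - (p x - g x)) ^+ 2 * w x)%:E <= (e / 8)%:E)%E.
  by under eq_integral do rewrite opprB addrA subrK; exact: ltW.
have h2 : (\int[lebesgue_tuple l]_x (((p x - g x) - (p x - q x)) ^+ 2 * w x)%:E <= (e / 8)%:E)%E.
  apply: le_trans (ltW hq); rewrite le_eqVlt; apply/orP; left; apply/eqP.
  by apply: eq_integral => x _; congr EFin; ring.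
apply: le_lt_trans (sqw_le _ _ _ h1 h2) _; try exact: measurable_funB.
by rewrite -!EFinM -EFinD lte_fin; lra.
Qed.

Lemma approxM_trig f p : trig p -> trig_approx f -> trig_approx (fun x => p x * f x).
Proof.
move=> tp [mf af]; have mp := trig_measurable tp.
split; first exact: measurable_funM.
move=> e e0; have [b b0 hb] := trig_bounded tp.
have b1 : 0 < b ^+ 2 + 1 by rewrite ltr_wpDl// sqr_ge0.
have [q [tq hq]] := af (e / (b ^+ 2 + 1)) (divr_gt0 e0 b1).
have mq := trig_measurable tq.
exists (fun x => p x * q x); split; first exact: trigM.
apply: (@le_lt_trans _ _ ((b ^+ 2)%:E * \int[lebesgue_tuple l]_x ((f x - q x) ^+ 2 * w x)%:E)%E).
  have mfq : measurable_fun setT (fun x => (f x - q x) ^+ 2 * w x).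
    by apply/measurable_EFinP; exact: m_sqw.
  rewrite -ge0_intZ ?sqr_ge0//; last by move=> x; rewrite mulr_ge0// sqr_ge0.
  apply: ge0_int_le => //.
  - by apply/measurable_EFinP; apply: (m_sqw (f := fun x => p x * f x) (g := fun x => p x * q x)); exact: measurable_funM.
  - exact: measurable_funM.
  - by move=> x; rewrite mulr_ge0// sqr_ge0.
  - move=> x _; rewrite -mulrBr exprMn -mulrA ler_wpM2r ?(mulr_ge0 (sqr_ge0 _) (w0 x))//.
    by rewrite -[leLHS](real_normK (num_real (p x))) ler_pXn2r ?nnegrE.
apply: (@le_lt_trans _ _ ((b ^+ 2)%:E * (e / (b ^+ 2 + 1))%:E)%E).
  by apply: lee_wpmul2l; [rewrite lee_fin sqr_ge0|exact: ltW].
rewrite -EFinM lte_fin mulrA ltr_pdivrMr//; have := sqr_ge0 b; nra.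
Qed.

Lemma approx_lim (F : nat -> V -> R) (f : V -> R) (C : R) : (forall n, trig_approx (F n)) ->
  (forall n x, `|F n x| <= C) -> (forall x, F n x @[n --> \oo] --> f x) -> trig_approx f.
Proof.
move=> aF bF cF.
have mF n : measurable_fun setT (F n) by case: (aF n).
have mf : measurable_fun setT f.
  by apply: (measurable_fun_cvg (h := F)) => // x _; exact: cF.
have bf x : `|f x| <= C.
  have /cvg_norm := cF x => h.
  apply: (cvgr_to_le h); near=> n; exact: bF.
have C0 : 0 <= C by apply: le_trans (bf point).
apply: approx_close => // e e0.
have mW : measurable_fun setT (fun x => 4 * C ^+ 2 * w x).
  by apply: measurable_funM.
have iW : (\int[lebesgue_tuple l]_x (4 * C ^+ 2 * w x)%:E < +oo)%E.
  rewrite ge0_intZ ?mulr_ge0 ?sqr_ge0//.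
  by rewrite lte_mul_pinfty// lee_fin mulr_ge0 ?sqr_ge0.
have [|||N] := @dominated_small _ _ _ (lebesgue_tuple l)
  (fun n x => (f x - F n x) ^+ 2 * w x) (fun x => 4 * C ^+ 2 * w x) _ _ mW iW _ e e0.
- by move=> n; apply/measurable_EFinP; exact: m_sqw.
- move=> n x; rewrite mulr_ge0 ?sqr_ge0//= ler_wpM2r//.
  have : `|f x - F n x| <= 2 * C.
    by apply: le_trans (ler_normB _ _) _; have := bf x; have := bF n x; lra.
  rewrite -(real_normK (num_real (f x - F n x))) => h.
  have -> : 4 * C ^+ 2 = (2 * C) ^+ 2 by ring.
  by rewrite ler_pXn2r ?nnegrE// mulr_ge0.
- move=> x; rewrite -[X in _ --> X](mul0r (w x)); apply: cvgM; last exact: cvg_cst.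
  rewrite (_ : 0 = (f x - f x) ^+ 2); last by rewrite subrr expr0n.
  by apply: cvgM; apply: cvgB => //; exact: cvg_cst.
move=> hN; exists (F N); split => //; exact: hN.
Unshelve. all: by end_near. Qed.

(** Asking for stability under multiplication by the periodic indicator, and not just for
    approximability of that indicator, makes closure under intersection immediate. *)
Definition good : set (set V) := [set E | measurable E /\
  forall f C, trig_approx f -> (forall x, `|f x| <= C) ->
    trig_approx (fun x => f x * (\1_E (tfrac x) : R))].

Lemma goodC E : good E -> good (~` E).
Proof.
move=> [mE gE]; split; first exact: measurableC.
move=> f C af bf; have := approxB af (gE f C af bf).
congr trig_approx; apply/funext => x; rewrite !indicE in_setC.
by case: (_ \in _) => /=; rewrite ?mulr1 ?mulr0 ?subrr ?subr0.
Qed.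

Lemma goodI E E' : good E -> good E' -> good (E `&` E').
Proof.
move=> [mE gE] [mE' gE']; split; first exact: measurableI.
move=> f C af bf; have bf' x : `|f x * (\1_E (tfrac x) : R)| <= C.
  rewrite normrM (le_trans _ (bf x))// ler_piMr// indicE.
  by case: (_ \in _); rewrite /= ?normr1 ?normr0.
have := gE' _ C (gE f C af bf) bf'; congr trig_approx; apply/funext => x.
by rewrite -mulrA; congr (_ * _); rewrite !indicE in_setI; do 2 case: (_ \in _); rewrite /= ?mulr1 ?mul0r ?mulr0.
Qed.

Lemma good0 : good set0.
Proof.
split => // f C af bf; apply: (approx_close (f := fun x => f x * \1_set0 (tfrac x))).
  by rewrite (_ : (fun x => _) = cst 0)//; apply/funext => x; rewrite indic0 mulr0.
move=> e e0; exists (fun=> 0); split; first by apply: approx_trig; exact: trig_cst.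
under eq_integral do rewrite indic0 mulr0 subrr expr0n mul0r.
by rewrite integral0 lte_fin.
Qed.

Lemma good_sigma_algebra : sigma_algebra setT good.
Proof.
split; first exact: good0.
  by move=> A gA; rewrite setTD; exact: goodC.
move=> A gA.
pose U n := \big[setU/set0]_(i < n) A i.
have gU n : good (U n).
  elim: n => [|n IH]; first by rewrite /U big_ord0; exact: good0.
  rewrite /U big_ord_recr /= -/(U n) -[_ `|` _]setCK setCU; apply: goodC.
  by apply: goodI; exact: goodC.
split; first by apply: bigcup_measurable => i _; case: (gA i).
move=> f C af bf.
apply: (@approx_lim (fun n x => f x * \1_(U n) (tfrac x)) _ C).
- by move=> n; case: (gU n) => _; apply.
- move=> n x; rewrite normrM (le_trans _ (bf x))// ler_piMr// indicE.
  by case: (_ \in _); rewrite /= ?normr1 ?normr0.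
- move=> x; apply: cvgM; first exact: cvg_cst.
  rewrite indicE; have [|nA] := boolP (tfrac x \in _).
    rewrite inE => -[k _ Ak]; apply: (@cvg_trans _ ((fun=> 1 : R) @ \oo)); last exact: cvg_cst.
    apply: near_eq_cvg; near=> n; rewrite indicE mem_set//.
    rewrite /U -bigcup_mkord; exists k => //=; near: n; exact: nbhs_infty_gt.
  apply: (@cvg_trans _ ((fun=> 0 : R) @ \oo)); last exact: cvg_cst.
  apply: near_eq_cvg; near=> n; rewrite indicE memNset// => Ux.
  move: nA; rewrite notin_setE; apply; move: Ux; rewrite /U -bigcup_mkord => -[k _ Ak].
  by exists k.
Unshelve. all: by end_near. Qed.

Definition zunit (i : 'I_l) : Z := [tuple (j == i)%:Z | j < l].

Lemma tdot_zunit i (x : V) : tdot (tint (zunit i)) x = tnth x i.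
Proof.
rewrite /tdot (bigD1 i)//= big1 ?addr0.
  by rewrite !tnth_mktuple eqxx mul1r.
by move=> j ji; rewrite !tnth_mktuple (negbTE ji) mul0r.
Qed.

(** The periodic indicator of the interval is the bounded pointwise limit of the trigonometric
    polynomials [stepX k n] of [arc]. *)
Lemma good_open i (a : R) : 0 < a <= 1 -> good [set x | 0 < (tnth x i : R) < a].
Proof.
move=> a01; split.
  have -> : [set x : V | 0 < (tnth x i : R) < a] = (fun x : V => (tnth x i : R)) @^-1` `]0, a[.
    by apply/seteqP; split => x /=; rewrite in_itv.
  by rewrite -[X in measurable X]setTI; exact: measurable_tnthR.
move=> f C af bf; have [k [arc01 hk]] := arcP a01.
pose h (x : V) := arc k a (tnth x i).
have th : trig h.
  apply: (eq_trig (p := fun x => (k%:R * sin (pi * a / 2) ^+ 2)^-1 *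
    ((1 + - cos (2 * pi * tdot (tint (zunit i)) x + - (pi * a))) * 2^-1))).
    by move=> x; rewrite tdot_zunit.
  apply: trigM; first exact: trig_cst.
  apply: trigM; last exact: trig_cst.
  apply: trigD; first exact: trig_cst.
  by apply: trigN; exact: trig_cos.
have hfrac (x : V) : arc k a (tnth (tfrac x) i) = h x.
  rewrite /arc /h /arc !tnth_mktuple.
  set t := tnth x i; set m := Num.floor t.
  have -> : 2 * pi * (t - m%:~R) - pi * a = (2 * pi * t - pi * a) - 2 * pi * m%:~R by ring.
  have := ee_int (R := R) m; rewrite /ee => /eqP; rewrite eq_complex /= => /andP[/eqP c1 /eqP s1].
  by rewrite [cos (_ - 2 * pi * _)]cosB c1 s1 mulr1 mulr0 addr0.
apply: (@approx_lim (fun n x => stepX k n (h x) * f x) _ C).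
- move=> n; apply: approxM_trig => //; apply: trigX; apply: trigD; first exact: trig_cst.
  by apply: trigN; exact: trigX.
- move=> n x; rewrite normrM (le_trans _ (bf x))// ler_piMl//.
  by have /andP[s0 s1] := stepX01 k n (arc01 (tnth x i)); rewrite ger0_norm.
- move=> x; rewrite mulrC; apply: cvgM; last exact: cvg_cst.
  have := @cvg_stepX _ k _ (arc01 (tnth x i)).
  rewrite indicE -/(h x) -hfrac hk ?frac_cube//.
  have [h1|h1] := boolP (_ < _ < _); first by rewrite mem_set.
  by rewrite memNset//=; exact/negP.
Qed.

Lemma good_coord i (a : R) : good [set x | (tnth x i : R) < a].
Proof.
have mlt : measurable [set x : V | (tnth x i : R) < a].
  have -> : [set x : V | (tnth x i : R) < a] = (fun x : V => (tnth x i : R)) @^-1` `]-oo, a[.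
    by apply/seteqP; split => x /=; rewrite in_itv.
  by rewrite -[X in measurable X]setTI; exact: measurable_tnthR.
have goodE E E' : measurable E' -> (forall x, E (tfrac x) <-> E' (tfrac x)) -> good E -> good E'.
  move=> mE' EE' [mE gE]; split => // f C af bf; have := gE f C af bf.
  congr trig_approx; apply/funext => x; congr (_ * _); rewrite !indicE; congr (_%:R : R).
  by congr nat_of_bool; apply/idP/idP; rewrite !inE => /EE'.
have goodT : good setT by rewrite -setC0; apply: goodC; exact: good0.
have [a0|a0] := leP a 0.
  apply: (goodE set0) => // [x|]; last exact: good0.
  split => //= h; have /andP[x0 _] := frac_cube x i; have := lt_le_trans h a0.
  by rewrite ltNge x0.
have [a1|a1] := leP a 1; last first.
  apply: (goodE setT) => // x; split => //= _; have /andP[_ x1] := frac_cube x i.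
  exact: lt_trans x1 a1.
(* This is (0, a) together with the complement of (0, 1); on fractional parts the latter is the
   point 0, so the result is [0, a). *)
apply: (goodE (~` (~` [set x | 0 < (tnth x i : R) < a] `&` [set x | 0 < (tnth x i : R) < 1]))) => //.
  move=> x /=; have /andP[x0 x1] := frac_cube x i; split.
    move=> h; rewrite ltNge; apply/negP => ax; apply: h; split.
      by apply/negP; rewrite negb_and -[X in _ || X]leNgt ax orbT.
    by rewrite x1 andbT; exact: lt_le_trans a0 ax.
  by move=> xa [] h /andP[xp _]; apply: h; rewrite xp.
apply: goodC; apply: goodI; first by apply: goodC; apply: good_open; rewrite a0.
by apply: good_open; rewrite ltr01 lexx.
Qed.

(** The half-spaces of [good_coord] generate the product sigma-algebra; this is expressed as
    measurability of the identity from the sigma-algebra of good sets. *)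
Lemma good_measurable E : measurable E -> good E.
Proof.
move=> mE.
pose T1 := g_sigma_algebraType good.
have goodE : <<s good >> = good by apply: sigma_algebra_id; exact: good_sigma_algebra.
have mid : measurable_fun [set: T1] (fun x : T1 => x : V).
  apply/measurable_fun_tnthP => i; apply: (measurability _ (RGenInftyO.measurableE R)) => //.
  move=> _ [_ [a ->] <-]; rewrite setTI.
  rewrite /measurable /= goodE.
  have := good_coord i a; congr good; apply/seteqP; split => x /=; by rewrite in_itv.
have := mid measurableT E mE; rewrite setTI /measurable /= goodE; exact.
Qed.

Lemma trig_dense E (e : R) : measurable E -> 0 < e -> exists p, trig p /\
  (\int[lebesgue_tuple l]_x ((\1_E (tfrac x) - p x) ^+ 2 * w x)%:E < e%:E)%E.
Proof.
move=> /good_measurable[mE gE] e0.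
have [|_ h] := gE (fun=> 1) 1 (approx_trig (trig_cst 1)); first by move=> x; rewrite normr1.
have [p [tp hp]] := h e e0; exists p; split => //.
by under eq_integral do rewrite -[\1_E _]mul1r.
Qed.

End density.
End trigonometric_polynomials.

(** * Localized Riesz inequality *)

Section finite_riesz.
Context {R : realType} {l : nat}.
Local Notation Z := (l.-tuple int).
Local Notation V := (Rspace R l).
Local Notation leb := (lebesgue_tuple l).
Implicit Types (g : V -> R[i]) (A B : R).

(** The Riesz bounds for finite combinations evaluated pointwise, so that no limits in L^2 are
    involved from here on. *)
Definition finite_riesz g A B := forall (s : seq (Z * Z)) (c : Z * Z -> R[i]), uniq s ->
  ((A * \sum_(i <- s) nsq (c i))%:E <=
     \int[leb]_x (nsq (\sum_(i <- s) c i * gabor g i x))%:E <=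
   (B * \sum_(i <- s) nsq (c i))%:E)%E.

Lemma cmeas_gabor g i : cmeasurable g -> cmeasurable (gabor g i).
Proof.
move=> mg; apply: cmeasM; first exact: cmeas_ee_tdot.
exact: (cmeas_comp mg (measurable_tsub_int i.1)).
Qed.

(** For finitely supported coefficients the unconditional sum s is at L^2 distance 0 from the
    pointwise finite sum, hence equal to it almost everywhere. *)
Lemma riesz_basis_finite g A B : cmeasurable g ->
  L2_riesz_basis leb (gabor g) A B -> finite_riesz g A B.
Proof.
move=> mg [_ _ A0 AB rb] s c us.
pose c' i := if i \in s then c i else 0.
have sc' : sqsum c' = (\sum_(i <- s) nsq (c i))%:E.
  rewrite /sqsum; pose a i := (nsq (c' i))%:E.
  have fs : finite_set [set` s] by exact: finite_seq.
  have -> : \esum_(i in [set: Z * Z]) (normc (c' i) ^+ 2)%:E = \esum_(i in [set` s]) a i.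
    rewrite [RHS]esum_mkcond; apply: eq_esum => i _; rewrite /a /c'.
    rewrite mem_setE; case: ifP => // _; by rewrite -/(nsq 0) nsq0.
  rewrite (esum_fset fs); last by move=> i _; rewrite lee_fin; exact: nsq_ge0.
  rewrite -(fsbig_seq _ a us) -sumEFin big_seq [RHS]big_seq; apply: eq_bigr => i si.
  by rewrite /a /c' si.
have [|f [[mf _] hf] hb] := rb c'; first by rewrite sc' ltry.
pose S x := \sum_(i <- s) c i * gabor g i x.
have mS : cmeasurable S.
  by apply: cmeas_sum => i; apply: cmeasM; [exact: cmeas_cst|exact: cmeas_gabor].
have d0 : L2sqdist leb S f = 0%E.
  have p0 : (0 <= L2sqdist leb S f)%E.
    by apply: integral_ge0 => x _; rewrite lee_fin sqr_ge0.
  apply/eqP; rewrite eq_le p0 andbT; apply/lee_addgt0Pr => e e0; rewrite add0e.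
  have [F0 hF0] := hf e e0.
  have := hF0 (F0 `|` [fset i in s])%fset (fsubsetUl _ _).
  rewrite (_ : lincomb _ _ _ = S); first exact: ltW.
  apply/funext => x; rewrite /lincomb /S.
  rewrite (eq_big_supp (s2 := s) (f := fun i => c' i * gabor g i x)) //.
  - by rewrite big_seq [RHS]big_seq; apply: eq_bigr => i si; rewrite /c' si.
  - exact: fset_uniq.
  - move=> i; rewrite /c'; case: ifP => si; last by rewrite mul0r eqxx.
    by rewrite in_fsetU !inE si orbT.
have -> : (\int[leb]_x (nsq (S x))%:E)%E = L2sqnorm leb f.
  have mD : measurable_fun setT (fun x => (nsq (S x - f x))%:E).
    by apply: emeasurable_nsq; exact: cmeasB.
  have absd0 : (\int[leb]_x `|(nsq (S x - f x))%:E| = 0)%E.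
    by rewrite -[RHS]d0; apply: eq_integral => x _; rewrite gee0_abs// lee_fin nsq_ge0.
  have /(ae_eq_integral_abs leb measurableT mD) ae0 := absd0.
  apply: ge0_ae_eq_integral => //; try exact: emeasurable_nsq.
  - by move=> x _; rewrite lee_fin; exact: nsq_ge0.
  - by move=> x _; rewrite lee_fin; exact: nsq_ge0.
  apply: filterS ae0 => x h _; congr EFin; have := h I => -[] /= /eqP.
  by rewrite sqrf_eq0 => /eqP/ComplexField.Normc.eq0_normc/subr0_eq ->.
by move: hb; rewrite sc' -!EFinM.
Qed.

Definition shiftf (s : V) g : V -> R[i] := fun x => g (tadd x s).

(** Translating g by s multiplies each coefficient by a unimodular constant, up to a translation of
    the whole sum. *)
Lemma finite_riesz_shift g A B s : cmeasurable g -> finite_riesz g A B ->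
  finite_riesz (shiftf s g) A B.
Proof.
move=> mg rg t c ut.
pose c' (i : Z * Z) := c i * ee (- tdot (tint i.2) s).
have := rg t c' ut.
have -> : \sum_(i <- t) nsq (c' i) = \sum_(i <- t) nsq (c i).
  by apply: eq_bigr => i _; rewrite nsqM nsq_ee mulr1.
suff -> : (\int[leb]_x (nsq (\sum_(i <- t) c' i * gabor g i x))%:E =
  \int[leb]_x (nsq (\sum_(i <- t) c i * gabor (shiftf s g) i x))%:E)%E by [].
rewrite -(integral_tadd s (f := fun x => (nsq (\sum_(i <- t) c' i * gabor g i x))%:E)).
- apply: eq_integral => x _; congr (nsq _)%:E; apply: eq_bigr => i _.
  rewrite /c' /gabor -!/(ee _) tdotDr eeD /shiftf.
  have -> : tsub (tadd x s) (tint i.1) = tadd (tsub x (tint i.1)) s.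
    by rewrite !tsubE -!taddA [tadd s _]taddC.
  rewrite -!mulrA; congr (_ * _); rewrite [ee (tdot _ s) * _]mulrC !mulrA.
  by rewrite [LHS]mulrAC [ee (- _) * _]mulrC -[_ * _ * ee _]mulrA -eeD addNr ee0 mulr1.
- apply: emeasurable_nsq; apply: cmeas_sum => i.
  by apply: cmeasM; [exact: cmeas_cst|exact: cmeas_gabor].
- by move=> x; rewrite lee_fin; exact: nsq_ge0.
Qed.

Section localization.
Variables (g : V -> R[i]) (A B : R) (s : seq Z) (c : Z -> R[i]).
Hypotheses (mg : cmeasurable g) (rg : finite_riesz g A B) (us : uniq s).
Hypotheses (A0 : 0 <= A) (B0 : 0 <= B).
Let f x := \sum_(m <- s) c m * g (tsub x (tint m)).
(** With both terms in the weight, one approximating polynomial p controls the integral of p^2 |f|^2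
    and that of p^2 over the cube. *)
Let w x := nsq (f x) + \1_(@cube R l) x.

Let mf : cmeasurable f.
Proof.
apply: cmeas_sum => m; apply: cmeasM; first exact: cmeas_cst.
exact: (cmeas_comp mg (measurable_tsub_int m)).
Qed.

Let mnf : measurable_fun setT (fun x => nsq (f x)).
Proof. exact: measurable_nsq. Qed.

Let mc : measurable_fun setT (\1_(@cube R l) : V -> R).
Proof. by apply: measurable_indic; exact: measurable_cube. Qed.

Let mw : measurable_fun setT w.
Proof. exact: measurable_funD. Qed.

Let c0 (x : V) : 0 <= \1_(@cube R l) x :> R.
Proof. by rewrite indicE. Qed.

Let w0 x : 0 <= w x.
Proof. by rewrite addr_ge0// nsq_ge0. Qed.

Let int_cube (h : V -> R) : 
  (\int[leb]_x (h x * \1_(@cube R l) x)%:E = \int[leb]_(x in @cube R l) (h x)%:E)%E.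
Proof.
rewrite [RHS]integral_mkcond; apply: eq_integral => x _.
by rewrite patchE indicE; case: ifP => _; rewrite ?mulr1 ?mulr0.
Qed.

Let trig_bounds p : trig p -> exists2 D : R, 0 <= D &
  [/\ (\int[leb]_x (p x ^+ 2 * \1_(@cube R l) x)%:E = D%:E)%E,
    ((A * (D * \sum_(m <- s) nsq (c m)))%:E <= \int[leb]_x (p x ^+ 2 * nsq (f x))%:E)%E &
    (\int[leb]_x (p x ^+ 2 * nsq (f x))%:E <= (B * (D * \sum_(m <- s) nsq (c m)))%:E)%E].
Proof.
move=> /trig_uniq[t [d [ut hp]]].
exists (\sum_(n <- t) nsq (d n)); first by apply: sumr_ge0 => n _; exact: nsq_ge0.
have -> : (\int[leb]_x (p x ^+ 2 * \1_(@cube R l) x)%:E = (\sum_(n <- t) nsq (d n))%:E)%E.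
  rewrite int_cube; have := cube_parseval (R := R) d ut; rewrite lebesgue_cube mule1 => <-.
  by apply: eq_integral => x _; rewrite -hp nsq_real.
have ust : uniq [seq (m, n) | m <- s, n <- t] by apply: allpairs_uniq => // -[? ?] [? ?] _ _ [-> ->].
have := rg (fun i => c i.1 * d i.2) ust.
rewrite big_allpairs_dep /=.
have -> : \sum_(m <- s) \sum_(n <- t) nsq (c m * d n) =
    (\sum_(n <- t) nsq (d n)) * \sum_(m <- s) nsq (c m).
  rewrite mulr_sumr; apply: eq_bigr => m _; rewrite mulr_suml; apply: eq_bigr => n _.
  by rewrite nsqM mulrC.
suff -> : (\int[leb]_x (nsq (\sum_(i <- [seq (m, n) | m <- s, n <- t]) c i.1 * d i.2 * gabor g i x))%:E =
  \int[leb]_x (p x ^+ 2 * nsq (f x))%:E)%E by case/andP.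
apply: eq_integral => x _; rewrite -nsq_real -nsqM big_allpairs_dep; congr (nsq _)%:E.
rewrite hp mulrC /f mulr_suml; apply: eq_bigr => m _; rewrite mulr_sumr; apply: eq_bigr => n _.
by rewrite /gabor -/(ee _) /=; ring.
Qed.

Let sq2 (u v : V -> R) (h : V -> R) : measurable_fun setT u -> measurable_fun setT v ->
  measurable_fun setT h -> (forall x, 0 <= h x <= w x) ->
  (\int[leb]_x (u x ^+ 2 * h x)%:E <= 2%:E * \int[leb]_x (v x ^+ 2 * h x)%:E +
    2%:E * \int[leb]_x ((u x - v x) ^+ 2 * w x)%:E)%E.
Proof.
move=> mu mv mh hw.
have h0 x : 0 <= h x by case/andP: (hw x).
have msq (a b : V -> R) : measurable_fun setT a -> measurable_fun setT b ->
    measurable_fun setT (fun x => a x ^+ 2 * b x).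
  by move=> ma mb; apply: measurable_funM => //; exact: measurable_funX.
have muv : measurable_fun setT (fun x => u x - v x) by exact: measurable_funB.
have sq0 (a b : V -> R) : (forall x, 0 <= b x) -> forall x, 0 <= a x ^+ 2 * b x.
  by move=> b0 x; exact: mulr_ge0 (sqr_ge0 _) (b0 x).
rewrite -!ge0_intZ//; try exact: msq; try exact: sq0.
rewrite -ge0_intD//; last 4 first.
- by apply: measurable_funM => //; exact: msq.
- by apply: measurable_funM => //; exact: msq.
- by move=> x; apply: mulr_ge0 => //; exact: sq0.
- by move=> x; apply: mulr_ge0 => //; exact: sq0 (fun y => u y - v y) w w0 x.
apply: ge0_int_le => //.
- exact: msq.
- by apply: measurable_funD; apply: measurable_funM => //; exact: msq.
- exact: sq0.
move=> x _; case/andP: (hw x) => hx hwx.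
have e1 : u x ^+ 2 <= 2 * v x ^+ 2 + 2 * (u x - v x) ^+ 2.
  by have := sqr_ge0 (u x - 2 * v x); nra.
have e2 := ler_wpM2r hx e1.
have e3 := ler_wpM2l (sqr_ge0 (u x - v x)) hwx.
lra.
Qed.

(** Adding modulations with the coefficients of a trigonometric polynomial p multiplies f by p, so
    the Riesz bounds compare the integral of p^2 |f|^2 with that of p^2 over the cube. Letting p
    approach the periodic indicator of E localizes them; the factors 1/4 and 4 come from two uses of
    (a + b)^2 <= 2 a^2 + 2 b^2. *)
Lemma localized_riesz E (m : R) : measurable E -> leb (E `&` @cube R l) = m%:E ->
  ((A / 4 * (m * \sum_(n <- s) nsq (c n)))%:E <=
     \int[leb]_x (\1_E (tfrac x) * nsq (f x))%:E <=
   (4 * B * (m * \sum_(n <- s) nsq (c n)))%:E)%E.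
Proof.
move=> mE hm; set S := \sum_(n <- s) _.
have S0 : 0 <= S by apply: sumr_ge0 => n _; exact: nsq_ge0.
pose u x : R := \1_E (tfrac x).
have usq x : u x ^+ 2 = u x by rewrite /u indicE; case: (_ \in _); rewrite ?expr1n ?expr0n.
have mu : measurable_fun setT u.
  have mE1 : measurable_fun setT (\1_E : V -> R) by exact: measurable_indic.
  exact: (measurableT_comp mE1 (@measurable_frac R l)).
have iw : (\int[leb]_x (w x)%:E < +oo)%E.
  rewrite ge0_intD//; last by move=> x; exact: nsq_ge0.
  rewrite integral_indic ?setIT//; last exact: measurable_cube.
  apply: lte_add_pinfty; last first.
    by change (lebesgue_tuple l (@cube R l) < +oo)%E; rewrite lebesgue_cube ltry.
  (* For the constant polynomial 1 the upper Riesz bound is the integrability of |f|^2. *)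
  have [D D0 [_ _ hD]] := trig_bounds (trig_cst 1).
  apply: le_lt_trans (ltry _); apply: le_trans hD; rewrite le_eqVlt; apply/orP; left; apply/eqP.
  by apply: eq_integral => x _; rewrite expr1n mul1r.
have uc : (\int[leb]_x (u x ^+ 2 * \1_(@cube R l) x)%:E = m%:E)%E.
  rewrite -hm -[X in leb X]setIT -integral_indic//; last exact: measurableI mE (@measurable_cube _ _).
  apply: eq_integral => x _; rewrite usq /u !indicE in_setI.
  have [xc|xc] := boolP (x \in @cube R l); last by rewrite mulr0 andbF.
  by rewrite mulr1 andbT frac_id//; move: xc; rewrite inE.
under eq_integral do rewrite -/(u _) -usq.
have hf x : 0 <= nsq (f x) <= w x by rewrite nsq_ge0 lerDl c0.
have hc x : 0 <= (\1_(@cube R l) x : R) <= w x by rewrite c0 /w lerDr nsq_ge0.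
have m0 : 0 <= m by rewrite -lee_fin -hm.
have eps e : 0 < e -> exists2 D : R, 0 <= D &
    [/\ m <= 2 * D + 2 * e, D <= 2 * m + 2 * e,
    ((A * (D * S))%:E <= 2%:E * \int[leb]_x (u x ^+ 2 * nsq (f x))%:E + (2 * e)%:E)%E &
    (\int[leb]_x (u x ^+ 2 * nsq (f x))%:E <= (2 * (B * (D * S)) + 2 * e)%:E)%E].
  move=> e0; have [p [tp hp]] := trig_dense mw w0 iw mE e0.
  have mp := trig_measurable tp.
  have hp' : (\int[leb]_x ((p x - u x) ^+ 2 * w x)%:E <= e%:E)%E.
    apply: le_trans (ltW hp); rewrite le_eqVlt; apply/orP; left; apply/eqP.
    by apply: eq_integral => x _; congr EFin; rewrite /u; ring.
  have [D D0 [hD1 hD2 hD3]] := trig_bounds tp; exists D => //.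
  have le2 (a b : \bar R) : (a <= b -> 2%:E * a <= 2%:E * b)%E by exact: lee_wpmul2l.
  split.
  - rewrite -lee_fin -uc; apply: le_trans (sq2 mu mp mc hc) _.
    by rewrite hD1 (EFinD (2 * D)) !EFinM leeD2l// le2// ltW.
  - rewrite -lee_fin -hD1; apply: le_trans (sq2 mp mu mc hc) _.
    by rewrite uc (EFinD (2 * m)) !EFinM leeD2l// le2.
  - apply: le_trans hD2 _; apply: le_trans (sq2 mp mu mnf hf) _.
    by rewrite (EFinM 2 e) leeD2l// le2.
  - apply: le_trans (sq2 mu mp mnf hf) _.
    by rewrite (EFinD (2 * _)) (EFinM 2 e) (EFinM 2 (B * _)); apply: leeD; apply: le2 => //; apply: ltW.
have I0 : (0 <= \int[leb]_x (u x ^+ 2 * nsq (f x))%:E)%E.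
  by apply: int_ge0 => x; exact: mulr_ge0 (sqr_ge0 _) (nsq_ge0 _).
have [y hy] : exists y : R, (\int[leb]_x (u x ^+ 2 * nsq (f x))%:E = y%:E)%E.
  have [D D0 [_ _ _ h]] := eps 1 ltr01.
  move: I0 h; case: (\int[leb]_x _)%E => [y|//|//] _ _; by exists y.
rewrite hy !lee_fin; apply/andP; split.
  rewrite leNgt; apply/negP => h.
  pose e := (A / 4 * (m * S) - y) / (A * S + 2).
  have AS : 0 < A * S + 2 by rewrite ltr_wpDl ?mulr_ge0.
  have e0 : 0 < e by rewrite divr_gt0// subr_gt0.
  have [D D0 [h1 h2 h3 h4]] := eps e e0.
  move: h3; rewrite hy -EFinM -EFinD lee_fin => h3.
  have ee : e * (A * S + 2) = A / 4 * (m * S) - y by rewrite /e divfK ?gt_eqF.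
  have : A * (S * m) <= A * (S * (2 * D + 2 * e)) by rewrite ler_wpM2l// ler_wpM2l.
  nra.
rewrite leNgt; apply/negP => h.
pose e := (y - 4 * B * (m * S)) / (4 * (B * S) + 4).
have AS : 0 < 4 * (B * S) + 4 by rewrite ltr_wpDl ?mulr_ge0.
have e0 : 0 < e by rewrite divr_gt0// subr_gt0.
have [D D0 [h1 h2 h3 h4]] := eps e e0.
move: h4; rewrite hy lee_fin => h4.
have ee : e * (4 * (B * S) + 4) = y - 4 * B * (m * S) by rewrite /e divfK ?gt_eqF.
have : B * (S * D) <= B * (S * (2 * m + 2 * e)) by rewrite ler_wpM2l// ler_wpM2l.
nra.
Qed.

End localization.
End finite_riesz.

(** * Series over the lattice *)

Section zser_sums.
Context {R : realType} {l : nat}.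
Local Notation Z := (l.-tuple int).
Local Notation V := (Rspace R l).
Local Notation leb := (lebesgue_tuple l).
Implicit Types (f : Z -> \bar R).

Lemma zser_finsupp f (s : seq Z) : uniq s -> (forall b, (0 <= f b)%E) ->
  (forall b, b \notin s -> f b = 0%E) -> zser f = (\sum_(b <- s) f b)%E.
Proof.
move=> us f0 fs; rewrite zser_esum//.
have -> : \esum_(i in [set: Z]) f i = \esum_(i in [set` s]) f i.
  rewrite [RHS]esum_mkcond; apply: eq_esum => i _.
  by rewrite mem_setE; case: ifPn => // /fs.
rewrite esum_fset; [|exact: finite_seq|by move=> i _; exact: f0].
by rewrite -(fsbig_seq _ f us).
Qed.

Lemma zser_le f f' : (forall b, (0 <= f b <= f' b)%E) -> (zser f <= zser f')%E.
Proof.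
move=> h; apply: lee_nneseries => n _; case: pickle_inv => //= b.
  by case/andP: (h b).
by case/andP: (h b).
Qed.

Lemma zser_ge_sum f (s : seq Z) : uniq s -> (forall b, (0 <= f b)%E) ->
  (\sum_(b <- s) f b <= zser f)%E.
Proof.
move=> us f0; pose f' b := if b \in s then f b else 0%E.
have f'0 b : (0 <= f' b)%E by rewrite /f'; case: ifP.
have -> : (\sum_(b <- s) f b)%E = zser f'.
  rewrite (zser_finsupp us f'0); last by move=> b /negbTE bs; rewrite /f' bs.
  by rewrite big_seq [RHS]big_seq; apply: eq_bigr => b bs; rewrite /f' bs.
by apply: zser_le => b; rewrite f'0 /f'; case: ifP => //=.
Qed.

End zser_sums.

(** * Window sums and the gap between two families of functions *)

Section window.
Context {R : realType} {l : nat}.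
Local Notation Z := (l.-tuple int).
Local Notation V := (Rspace R l).
Local Notation leb := (lebesgue_tuple l).
Implicit Types (h G : V -> R[i]) (x y : V).

(** A combination of N^l translates with unimodular coefficients, to which the Riesz bounds apply;
    away from the boundary of the window it reproduces the Zak transform at frequency y. *)
Definition wsum (N : nat) y h x : R[i] :=
  \sum_(a <- zbox 0 N) ee (tdot (tint a) y) * h (tsub x (tint a)).

(** The Zak transform with lattice sum cut to |m_i| <= P. For x in the cube nothing is lost if h is
    supported on those cells. *)
Definition persum (P : nat) h x y : R[i] :=
  \sum_(m <- zbox (- P%:Z) (2 * P + 1)) h (tadd x (tint m)) * ee (- tdot (tint m) y).

Lemma cmeas_shift h (s : V) : cmeasurable h -> cmeasurable (fun x => h (tadd x s)).
Proof. by move=> mh; exact: (cmeas_comp mh (measurable_tadd s)). Qed.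

Lemma cmeas_wsum N y h : cmeasurable h -> cmeasurable (wsum N y h).
Proof.
move=> mh; apply: cmeas_sum => a; apply: cmeasM; first exact: cmeas_cst.
exact: (cmeas_comp mh (measurable_tsub_int a)).
Qed.

Lemma cmeas_persum P y h : cmeasurable h -> cmeasurable (fun x => persum P h x y).
Proof.
by move=> mh; apply: cmeas_sum => a; apply: cmeasM; [exact: cmeas_shift|exact: cmeas_cst].
Qed.

Lemma wsumB N y h G x : wsum N y (fun x => h x - G x) x = wsum N y h x - wsum N y G x.
Proof. by rewrite /wsum -sumrB; apply: eq_bigr => a _; rewrite mulrBr. Qed.

(** The shift [eta] only changes the phases of the coefficients, so [finite_parseval] applies
    pointwise in x; each of the N^l translates then has the same integral. *)
Lemma wsum_parseval N (eta : V) h : (0 < N)%N -> cmeasurable h ->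
  (\sum_(f : {ffun 'I_l -> 'I_N}) \int[leb]_x (nsq (wsum N (tadd (ypt f) eta) h x))%:E =
   ((N ^ l)%:R ^+ 2)%:E * \int[leb]_x (nsq (h x))%:E)%E.
Proof.
move=> N0 mh.
have mn : measurable_fun setT (fun x => nsq (h x)) by exact: measurable_nsq.
rewrite -ge0_integral_sum//; last 2 first.
- by move=> f; apply: emeasurable_nsq; exact: cmeas_wsum.
- by move=> f x _; rewrite lee_fin nsq_ge0.
transitivity (\int[leb]_x ((N ^ l)%:R * \sum_(a <- zbox 0 N) nsq (h (tsub x (tint a))))%:E)%E.
  apply: eq_integral => x _; rewrite sumEFin; congr EFin.
  pose d (a : Z) := ee (tdot (tint a) eta) * h (tsub x (tint a)).
  transitivity ((N ^ l)%:R * \sum_(a <- zbox 0 N) nsq (d a)).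
    rewrite -(@finite_parseval R l N (zbox 0 N))//; last 2 first.
    - exact: zbox_uniq.
    - move=> m n; rewrite !mem_zbox => /forallP hm /forallP hn i.
      have := hm i; have := hn i; lia.
    apply: eq_bigr => f _; congr nsq; apply: eq_bigr => a _.
    by rewrite /d tdotDr eeD; ring.
  by congr (_ * _); apply: eq_bigr => a _; rewrite nsqM nsq_ee mul1r.
have mt a : measurable_fun setT (fun x : V => nsq (h (tsub x (tint a)))).
  exact: measurable_nsq (cmeas_comp mh (measurable_tsub_int a)).
rewrite ge0_intZ//; last 2 first.
- exact: measurable_sum.
- by move=> x; apply: sumr_ge0 => a _; exact: nsq_ge0.
rewrite ge0_int_sum//; last by move=> a x; exact: nsq_ge0.
have tr a : (\int[leb]_x (nsq (h (tsub x (tint a))))%:E = \int[leb]_x (nsq (h x))%:E)%E.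
  under eq_integral do rewrite tsubE.
  rewrite (integral_tadd (topp (tint a)) (f := fun x => (nsq (h x))%:E))//.
    exact/measurable_EFinP.
  by move=> x; rewrite lee_fin nsq_ge0.
under eq_bigr do rewrite tr.
rewrite big_const_seq count_predT size_zbox iter_addr_0.
by rewrite expr2 EFinM -muleA; congr (_ * _)%E; rewrite mule_natl.
Qed.

Section boxed.
Variables (P : nat) (G : V -> R[i]).
Hypothesis mG : cmeasurable G.
Hypothesis suppG : forall x, G x != 0 -> tfloor x \in zbox (- P%:Z) (2 * P + 1).

Lemma supp_cube z b : cube z -> G (tadd z (tint b)) != 0 -> b \in zbox (- P%:Z) (2 * P + 1).
Proof.
move=> cz /suppG; rewrite tfloor_add tfloor_cube//.
suff -> : zadd [tuple (0 : int) | _ < l] b = b by [].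
by apply: tuple_ext => i; rewrite !tnth_mktuple add0r.
Qed.

Lemma wsum_box N y z b : cube z ->
  wsum N y G (tadd z (tint b)) = ee (tdot (tint b) y) *
    \sum_(m <- zbox (- P%:Z) (2 * P + 1)) (zsub b m \in zbox 0 N)%:R *
       (G (tadd z (tint m)) * ee (- tdot (tint m) y)).
Proof.
move=> cz.
have e1 a : tsub (tadd z (tint b)) (tint a) = tadd z (tint (zsub b a)).
  by apply: tuple_ext => i; rewrite !tnth_mktuple rmorphB addrA.
pose F (m : Z) := (zsub b m \in zbox 0 N)%:R * (G (tadd z (tint m)) * ee (- tdot (tint m) y)).
have zK a a' : zsub b a = zsub b a' -> a = a'.
  by move=> /(congr1 (zsub b)); rewrite !zsubKK.
rewrite -(eq_big_supp (s1 := map (zsub b) (zbox 0 N)) (f := F)); last 3 first.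
- by rewrite map_inj_uniq ?zbox_uniq// => a a' /zK.
- exact: zbox_uniq.
- move=> m; rewrite /F; have [bm|] := boolP (zsub b m \in zbox 0 N); last by rewrite mul0r eqxx.
  rewrite mul1r => hm.
  have -> : m \in map (zsub b) (zbox 0 N).
    by apply/mapP; exists (zsub b m) => //; rewrite zsubKK.
  apply/esym/(supp_cube cz); apply: contraNneq hm => ->; by rewrite mul0r.
rewrite big_map mulr_sumr /wsum big_seq [RHS]big_seq; apply: eq_bigr => a ha.
rewrite /F zsubKK ha mul1r e1 [RHS]mulrCA -eeD [LHS]mulrC; congr (_ * ee _).
by rewrite tint_sub tdotBl; ring.
Qed.

(** For such b every m of the support box has b - m in the window, so the window sum is the complete
    Zak transform up to a phase. *)
Lemma wsum_deep N y z b : cube z -> b \in zbox P%:Z (N - 2 * P) ->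
  nsq (wsum N y G (tadd z (tint b))) = nsq (persum P G z y).
Proof.
move=> cz; rewrite mem_zbox => /forallP hb; rewrite wsum_box// nsqM nsq_ee mul1r.
congr nsq; rewrite /persum big_seq [RHS]big_seq; apply: eq_bigr => m hm0.
have hm : forall i, - P%:Z <= tnth m i < - P%:Z + (2 * P + 1)%:Z.
  by apply/forallP; rewrite -mem_zbox.
rewrite (_ : _ \in _ = true) ?mul1r// mem_zbox; apply/forallP => i.
rewrite tnth_mktuple; move: (hb i) (hm i); set u : int := tnth b i; set v : int := tnth m i.
lia.
Qed.

Lemma wsum_outside N y z b : cube z -> b \notin zbox (- P%:Z) (N + 2 * P) ->
  wsum N y G (tadd z (tint b)) = 0.
Proof.
move=> cz hb; rewrite wsum_box// big_seq big1 ?mulr0// => m hm.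
rewrite (_ : _ \in _ = false) ?mul0r//; apply/negbTE; apply: contraNN hb.
move: hm; rewrite !mem_zbox => /forallP hm /forallP ha; apply/forallP => i.
have := ha i; rewrite tnth_mktuple; have := hm i; lia.
Qed.

Lemma wsum_le N y z b : cube z -> nsq (wsum N y G (tadd z (tint b))) <=
  ((2 * P + 1) ^ l)%:R * \sum_(m <- zbox (- P%:Z) (2 * P + 1)) nsq (G (tadd z (tint m))).
Proof.
move=> cz; rewrite wsum_box// nsqM nsq_ee mul1r.
apply: le_trans (nsq_sum_le _ _) _; rewrite size_zbox ler_wpM2l// ler_sum// => m _.
rewrite !nsqM nsq_ee mulr1 ler_piMl ?nsq_ge0//.
by case: (_ \in _); rewrite ?nsq1 ?nsq0.
Qed.

Lemma int_persum_le (D : R) : (\int[leb]_x (nsq (G x))%:E <= D%:E)%E ->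
  (\int[leb]_(x in @cube R l) (\sum_(m <- zbox (- P%:Z) (2 * P + 1)) nsq (G (tadd x (tint m))))%:E
    <= D%:E)%E.
Proof.
move=> hD.
have mn b : measurable_fun (@cube R l) (fun x => nsq (G (tadd x (tint b)))).
  by apply: measurable_funTS; exact: measurable_nsq (cmeas_shift _ mG).
rewrite ge0_int_sum//; [|exact: measurable_cube|by move=> m x; exact: nsq_ge0].
apply: le_trans hD; rewrite [leRHS]integral_tiling//; last 2 first.
- by apply: emeasurable_nsq.
- by move=> x; rewrite lee_fin nsq_ge0.
apply: (zser_ge_sum (zbox_uniq _ _)) => b.
by apply: int_ge0 => x; exact: nsq_ge0.
Qed.

(** Deep cells contribute at most [del * m] each by [wsum_deep]. The cells of the boundary layer are
    counted and bounded crudely by Cauchy-Schwarz; cells further out contribute nothing. *)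
Lemma wsum_local N y E (m del D : R) : measurable E -> E `<=` @cube R l -> leb E = m%:E ->
  (2 * P <= N)%N -> 0 <= del ->
  (forall z, E z -> nsq (persum P G z y) <= del) ->
  (\int[leb]_x (nsq (G x))%:E <= D%:E)%E ->
  (\int[leb]_x (\1_E (tfrac x) * nsq (wsum N y G x))%:E <=
    ((N ^ l)%:R * (del * m) + (((N + 2 * P) ^ l)%:R - ((N - 2 * P) ^ l)%:R) *
       (((2 * P + 1) ^ l)%:R * D))%:E)%E.
Proof.
move=> mE Ec hm PN d0 hE hD.
have mnw : measurable_fun setT (fun x => nsq (wsum N y G x)).
  exact: measurable_nsq (cmeas_wsum _ _ mG).
have mE1 : measurable_fun setT (fun x : V => \1_E (tfrac x) : R).
  have mE1 : measurable_fun setT (\1_E : V -> R) by exact: measurable_indic.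
  exact: (measurableT_comp mE1 (@measurable_frac R l)).
have i0 x : 0 <= \1_E x :> R by rewrite indicE.
have mu : measurable_fun setT (fun x : V => \1_E (tfrac x) * nsq (wsum N y G x)).
  exact: measurable_funM.
have u0 x : 0 <= \1_E (tfrac x) * nsq (wsum N y G x) by exact: mulr_ge0 (i0 _) (nsq_ge0 _).
rewrite integral_tiling//; [|exact/measurable_EFinP].
set cell_int := fun b : Z => _.
have c0 b : (0 <= cell_int b)%E by apply: int_ge0 => x; exact: u0.
have D0 : 0 <= D.
  by rewrite -lee_fin; apply: le_trans hD; apply: int_ge0 => x; exact: nsq_ge0.
have m0 : 0 <= m by rewrite -lee_fin -hm.
have intE : (\int[leb]_(x in @cube R l) (del * \1_E x)%:E = (del * m)%:E)%E.
  rewrite ge0_intZ//; last exact: measurable_cube.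
  rewrite integral_indic//; last exact: measurable_cube.
  by rewrite setIidl// EFinM; congr (_ * _)%E.
have mucell b : measurable_fun (@cube R l) (fun x => \1_E (tfrac (tadd x (tint b))) * nsq (wsum N y G (tadd x (tint b)))).
  by apply: measurable_funTS; exact: (measurableT_comp mu (measurable_tadd _)).
have deep b : b \in zbox P%:Z (N - 2 * P) -> (cell_int b <= (del * m)%:E)%E.
  move=> hb; rewrite -intE; apply: ge0_int_le => //; first exact: measurable_cube.
    by apply: measurable_funTS; apply: measurable_funM => //; exact: measurable_indic.
  move=> x cx; rewrite frac_add frac_id// indicE; case: (boolP (x \in E)) => xE.
    by rewrite mul1r mulr1 (wsum_deep _ cx hb) hE//; move: xE; rewrite inE.
  by rewrite mul0r mulr0.
have shallow b : (cell_int b <= (((2 * P + 1) ^ l)%:R * D)%:E)%E.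
  have msum : measurable_fun (@cube R l)
      (fun x => \sum_(m <- zbox (- P%:Z) (2 * P + 1)) nsq (G (tadd x (tint m)))).
    apply: measurable_sum => n; apply: measurable_funTS.
    exact: measurable_nsq (cmeas_shift _ mG).
  have s0 x : 0 <= \sum_(m <- zbox (- P%:Z) (2 * P + 1)) nsq (G (tadd x (tint m))).
    by apply: sumr_ge0 => n _; exact: nsq_ge0.
  apply: (@le_trans _ _ (\int[leb]_(x in @cube R l) (((2 * P + 1) ^ l)%:R *
      \sum_(m <- zbox (- P%:Z) (2 * P + 1)) nsq (G (tadd x (tint m))))%:E)%E).
    apply: ge0_int_le => //; first exact: measurable_cube.
      exact: measurable_funM.
    move=> x cx; apply: le_trans (wsum_le N y b cx).
    by rewrite ler_piMl ?nsq_ge0// indicE; case: (_ \in _).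
  rewrite ge0_intZ//; last exact: measurable_cube.
  by rewrite EFinM; apply: lee_wpmul2l; [rewrite lee_fin|exact: int_persum_le].
have out b : b \notin zbox (- P%:Z) (N + 2 * P) -> cell_int b = 0%E.
  move=> hb; rewrite /cell_int; apply: integral0_eq => x cx.
  by rewrite (wsum_outside _ cx hb) nsq0 mulr0.
rewrite (zser_finsupp (zbox_uniq _ _) c0 out).
set big := zbox (- P%:Z) _; pose small : seq Z := zbox P%:Z (N - 2 * P).
apply: (@le_trans _ _ (\sum_(b <- big) ((b \in small)%:R * (del * m) +
  (b \notin small)%:R * (((2 * P + 1) ^ l)%:R * D))%:E)%E).
  apply: lee_sum => b _; case: (boolP (b \in small)) => bs /=.
    by rewrite mul1r mul0r addr0 deep.
  by rewrite mul0r mul1r add0r shallow.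
rewrite sumEFin lee_fin big_split /= -!mulr_suml.
have cnt : \sum_(b <- big) (b \in small)%:R = ((N - 2 * P) ^ l)%:R :> R.
  rewrite -natr_sum -(size_zbox (l := l) P%:Z) -/small -sum1_size; congr (_%:R).
  rewrite -big_mkcond /= -big_filter; apply: perm_big; apply: uniq_perm.
  - by rewrite filter_uniq ?zbox_uniq.
  - exact: zbox_uniq.
  move=> b; rewrite mem_filter; case: (boolP (b \in small)) => //= hb.
  have hb' : forall i, P%:Z <= tnth b i < P%:Z + (N - 2 * P)%:Z by apply/forallP; rewrite -mem_zbox.
  rewrite /big mem_zbox; apply/forallP => i; move: (hb' i); set u : int := tnth b i.
  move: u => u; clear -PN; lia.
have cnt' : \sum_(b <- big) (b \notin small)%:R = ((N + 2 * P) ^ l)%:R - ((N - 2 * P) ^ l)%:R :> R.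
  rewrite -cnt -(size_zbox (l := l) (- P%:Z)) -/big -sum1_size natr_sum -sumrB.
  by apply: eq_bigr => b _; case: (_ \in _); rewrite ?subrr ?subr0.
have pow_le : ((N - 2 * P) ^ l <= N ^ l)%N by case: (l) => // l'; rewrite leq_exp2r// leq_subr.
by rewrite cnt cnt'; apply: lerD => //; rewrite ler_wpM2r ?mulr_ge0// ler_nat.
Qed.

End boxed.

(** From (1 + t)^n (1 - t)^n <= 1 and Bernoulli for the second factor. *)
Lemma one_add_pow_le (t : R) (n : nat) : 0 <= t <= 1 -> n%:R * t <= 1 / 2 ->
  (1 + t) ^+ n <= 1 + 2 * (n%:R * t).
Proof.
move=> /andP[t0 t1] nt; have q0 : 0 <= (1 + t) ^+ n by rewrite exprn_ge0// addr_ge0.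
have h1 : (1 + t) ^+ n * (1 - t) ^+ n <= 1.
  by rewrite -exprMn exprn_ile1//; have := mulr_ge0 t0 t0; nra.
have h2 := bernoulli_ge n t1.
have h3 := ler_wpM2l q0 h2.
have s0 : 0 <= n%:R * t by rewrite mulr_ge0.
nra.
Qed.

(** The boundary layer is a fraction O(l P / N) of the window, so it disappears as N grows with P
    fixed. *)
Lemma pow_gap (N P : nat) : (0 < N)%N -> (2 * P <= N)%N -> (4 * (l * P) <= N)%N ->
  ((N + 2 * P) ^ l)%:R - ((N - 2 * P) ^ l)%:R <= 6 * (l * P)%:R / N%:R * (N ^ l)%:R :> R.
Proof.
move=> N0 PN lPN; have Np : 0 < N%:R :> R by rewrite ltr0n.
pose t : R := (2 * P)%:R / N%:R.
have t01 : 0 <= t <= 1 by rewrite divr_ge0//= ler_pdivrMr// mul1r ler_nat.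
have lt : l%:R * t = 2 * (l * P)%:R / N%:R by rewrite /t !natrM; ring.
have lt2 : l%:R * t <= 1 / 2.
  rewrite lt ler_pdivrMr// mulrC; have : (4 * (l * P))%:R <= N%:R :> R by rewrite ler_nat.
  rewrite natrM; lra.
have h1 := one_add_pow_le t01 lt2.
have h2 := @bernoulli_ge R t l (proj2 (andP t01)).
have e1 : (N + 2 * P)%:R = N%:R * (1 + t) :> R by rewrite natrD /t; field; rewrite gt_eqF.
have e2 : (N - 2 * P)%:R = N%:R * (1 - t) :> R by rewrite natrB// /t; field; rewrite gt_eqF.
rewrite !natrX e1 e2 !exprMn -mulrBr mulrC ler_wpM2r ?(exprn_ge0 _ (ltW Np))//.
have -> : 6 * (l * P)%:R / N%:R = 3 * (l%:R * t) by rewrite lt; ring.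
lra.
Qed.

Section averaging.
Variables (K L P : nat) (h G : 'I_K -> V -> R[i]) (eta : 'I_L -> V) (A B : R) (C D : 'I_K -> R).
Hypotheses (A0 : 0 < A) (B0 : 0 <= B).
Hypotheses (mh : forall i, cmeasurable (h i)) (rh : forall i, finite_riesz (h i) A B).
Hypotheses (mG : forall i, cmeasurable (G i)).
Hypothesis suppG : forall i x, G i x != 0 -> tfloor x \in zbox (- P%:Z) (2 * P + 1).
Hypothesis hC : forall i, (\int[leb]_x (nsq (G i x))%:E <= (C i)%:E)%E.
Hypothesis hD : forall i, (\int[leb]_x (nsq (h i x - G i x))%:E <= (D i)%:E)%E.
(** Base points with a near zero at the grid point p; by [cover] these sets exhaust the cube up to a
    null set at every frequency y. *)
Let E (y : V) (p : 'I_K * 'I_L) : set V :=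
  [set z | cube z /\ nsq (persum P (G p.1) z (tadd y (eta p.2))) <= A / 16].
Hypothesis cover : forall y, (1 <= leb (\bigcup_p E y p))%E.

Let mE y p : measurable (E y p).
Proof.
rewrite (_ : E y p = @cube R l `&`
  (fun z => nsq (persum P (G p.1) z (tadd y (eta p.2)))) @^-1` `]-oo, A / 16]); last first.
  by apply/seteqP; split => z /=; rewrite in_itv.
apply: measurableI; first exact: measurable_cube.
rewrite -[X in measurable X]setTI; apply: measurable_nsq => //.
exact: (cmeas_persum P _ (mG p.1)).
Qed.

Let m y p : R := fine (leb (E y p)).

Let mP y p : leb (E y p) = (m y p)%:E.
Proof.
rewrite /m fineK// ge0_fin_numE//; apply: (@le_lt_trans _ _ 1%E); last exact: ltry.
rewrite -(lebesgue_cube R l); apply: le_measure; rewrite ?inE//; first exact: measurable_cube.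
by move=> z [].
Qed.

Let m0 y p : 0 <= m y p. Proof. exact: fine_ge0. Qed.

Let m_sum y : 1 <= \sum_p m y p.
Proof.
rewrite -lee_fin (le_trans (cover y))// -sumEFin.
rewrite (eq_bigr (fun p => leb (E y p))); last by move=> p _; rewrite mP.
have enumT : [set` enum {: 'I_K * 'I_L}] = setT.
  by apply/seteqP; split => // p _; rewrite /= mem_enum.
have -> : (\sum_p leb (E y p) = \sum_(p \in [set: 'I_K * 'I_L]) leb (E y p))%E.
  by rewrite -enumT -(fsbig_seq _ (fun p => leb (E y p)) (enum_uniq _)) big_enum.
apply: content_sub_fsum => //.
- by rewrite -enumT; exact: finite_seq.
- by apply: fin_bigcup_measurable => //; rewrite -enumT; exact: finite_seq.
Qed.

(** On [E y p] the lower Riesz bound gives the window sum of h_i at least A/4 per unit of measure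
    and window point, while that of G_i has at most A/16 plus the boundary; after doubling, h_i -
    G_i must supply A/8. Summing over p uses the cover, and averaging over y uses
    [wsum_parseval]. *)
Lemma window_average (N : nat) : (0 < N)%N -> (2 * P <= N)%N ->
  A / 8 * (N ^ l)%:R ^+ 2 <=
  2 * L%:R * (N ^ l)%:R * (((N + 2 * P) ^ l)%:R - ((N - 2 * P) ^ l)%:R) *
    \sum_i (((2 * P + 1) ^ l)%:R * C i) + 2 * L%:R * (N ^ l)%:R ^+ 2 * \sum_i D i.
Proof.
move=> N0 PN; set n : R := (N ^ l)%:R; set b : R := (_ - _); set W : R := ((2 * P + 1) ^ l)%:R.
have n0 : 0 < n by rewrite ltr0n expn_gt0 N0.
pose y (f : {ffun 'I_l -> 'I_N}) : V := ypt f.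
pose X (p : 'I_K * 'I_L) f : \bar R :=
  (\int[leb]_x (nsq (wsum N (tadd (y f) (eta p.2)) (fun x => h p.1 x - G p.1 x) x))%:E)%E.
have X0 p f : (0 <= X p f)%E by apply: int_ge0 => x; exact: nsq_ge0.
have mhG i : cmeasurable (fun x => h i x - G i x) by exact: cmeasB.
have sumX p : (\sum_f X p f <= (n ^+ 2 * D p.1)%:E)%E.
  rewrite /X wsum_parseval// (EFinM (n ^+ 2)); apply: lee_wpmul2l; last exact: hD.
  by rewrite lee_fin sqr_ge0.
pose x p f := fine (X p f).
have xP p f : X p f = (x p f)%:E.
  rewrite /x fineK// ge0_fin_numE//; apply: (@le_lt_trans _ _ (n ^+ 2 * D p.1)%:E); last exact: ltry.
  apply: le_trans (sumX p); rewrite (bigD1 f)//= leeDl// sume_ge0//.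
have sumx p : \sum_f x p f <= n ^+ 2 * D p.1.
  by rewrite -lee_fin -sumEFin; under eq_bigr do rewrite -xP.
have key p f : A / 8 * n * m (y f) p <= 2 * (b * (W * C p.1)) + 2 * x p f.
  pose Y := tadd (y f) (eta p.2).
  have := localized_riesz (s := zbox 0 N) (fun a => ee (tdot (tint a) Y)) (mh p.1) (rh p.1)
    (zbox_uniq _ _) (ltW A0) B0 (mE (y f) p) (m := m (y f) p).
  have -> : \sum_(a <- zbox 0 N) nsq (ee (tdot (tint a) Y)) = n.
    rewrite (eq_bigr (fun=> 1)); last by move=> a _; rewrite nsq_ee.
    by rewrite big_const_seq count_predT size_zbox iter_addr_0.
  case/(_ _)/andP.
    rewrite -mP; congr (leb _); apply/seteqP; split => [z []//|z Ez]; split => //; by case: Ez.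
  move=> lo _; have hi := wsum_local (mG p.1) (@suppG p.1) (N := N) (y := Y) (mE (y f) p) _ (mP (y f) p)
    PN (del := A / 16) _ _ (hC p.1).
  have {}hi := hi (fun z => @proj1 _ _) (divr_ge0 (ltW A0) (ler0n _ _)) (fun z => @proj2 _ _).
  have mE1 : measurable_fun setT (fun x : V => \1_(E (y f) p) (tfrac x) : R).
    have mE1 : measurable_fun setT (\1_(E (y f) p) : V -> R) by exact: measurable_indic.
    exact: (measurableT_comp mE1 (@measurable_frac R l)).
  have i0 z : 0 <= \1_(E (y f) p) z :> R by rewrite indicE.
  have i1 z : \1_(E (y f) p) z <= 1 :> R by rewrite indicE; case: (_ \in _).
  have mw u : cmeasurable u -> measurable_fun setT (fun x => nsq (wsum N Y u x)).
    by move=> mu; apply: measurable_nsq; exact: cmeas_wsum.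
  have split_le : (\int[leb]_x (\1_(E (y f) p) (tfrac x) * nsq (wsum N Y (h p.1) x))%:E <=
      2%:E * \int[leb]_x (\1_(E (y f) p) (tfrac x) * nsq (wsum N Y (G p.1) x))%:E + 2%:E * X p f)%E.
    rewrite /X -!ge0_intZ//; try (by apply: measurable_funM => //; exact: mw); try (exact: mw);
      try (by move=> z; exact: mulr_ge0 (i0 _) (nsq_ge0 _)); try (by move=> z; exact: nsq_ge0).
    rewrite -ge0_intD//; last 4 first.
    - by apply: measurable_funM => //; apply: measurable_funM => //; exact: mw.
    - by apply: measurable_funM => //; exact: mw.
    - by move=> z; apply: mulr_ge0 => //; exact: mulr_ge0 (i0 _) (nsq_ge0 _).
    - by move=> z; apply: mulr_ge0 => //; exact: nsq_ge0.
    apply: ge0_int_le => //.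
    - by apply: measurable_funM => //; exact: mw.
    - apply: measurable_funD; apply: measurable_funM => //; last exact: mw.
      by apply: measurable_funM => //; exact: mw.
    - by move=> z; exact: mulr_ge0 (i0 _) (nsq_ge0 _).
    move=> z _; set hw := wsum N Y (h p.1) z; set gw := wsum N Y (G p.1) z.
    have -> : wsum N Y (fun x => h p.1 x - G p.1 x) z = hw - gw by rewrite wsumB.
    have e1 : nsq hw <= 2 * nsq gw + 2 * nsq (hw - gw).
      by apply: le_trans (nsqD_le _ _); rewrite addrC subrK.
    have e2 := ler_wpM2l (i0 (tfrac z)) e1.
    have e3 := ler_wpM2r (nsq_ge0 (hw - gw)) (i1 (tfrac z)).
    lra.
  have := le_trans lo (le_trans split_le _) => /(_ ((2 * (n * (A / 16 * m (y f) p) + b * (W * C p.1)) + 2 * x p f)%:E)).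
  rewrite lee_fin => fin.
  have {}fin := fin (_ : _ <= _)%E.
  suff : A / 4 * (m (y f) p * n) <= 2 * (n * (A / 16 * m (y f) p) + b * (W * C p.1)) + 2 * x p f by lra.
  apply: fin; rewrite (EFinD (2 * _)) !(EFinM 2) xP; apply: leeD => //; apply: lee_wpmul2l => //.
have step1 f : A / 8 * n <= \sum_p (2 * (b * (W * C p.1)) + 2 * x p f).
  apply: (@le_trans _ _ (\sum_p A / 8 * n * m (y f) p)); last by apply: ler_sum => p _; exact: key.
  rewrite -mulr_sumr ler_peMr// mulr_ge0 ?(ltW n0)// divr_ge0// ltW//.
have step2 : A / 8 * n * n <= \sum_(p : 'I_K * 'I_L) (2 * (b * (W * C p.1)) * n + 2 * (n ^+ 2 * D p.1)).
  pose cst (f : {ffun 'I_l -> 'I_N}) : R := A / 8 * n.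
  have -> : A / 8 * n * n = \sum_f cst f.
    by rewrite sumr_const card_ffun !card_ord -[RHS]mulr_natr.
  apply: (@le_trans _ _ (\sum_(f : {ffun 'I_l -> 'I_N}) \sum_p (2 * (b * (W * C p.1)) + 2 * x p f))).
    by apply: ler_sum => f _.
  rewrite exchange_big /=; apply: ler_sum => p _.
  rewrite big_split /= -[X in _ + X]mulr_sumr; apply: lerD; last by rewrite ler_wpM2l.
  by rewrite sumr_const card_ffun !card_ord -[leLHS]mulr_natr.
have pairs (F : 'I_K -> R) : \sum_(p : 'I_K * 'I_L) F p.1 = L%:R * \sum_i F i.
  rewrite -(pair_big xpredT xpredT (fun i (_ : 'I_L) => F i)) /= mulr_sumr; apply: eq_bigr => i _.
  by rewrite sumr_const card_ord mulr_natl.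
rewrite expr2 mulrA; apply: le_trans step2 _.
rewrite (pairs (fun i => 2 * (b * (W * C i)) * n + 2 * (n ^+ 2 * D i))) big_split /=.
rewrite -mulr_suml -!mulr_sumr le_eqVlt; apply/orP; left; apply/eqP; ring.
Qed.

(* If at every frequency the sets where some Zak transform of G_i is small cover
   the cube, the lower Riesz bound of h_i is violated there unless h_i and G_i
   are far apart. *)
Lemma frame_gap : A / 8 <= 2 * L%:R * \sum_i D i.
Proof.
set SD := \sum_i D i; pose S := \sum_i (((2 * P + 1) ^ l)%:R * C i).
have S0 : 0 <= S.
  apply: sumr_ge0 => i _; rewrite mulr_ge0// -lee_fin; apply: le_trans (hC i).
  by apply: int_ge0 => x; exact: nsq_ge0.
rewrite leNgt; apply/negP => gap.
pose e := A / 8 - 2 * L%:R * SD; have e0 : 0 < e by rewrite subr_gt0.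
pose q := 2 * L%:R * (6 * (l * P)%:R) * S / e.
(* Exceeding q makes the boundary term smaller than the supposed gap e; the first two summands meet
   the hypotheses of [pow_gap]. *)
pose N := (2 * P + 4 * (l * P) + (Num.truncn q).+1)%N.
have N0 : (0 < N)%N by rewrite /N addnS.
have PN : (2 * P <= N)%N by rewrite /N -addnA leq_addr.
have lPN : (4 * (l * P) <= N)%N by rewrite /N addnAC leq_addl.
have qN : q < N%:R.
  apply: lt_le_trans (truncnS_gt q) _; rewrite ler_nat /N leq_addl//.
have Np : 0 < N%:R :> R by rewrite ltr0n.
have np : 0 < (N ^ l)%:R :> R by rewrite ltr0n expn_gt0 N0.
have := window_average N0 PN; have := pow_gap N0 PN lPN; rewrite -/SD -/S.
set n : R := (N ^ l)%:R; set b : R := (_ - _) => hb wa.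
have L0 : 0 <= 2 * L%:R * n * S by rewrite !mulr_ge0// ltW.
have hb' := ler_wpM2r L0 hb.
have n2 : 0 < n ^+ 2 by rewrite exprn_gt0.
have : e * n ^+ 2 <= 2 * L%:R * (6 * (l * P)%:R) * S / N%:R * n ^+ 2.
  have eq1 : e * n ^+ 2 = A / 8 * n ^+ 2 - 2 * L%:R * n ^+ 2 * SD by rewrite /e; ring.
  have eq2 : 2 * L%:R * (6 * (l * P)%:R) * S / N%:R * n ^+ 2 =
    6 * (l * P)%:R / N%:R * n * (2 * L%:R * n * S) by ring.
  have eq3 : 2 * L%:R * n * b * S = b * (2 * L%:R * n * S) by ring.
  by rewrite eq1 eq2 lerBlDr (le_trans wa)// eq3 lerD2r.
rewrite ler_pM2r// ler_pdivlMr// mulrC -ler_pdivlMr//; rewrite -/q.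
by rewrite leNgt qN.
Qed.

End averaging.
End window.

(** * Smoothing of bounded quasi-periodic arrays *)

Section smoothing.
Context {R : realType}.
Implicit Types (w u : nat -> R[i]).

Lemma normcM_le (a b : R[i]) (x y : R) : normc a <= x -> normc b <= y -> normc (a * b) <= x * y.
Proof. by move=> h1 h2; rewrite ComplexField.Normc.normcM ler_pM// normc_ge0. Qed.

Lemma normcD_le (a b : R[i]) : normc (a + b) <= normc a + normc b.
Proof.
have := @normc_sum_le R bool [:: true; false] (fun t => if t then a else b).
by rewrite !big_cons !big_nil !addr0.
Qed.

Lemma normcN (a : R[i]) : normc (- a) = normc a.
Proof. by case: a => x y /=; rewrite !sqrrN. Qed.

Lemma normcB_le (a b : R[i]) : normc (a - b) <= normc a + normc b.
Proof. by apply: le_trans (normcD_le _ _) _; rewrite normcN. Qed.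

Lemma normc_real (r : R) : 0 <= r -> normc r%:C%C = r.
Proof. by move=> r0 /=; rewrite expr0n addr0 sqrtr_sqr ger0_norm. Qed.

Lemma normc_eeM (t : R) (z : R[i]) : normc (ee t * z) = normc z.
Proof. by rewrite ComplexField.Normc.normcM normc_ee mul1r. Qed.

(** Abel summation: a shift of the argument is moved onto the weights, whose variation is known. *)
Lemma sum_shift_by_parts w u (N : nat) :
  \sum_(s < N) w s * u s - \sum_(s < N) w s * u s.+1 =
  \sum_(s < N) (w s.+1 - w s) * u s.+1 + (w 0%N * u 0%N - w N * u N).
Proof.
elim: N => [|N IH]; first by rewrite !big_ord0 subrr add0r subrr.
have := IH; rewrite !big_ord_recr /=; set a := \sum_(_ < _) _; set b := \sum_(_ < _) _.
by set c := \sum_(_ < _) _ => /eqP; rewrite subr_eq => /eqP ->; ring.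
Qed.

Lemma normc_sumM (N : nat) (w u : 'I_N -> R[i]) (S : R) : (forall s, normc (u s) <= S) ->
  normc (\sum_(s < N) w s * u s) <= (\sum_(s < N) normc (w s)) * S.
Proof.
move=> uS; apply: le_trans (normc_sum_le _ _) _; rewrite mulr_suml; apply: ler_sum => s _.
by apply: normcM_le.
Qed.

Definition fvp_weight (M N : nat) (j : int) : R[i] := (N%:R ^- 2)%:C%C * vp M N j.

Section weights.
Variables (M N : nat).
Hypotheses (M0 : (0 < M)%N) (MN : (3 * M <= N)%N).
Let N0 : (0 < N)%N. Proof. lia. Qed.
Let NR : 0 < N%:R :> R. Proof. by rewrite ltr0n. Qed.

Lemma sum_periodic_l (f : int -> R) (s : nat) : (s < N)%N -> (forall j, f (j + N%:Z) = f j) ->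
  \sum_(i < N) f (i%:Z - s%:Z) = \sum_(j < N) f j%:Z.
Proof.
move=> sN fper; pose f' j := f (- j).
have f'per j : f' (j + N%:Z) = f' j by rewrite /f' -[LHS]fper opprD subrK.
rewrite (eq_bigr (fun i : 'I_N => f' (s%:Z - i%:Z))); last by move=> i _; rewrite /f' opprB.
rewrite (sum_periodic sN f'per) -(sum_periodic N0 fper).
by apply: eq_bigr => i _; rewrite /f' add0r.
Qed.

Lemma fvp_weight_l1 : \sum_(s < N) \sum_(s' < N) normc (fvp_weight M N (s%:Z - s'%:Z)) <= 2.
Proof.
rewrite (eq_bigr (fun=> N%:R ^- 2 * \sum_(j < N) normc (vp M N j%:Z : R[i]))); last first.
  move=> s _; rewrite -(sum_periodic (f := fun j => normc (vp M N j)) (ltn_ord s)); last first.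
    by move=> j; rewrite vp_periodic.
  rewrite mulr_sumr; apply: eq_bigr => s' _.
  by rewrite ComplexField.Normc.normcM normc_real.
rewrite sumr_const card_ord -[leLHS]mulr_natl.
apply: (@le_trans _ _ (N%:R * (N%:R ^- 2 * (2 * N%:R)))).
  by rewrite ler_wpM2l// ler_wpM2l// vp_l1.
rewrite le_eqVlt; apply/orP; left; apply/eqP; field; rewrite gt_eqF//.
Qed.

Lemma fvp_weight_var (s' : 'I_N) :
  \sum_(s < N) normc (fvp_weight M N (s.+1%:Z - s'%:Z) - fvp_weight M N (s%:Z - s'%:Z)) <=
  N%:R ^- 2 * (80 * M%:R).
Proof.
have h := sum_periodic_l (f := fun j => normc (vp M N (j + 1) - vp M N j)) (ltn_ord s').
rewrite (eq_bigr (fun s : 'I_N => N%:R ^- 2 * normc (vp M N (s%:Z - s'%:Z + 1) - vp M N (s%:Z - s'%:Z)))).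
  rewrite -mulr_sumr h; first by rewrite ler_wpM2l// vp_var.
  by move=> j; rewrite addrAC !vp_periodic.
move=> s _; rewrite /fvp_weight -mulrBr ComplexField.Normc.normcM normc_real//.
by have -> : s.+1%:Z - s'%:Z = s%:Z - s'%:Z + 1 by lia.
Qed.

Lemma normc_fvp_weight j : normc (fvp_weight M N j) <= N%:R ^- 2 * (3 * M%:R).
Proof. by rewrite ComplexField.Normc.normcM normc_real// ler_wpM2l// normc_vp. Qed.

End weights.

Section dichotomy.
Variables (K L M M' N : nat) (H : int -> nat -> R[i]) (y S c : R).
Hypotheses (K0 : (0 < K)%N) (L2 : (2 < L)%N) (M0 : (0 < M)%N) (ML : (3 * M <= L)%N).
Hypotheses (M'0 : (0 < M')%N) (M'N : (3 * M' <= N)%N) (c0 : 0 < c) (cM : 1 <= c ^+ 2 * M%:R).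
Hypothesis HS : forall t j, normc (H t j) <= S.
Hypothesis HL : forall t j, H t (j + L)%N = H t j.
Hypothesis HK : forall t j, H (t + K%:Z) j = ee (y + j%:R / L%:R) * H t j.

(** [H] stands for the values of a Zak transform on a grid, t numbering translations and j
    frequencies. Averaging over t with these weights is the Fourier multiplier [fvp] applied to the
    function. *)
Definition smooth_x (i j : nat) : R[i] :=
  \sum_(s < N) \sum_(s' < N) fvp_weight M' N (s%:Z - s'%:Z) * H (i%:Z - s%:Z + s'%:Z) j.

(** The cyclic average over frequencies corresponds to the cut-off [vpmult] in x_k; see
    [persum_smoothed]. *)
Definition smooth_xy (i j : nat) : R[i] :=
  (L%:R^-1)%:C%C * \sum_(r < L) vp M L r%:Z * smooth_x i (j + r).

Let N0 : (0 < N)%N. Proof. lia. Qed.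
Let LR : 0 < L%:R :> R. Proof. by rewrite ltr0n; lia. Qed.
Let NR : 0 < N%:R :> R. Proof. by rewrite ltr0n. Qed.
Let Li : 0 <= L%:R^-1 :> R. Proof. by rewrite invr_ge0 ltW. Qed.
Let S0 : 0 <= S. Proof. exact: le_trans (normc_ge0 _) (HS 0 0%N). Qed.

Let smooth_x_le i j : normc (smooth_x i j) <= 2 * S.
Proof.
apply: le_trans (normc_sum_le _ _) _.
apply: (@le_trans _ _ ((\sum_(s < N) \sum_(s' < N) normc (fvp_weight M' N (s%:Z - s'%:Z) : R[i])) * S)).
  by rewrite mulr_suml; apply: ler_sum => s _; apply: normc_sumM.
by rewrite ler_wpM2r// fvp_weight_l1.
Qed.

(** For fixed s' a unit step in i shifts s. Summation by parts gives 80 M' from the variation and 3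
    M' from each boundary term, whence 86; the N values of s' reduce N^(-2) to 1/N. *)
Let smooth_x_step i j :
  normc (smooth_x i.+1 j - smooth_x i j) <= 86 * (M'%:R / N%:R) * S.
Proof.
rewrite /smooth_x exchange_big /= [X in _ - X]exchange_big /= -sumrB.
apply: le_trans (normc_sum_le _ _) _.
apply: (@le_trans _ _ (\sum_(s' < N) (N%:R ^- 2 * (80 * M'%:R) + (N%:R ^- 2 * (3 * M'%:R) + N%:R ^- 2 * (3 * M'%:R))) * S)).
  apply: ler_sum => s' _.
  pose w (s : nat) : R[i] := fvp_weight M' N (s%:Z - s'%:Z).
  pose u (s : nat) := H (i.+1%:Z - s%:Z + s'%:Z) j.
  have -> : \sum_(s < N) fvp_weight M' N (s%:Z - s'%:Z) * H (i.+1%:Z - s%:Z + s'%:Z) j -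
     \sum_(s < N) fvp_weight M' N (s%:Z - s'%:Z) * H (i%:Z - s%:Z + s'%:Z) j =
     \sum_(s < N) w s * u s - \sum_(s < N) w s * u s.+1.
    congr (_ - _); apply: eq_bigr => s _; congr (_ * H _ _).
    lia.
  rewrite sum_shift_by_parts; apply: le_trans (normcD_le _ _) _; rewrite mulrDl.
  apply: lerD.
    apply: le_trans (normc_sumM (S := S) _ _) _; first by move=> s; exact: HS.
    by rewrite ler_wpM2r// fvp_weight_var.
  apply: le_trans (normcB_le _ _) _; rewrite mulrDl.
  by apply: lerD; apply: normcM_le (HS _ _); exact: normc_fvp_weight.
rewrite sumr_const card_ord -[leLHS]mulr_natl le_eqVlt; apply/orP; left; apply/eqP.
field; rewrite gt_eqF//.
Qed.

Let avg_le (u : nat -> R[i]) (b : R) : (forall r, normc (u r) <= b) ->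
  normc ((L%:R^-1)%:C%C * \sum_(r < L) vp M L r%:Z * u r) <= 2 * b.
Proof.
move=> ub; have b0 : 0 <= b by exact: le_trans (normc_ge0 _) (ub 0%N).
have h : normc (\sum_(r < L) vp M L r%:Z * u r) <= 2 * L%:R * b.
  by apply: le_trans (normc_sumM (S := b) _ _) _ => //; rewrite ler_wpM2r// vp_l1.
rewrite ComplexField.Normc.normcM normc_real ?Li//.
by rewrite mulrC ler_pdivrMr// mulrAC.
Qed.

Let smooth_xy_le i j : normc (smooth_xy i j) <= 4 * S.
Proof.
have -> : 4 * S = 2 * (2 * S) by ring.
by apply: (avg_le (u := fun r => smooth_x i (j + r))) => r; exact: smooth_x_le.
Qed.

Let smooth_xy_x i j : normc (smooth_xy i.+1 j - smooth_xy i j) <= 172 * (M'%:R / N%:R) * S.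
Proof.
rewrite /smooth_xy -mulrBr -sumrB.
under eq_bigr do rewrite -mulrBr.
rewrite (_ : 172 * (M'%:R / N%:R) * S = 2 * (86 * (M'%:R / N%:R) * S)); last by ring.
apply: (avg_le (u := fun r => smooth_x i.+1 (j + r) - smooth_x i (j + r))) => r.
exact: smooth_x_step.
Qed.

Let smooth_xL i j : smooth_x i (j + L) = smooth_x i j.
Proof. by apply: eq_bigr => s _; apply: eq_bigr => s' _; rewrite HL. Qed.

Let smooth_xyL i j : smooth_xy i (j + L) = smooth_xy i j.
Proof. by congr (_ * _); apply: eq_bigr => r _; rewrite addnAC smooth_xL. Qed.

(** Periodicity in j cancels the boundary terms of the summation by parts, leaving the variation 80
    M times the bound 2S. *)
Let smooth_xy_y i j : normc (smooth_xy i j.+1 - smooth_xy i j) <= 160 * (M%:R / L%:R) * S.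
Proof.
rewrite -normcN opprB /smooth_xy -mulrBr.
pose w (r : nat) : R[i] := vp M L r%:Z; pose u r := smooth_x i (j + r).
have -> : \sum_(r < L) vp M L r%:Z * smooth_x i (j + r) - \sum_(r < L) vp M L r%:Z * smooth_x i (j.+1 + r) =
   \sum_(r < L) w r * u r - \sum_(r < L) w r * u r.+1.
  by congr (_ - _); apply: eq_bigr => r _; rewrite /u addSnnS.
rewrite sum_shift_by_parts.
have -> : w 0%N * u 0%N - w L * u L = 0.
  have e : vp M L L%:Z = vp M L 0 :> R[i] by have := @vp_periodic R M L M0 ML 0; rewrite add0r.
  by rewrite /w /u addn0 smooth_xL e subrr.
rewrite addr0 ComplexField.Normc.normcM normc_real ?Li//.
rewrite mulrC ler_pdivrMr//.
apply: le_trans (normc_sumM (S := 2 * S) _ _) _; first by move=> r; exact: smooth_x_le.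
apply: (@le_trans _ _ (80 * M%:R * (2 * S))).
  apply: ler_wpM2r; first by rewrite mulr_ge0.
  apply: le_trans (@vp_var R M L M0 ML).
  by apply: ler_sum => r _; rewrite /w (_ : r.+1%:Z = r%:Z + 1)//; lia.
rewrite le_eqVlt; apply/orP; left; apply/eqP; field; rewrite gt_eqF//.
Qed.

(** The quasi-periodic phase depends on the frequency being averaged: the term r carries an extra
    e(r/L). Replacing it by 1 costs the first moment [vp_moment]. *)
Let smooth_xy_K j : normc (smooth_xy K j - ee (y + j%:R / L%:R) * smooth_xy 0 j) <= 8 * c * S.
Proof.
have xK r : smooth_x K (j + r) = ee (y + j%:R / L%:R) * ee (r%:R / L%:R) * smooth_x 0 (j + r).
  rewrite /smooth_x mulr_sumr; apply: eq_bigr => s _; rewrite mulr_sumr; apply: eq_bigr => s' _.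
  have -> : K%:Z - s%:Z + s'%:Z = (0%:Z - s%:Z + s'%:Z) + K%:Z by lia.
  rewrite HK mulrCA; congr (_ * _); rewrite -eeD; congr ee.
  by rewrite natrD mulrDl addrA.
have -> : smooth_xy K j - ee (y + j%:R / L%:R) * smooth_xy 0 j =
   (L%:R^-1)%:C%C * ee (y + j%:R / L%:R) *
     \sum_(r < L) (vp M L r%:Z * (ee (r%:R / L%:R) - 1)) * smooth_x 0 (j + r).
  rewrite /smooth_xy mulrCA -!mulrBr -mulrA; congr (_ * _); rewrite !mulr_sumr -sumrB.
  by apply: eq_bigr => r _; rewrite xK; ring.
rewrite !ComplexField.Normc.normcM normc_ee mulr1 normc_real ?Li//.
rewrite mulrC ler_pdivrMr//.
apply: le_trans (normc_sumM (S := 2 * S) _ _) _; first by move=> r; exact: smooth_x_le.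
under eq_bigr do rewrite ComplexField.Normc.normcM.
apply: le_trans (ler_wpM2r _ (vp_moment M0 ML c0 cM)) _; first by rewrite mulr_ge0.
by rewrite le_eqVlt; apply/orP; left; apply/eqP; ring.
Qed.

(* Smoothing makes the array vary slowly in both indices while keeping it
   quasi-periodic; [quasiperiodic_jump] then forbids a lower bound. *)
Lemma smoothing_dichotomy (del : R) :
  172 * (M'%:R / N%:R) * S + 8 * c * S < del -> 192 * (M%:R / L%:R) * S < del ->
  exists i : 'I_K, exists j : 'I_L, normc (smooth_xy i j) < del.
Proof.
move=> hx hy; apply: contrapT => hn.
have big i j : (i < K)%N -> (j < L)%N -> del <= normc (smooth_xy i j).
  move=> iK jL; rewrite leNgt; apply/negP => h; apply: hn.
  by exists (Ordinal iK), (Ordinal jL).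
have big' i j : (i < K)%N -> (j <= L)%N -> del <= normc (smooth_xy i j).
  move=> iK; rewrite leq_eqVlt => /orP[/eqP ->|jL]; last exact: big.
  by rewrite -[L]add0n smooth_xyL big// (ltn_trans _ L2).
(* Row K is replaced by the exact quasi-periodic image of row 0. The defect 8cS then enters only in
   the step from row K - 1 to row K. *)
pose F i j := if (i < K)%N then smooth_xy i j else ee (y + j%:R / L%:R) * smooth_xy 0 j.
have nF i j : (j <= L)%N -> del <= normc (F i j).
  move=> jL; rewrite /F; case: ifP => iK; first exact: big'.
  by rewrite ComplexField.Normc.normcM normc_ee mul1r big'.
have sq (a b : R[i]) : normc a < del -> del <= normc b -> nsq a < nsq b.
  by move=> h1 h2; rewrite /nsq ltr_pXn2r ?nnegrE ?normc_ge0// (lt_le_trans h1).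
have xy0 : 0 <= 172 * (M'%:R / N%:R) * S by rewrite !mulr_ge0 ?invr_ge0.
have c8 : 0 <= 8 * c * S by rewrite !mulr_ge0// ltW.
apply: (@quasiperiodic_jump R K L F y L2).
- move=> i iK; rewrite /F; case: ifP => _; first by rewrite -[L in LHS]add0n smooth_xyL.
  rewrite -[L in X in _ * X = _]add0n smooth_xyL; congr (_ * _).
  by rewrite divff ?gt_eqF// mul0r addr0 eeD -[1]/(1%:R) ee_nat mulr1.
- by move=> j jL; rewrite /F ltnn K0.
- move=> i j iK jL; apply: sq (nF _ _ jL); rewrite /F iK; case: ifPn => iK'.
    by apply: le_lt_trans (smooth_xy_x i j) _; lra.
  have iE : i.+1 = K by apply/eqP; rewrite eqn_leq iK leqNgt iK'.
  have := smooth_xy_x i j; rewrite iE => h1; have h2 := smooth_xy_K j.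
  apply: le_lt_trans hx; rewrite [X in X <= _](_ : _ = normc
    ((smooth_xy K j - smooth_xy i j) - (smooth_xy K j - ee (y + j%:R / L%:R) * smooth_xy 0 j))); last first.
    congr normc; move: (_ * smooth_xy 0 j) (smooth_xy i j) (smooth_xy K j) => a b d; ring.
  by apply: le_trans (normcB_le _ _) _; exact: lerD.
- move=> i j iK jL; apply: sq (nF _ _ (ltnW jL)); apply: le_lt_trans hy; rewrite /F.
  have h1 k := smooth_xy_y k j.
  have ML0 : 0 <= M%:R / L%:R * S by rewrite !mulr_ge0.
  case: ifPn => iK'; first by apply: le_trans (h1 i) _; lra.
  (* In the replaced row the phase also moves, by 1/L: this adds (8/L)(4S) <= 32 (M/L) S to the 160
     (M/L) S of [smooth_xy_y], hence the constant 192. *)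
  have -> : ee (y + j.+1%:R / L%:R) * smooth_xy 0 j.+1 - ee (y + j%:R / L%:R) * smooth_xy 0 j =
     ee (y + j.+1%:R / L%:R) * (smooth_xy 0 j.+1 - smooth_xy 0 j) +
     ee (y + j%:R / L%:R) * ((ee (L%:R^-1) - 1) * smooth_xy 0 j).
    have -> : y + j.+1%:R / L%:R = y + j%:R / L%:R + L%:R^-1.
      by rewrite -natr1 mulrDl mul1r addrA.
    move: (smooth_xy 0 j) (smooth_xy 0 j.+1) => z z'; rewrite eeD; ring.
  have e1 : normc (ee (L%:R^-1) - 1 : R[i]) <= 8 / L%:R.
    rewrite normc_le ?divr_ge0//; apply: le_trans (nsq_ee_sub1_le _) _.
    rewrite ler_pXn2r ?nnegrE ?mulr_ge0 ?pi_ge0 ?Li//.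
    rewrite ler_wpM2r ?Li//.
    by have := @pihalf_lt2 R; rewrite ltr_pdivrMr//; lra.
  apply: le_trans (normcD_le _ _) _; rewrite !normc_eeM.
  have h2 := normcM_le e1 (smooth_xy_le 0 j).
  have : 8 / L%:R * (4 * S) <= 32 * (M%:R / L%:R * S).
    have -> : 8 / L%:R * (4 * S) = 32 * (1 / L%:R * S) by ring.
    by rewrite ler_pM2l// ler_wpM2r// ler_wpM2r ?Li// ler1n.
  by have := h1 0%N; lra.
Qed.

End dichotomy.
End smoothing.

(** * The smoothed Zak transform *)

Section floor_functions.
Context {R : realType} {l : nat}.
Local Notation Z := (l.-tuple int).
Local Notation V := (Rspace R l).

Lemma measurable_tfloor_set (Q : set Z) : measurable [set x : V | Q (tfloor x)].
Proof.
pose F n : set V := oapp (fun b => if b \in Q then @cell R l b else set0) set0 (pickle_inv n).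
rewrite (_ : [set x : V | Q (tfloor x)] = \bigcup_n F n).
  apply: bigcup_measurable => n _; rewrite /F; case: pickle_inv => //= b.
  by case: ifP => // _; exact: measurable_cell.
apply/seteqP; split => [x /= Qx|x [n _]].
  by exists (pickle (tfloor x)) => //; rewrite /F pickleK_inv /= mem_set.
rewrite /F; case: pickle_inv => //= b; case: ifPn => //.
by rewrite inE => Qb xb; rewrite (xb : tfloor x = b).
Qed.

Lemma measurable_fun_tfloor (F : Z -> R) : measurable_fun setT (fun x : V => F (tfloor x)).
Proof. by move=> _ Y mY; rewrite setTI; exact: (measurable_tfloor_set (F @^-1` Y)). Qed.

Lemma cmeas_tfloor (F : Z -> R[i]) : cmeasurable (fun x : V => F (tfloor x)).
Proof.
split; [exact: (measurable_fun_tfloor (fun m => complex.Re (F m)))|].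
exact: (measurable_fun_tfloor (fun m => complex.Im (F m))).
Qed.

Definition tek (k : 'I_l) (t : R) : V := [tuple (if i == k then t else 0) | i < l].

Lemma tdot_tek (m : Z) k t : tdot (tint m) (tek k t) = (tnth m k)%:~R * t.
Proof.
rewrite /tdot (bigD1 k)//= big1 ?addr0.
  by rewrite !tnth_mktuple eqxx.
by move=> j /negbTE jk; rewrite !tnth_mktuple jk mulr0.
Qed.

Lemma tekD k s t : tek k (s + t) = tadd (tek k s) (tek k t).
Proof.
by apply: tuple_ext => i; rewrite !tnth_mktuple; case: ifP => _; rewrite ?addr0.
Qed.

Lemma tek_int k (n : int) : tek k n%:~R = tint [tuple (if i == k then n else 0) | i < l].
Proof. by apply: tuple_ext => i; rewrite !tnth_mktuple; case: ifP. Qed.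

End floor_functions.

Section truncated_zak.
Context {R : realType} {l : nat}.
Local Notation Z := (l.-tuple int).
Local Notation V := (Rspace R l).
Local Notation leb := (lebesgue_tuple l).
Variables (g : V -> R[i]) (N1 T : nat).
Hypotheses (mg : cmeasurable g) (N10 : (0 < N1)%N).

(* Averaging sharp cut-offs over b expresses the Zak transform of the truncated
   function as a mean of window sums, which the upper Riesz bound controls. *)
Definition wcut (m : Z) : R :=
  ((N1 ^ l)%:R)^-1 * \sum_(b <- zbox 0 N1) (zsub b m \in zbox (- T%:Z) (N1 + 2 * T))%:R.

Definition gtr (x : V) : R[i] := (wcut (tfloor x))%:C%C * g x.

Let nl : 0 < (N1 ^ l)%:R :> R. Proof. by rewrite ltr0n expn_gt0 N10. Qed.

Lemma wcut01 m : 0 <= wcut m <= 1.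
Proof.
rewrite /wcut mulr_ge0 ?invr_ge0 ?sumr_ge0 ?(ltW nl)//= mulrC ler_pdivrMr// mul1r.
rewrite -(size_zbox (l := l) 0 N1) -sum1_size natr_sum; apply: ler_sum => b _.
by case: (_ \in _).
Qed.

Lemma wcut1 m : (forall i, `|tnth m i| <= T%:Z) -> wcut m = 1.
Proof.
move=> hm; rewrite /wcut.
rewrite (_ : \sum_(b <- _) _ = (N1 ^ l)%:R) ?mulVf ?gt_eqF//.
rewrite -(size_zbox (l := l) 0 N1) -sum1_size natr_sum big_seq [RHS]big_seq.
apply: eq_bigr => b hb; rewrite (_ : _ \in _ = true)// mem_zbox; apply/forallP => i.
have hb' : forall i, 0 <= tnth b i < 0 + N1%:Z by apply/forallP; rewrite -mem_zbox.
rewrite tnth_mktuple; move: (hb' i) (hm i); set u : int := tnth b i; set v : int := tnth m i.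
move: u v => u v; clear; lia.
Qed.

Lemma wcut_supp m : wcut m != 0 -> m \in zbox (- (N1 + T)%:Z) (2 * (N1 + T) + 1).
Proof.
apply: contraNT => hm; rewrite /wcut big_seq big1 ?mulr0// => b hb.
apply/eqP; rewrite pnatr_eq0 eqb0; apply: contraNN hm => hbm.
have hb' : forall i, 0 <= tnth b i < 0 + N1%:Z by apply/forallP; rewrite -mem_zbox.
have hbm' : forall i, - T%:Z <= tnth (zsub b m) i < - T%:Z + (N1 + 2 * T)%:Z.
  by apply/forallP; rewrite -mem_zbox.
rewrite mem_zbox; apply/forallP => i; move: (hb' i) (hbm' i); rewrite tnth_mktuple.
set u : int := tnth b i; set v : int := tnth m i; move: u v => u v; clear; lia.
Qed.

Lemma cmeas_gtr : cmeasurable gtr.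
Proof. by apply: cmeasM => //; exact: (cmeas_tfloor (fun m => (wcut m)%:C%C)). Qed.

Lemma gtr_supp x : gtr x != 0 -> tfloor x \in zbox (- (N1 + T)%:Z) (2 * (N1 + T) + 1).
Proof.
move=> h; apply: wcut_supp; apply: contraNneq h => h.
by rewrite /gtr h mul0r.
Qed.

(** The weight [wcut] counts the b whose window retains m, so N1^l times the truncated Zak transform
    is a sum over b of sharp window sums with unimodular factors; Cauchy-Schwarz follows. *)
Lemma gtr_persum_le x y : cube x -> nsq (persum (N1 + T) gtr x y) <=
  ((N1 ^ l)%:R)^-1 * \sum_(b <- zbox 0 N1)
    nsq (\sum_(a <- zbox (- T%:Z) (N1 + 2 * T)) ee (tdot (tint a) y) * g (tsub (tadd x (tint b)) (tint a))).
Proof.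
move=> cx; pose U (b : Z) := \sum_(a <- zbox (- T%:Z) (N1 + 2 * T))
  ee (tdot (tint a) y) * g (tsub (tadd x (tint b)) (tint a)).
rewrite -[X in _ <= _ * X]/(\sum_(b <- zbox 0 N1) nsq (U b)).
have key : (N1 ^ l)%:R * persum (N1 + T) gtr x y = \sum_(b <- zbox 0 N1) ee (- tdot (tint b) y) * U b.
  have step b : b \in zbox 0 N1 -> ee (- tdot (tint b) y) * U b =
      \sum_(m <- zbox (- (N1 + T)%:Z) (2 * (N1 + T) + 1))
         (zsub b m \in zbox (- T%:Z) (N1 + 2 * T))%:R * (g (tadd x (tint m)) * ee (- tdot (tint m) y)).
    move=> hb.
    pose F (m : Z) := (zsub b m \in zbox (- T%:Z) (N1 + 2 * T))%:R * (g (tadd x (tint m)) * ee (- tdot (tint m) y)).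
    have zK a a' : zsub b a = zsub b a' -> a = a'.
      by move=> /(congr1 (zsub b)); rewrite !zsubKK.
    rewrite -(eq_big_supp (s1 := map (zsub b) (zbox (- T%:Z) (N1 + 2 * T))) (f := F)); last 3 first.
    - by rewrite map_inj_uniq ?zbox_uniq// => a a' /zK.
    - exact: zbox_uniq.
    - move=> m; rewrite /F; have [bm|] := boolP (zsub b m \in zbox _ _); last by rewrite mul0r eqxx.
      rewrite mul1r => hm.
      have -> : m \in map (zsub b) (zbox (- T%:Z) (N1 + 2 * T)).
        by apply/mapP; exists (zsub b m) => //; rewrite zsubKK.
      apply/esym; have hb' : forall i, 0 <= tnth b i < 0 + N1%:Z by apply/forallP; rewrite -mem_zbox.
      have hbm' : forall i, - T%:Z <= tnth (zsub b m) i < - T%:Z + (N1 + 2 * T)%:Z.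
        by apply/forallP; rewrite -mem_zbox.
      rewrite mem_zbox; apply/forallP => i; move: (hb' i) (hbm' i); rewrite tnth_mktuple.
      set u : int := tnth b i; set v : int := tnth m i; move: u v => u v; clear; lia.
    rewrite big_map mulr_sumr big_seq [RHS]big_seq; apply: eq_bigr => a ha.
    rewrite /F zsubKK ha mul1r.
    have -> : tsub (tadd x (tint b)) (tint a) = tadd x (tint (zsub b a)).
      by apply: tuple_ext => i; rewrite !tnth_mktuple rmorphB addrA.
    by rewrite mulrA -eeD mulrC tint_sub tdotBl; congr (_ * ee _); ring.
  rewrite big_seq (eq_bigr _ step) -big_seq exchange_big /= mulr_sumr; apply: eq_bigr => m _.
  rewrite -mulr_suml /gtr tfloor_add tfloor_cube//.
  have -> : zadd [tuple (0 : int) | _ < l] m = m.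
    by apply: tuple_ext => i; rewrite !tnth_mktuple add0r.
  have e : ((N1 ^ l)%:R : R[i]) * (wcut m)%:C%C =
      \sum_(b <- zbox 0 N1) (zsub b m \in zbox (- T%:Z) (N1 + 2 * T))%:R.
    rewrite -(rmorph_nat (@real_complex R)) -rmorphM /wcut mulVKf ?gt_eqF// rmorph_sum.
    by apply: eq_bigr => b _; rewrite rmorph_nat.
  by rewrite -e !mulrA.
have n2 : nsq ((N1 ^ l)%:R : R[i]) = (N1 ^ l)%:R ^+ 2 :> R.
  by rewrite -(rmorph_nat (@real_complex R)) nsq_real.
have h : (N1 ^ l)%:R ^+ 2 * nsq (persum (N1 + T) gtr x y) <= (N1 ^ l)%:R * \sum_(b <- zbox 0 N1) nsq (U b).
  rewrite -n2 -nsqM key; apply: le_trans (nsq_sum_le _ _) _; rewrite size_zbox ler_wpM2l//.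
  by apply: ler_sum => b _; rewrite nsqM nsq_ee mul1r.
rewrite mulrC ler_pdivlMr// -(ler_pM2l nl); apply: le_trans h.
by rewrite le_eqVlt; apply/orP; left; apply/eqP; ring.
Qed.

(** On the exceptional set the localized upper bound allows a mean square of at most 4B times (N1 +
    2T)^l / N1^l <= 2, that is 8B, against the assumed 16B; so the set is null. *)
Lemma zak_bounded A B y : finite_riesz g A B -> 0 <= A -> 0 < B ->
  ((N1 + 2 * T) ^ l <= 2 * N1 ^ l)%N ->
  leb [set z | cube z /\ 16 * B < nsq (persum (N1 + T) gtr z y)] = 0%E.
Proof.
move=> rg A0 B0 hr; set E := [set z | _].
pose s : seq Z := zbox (- T%:Z) (N1 + 2 * T).
pose U (x : V) := \sum_(a <- s) ee (tdot (tint a) y) * g (tsub x (tint a)).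
have mU : cmeasurable U.
  by apply: cmeas_sum => a; apply: cmeasM; [exact: cmeas_cst|exact: (cmeas_comp mg (measurable_tsub_int a))].
have mnU : measurable_fun setT (fun x => nsq (U x)) by exact: measurable_nsq.
have mP : measurable_fun setT (fun z => nsq (persum (N1 + T) gtr z y)).
  by apply: measurable_nsq; apply: cmeas_persum; exact: cmeas_gtr.
have mE : measurable E.
  rewrite (_ : E = @cube R l `&` (fun z => nsq (persum (N1 + T) gtr z y)) @^-1` `]16 * B, +oo[); last first.
    by apply/seteqP; split => z /=; rewrite in_itv/= andbT.
  apply: measurableI; first exact: measurable_cube.
  by rewrite -[X in measurable X]setTI; exact: mP.
have Ec : E `<=` @cube R l by move=> z [].
have mE1 : measurable_fun setT (\1_E : V -> R) by exact: measurable_indic.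
have mEf : measurable_fun setT (fun x : V => \1_E (tfrac x) : R) := measurableT_comp mE1 (@measurable_frac R l).
have i0 x : 0 <= \1_E x :> R by rewrite indicE.
have finE : leb E \is a fin_num.
  rewrite ge0_fin_numE//; apply: (@le_lt_trans _ _ 1%E); last exact: ltry.
  by rewrite -(lebesgue_cube R l); apply: le_measure; rewrite ?inE//; exact: measurable_cube.
pose m := fine (leb E); have mP' : leb E = m%:E by rewrite fineK.
have m0 : 0 <= m by exact: fine_ge0.
suff m00 : m = 0 by rewrite mP' m00.
apply: le_anti; rewrite m0 andbT.
have up : (\int[leb]_x (\1_E (tfrac x) * nsq (U x))%:E <= (4 * B * (m * (2 * (N1 ^ l)%:R)))%:E)%E.
  have := localized_riesz (s := s) (fun a => ee (tdot (tint a) y)) mg rg (zbox_uniq _ _) A0 (ltW B0) mE (m := m).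
  case/(_ _)/andP; first by rewrite setIidl.
  move=> _ h; apply: le_trans h _; rewrite lee_fin !ler_wpM2l ?(ltW B0)// ?mulr_ge0 ?(ltW B0)//.
  rewrite (eq_bigr (fun=> 1)); last by move=> a _; rewrite nsq_ee.
  rewrite big_const_seq count_predT size_zbox iter_addr_0 -natrM ler_nat//.
have mUb b : measurable_fun setT (fun x : V => nsq (U (tadd x (tint b)))).
  by apply: measurable_nsq; exact: cmeas_shift.
have mc := @measurable_cube R l.
have mEU b : measurable_fun (@cube R l) (fun x : V => \1_E x * nsq (U (tadd x (tint b)))).
  by apply: measurable_funTS; exact: measurable_funM mE1 (mUb b).
have mEUf : measurable_fun setT (fun x : V => \1_E (tfrac x) * nsq (U x)) := measurable_funM mEf mnU.
have mEUs b : measurable_fun (@cube R l) (fun x : V => \1_E (tfrac (tadd x (tint b))) * nsq (U (tadd x (tint b)))).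
  by apply: measurable_funTS; exact: (measurableT_comp mEUf (measurable_tadd (tint b))).
have EU0 (b : Z) x : 0 <= \1_E x * nsq (U (tadd x (tint b))) by exact: mulr_ge0 (i0 _) (nsq_ge0 _).
have EUf0 x : 0 <= \1_E (tfrac x) * nsq (U x) by exact: mulr_ge0 (i0 _) (nsq_ge0 _).
have ni : 0 <= ((N1 ^ l)%:R)^-1 :> R by rewrite invr_ge0 ltW.
have tile : (\sum_(b <- zbox 0 N1) \int[leb]_(x in @cube R l) (\1_E x * nsq (U (tadd x (tint b))))%:E <=
    \int[leb]_x (\1_E (tfrac x) * nsq (U x))%:E)%E.
  have mEUE : measurable_fun setT (fun x : V => (\1_E (tfrac x) * nsq (U x))%:E).
    exact/measurable_EFinP.
  rewrite [leRHS](integral_tiling mEUE); last by move=> x; rewrite lee_fin.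
  apply: le_trans (zser_ge_sum (zbox_uniq 0 N1) _); last first.
    by move=> b; apply: int_ge0 => x; exact: EUf0.
  apply: lee_sum => b _; apply: (ge0_int_le _ mc (mEU b) (mEUs b) (EU0 b)) => x cx.
  by rewrite frac_add frac_id.
have low : ((16 * B * m)%:E <= (((N1 ^ l)%:R)^-1)%:E * \sum_(b <- zbox 0 N1) \int[leb]_(x in @cube R l) (\1_E x * nsq (U (tadd x (tint b))))%:E)%E.
  have ms : measurable_fun (@cube R l) (fun x => \sum_(b <- zbox 0 N1) \1_E x * nsq (U (tadd x (tint b)))).
    by apply: measurable_sum => b; exact: mEU.
  have s0 x : 0 <= \sum_(b <- zbox 0 N1) \1_E x * nsq (U (tadd x (tint b))).
    by apply: sumr_ge0 => b _; exact: EU0.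
  have mE1c : measurable_fun (@cube R l) (\1_E : V -> R) by exact: measurable_funTS.
  have B16 : 0 <= 16 * B by rewrite mulr_ge0 ?ltW.
  rewrite -(ge0_int_sum leb (zbox 0 N1) mc mEU EU0) -(ge0_intZ leb mc ni ms s0).
  have -> : (16 * B * m)%:E = (\int[leb]_(x in @cube R l) (16 * B * \1_E x)%:E)%E.
    rewrite (ge0_intZ leb mc B16 mE1c i0) integral_indic//.
    by rewrite setIidl// EFinM; congr (_ * _)%E.
  apply: (ge0_int_le _ mc) => //.
  - exact: measurable_funM.
  - exact: measurable_funM.
  - by move=> x; exact: mulr_ge0 B16 (i0 _).
  move=> x cx; rewrite -mulr_sumr indicE; case: (boolP (x \in E)) => [|_]; last by rewrite !(mul0r, mulr0).
  rewrite inE => -[_ hx]; rewrite mulr1 mul1r; apply: le_trans (ltW hx) _.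
  exact: gtr_persum_le.
have := le_trans low (lee_wpmul2l _ (le_trans tile up)).
rewrite -EFinM !lee_fin invr_ge0 => /(_ (ltW nl)).
have -> : ((N1 ^ l)%:R)^-1 * (4 * B * (m * (2 * (N1 ^ l)%:R))) = 8 * B * m by field; rewrite gt_eqF.
by have := mulr_ge0 (ltW B0) m0; nra.
Qed.

End truncated_zak.

Lemma int_shift_nat (t : int) (K : nat) : (0 < K)%N ->
  exists q m : nat, t + (q * K)%N%:Z = m%:Z.
Proof.
move=> K0; case: t => n; first by exists 0%N, n; rewrite mul0n addr0.
exists n.+1, (n.+1 * K - n.+1)%N; rewrite -subzn ?leq_pmulr// NegzE addrC //.
Qed.

(** Apply [integral_cube_shift] to the indicator of the periodic set where h > b. *)
Lemma null_shift {R : realType} {l : nat} (h : Rspace R l -> R) (b : R) (s : Rspace R l) :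
  measurable_fun setT h -> (forall x n, h (tadd x (tint n)) = h x) ->
  lebesgue_tuple l [set x | cube x /\ b < h x] = 0%E ->
  lebesgue_tuple l [set x | cube x /\ b < h (tadd x s)] = 0%E.
Proof.
move=> mh hper h0; pose D := [set x | b < h x].
have mD : measurable D.
  rewrite (_ : D = h @^-1` `]b, +oo[); last by apply/seteqP; split => z /=; rewrite in_itv/= andbT.
  by rewrite -[X in measurable X]setTI; exact: mh.
have mc := @measurable_cube R l.
have mD1 : measurable_fun setT (fun x : Rspace R l => (\1_D x : R)%:E).
  by apply/measurable_EFinP; exact: measurable_indic.
have D0 x : (0 <= (\1_D x : R)%:E)%E by rewrite lee_fin indicE.
have per x n : (\1_D (tadd x (tint n)) : R)%:E = (\1_D x : R)%:E.
  have -> // : \1_D (tadd x (tint n)) = \1_D x :> R.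
  by rewrite !indicE; congr (_%:R); congr nat_of_bool; apply/idP/idP; rewrite !inE /D /= hper.
have e := integral_cube_shift s mD1 D0 per.
have iD (E : set (Rspace R l)) : measurable E ->
    (\int[lebesgue_tuple l]_(x in @cube R l) (\1_E x)%:E = lebesgue_tuple l (E `&` @cube R l))%E.
  by move=> mE; rewrite integral_indic.
pose Ds := (fun x => tadd x s) @^-1` D.
have mDs : measurable Ds by rewrite -[X in measurable X]setTI; exact: (measurable_tadd s).
have eDs := iD _ mDs.
have -> : [set x | cube x /\ b < h (tadd x s)] = Ds `&` @cube R l by rewrite setIC.
rewrite -eDs -[RHS]h0.
have -> : [set x | cube x /\ b < h x] = D `&` @cube R l by rewrite setIC.
exact: etrans e (iD _ mD).
Qed.

Section smoothed_zak.
Context {R : realType} {l : nat}.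
Local Notation Z := (l.-tuple int).
Local Notation V := (Rspace R l).
Local Notation leb := (lebesgue_tuple l).
Variables (g : V -> R[i]) (N1 T : nat) (k : 'I_l).
Hypotheses (mg : cmeasurable g) (N10 : (0 < N1)%N).
Local Notation g0 := (gtr g N1 T).
Local Notation P0 := (N1 + T)%N.

(* The extension of [persum] from the cube that makes the quasi-periodicity in z
   hold exactly. *)
Definition zak (z y : V) : R[i] :=
  ee (tdot (tint (tfloor z)) y) * persum P0 g0 (tfrac z) y.

Lemma normc_zak z y : normc (zak z y) = normc (persum P0 g0 (tfrac z) y).
Proof. exact: normc_eeM. Qed.

Lemma zak_add_int z n y : zak (tadd z (tint n)) y = ee (tdot (tint n) y) * zak z y.
Proof. by rewrite /zak frac_add tfloor_add tint_add tdotDl eeD mulrA; congr (_ * _); rewrite mulrC. Qed.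

Lemma zak_int_add z n y : zak z (tadd y (tint n)) = zak z y.
Proof.
rewrite /zak tdotDr eeD ee_tdot_int mulr1; congr (_ * _); apply: eq_bigr => m _.
have -> : - tdot (tint m) (tadd y (tint n)) = - tdot (tint m) y + tdot (tint (zopp m)) (tint n).
  rewrite tdotDr opprD; congr (_ + _); rewrite /tdot -sumrN; apply: eq_bigr => i _.
  by rewrite !tnth_mktuple rmorphN mulNr.
by rewrite eeD ee_tdot_int mulr1.
Qed.

(** The box of radius P still contains the whole support after a translation by the integer part of
    z; re-indexing produces exactly the phase built into [zak]. *)
Lemma persum_zak (Q P : nat) z y : tfloor z \in zbox (- Q%:Z) (2 * Q + 1) -> (P0 + Q <= P)%N ->
  persum P g0 z y = zak z y.
Proof.
move=> hz hP; set n := tfloor z.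
have hz' : forall i, - Q%:Z <= tnth n i < - Q%:Z + (2 * Q + 1)%:Z by apply/forallP; rewrite -mem_zbox.
pose F (m : Z) := g0 (tadd (tfrac z) (tint m)) * ee (- tdot (tint (zsub m n)) y).
have zK : injective (zadd n) by move=> a b /(congr1 (fun t => zsub t n)); rewrite ![zadd n _]zaddC !zaddK.
transitivity (\sum_(m <- map (zadd n) (zbox (- P%:Z) (2 * P + 1))) F m).
  rewrite big_map; apply: eq_bigr => m _; rewrite /F zaddC zaddK; congr (g0 _ * _).
  by rewrite zaddC tint_add taddA frac_floor.
rewrite (eq_big_supp (s2 := zbox (- P0%:Z) (2 * P0 + 1))); last 3 first.
- by rewrite map_inj_uniq ?zbox_uniq.
- exact: zbox_uniq.
- move=> m hm; have g0m : g0 (tadd (tfrac z) (tint m)) != 0.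
    by apply: contraNneq hm => h; rewrite /F h mul0r.
  have mP0 := supp_cube (@gtr_supp _ _ g N1 T) (frac_cube z) g0m.
  rewrite mP0; apply/mapP; exists (zsub m n); last by rewrite zaddC zsubK.
  have mP0' : forall i, - P0%:Z <= tnth m i < - P0%:Z + (2 * P0 + 1)%:Z by apply/forallP; rewrite -mem_zbox.
  rewrite mem_zbox; apply/forallP => i; move: (mP0' i) (hz' i).
  have -> : tnth (zsub m n) i = tnth m i - tnth n i by rewrite [LHS]tnth_mktuple.
  set u : int := tnth m i; set v : int := tnth n i; move: u v => u v; move: hP; clear; lia.
rewrite /zak mulr_sumr; apply: eq_bigr => m _; rewrite mulrCA -eeD; congr (_ * ee _).
by rewrite tint_sub tdotBl; ring.
Qed.

Variables (K L M M' N : nat).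
Hypotheses (K0 : (0 < K)%N) (N0 : (0 < N)%N).

Definition pos (t : int) : V := tek k (t%:~R / K%:R).

(** The function G_i to be compared with g translated by i/K. The cut-off is constant on cells, so
    in a Zak transform it depends on the lattice point only and becomes a convolution in
    frequency. *)
Definition smoothed (i : nat) (x : V) : R[i] :=
  vpmult M L (tnth (tfloor x) k) * \sum_(s < N) \sum_(s' < N)
    fvp_weight M' N (s%:Z - s'%:Z) * g0 (tadd x (pos (i%:Z - s%:Z + s'%:Z))).

Definition sbox : nat := (P0 + (2 * K + N + 1))%N.

Lemma tfloor_pos (t : int) (x : V) : `|t| <= (K + N)%:Z ->
  forall i, `|tnth (tfloor (tadd x (pos t))) i - tnth (tfloor x) i| <= (K + N + 1)%:Z.
Proof.
move=> ht i; rewrite !tnth_mktuple; case: ifP => _; last first.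
  by rewrite addr0 subrr normr0.
set u := tnth x i; set v := t%:~R / K%:R.
have KR : 1 <= K%:R :> R by rewrite ler1n.
have hv : `|v| <= (K + N)%:R.
  rewrite /v normrM normfV [ `|K%:R| ]ger0_norm// ler_pdivrMr ?ltr0n//.
  apply: (@le_trans _ _ (K + N)%:R); last by rewrite ler_peMr.
  by rewrite -intr_norm -[(K + N)%:R]/((K + N)%:Z%:~R) ler_int.
have [h1 h2] := andP (floor_itv (u + v)); have [h3 h4] := andP (floor_itv u).
set a := Num.floor _ in h1 h2 *; set b := Num.floor _ in h3 h4 *.
have e : `|a%:~R - b%:~R| <= (K + N)%:R + 1 :> R.
  move: hv; rewrite !ler_norml => /andP[v1 v2]; move: h2 h4; rewrite !intrD /= => h2 h4.
  by apply/andP; split; lra.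
by move: e; rewrite -rmorphB /= -intr_norm natr1 addn1 -[_.+1%:R]/(_.+1%:Z%:~R) ler_int.
Qed.

Lemma cmeas_smoothed i : cmeasurable (smoothed i).
Proof.
apply: cmeasM; first exact: (cmeas_tfloor (fun m => vpmult M L (tnth m k))).
apply: cmeas_sum => s; apply: cmeas_sum => s'; apply: cmeasM; first exact: cmeas_cst.
by apply: cmeas_shift; exact: cmeas_gtr.
Qed.

Let off_le (i : nat) (s s' : 'I_N) : (i < K)%N -> `|i%:Z - s%:Z + s'%:Z| <= (K + N)%:Z.
Proof. by move: (nat_of_ord s) (ltn_ord s) (nat_of_ord s') (ltn_ord s') => a ? b ? ?; lia. Qed.

Lemma smoothed_supp i x : (i < K)%N -> smoothed i x != 0 ->
  tfloor x \in zbox (- sbox%:Z) (2 * sbox + 1).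
Proof.
move=> iK; apply: contraNT => hx; rewrite /smoothed big1 ?mulr0// => s _; rewrite big1// => s' _.
apply/eqP; rewrite mulf_eq0; apply/orP; right; apply: contraNT hx => /gtr_supp h.
have h' : forall j, - P0%:Z <= tnth (tfloor (tadd x (pos (i%:Z - s%:Z + s'%:Z)))) j < - P0%:Z + (2 * P0 + 1)%:Z.
  by apply/forallP; rewrite -mem_zbox.
rewrite mem_zbox; apply/forallP => j; move: (h' j) (tfloor_pos x (off_le s s' iK) j).
set u : int := tnth _ j; set v : int := tnth _ j; move: u v => u v; rewrite /sbox; clear; lia.
Qed.

(** The cut-off [vpmult] at m_k is an average over r of [vp r] times e(-r m_k / L), and that phase
    shifts the k-th frequency by r/L. Exchanging the sums, the Zak transform of the smoothed
    function is the smoothed array of Zak values. *)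
Lemma persum_smoothed (i j : nat) (y x : V) : (i < K)%N -> cube x ->
  persum sbox (smoothed i) x (tadd y (tek k (j%:R / L%:R))) =
  smooth_xy L M M' N (fun t j => zak (tadd x (pos t)) (tadd y (tek k (j%:R / L%:R)))) i j.
Proof.
move=> iK cx.
have inner (s s' : 'I_N) (r : 'I_L) :
   zak (tadd x (pos (i%:Z - s%:Z + s'%:Z))) (tadd y (tek k ((j + r)%:R / L%:R))) =
   \sum_(m <- zbox (- sbox%:Z) (2 * sbox + 1)) g0 (tadd (tadd x (tint m)) (pos (i%:Z - s%:Z + s'%:Z))) *
     (ee (- tdot (tint m) (tadd y (tek k (j%:R / L%:R)))) * ee (- (r%:R * (tnth m k)%:~R / L%:R))).
  rewrite -(@persum_zak (K + N + 1) sbox); last 2 first.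
  - rewrite mem_zbox; apply/forallP => i'; have := tfloor_pos x (off_le s s' iK) i'.
    rewrite (tfloor_cube cx) [tnth [tuple _ | _ < l] i']tnth_mktuple.
    set u : int := tnth _ i'; move: u => u; clear; lia.
  - by rewrite /sbox; lia.
  apply: eq_bigr => m _; rewrite -eeD; congr (g0 _ * ee _).
    by rewrite -!taddA [tadd (pos _) _]taddC.
  by rewrite natrD mulrDl tekD taddA [in LHS]tdotDr opprD; congr (_ - _); rewrite tdot_tek; ring.
rewrite /smooth_xy /smooth_x.
under [X in _ = _ * X]eq_bigr => r _ do under eq_bigr => s _ do under eq_bigr => s' _ do rewrite inner mulr_sumr.
under [X in _ = _ * X]eq_bigr => r _ do under eq_bigr => s _ do rewrite exchange_big /=.
under [X in _ = _ * X]eq_bigr => r _ do rewrite exchange_big /= mulr_sumr.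
rewrite exchange_big /= mulr_sumr; apply: eq_bigr => m _.
rewrite /smoothed tfloor_add (tfloor_cube cx).
have -> : tnth (zadd [tuple (0 : int) | _ < l] m) k = tnth m k by rewrite !tnth_mktuple add0r.
rewrite /vpmult -!mulrA; congr (_ * _); rewrite mulr_suml; apply: eq_bigr => r _.
rewrite mulrACA -mulrA; congr (_ * _); rewrite [X in _ * X]mulrC mulr_suml; apply: eq_bigr => s _.
by rewrite mulr_suml; apply: eq_bigr => s' _; rewrite -!mulrA.
Qed.

Section cover.
Variables (A B c : R) (y : V).
Hypotheses (rg : finite_riesz g A B) (A0 : 0 < A) (B0 : 0 < B).
Hypothesis NT : ((N1 + 2 * T) ^ l <= 2 * N1 ^ l)%N.
Hypotheses (L2 : (2 < L)%N) (M0 : (0 < M)%N) (ML : (3 * M <= L)%N).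
Hypotheses (M'0 : (0 < M')%N) (M'N : (3 * M' <= N)%N) (c0 : 0 < c) (cM : 1 <= c ^+ 2 * M%:R).
(** [S] and [del] are the square roots of the thresholds 16B of [zak_bounded] and A/16 of
    [window_average]. *)
Let S : R := 4 * Num.sqrt B.
Let del : R := Num.sqrt A / 4.
Hypotheses (hx : 172 * (M'%:R / N%:R) * S + 8 * c * S < del) (hy : 192 * (M%:R / L%:R) * S < del).
Let eta (j : nat) : V := tadd y (tek k (j%:R / L%:R)).

Let bad (p : 'I_K * 'I_L) : set V :=
  [set x | cube x /\ 16 * B < nsq (persum P0 g0 (tfrac (tadd x (pos p.1%:Z))) (eta p.2))].

Let mpers z : measurable_fun setT (fun x : V => nsq (persum P0 g0 (tfrac x) z)).
Proof.
have h := measurable_nsq (cmeas_persum P0 z (cmeas_gtr N1 T mg)).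
exact: (measurableT_comp h (@measurable_frac R l)).
Qed.

Let mbad p : measurable (bad p).
Proof.
rewrite (_ : bad p = @cube R l `&` (fun x => nsq (persum P0 g0 (tfrac (tadd x (pos p.1%:Z))) (eta p.2)))
    @^-1` `]16 * B, +oo[); last first.
  by apply/seteqP; split => z /=; rewrite in_itv/= andbT.
apply: measurableI; first exact: measurable_cube.
rewrite -[X in measurable X]setTI.
exact: (measurableT_comp (mpers (eta p.2)) (measurable_tadd (pos p.1%:Z))).
Qed.

Let bad0 p : leb (bad p) = 0%E.
Proof.
pose h (x : V) := nsq (persum P0 g0 (tfrac x) (eta p.2)).
apply: (@null_shift _ _ h (16 * B) (pos p.1%:Z) (mpers (eta p.2))).
  by move=> x b; rewrite /h frac_add.
have := zak_bounded mg N10 (eta p.2) rg (ltW A0) B0 NT.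
have -> // : [set z | cube z /\ 16 * B < nsq (persum P0 g0 z (eta p.2))] = [set z | cube z /\ 16 * B < h z].
by apply/seteqP; split => z [cz] hz; split => //; move: hz; rewrite /h frac_id.
Qed.

(** Off the finite union of null sets [bad], all K L grid values are at most S in modulus.
    Periodicity in j and quasi-periodicity in t extend this to the whole array, and
    [smoothing_dichotomy] then yields a near zero. *)
Lemma smoothed_cover : (1 <= leb (\bigcup_(p : 'I_K * 'I_L)
  [set z | cube z /\ (nsq (persum sbox (smoothed p.1) z (eta p.2)) <= A / 16)%R]))%E.
Proof.
set U := \bigcup_p _.
have enumT : [set` enum {: 'I_K * 'I_L}] = setT.
  by apply/seteqP; split => // p _; rewrite /= mem_enum.
have fT : finite_set [set: 'I_K * 'I_L] by rewrite -enumT; exact: finite_seq.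
have mBad : measurable (\bigcup_p bad p) by exact: fin_bigcup_measurable.
have mU : measurable U.
  apply: fin_bigcup_measurable => // p _.
  rewrite (_ : [set z | _] = @cube R l `&`
    (fun z => nsq (persum sbox (smoothed p.1) z (eta p.2))) @^-1` `]-oo, A / 16]); last first.
    by apply/seteqP; split => z /=; rewrite in_itv.
  apply: measurableI; first exact: measurable_cube.
  rewrite -[X in measurable X]setTI; apply: measurable_nsq => //.
  by apply: cmeas_persum; exact: cmeas_smoothed.
have Bad0 : leb (\bigcup_p bad p) = 0%E.
  apply/eqP; rewrite eq_le measure_ge0 andbT.
  apply: le_trans (content_sub_fsum leb fT (fun p _ => mbad p) mBad (fun _ => id)) _.
  by rewrite fsbig1// => p _; exact: bad0.
rewrite -(lebesgue_cube R l).
apply: (@le_trans _ _ (leb (U `|` \bigcup_p bad p))); last first.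
  apply: le_trans (measureU2 leb mU mBad) _; rewrite -[leRHS]adde0; apply: leeD => //.
  by have := lexx (leb (\bigcup_p bad p)); rewrite {2}Bad0.
apply: le_measure; rewrite ?inE; [exact: measurable_cube|exact: measurableU|].
move=> x cx; have [|good] := pselect ((\bigcup_p bad p) x); [by right|left].
pose H (t : int) (j : nat) := zak (tadd x (pos t)) (eta j).
have KR : K%:R != 0 :> R by rewrite pnatr_eq0 -lt0n.
have LR : L%:R != 0 :> R by rewrite pnatr_eq0 -lt0n (ltn_trans _ L2).
pose ek : Z := [tuple (if i == k then 1 else 0) | i < l].
have HL t j : H t (j + L)%N = H t j.
  rewrite /H /eta natrD mulrDl divff// tekD taddA (tek_int k 1); exact: zak_int_add.
have posD t : pos (t + K%:Z) = tadd (pos t) (tint ek).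
  by rewrite /pos rmorphD mulrDl divff// tekD (tek_int k 1).
have HK t j : H (t + K%:Z) j = ee ((tnth y k : R) + j%:R / L%:R) * H t j.
  rewrite /H posD taddA zak_add_int; congr (ee _ * _).
  rewrite -(tek_int k 1) tdotC -[tek k 1%:~R]/(tek k 1) /eta.
  rewrite /tdot (bigD1 k)//= big1 ?addr0; last first.
    by move=> i /negbTE ik; rewrite !tnth_mktuple ik mulr0.
  by rewrite !tnth_mktuple eqxx mulr1.
have S0 : 0 <= S by rewrite mulr_ge0// sqrtr_ge0.
have S2 : S ^+ 2 = 16 * B by rewrite exprMn sqr_sqrtr ?ltW//; ring.
have HS0 (t : nat) j : (t < K)%N -> (j < L)%N -> normc (H t%:Z j) <= S.
  move=> tK jL; rewrite /H normc_zak normc_le// S2 leNgt; apply/negP => h; apply: good.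
  by exists (Ordinal tK, Ordinal jL).
have HSj (t : nat) j : (t < K)%N -> normc (H t%:Z j) <= S.
  move=> tK; rewrite (divn_eq j L); elim: (j %/ L)%N => [|q IH].
    by rewrite mul0n add0n HS0// ltn_mod (ltn_trans _ L2).
  by rewrite mulSn -addnA addnC HL.
have HKn (q : nat) t j : normc (H (t + (q * K)%N%:Z) j) = normc (H t j).
  elim: q => [|q IH]; first by rewrite mul0n addr0.
  by rewrite mulSn addnC PoszD addrA HK normc_eeM.
have HS t j : normc (H t j) <= S.
  have [q [m e]] := int_shift_nat t K0.
  by rewrite -(HKn q) e (divn_eq m K) addnC PoszD HKn HSj// ltn_mod.
have [i [j hij]] := smoothing_dichotomy K0 L2 M0 ML M'0 M'N c0 cM HS HL HK hx hy.
exists (i, j) => //; split => //=.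
rewrite /eta persum_smoothed//; have d0 : 0 <= del by rewrite divr_ge0// sqrtr_ge0.
have -> : A / 16 = del ^+ 2 by rewrite /del exprMn sqr_sqrtr ?ltW// exprVn; congr (_ / _); ring.
by rewrite -normc_le// ltW.
Qed.

End cover.
End smoothed_zak.

(** * Approximation of g by the smoothed functions *)

Section approximation.
Context {R : realType} {l : nat}.
Local Notation Z := (l.-tuple int).
Local Notation V := (Rspace R l).
Local Notation leb := (lebesgue_tuple l).
Variables (g : V -> R[i]) (k : 'I_l).
Hypothesis (mg : cmeasurable g).

(* On the Fourier side this is multiplication by [fvp M' N K] of the k-th
   coordinate. *)
Definition translates (K M' N : nat) (f : V -> R[i]) (x : V) : R[i] :=
  \sum_(s < N) \sum_(s' < N) fvp_weight M' N (s%:Z - s'%:Z) *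
    f (tadd x (pos k K (s'%:Z - s%:Z))).

Lemma cmeas_translates K M' N f : cmeasurable f -> cmeasurable (translates K M' N f).
Proof.
move=> mf; apply: cmeas_sum => s; apply: cmeas_sum => s'; apply: cmeasM; first exact: cmeas_cst.
exact: cmeas_shift.
Qed.

Lemma int_nsq_shift (f : V -> R[i]) (s : V) : cmeasurable f ->
  (\int[leb]_x (nsq (f (tadd x s)))%:E = \int[leb]_x (nsq (f x))%:E)%E.
Proof.
move=> mf; apply: (integral_tadd s (f := fun x => (nsq (f x))%:E)).
  exact: emeasurable_nsq.
by move=> x; rewrite lee_fin nsq_ge0.
Qed.

(** The weight [wcut] is 1 on the cells |m_i| <= T whatever N1 is, so T comes from the tail of g
    alone and N1 may be adapted to it afterwards. *)
Lemma truncation_error : (\int[leb]_x (nsq (g x))%:E < +oo)%E -> forall e : R, 0 < e ->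
  exists T : nat, forall N1, (0 < N1)%N ->
    (\int[leb]_x (nsq (g x - gtr g N1 T x))%:E <= e%:E)%E.
Proof.
move=> ig e e0.
pose far (T : nat) (m : Z) : R := (~~ [forall i, `|tnth m i| <= T%:Z])%:R.
have far01 T m : 0 <= far T m <= 1 by rewrite /far; case: (~~ _); rewrite ?lexx ?ler01.
have mh T : measurable_fun setT (fun x : V => far T (tfloor x) * nsq (g x)).
  by apply: measurable_funM; [exact: measurable_fun_tfloor|exact: measurable_nsq].
have h0 T x : 0 <= far T (tfloor x) * nsq (g x) <= nsq (g x).
  have /andP[f0 f1] := far01 T (tfloor x).
  by rewrite (mulr_ge0 f0 (nsq_ge0 _)) ler_piMl// nsq_ge0.
have hc x : far T (tfloor x) * nsq (g x) @[T --> \oo] --> (0 : R).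
  apply: (@cvg_trans _ ((fun=> 0 : R) @ \oo)); last exact: cvg_cst.
  apply: near_eq_cvg; near=> T; rewrite /far.
  have -> : [forall i, `|tnth (tfloor x) i| <= T%:Z].
    apply/forallP => i; apply: (@le_trans _ _ (\sum_(j < l) `|tnth (tfloor x) j|%N)%N%:Z).
      by rewrite -abszE lez_nat (bigD1 i)//= leq_addr.
    by rewrite lez_nat; near: T; exact: nbhs_infty_ge.
  by rewrite mul0r.
have [T hT] := dominated_small mh h0 (measurable_nsq mg) ig hc e0.
exists T => N1 N10; apply: le_trans (ltW (hT T (leqnn _))).
apply: ge0_int_le => //.
- by apply: measurable_nsq; apply: cmeasB => //; exact: cmeas_gtr.
- by move=> x; exact: nsq_ge0.
move=> x _; rewrite /far; case: forallP => /= hx.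
  by rewrite /gtr (wcut1 N10 hx) mul1r subrr nsq0 mul0r.
have /andP[t0 t1] := @wcut01 R l N1 T N10 (tfloor x).
rewrite mul1r /gtr -[X in X - _]mul1r -mulrBl nsqM ler_piMl ?nsq_ge0//.
have -> : 1 - (wcut N1 T (tfloor x))%:C%C = (1 - wcut N1 T (tfloor x))%:C%C :> R[i].
  by rewrite rmorphB.
by rewrite nsq_real exprn_ile1 ?subr_ge0// gerBl.
Unshelve. all: by end_near. Qed.

(** Taking N1 at least 4 l T makes l times 2T/N1 at most 1/2, as [one_add_pow_le] asks. *)
Lemma window_choice (T : nat) : exists2 N1 : nat, (0 < N1)%N & ((N1 + 2 * T) ^ l <= 2 * N1 ^ l)%N.
Proof.
pose N1 := (4 * (l * T) + 2 * T + 1)%N; have N10 : (0 < N1)%N by rewrite /N1 addn1.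
exists N1 => //; have Np : 0 < N1%:R :> R by rewrite ltr0n.
pose t : R := (2 * T)%:R / N1%:R.
have t01 : 0 <= t <= 1.
  rewrite divr_ge0//= ler_pdivrMr// mul1r ler_nat /N1; lia.
have lt2 : l%:R * t <= 1 / 2.
  rewrite /t mulrA ler_pdivrMr// -natrM mulrC mulrA mulr1 ler_pdivlMr// -natrM ler_nat /N1.
  by rewrite mulnCA mulnAC -[(2 * 2)%N]/4%N -addnA leq_addr.
have h1 := one_add_pow_le t01 lt2.
have e1 : (N1 + 2 * T)%:R = N1%:R * (1 + t) :> R by rewrite natrD /t; field; rewrite gt_eqF.
rewrite -(ler_nat R) natrM !natrX e1 exprMn mulrC ler_wpM2r ?(exprn_ge0 _ (ltW Np))//.
by apply: le_trans h1 _; lra.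
Qed.

Section error.
Variables (K L M M' N : nat).
Hypotheses (K0 : (0 < K)%N) (L0 : (2 < L)%N) (M0 : (0 < M)%N) (ML : (3 * M <= L)%N).

Let tail (x : V) : R := (M%:R - 1 <= `|tnth x k : R|)%R%:R * nsq (g x).

Lemma measurable_tail (a : R) (f : V -> R[i]) : cmeasurable f ->
  measurable_fun setT (fun x : V => ((a <= `|tnth x k : R|)%R%:R * nsq (f x) : R)).
Proof.
move=> mf; apply: measurable_funM; last exact: measurable_nsq.
pose E := [set x : V | a <= `|tnth x k : R|].
have mE : measurable E.
  have mt : measurable_fun setT (fun x : V => `|tnth x k : R|).
    by apply: measurableT_comp; [exact: normr_measurable|exact: measurable_tnthR].
  rewrite (_ : E = (fun x : V => `|tnth x k : R|) @^-1` `[a, +oo[); last first.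
    by apply/seteqP; split => x /=; rewrite in_itv/= andbT.
  by rewrite -[X in measurable X]setTI; exact: mt.
have mE1 : measurable_fun setT (\1_E : V -> R) by exact: measurable_indic.
apply: eq_measurable_fun mE1 => x _; rewrite indicE; congr (_%:R); congr nat_of_bool.
by apply/idP/idP; rewrite inE.
Qed.

(** A crude Cauchy-Schwarz constant for the operator [translates]. It only multiplies errors that
    are sent to 0 with the smoothing parameters fixed. *)
Definition fvp_energy : R :=
  (N * N)%:R * \sum_(s < N) \sum_(s' < N) nsq (fvp_weight M' N (s%:Z - s'%:Z) : R[i]).

Lemma nsq_translates_le (f : V -> R[i]) x :
  nsq (translates K M' N f x) <= (N * N)%:R * \sum_(s < N) \sum_(s' < N)
    nsq (fvp_weight M' N (s%:Z - s'%:Z) : R[i]) * nsq (f (tadd x (pos k K (s'%:Z - s%:Z)))).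
Proof.
rewrite /translates !pair_big /= -[X in nsq X]big_enum /=.
apply: le_trans (nsq_sum_le _ _) _; rewrite -cardE card_prod !card_ord; apply: ler_wpM2l => //.
by rewrite big_enum; apply: ler_sum => p _; rewrite nsqM.
Qed.

Lemma int_translates_le (f : V -> R[i]) (e : R) : cmeasurable f ->
  (\int[leb]_x (nsq (f x))%:E <= e%:E)%E ->
  (\int[leb]_x (nsq (translates K M' N f x))%:E <= (fvp_energy * e)%:E)%E.
Proof.
move=> mf he.
pose F (s s' : 'I_N) (x : V) : R :=
  nsq (fvp_weight M' N (s%:Z - s'%:Z) : R[i]) * nsq (f (tadd x (pos k K (s'%:Z - s%:Z)))).
have mF s s' : measurable_fun setT (F s s').
  by apply: measurable_funM => //; apply: measurable_nsq; exact: cmeas_shift.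
have F0 s s' x : 0 <= F s s' x by exact: mulr_ge0 (nsq_ge0 _) (nsq_ge0 _).
have mFs s : measurable_fun setT (fun x => \sum_(s' < N) F s s' x) by exact: measurable_sum.
have Fs0 s x : 0 <= \sum_(s' < N) F s s' x by apply: sumr_ge0.
have mFss : measurable_fun setT (fun x => \sum_(s < N) \sum_(s' < N) F s s' x) by exact: measurable_sum.
have Fss0 x : 0 <= \sum_(s < N) \sum_(s' < N) F s s' x by apply: sumr_ge0.
apply: (@le_trans _ _ (\int[leb]_x ((N * N)%:R * \sum_(s < N) \sum_(s' < N) F s s' x)%:E)%E).
  apply: ge0_int_le => //.
  - by apply: measurable_nsq; exact: cmeas_translates.
  - exact: measurable_funM.
  - by move=> x; exact: nsq_ge0.
  - by move=> x _; exact: nsq_translates_le.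
rewrite ge0_intZ// /fvp_energy -mulrA EFinM; apply: lee_wpmul2l => //.
rewrite ge0_int_sum// mulr_suml -sumEFin; apply: lee_sum => s _.
rewrite ge0_int_sum// mulr_suml -sumEFin; apply: lee_sum => s' _.
have mfs : measurable_fun setT (fun x => nsq (f (tadd x (pos k K (s'%:Z - s%:Z))))).
  by apply: measurable_nsq; exact: cmeas_shift.
rewrite (ge0_intZ leb measurableT (nsq_ge0 _) mfs (fun x => nsq_ge0 _)).
rewrite (EFinM (nsq _) e); apply: lee_wpmul2l; first by rewrite lee_fin nsq_ge0.
by rewrite int_nsq_shift.
Qed.

Variables (N1 T : nat) (d1 d2 d3 : R).
Hypothesis N10 : (0 < N1)%N.
Hypothesis hd1 : (\int[leb]_x (nsq (translates K M' N g x - g x))%:E <= d1%:E)%E.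
Hypothesis hd2 : (\int[leb]_x (tail x)%:E <= d2%:E)%E.
Hypothesis hd3 : (\int[leb]_x (nsq (g x - gtr g N1 T x))%:E <= d3%:E)%E.

(** With p the cut-off at x, the difference is (1 - p) g - p (translates of g, minus g) + p
    (translates of the truncation error), all at x + i/K. As 0 <= p <= 1, the three squares are
    bounded separately, with a factor 3. *)
Lemma smoothed_error (i : nat) : (i < K)%N ->
  (\int[leb]_x (nsq (shiftf (pos k K i%:Z) g x - smoothed g N1 T k K L M M' N i x))%:E <=
    (3 * (d2 + d1 + fvp_energy * d3))%:E)%E.
Proof.
move=> iK; pose pi_ := pos k K i%:Z : V.
pose G2 x := translates K M' N g x - g x.
pose G3 x := translates K M' N (fun y => g y - gtr g N1 T y) x.
have mgd : cmeasurable (fun y => g y - gtr g N1 T y) by apply: cmeasB => //; exact: cmeas_gtr.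
have mG2 : cmeasurable G2 by apply: cmeasB => //; exact: cmeas_translates.
have mG3 : cmeasurable G3 by exact: cmeas_translates.
have mt := measurable_tail (M%:R - 1) mg.
have t0 x : 0 <= tail x by exact: mulr_ge0 (ler0n _ _) (nsq_ge0 _).
have pw x : nsq (shiftf pi_ g x - smoothed g N1 T k K L M M' N i x) <=
    3 * (tail (tadd x pi_) + nsq (G2 (tadd x pi_)) + nsq (G3 (tadd x pi_))).
  have [p hp [p0 p1 pM]] := vpmultP (R := R) M0 ML (tnth (tfloor x) k).
  have e : smoothed g N1 T k K L M M' N i x = p%:C%C *
      (translates K M' N g (tadd x pi_) - G3 (tadd x pi_)).
    rewrite /smoothed hp; congr (_ * _); rewrite /G3 /translates -sumrB; apply: eq_bigr => s _.
    rewrite -sumrB; apply: eq_bigr => s' _; rewrite -mulrBr subKr; congr (_ * gtr _ _ _ _).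
    rewrite -taddA /pi_ /pos -tekD -mulrDl -rmorphD /=; congr (tadd _ (tek _ (_%:~R / _))).
    by ring.
  have -> : shiftf pi_ g x - smoothed g N1 T k K L M M' N i x =
      (1 - p%:C%C) * g (tadd x pi_) - p%:C%C * G2 (tadd x pi_) + p%:C%C * G3 (tadd x pi_).
    by rewrite e /shiftf /G2; ring.
  have n3 (a b c : R[i]) : nsq (a - b + c) <= 3 * (nsq a + nsq b + nsq c).
    rewrite !nsqE; case: a => a a'; case: b => b b'; case: c => c c' /=.
    have := sqr_ge0 (a + b); have := sqr_ge0 (a - c); have := sqr_ge0 (b + c).
    have := sqr_ge0 (a' + b'); have := sqr_ge0 (a' - c'); have := sqr_ge0 (b' + c').
    nra.
  apply: le_trans (n3 _ _ _) _; rewrite ler_pM2l//.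
  have pp : nsq (p%:C%C : R[i]) <= 1 by rewrite nsq_real exprn_ile1.
  rewrite !nsqM; apply: lerD; last by rewrite ler_piMl ?nsq_ge0.
  apply: lerD; last by rewrite ler_piMl ?nsq_ge0.
  have -> : 1 - p%:C%C = (1 - p)%:C%C :> R[i] by rewrite rmorphB.
  rewrite nsq_real /tail; have [near|far] := leP `|tnth (tfloor x) k| M%:Z.
    by rewrite pM// subrr expr0n mul0r mulr_ge0 ?nsq_ge0.
  rewrite ler_wpM2r ?nsq_ge0//.
  (* Here the cell index exceeds M in modulus; for negative indices, rounding down and the shift i/K
     <= 1 can bring the coordinate down to M - 1. *)
  have -> : M%:R - 1 <= `|tnth (tadd x pi_) k : R|.
    have [h1 h2] := andP (floor_itv (tnth x k : R)).
    rewrite !tnth_mktuple eqxx; move: far; rewrite tnth_mktuple; set n := Num.floor _ in h1 h2 *.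
    set v := tnth x k in h1 h2 * => far.
    have i0 : 0 <= i%:Z%:~R / K%:R :> R by rewrite divr_ge0.
    have i1 : i%:Z%:~R / K%:R <= 1 :> R by rewrite ler_pdivrMr ?ltr0n// mul1r ler_nat ltnW.
    have [n0|n0] := leP 0 n.
      move: far; rewrite ger0_norm// -(ltr_int R) => far.
      by rewrite ler_normr; apply/orP; left; rewrite (_ : M%:R = M%:Z%:~R)//; lra.
    move: far; rewrite ltr0_norm// => far.
    have : (n + 1)%:~R <= - M%:Z%:~R :> R by rewrite -rmorphN /= ler_int; move: far; clear; lia.
    by move=> far'; rewrite ler_normr; apply/orP; right; rewrite (_ : M%:R = M%:Z%:~R)//; lra.
  by rewrite exprn_ile1 ?subr_ge0// gerBl.
apply: (@le_trans _ _ (\int[leb]_x (3 * (tail (tadd x pi_) + nsq (G2 (tadd x pi_)) + nsq (G3 (tadd x pi_))))%:E)%E).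
  have m1 := measurableT_comp mt (measurable_tadd pi_).
  have m2 : measurable_fun setT (fun x => nsq (G2 (tadd x pi_))) by apply: measurable_nsq; exact: cmeas_shift.
  have m3 : measurable_fun setT (fun x => nsq (G3 (tadd x pi_))) by apply: measurable_nsq; exact: cmeas_shift.
  apply: ge0_int_le => //.
  - apply: measurable_nsq; apply: cmeasB; first exact: cmeas_shift.
    exact: cmeas_smoothed.
  - by apply: measurable_funM => //; apply: measurable_funD => //; exact: measurable_funD.
  - by move=> x; exact: nsq_ge0.
have mS : measurable_fun setT (fun x => 3 * (tail x + nsq (G2 x) + nsq (G3 x))).
  apply: measurable_funM => //; apply: measurable_funD; last exact: measurable_nsq.
  by apply: measurable_funD => //; exact: measurable_nsq.
have S0 x : 0 <= tail x + nsq (G2 x) by exact: addr_ge0 (t0 _) (nsq_ge0 _).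
have S1 x : 0 <= tail x + nsq (G2 x) + nsq (G3 x) by exact: addr_ge0 (S0 _) (nsq_ge0 _).
have mSE : measurable_fun setT (fun x => (3 * (tail x + nsq (G2 x) + nsq (G3 x)))%:E).
  exact/measurable_EFinP.
rewrite (integral_tadd pi_ mSE); last by move=> x; rewrite lee_fin mulr_ge0.
have m2 := measurable_nsq mG2; have m3 := measurable_nsq mG3.
have m12 : measurable_fun setT (fun x => tail x + nsq (G2 x)) by exact: measurable_funD.
have m123 : measurable_fun setT (fun x => tail x + nsq (G2 x) + nsq (G3 x)) by exact: measurable_funD.
rewrite ge0_intZ// (EFinM 3); apply: lee_wpmul2l => //.
rewrite ge0_intD//; [|by move=> x; exact: nsq_ge0].
rewrite ge0_intD//; [|by move=> x; exact: nsq_ge0].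
rewrite (EFinD (d2 + d1)) (EFinD d2); apply: leeD; first exact: leeD.
exact: int_translates_le.
Qed.

End error.
End approximation.

Lemma le_of_eps (R : realType) (a b C : R) : 0 <= C ->
  (forall e, 0 < e <= 1 -> a <= b + C * e) -> a <= b.
Proof.
move=> C0 h; rewrite leNgt; apply/negP => ab.
pose e := Num.min 1 ((a - b) / (2 * (C + 1))).
have C1 : 0 < 2 * (C + 1) by lra.
have e0 : 0 < e <= 1 by rewrite lt_min ltr01 divr_gt0 ?subr_gt0//= ge_min lexx.
have := h e e0; have : e <= (a - b) / (2 * (C + 1)) by rewrite ge_min lexx orbT.
rewrite ler_pdivlMr//; case/andP: e0 => e0 _.
have := mulr_ge0 C0 (ltW e0); nra.
Qed.

(** * The quantitative Balian-Low inequality *)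

Section gap.
Context {R : realType} {l : nat}.
Local Notation V := (Rspace R l).
Local Notation leb := (lebesgue_tuple l).
Variables (g : V -> R[i]) (k : 'I_l) (A B c : R) (K L M M' N : nat).
Hypotheses (mg : cmeasurable g) (ig : (\int[leb]_x (nsq (g x))%:E < +oo)%E).
Hypotheses (rg : finite_riesz g A B) (A0 : 0 < A) (B0 : 0 < B).
Hypotheses (K0 : (0 < K)%N) (L2 : (2 < L)%N) (M0 : (0 < M)%N) (ML : (3 * M <= L)%N).
Hypotheses (M'0 : (0 < M')%N) (M'N : (3 * M' <= N)%N) (c0 : 0 < c) (cM : 1 <= c ^+ 2 * M%:R).
Hypothesis hx : 172 * (M'%:R / N%:R) * (4 * Num.sqrt B) + 8 * c * (4 * Num.sqrt B) < Num.sqrt A / 4.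
Hypothesis hy : 192 * (M%:R / L%:R) * (4 * Num.sqrt B) < Num.sqrt A / 4.
Variables (d1 d2 : R).
Hypothesis hd1 : (\int[leb]_x (nsq (translates k K M' N g x - g x))%:E <= d1%:E)%E.
Hypothesis hd2 : (\int[leb]_x ((M%:R - 1 <= `|tnth x k : R|)%R%:R * nsq (g x))%:E <= d2%:E)%E.

(** The truncation parameters are chosen after K, L, M, M', N, so letting the truncation error e
    tend to 0 removes [fvp_energy]. The constant 6LK is 2L from [frame_gap], K functions, and 3 from
    [smoothed_error]. *)
Lemma gap_core : A / 8 <= 6 * L%:R * K%:R * (d2 + d1).
Proof.
have N0 : (0 < N)%N by apply: leq_trans M'N; rewrite muln_gt0.
have E0 : 0 <= fvp_energy M' N :> R.
  by rewrite /fvp_energy mulr_ge0// sumr_ge0// => s _; rewrite sumr_ge0// => s' _; exact: nsq_ge0.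
apply: (le_of_eps (C := 6 * L%:R * K%:R * fvp_energy M' N)).
  by apply: mulr_ge0 E0; rewrite !mulr_ge0.
move=> e /andP[e0 _]; have [T hT] := truncation_error mg ig e0.
have [N1 N10 NT] := @window_choice R l T.
have err i (iK : (i < K)%N) :
    (\int[leb]_x (nsq (shiftf (pos k K i%:Z) g x - smoothed g N1 T k K L M M' N i x))%:E <=
    (3 * (d2 + d1 + fvp_energy M' N * e))%:E)%E.
  by apply: smoothed_error => //; exact: hT.
pose D : R := 3 * (d2 + d1 + fvp_energy M' N * e).
pose C : R := 2 * fine (\int[leb]_x (nsq (g x))%:E) + 2 * D.
pose h (i : 'I_K) := shiftf (pos k K i%:Z) g.
have mh i : cmeasurable (h i) by exact: cmeas_shift.
have mS i : cmeasurable (smoothed g N1 T k K L M M' N i) by exact: cmeas_smoothed.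
have hC (i : 'I_K) : (\int[leb]_x (nsq (smoothed g N1 T k K L M M' N i x))%:E <= C%:E)%E.
  have m1 := measurable_nsq (mh i); have m2 := measurable_nsq (cmeasB (mh i) (mS i)).
  have n1 x : 0 <= nsq (h i x) by exact: nsq_ge0.
  have n2 x : 0 <= nsq (h i x - smoothed g N1 T k K L M M' N i x) by exact: nsq_ge0.
  apply: (@le_trans _ _ (\int[leb]_x (2 * nsq (h i x) + 2 * nsq (h i x - smoothed g N1 T k K L M M' N i x))%:E)%E).
    apply: ge0_int_le => //.
    - exact: measurable_nsq.
    - by apply: measurable_funD; exact: measurable_funM.
    - by move=> x; exact: nsq_ge0.
    by move=> x _; apply: le_trans (nsqB_le _ _); rewrite subKr.
  rewrite ge0_intD//; last 4 first.
  - exact: measurable_funM.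
  - exact: measurable_funM.
  - by move=> x; rewrite mulr_ge0.
  - by move=> x; rewrite mulr_ge0.
  rewrite !ge0_intZ// /C (EFinD (2 * _)) !(EFinM 2); apply: leeD; apply: lee_wpmul2l => //.
    rewrite int_nsq_shift// fineK// ge0_fin_numE//.
    by apply: int_ge0 => x; exact: nsq_ge0.
  exact: err (ltn_ord i).
have hD (i : 'I_K) : (\int[leb]_x (nsq (h i x - smoothed g N1 T k K L M M' N i x))%:E <= D%:E)%E.
  exact: err (ltn_ord i).
have cov y := smoothed_cover k mg N10 K0 N0 y rg A0 B0 NT L2 M0 ML M'0 M'N c0 cM hx hy.
have supp (i : 'I_K) x : smoothed g N1 T k K L M M' N i x != 0 -> _ :=
  smoothed_supp N10 K0 N0 (ltn_ord i) (x := x).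
have rh i : finite_riesz (h i) A B by exact: finite_riesz_shift.
have := frame_gap (eta := fun j : 'I_L => tek k (j%:R / L%:R)) (C := fun=> C) (D := fun=> D)
  A0 (ltW B0) mh rh (fun i => mS i) supp hC hD cov.
rewrite sumr_const card_ord -[D *+ K]mulr_natl /D => hh; apply: le_trans hh _.
by rewrite le_eqVlt; apply/orP; left; apply/eqP; ring.
Qed.

End gap.

Definition tail_energy (R : realType) (l : nat) (k : 'I_l) (f : Rspace R l -> R[i]) (Q : R) : \bar R :=
  (\int[lebesgue_tuple l]_x ((Q <= `|tnth x k : R|)%R%:R * nsq (f x))%:E)%E.

Lemma tail_energy_fin (R : realType) (l : nat) (k : 'I_l) (f : Rspace R l -> R[i]) (Q : R) :
  cmeasurable f -> (\int[lebesgue_tuple l]_x (nsq (f x))%:E < +oo)%E ->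
  exists2 t : R, 0 <= t & tail_energy k f Q = t%:E.
Proof.
move=> mf hf.
have t0 x : 0 <= (Q <= `|tnth x k : R|)%R%:R * nsq (f x) by exact: mulr_ge0 (ler0n _ _) (nsq_ge0 _).
have h0 : (0 <= tail_energy k f Q)%E by exact: int_ge0.
have hfin : (tail_energy k f Q < +oo)%E.
  apply: le_lt_trans hf; apply: ge0_int_le => //.
  - exact: measurable_tail.
  - exact: measurable_nsq.
  - by move=> x _; rewrite ler_piMl ?nsq_ge0// lern1 leq_b1.
by exists (fine (tail_energy k f Q)); rewrite ?fine_ge0// fineK// ge0_fin_numE.
Qed.

(** The Fourier transform enters through a single inequality, a hypothesis here, which
    [translates_plancherel] supplies. All constants below are fixed before l, g and k. *)
Lemma balian_low (R : realType) (A B : R) : 0 < A -> 0 < B -> exists2 c : R, 0 < c &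
  forall (l : nat) (g ghat : Rspace R l -> R[i]) (k : 'I_l),
  cmeasurable g -> (\int[lebesgue_tuple l]_x (nsq (g x))%:E < +oo)%E ->
  cmeasurable ghat -> (\int[lebesgue_tuple l]_x (nsq (ghat x))%:E < +oo)%E ->
  finite_riesz g A B ->
  (forall K M' N, (0 < K)%N ->
     (\int[lebesgue_tuple l]_x (nsq (translates k K M' N g x - g x))%:E <=
     8%:E * \int[lebesgue_tuple l]_xi (nsq (fvp M' N K (tnth xi k) - 1) * nsq (ghat xi))%:E)%E) ->
  forall Q P : R, 1 <= Q -> 1 <= P ->
  ((c / (Q * P))%:E <= tail_energy k g Q + tail_energy k ghat P)%E.
Proof.
move=> A0 B0.
have sA : 0 < Num.sqrt A by rewrite sqrtr_gt0.
have sB : 0 < Num.sqrt B by rewrite sqrtr_gt0.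
pose S := 4 * Num.sqrt B; pose del := Num.sqrt A / 4.
have S0 : 0 < S by rewrite mulr_gt0.
have del0 : 0 < del by rewrite divr_gt0.
(* Makes the quasi-periodicity defect 8 c1 S equal to del/4; [m1] is then the width of the cut-off
   that [vp_moment] requires. *)
pose c1 := del / (32 * S); have c10 : 0 < c1 by rewrite divr_gt0// mulr_gt0.
pose m1 := (Num.truncn (c1 ^- 2)).+1.
(* [kap] is the common ratio K/m0 = L/M. Since 688 = 4 * 172, the variation 172 S / kap is below
   del/4, and 192 S / kap is below del; the summand 3 ensures 3M <= L. *)
pose kap := ((Num.truncn (688 * S / del)).+1 + 3)%N.
have kapR : 0 < kap%:R :> R by rewrite ltr0n /kap addnS.
have hkap : 688 * S < kap%:R * del.
  rewrite -ltr_pdivrMr//; apply: lt_le_trans (truncnS_gt _) _.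
  by rewrite ler_nat /kap leq_addr.
have m1R : 0 < m1%:R :> R by rewrite ltr0n.
have kap3 : (3 <= kap)%N by rewrite /kap addnC leq_addr.
have hm1 : 1 <= c1 ^+ 2 * m1%:R.
  rewrite mulrC -ler_pdivrMr ?exprn_gt0// mul1r; exact/ltW/truncnS_gt.
have m10 : (0 < m1)%N by [].
clearbody kap m1.
(* From A/8 <= 48 L K (t1 + t2) and L K <= 6 kap^2 m1 Q P: the product 8 * 48 * 6 equals 48 * 48. *)
pose den : R := 48 * (48 * (kap%:R ^+ 2 * m1%:R)).
have den0 : 0 < den.
  have h48 : 0 < 48 :> R by rewrite ltr0n.
  exact: mulr_gt0 h48 (mulr_gt0 h48 (mulr_gt0 (exprn_gt0 2 kapR) m1R)).
exists (A / den); first by rewrite divr_gt0.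
move=> l g ghat k mg ig mh ih rg plan Q P Q1 P1.
(* M must satisfy M - 1 >= Q because [smoothed_error] sees the tail beyond M - 1, and be a multiple
   of m1; m0 must exceed P strictly for [fvp_exists]. *)
pose M := ((Num.truncn Q).+2 * m1)%N; pose m0 := (Num.truncn P).+1.
have M0 : (0 < M)%N by rewrite /M muln_gt0.
pose K := (kap * m0)%N; pose L := (kap * M)%N.
have K0 : (0 < K)%N by rewrite /K muln_gt0 (leq_trans _ kap3).
have ML : (3 * M <= L)%N by rewrite /L leq_mul2r kap3 orbT.
have L2 : (2 < L)%N by apply: leq_trans ML; rewrite -{1}[3%N]muln1 leq_mul2l M0 orbT.
have mK : (3 * m0 <= K)%N by rewrite /K leq_mul2r kap3 orbT.
have Pm0 : P < m0%:R by exact: truncnS_gt.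
have [t1 t10 e1] := tail_energy_fin k Q mg ig.
have [t2 t20 e2] := tail_energy_fin k P mh ih.
pose H := fine (\int[lebesgue_tuple l]_x (nsq (ghat x))%:E).
have HE : (\int[lebesgue_tuple l]_x (nsq (ghat x))%:E = H%:E)%E.
  by rewrite /H fineK// ge0_fin_numE// int_ge0// => x; exact: nsq_ge0.
have H0 : 0 <= H by apply/fine_ge0/int_ge0 => x; exact: nsq_ge0.
have QM : Q <= M%:R - 1.
  have h1 : Q < (Num.truncn Q).+1%:R by exact: truncnS_gt.
  have h2 : (Num.truncn Q).+1%:R + 1 <= M%:R :> R by rewrite natr1 ler_nat leq_pmulr.
  by move: h1 h2; clear; lra.
have hd2 : (\int[lebesgue_tuple l]_x ((M%:R - 1 <= `|tnth x k : R|)%R%:R * nsq (g x))%:E <= t1%:E)%E.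
  rewrite -e1; apply: ge0_int_le => //.
  - exact: measurable_tail.
  - exact: measurable_tail.
  - by move=> x; exact: mulr_ge0 (ler0n _ _) (nsq_ge0 _).
  move=> x _; rewrite ler_wpM2r ?nsq_ge0// ler_nat; case: (leP (M%:R - 1) _) => // hM.
  by rewrite (le_trans QM).
have LK : L%:R * K%:R <= 6 * kap%:R ^+ 2 * m1%:R * (Q * P).
  rewrite /L /K /M /m0 !natrM.
  have q0 : 0 <= Q by exact: le_trans ler01 _.
  have p0 : 0 <= P by exact: le_trans ler01 _.
  have hq : (Num.truncn Q).+2%:R <= 3 * Q.
    have := truncn_le Q; rewrite q0 -natr1 -natr1 => h; move: h Q1; clear; lra.
  have hp : (Num.truncn P).+1%:R <= 2 * P.
    have := truncn_le P; rewrite p0 -natr1 => h; move: h P1; clear; lra.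
  have -> : kap%:R * ((Num.truncn Q).+2%:R * m1%:R) * (kap%:R * (Num.truncn P).+1%:R) =
    kap%:R ^+ 2 * m1%:R * ((Num.truncn Q).+2%:R * (Num.truncn P).+1%:R) :> R by ring.
  have -> : 6 * kap%:R ^+ 2 * m1%:R * (Q * P) = kap%:R ^+ 2 * m1%:R * (3 * Q * (2 * P)) by ring.
  by rewrite ler_wpM2l ?mulr_ge0 ?exprn_ge0 ?ler0n// ler_pM.
have main : A / 8 <= 48 * (L%:R * K%:R) * (t1 + t2).
  apply: (@le_trans _ _ (6 * (L%:R * K%:R) * (t1 + 8 * t2))); last first.
    have : 0 <= L%:R * K%:R * t1 :> R by rewrite !mulr_ge0.
    lra.
  apply: (le_of_eps (C := 48 * (L%:R * K%:R))); first by rewrite !mulr_ge0.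
  move=> e /andP[e0 e1'].
  pose eta := e / (H + 1); have H1 : 0 < H + 1 by exact: ltr_wpDl.
  have eta0 : 0 < eta by rewrite divr_gt0.
  have etaH : eta ^+ 2 * H <= e.
    have h1 : eta * (H + 1) = e by rewrite /eta divfK ?gt_eqF.
    have h2 : eta <= 1 by rewrite /eta ler_pdivrMr// mul1r; move: e1' H0; clear; lra.
    by rewrite -h1 expr2 -mulrA ler_pM2l//; move: h2 H0; clear; nra.
  have [p p0 hp] := fvp_exists Pm0 (ltn0Sn _ : (0 < m0)%N) mK eta0.
  (* Below P the multiplier is within [eta] of 1, which costs at most e in total; beyond P its
     distance from 1 is at most 1, which costs the tail t2. *)
  have d1 : (\int[lebesgue_tuple l]_x (nsq (translates k K (m0 * p) (K * p) g x - g x))%:E <= (8 * (e + t2))%:E)%E.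
    apply: le_trans (plan K (m0 * p)%N (K * p)%N K0) _; rewrite (EFinM 8); apply: lee_wpmul2l => //.
    have mt := measurable_tail k P mh; have mn := measurable_nsq mh.
    have t0 x : 0 <= (P <= `|tnth x k : R|)%R%:R * nsq (ghat x) by exact: mulr_ge0 (ler0n _ _) (nsq_ge0 _).
    have n0 x : 0 <= nsq (ghat x) by exact: nsq_ge0.
    have eta2 : 0 <= eta ^+ 2 by exact: sqr_ge0.
    apply: (@le_trans _ _ (\int[lebesgue_tuple l]_x (eta ^+ 2 * nsq (ghat x) + (P <= `|tnth x k : R|)%R%:R * nsq (ghat x))%:E)%E).
      apply: ge0_int_le => //.
      - apply: measurable_funM => //; apply: measurable_nsq; apply: cmeasB; last exact: cmeas_cst.
        apply: cmeas_sum => s; apply: cmeas_sum => s'; apply: cmeasM; first exact: cmeas_cst.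
        apply: cmeas_ee; apply: measurableT_comp => //; apply: measurable_funM => //.
        by apply: measurable_funM => //; exact: measurable_tnthR.
      - by apply: measurable_funD => //; exact: measurable_funM.
      - by move=> x; exact: mulr_ge0 (nsq_ge0 _) (nsq_ge0 _).
      move=> x _; rewrite -mulrDl ler_wpM2r ?nsq_ge0//.
      have [q -> [q0 q1 hq]] := hp (tnth x k).
      have -> : q%:C%C - 1 = (q - 1)%:C%C :> R[i] by rewrite rmorphB.
      rewrite nsq_real -sqrrN opprB; have [xP|xP] := leP P `|tnth x k : R|.
        have : (1 - q) ^+ 2 <= 1 by rewrite exprn_ile1 ?subr_ge0// gerBl.
        by move=> q2; rewrite -[leLHS]add0r lerD.
      by rewrite addr0 ler_pXn2r ?nnegrE ?subr_ge0 ?(ltW eta0)// hq// ltW.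
    rewrite ge0_intD//; [|exact: measurable_funM|by move=> x; rewrite mulr_ge0].
    rewrite ge0_intZ// HE -/(tail_energy k ghat P) e2 -EFinM -EFinD lee_fin lerD2r; exact: etaH.
  have M'N : (3 * (m0 * p) <= K * p)%N by rewrite mulnA leq_mul2r mK orbT.
  have M'0 : (0 < m0 * p)%N by rewrite muln_gt0 p0.
  have pR : 0 < p%:R :> R by rewrite ltr0n.
  have m0R : 0 < m0%:R :> R by rewrite ltr0n.
  have MR : 0 < M%:R :> R by rewrite ltr0n.
  have r1 : (m0 * p)%:R / (K * p)%:R = kap%:R^-1 :> R.
    by rewrite /K !natrM; field; rewrite !gt_eqF.
  have r2 : M%:R / L%:R = kap%:R^-1 :> R by rewrite /L natrM; field; rewrite !gt_eqF.
  have ki : kap%:R^-1 * (688 * S) < del by rewrite ltr_pdivrMl.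
  have c1S : 8 * c1 * S = del / 4 by rewrite /c1; field; rewrite gt_eqF.
  have cM : 1 <= c1 ^+ 2 * M%:R.
    apply: le_trans hm1 _; rewrite ler_wpM2l ?sqr_ge0// ler_nat /M leq_pmull//.
  have hx : 172 * ((m0 * p)%:R / (K * p)%:R) * S + 8 * c1 * S < del by rewrite r1 c1S; move: ki del0; clear; lra.
  have hy : 192 * (M%:R / L%:R) * S < del.
    have : 0 <= kap%:R^-1 * S by rewrite mulr_ge0 ?invr_ge0 ?ltW.
    by rewrite r2; move: ki; clear; lra.
  have := gap_core mg ig rg A0 B0 K0 L2 M0 ML M'0 M'N c10 cM hx hy d1 hd2.
  by move=> hh; apply: le_trans hh _; rewrite le_eqVlt; apply/orP; left; apply/eqP; ring.
rewrite e1 e2 -EFinD lee_fin ler_pdivrMr; last by apply: mulr_gt0; exact: lt_le_trans ltr01 _.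
rewrite ler_pdivrMr//.
have tt : 0 <= t1 + t2 by exact: addr_ge0.
have h := ler_wpM2r tt LK.
have -> : (t1 + t2) * (Q * P) * den = 384 * (6 * kap%:R ^+ 2 * m1%:R * (Q * P) * (t1 + t2)).
  by rewrite /den; ring.
move: h main; clear; lra.
Qed.

(** * Plancherel inequality *)

Section complex_integral.
Context d (T : measurableType d) (R : realType) (mu : {measure set T -> \bar R}).
Implicit Types (f g : T -> R[i]).

Lemma Re_le_normc (z : R[i]) : `|complex.Re z| <= normc z.
Proof.
by case: z => a b /=; rewrite -sqrtr_sqr ler_wsqrtr// lerDl sqr_ge0.
Qed.

Lemma Im_le_normc (z : R[i]) : `|complex.Im z| <= normc z.
Proof.
by case: z => a b /=; rewrite -sqrtr_sqr ler_wsqrtr// lerDr sqr_ge0.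
Qed.

Lemma measurable_normc f : cmeasurable f -> measurable_fun setT (fun x => normc (f x)).
Proof.
move=> mf; have -> : (fun x => normc (f x)) = (fun x => Num.sqrt (nsq (f x))).
  by apply/funext => x; rewrite sqrtr_sqr ger0_norm// normc_ge0.
apply: (@measurableT_comp _ _ _ _ _ _ (@Num.sqrt R)); last exact: measurable_nsq.
by apply: continuous_measurable_fun => x; exact: sqrt_continuous.
Qed.

Lemma L1fun_le f (h : T -> R) : cmeasurable f -> measurable_fun setT h ->
  (forall x, normc (f x) <= h x) -> (\int[mu]_x (h x)%:E < +oo)%E -> L1fun mu f.
Proof.
move=> mf mh fh ih; split => //; apply: le_lt_trans ih; apply: ge0_int_le => //.
- exact: measurable_normc.
- by move=> x; exact: normc_ge0.
Qed.

Lemma L1funD f g : L1fun mu f -> L1fun mu g -> L1fun mu (fun x => f x + g x).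
Proof.
move=> [mf hf] [mg hg]; apply: (L1fun_le (h := fun x => normc (f x) + normc (g x))).
- exact: cmeasD.
- by apply: measurable_funD; exact: measurable_normc.
- by move=> x; exact: normcD_le.
- rewrite ge0_intD//; try exact: measurable_normc; try by move=> x; exact: normc_ge0.
  exact: lte_add_pinfty.
Qed.

Lemma L1funM f g (C : R) : L1fun mu f -> cmeasurable g -> (forall x, normc (g x) <= C) ->
  L1fun mu (fun x => g x * f x).
Proof.
move=> [mf hf] mg gC.
have C0 (x : T) : 0 <= C by apply: le_trans (normc_ge0 _) (gC x).
apply: (L1fun_le (h := fun x => `|C| * normc (f x))).
- exact: cmeasM.
- by apply: measurable_funM => //; exact: measurable_normc.
- by move=> x; apply: normcM_le => //; apply: le_trans (gC x) (ler_norm _).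
- rewrite ge0_intZ//; [|exact: measurable_normc|by move=> x; exact: normc_ge0].
  by rewrite lte_mul_pinfty// lee_fin.
Qed.

Lemma L1funZ f (c : R[i]) : L1fun mu f -> L1fun mu (fun x => c * f x).
Proof. by move=> hf; apply: (L1funM (g := fun=> c) (C := normc c)) => //; exact: cmeas_cst. Qed.

Lemma L1fun0 : L1fun mu (fun=> 0).
Proof.
split; first exact: cmeas_cst.
under eq_integral do rewrite ComplexField.Normc.normc0.
by rewrite integral0 ltry.
Qed.

Lemma L1fun_sum (I : eqType) (s : seq I) (F : I -> T -> R[i]) : (forall i, L1fun mu (F i)) ->
  L1fun mu (fun x => \sum_(i <- s) F i x).
Proof.
move=> hF; elim: s => [|i s IH].
  have -> : (fun x => \sum_(i <- [::]) F i x) = fun=> 0 by apply/funext => x; rewrite big_nil.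
  exact: L1fun0.
have -> : (fun x => \sum_(j <- i :: s) F j x) = fun x => F i x + \sum_(j <- s) F j x.
  by apply/funext => x; rewrite big_cons.
exact: L1funD.
Qed.

Lemma L1fun_Re f : L1fun mu f -> mu.-integrable setT (EFin \o (fun x => complex.Re (f x))).
Proof.
move=> [mf hf]; apply/integrableP; split; first by apply/measurable_EFinP; exact: mf.1.
apply: le_lt_trans hf; apply: ge0_int_le => //.
- by apply: measurableT_comp mf.1.
- exact: measurable_normc.
- by move=> x _; exact: Re_le_normc.
Qed.

Lemma L1fun_Im f : L1fun mu f -> mu.-integrable setT (EFin \o (fun x => complex.Im (f x))).
Proof.
move=> [mf hf]; apply/integrableP; split; first by apply/measurable_EFinP; exact: mf.2.
apply: le_lt_trans hf; apply: ge0_int_le => //.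
- by apply: measurableT_comp mf.2.
- exact: measurable_normc.
- by move=> x _; exact: Im_le_normc.
Qed.

Lemma cintegralD f g : L1fun mu f -> L1fun mu g ->
  cintegral mu (fun x => f x + g x) = cintegral mu f + cintegral mu g.
Proof.
move=> hf hg; rewrite /cintegral; apply/eqP; rewrite eq_complex /=; apply/andP; split; apply/eqP.
  rewrite -RintegralD//; [|exact: L1fun_Re|exact: L1fun_Re].
  by apply: eq_Rintegral => x _; case: (f x) => ? ?; case: (g x).
rewrite -RintegralD//; [|exact: L1fun_Im|exact: L1fun_Im].
by apply: eq_Rintegral => x _; case: (f x) => ? ?; case: (g x).
Qed.

Lemma cintegralZ f (c : R[i]) : L1fun mu f ->
  cintegral mu (fun x => c * f x) = c * cintegral mu f.
Proof.
move=> hf; have hr := L1fun_Re hf; have hi := L1fun_Im hf.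
have iz (a : R) (h : T -> R) : mu.-integrable setT (EFin \o h) ->
    mu.-integrable setT (EFin \o (fun x => a * h x)).
  by move=> ih; exact: (integrableZl measurableT a ih).
case: c => a b; rewrite /cintegral; apply/eqP; rewrite eq_complex /=; apply/andP; split; apply/eqP.
  rewrite -!RintegralZl// -RintegralB//; try exact: iz.
  by apply: eq_Rintegral => x _; case: (f x).
rewrite -!RintegralZl// -RintegralD//; try exact: iz.
by apply: eq_Rintegral => x _; case: (f x).
Qed.

Lemma cintegral0 : cintegral mu (fun=> 0) = 0.
Proof. by rewrite /cintegral /= /Rintegral !integral0. Qed.

Lemma eq_cintegral f g : f =1 g -> cintegral mu f = cintegral mu g.
Proof. by move=> fg; congr cintegral; exact/funext. Qed.

Lemma cintegral_sum (I : eqType) (s : seq I) (F : I -> T -> R[i]) : (forall i, L1fun mu (F i)) ->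
  cintegral mu (fun x => \sum_(i <- s) F i x) = \sum_(i <- s) cintegral mu (F i).
Proof.
move=> hF; elim: s => [|i s IH].
  rewrite big_nil -[RHS]cintegral0; apply: eq_cintegral => x; exact: big_nil.
rewrite big_cons -IH -cintegralD//; last exact: L1fun_sum.
by apply: eq_cintegral => x; exact: big_cons.
Qed.

Lemma cintegral_cvg (F : nat -> T -> R[i]) f : L1fun mu f -> (forall n, cmeasurable (F n)) ->
  (forall n x, normc (F n x) <= normc (f x)) ->
  (forall x, exists N, forall n, (N <= n)%N -> F n x = f x) ->
  nsq (cintegral mu (F n) - cintegral mu f) @[n --> \oo] --> (0 : R).
Proof.
move=> hf mF Ff ev; have [mf nf] := hf.
have in_ : mu.-integrable setT (fun x => (normc (f x))%:E).
  apply/integrableP; split; first by apply/measurable_EFinP; exact: measurable_normc.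
  by under eq_integral do rewrite gee0_abs ?lee_fin ?normc_ge0//.
have dc (p : R[i] -> R) : (forall g, cmeasurable g -> measurable_fun setT (fun x => p (g x))) ->
    (forall z, `|p z| <= normc z) ->
    Rintegral mu setT (fun x => p (F n x)) @[n --> \oo] --> Rintegral mu setT (fun x => p (f x)).
  move=> mp pn.
  have mhE n : measurable_fun setT (fun x => (p (F n x))%:E) by apply/measurable_EFinP; exact: mp.
  have hc x : (p (F n x))%:E @[n --> \oo] --> (p (f x))%:E.
    apply: (@cvg_trans _ ((fun=> (p (f x))%:E) @ \oo)); last exact: cvg_cst.
    have [N hN] := ev x; apply: near_eq_cvg; exists N => // n /= Nn; by rewrite hN.
  have hb n x : (`|(p (F n x))%:E| <= (normc (f x))%:E)%E.
    by rewrite /= lee_fin (le_trans (pn _)).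
  have ip : mu.-integrable setT (fun x => (p (f x))%:E).
    apply/integrableP; split; first by apply/measurable_EFinP; exact: mp.
    apply: le_lt_trans nf; apply: ge0_int_le => //.
    - by apply: measurableT_comp; [exact: normr_measurable|exact: mp].
    - exact: measurable_normc.
  have := @dominated_cvg _ _ _ mu setT measurableT (fun n x => (p (F n x))%:E) (fun x => (p (f x))%:E)
    (fun x => (normc (f x))%:E) mhE (fun x _ => hc x) (fun x _ => isT) in_ (fun n x _ => hb n x).
  by rewrite -(fineK (integrable_fin_num measurableT ip)) => /fine_cvg.
have cr := dc (@complex.Re R) (fun g mg => mg.1) Re_le_normc.
have ci := dc (@complex.Im R) (fun g mg => mg.2) Im_le_normc.
under eq_fun do rewrite nsqE /=.
rewrite (_ : 0 = (Rintegral mu setT (fun x => complex.Re (f x)) - Rintegral mu setT (fun x => complex.Re (f x))) ^+ 2 +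
  (Rintegral mu setT (fun x => complex.Im (f x)) - Rintegral mu setT (fun x => complex.Im (f x))) ^+ 2); last first.
  by rewrite !subrr expr0n addr0.
by apply: cvgD; apply: cvgM; apply: cvgB => //; exact: cvg_cst.
Qed.

End complex_integral.

(** * The Fourier transform of integrable functions *)

Section fourier_transform.
Context {R : realType} {l : nat}.
Local Notation Z := (l.-tuple int).
Local Notation V := (Rspace R l).
Local Notation leb := (lebesgue_tuple l).
Implicit Types (u v : V -> R[i]) (x xi : V).

Lemma fourierE u xi : fourier u xi = cintegral leb (fun x => ee (- tdot x xi) * u x).
Proof. by apply: eq_cintegral => x; rewrite mulrC /ee mulrN. Qed.

Lemma cmeas_char xi : cmeasurable (fun x : V => ee (- tdot x xi)).
Proof.
apply: cmeas_ee; apply: measurableT_comp => //.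
have -> : (fun x : V => tdot x xi) = (fun x => tdot xi x) by apply/funext => x; rewrite tdotC.
exact: measurable_tdotl.
Qed.

Lemma L1fun_char u xi : L1fun leb u -> L1fun leb (fun x => ee (- tdot x xi) * u x).
Proof.
by move=> hu; apply: (L1funM (C := 1) hu) => [|x]; [exact: cmeas_char|rewrite normc_ee].
Qed.

Lemma fourierD u v xi : L1fun leb u -> L1fun leb v ->
  fourier (fun x => u x + v x) xi = fourier u xi + fourier v xi.
Proof.
move=> hu hv; rewrite !fourierE -cintegralD; [|exact: L1fun_char|exact: L1fun_char].
by apply: eq_cintegral => x; rewrite mulrDr.
Qed.

Lemma fourierZ u (c : R[i]) xi : L1fun leb u ->
  fourier (fun x => c * u x) xi = c * fourier u xi.
Proof.
move=> hu; rewrite !fourierE -cintegralZ; last exact: L1fun_char.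
by apply: eq_cintegral => x; rewrite mulrCA.
Qed.

Lemma fourierB u v xi : L1fun leb u -> L1fun leb v ->
  fourier (fun x => u x - v x) xi = fourier u xi - fourier v xi.
Proof.
move=> hu hv; rewrite -[fourier v xi]mul1r -mulNr -fourierZ// -fourierD//; last exact: L1funZ.
by congr (fourier _ xi); apply/funext => x; rewrite mulNr mul1r.
Qed.

Lemma fourier_sum (I : eqType) (s : seq I) (F : I -> V -> R[i]) xi : (forall i, L1fun leb (F i)) ->
  fourier (fun x => \sum_(i <- s) F i x) xi = \sum_(i <- s) fourier (F i) xi.
Proof.
move=> hF; rewrite fourierE.
under [RHS]eq_bigr do rewrite fourierE.
rewrite -cintegral_sum; last by move=> i; exact: L1fun_char.
by apply: eq_cintegral => x; rewrite mulr_sumr.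
Qed.

Lemma Rintegral_tadd (s : V) (f : V -> R) : measurable_fun setT f ->
  Rintegral leb setT (fun x => f (tadd x s)) = Rintegral leb setT f.
Proof.
move=> mf; congr fine; rewrite integralE [RHS]integralE; congr (_ - _)%E.
  rewrite -(integral_tadd s (f := fun x => ((fun x => (f x)%:E)^\+)%E x))//.
    by apply: eq_integral => x _; rewrite !funeposE.
  by apply: measurable_funepos; exact/measurable_EFinP.
rewrite -(integral_tadd s (f := fun x => ((fun x => (f x)%:E)^\-)%E x))//.
  by apply: eq_integral => x _; rewrite !funenegE.
by apply: measurable_funeneg; exact/measurable_EFinP.
Qed.

Lemma cintegral_tadd (s : V) u : cmeasurable u ->
  cintegral leb (fun x => u (tadd x s)) = cintegral leb u.
Proof.
move=> [m1 m2]; rewrite /cintegral; congr Complex.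
  exact: (Rintegral_tadd s m1).
exact: (Rintegral_tadd s m2).
Qed.

Lemma fourier_shift u (s : V) xi : L1fun leb u ->
  fourier (fun x => u (tadd x s)) xi = ee (tdot s xi) * fourier u xi.
Proof.
move=> hu; rewrite !fourierE -cintegralZ; last exact: L1fun_char.
rewrite -(cintegral_tadd s (u := fun x => ee (tdot s xi) * (ee (- tdot x xi) * u x))).
  apply: eq_cintegral => x; rewrite mulrA -eeD; congr (ee _ * _).
  by rewrite tdotDl; ring.
by apply: cmeasM; [exact: cmeas_cst|case: (L1fun_char xi hu)].
Qed.

Lemma L1fun_shift u (s : V) : L1fun leb u -> L1fun leb (fun x => u (tadd x s)).
Proof.
move=> [mu nu]; split; first exact: cmeas_shift.
rewrite (integral_tadd s (f := fun x => (normc (u x))%:E))//.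
  by apply/measurable_EFinP; exact: measurable_normc.
by move=> x; rewrite lee_fin normc_ge0.
Qed.

Lemma measurable_Rintegral2 (f : V * V -> R) : measurable_fun setT f ->
  measurable_fun setT (fun xi => Rintegral leb setT (fun x => f (xi, x))).
Proof.
move=> mf; have mfE : measurable_fun setT (fun z => (f z)%:E) by exact/measurable_EFinP.
have mp := measurable_funepos mfE; have mn := measurable_funeneg mfE.
have h1 := @measurable_fun_fubini_tonelli_F _ _ _ _ R leb _ mp (funepos_ge0 _).
have h2 := @measurable_fun_fubini_tonelli_F _ _ _ _ R leb _ mn (funeneg_ge0 _).
have hd : measurable_fun setT (fun xi => (\int[leb]_x (f (xi, x))%:E)%E).
  apply: eq_measurable_fun (emeasurable_funB h1 h2) => xi _.
  by rewrite [RHS]integralE /fubini_F; congr (_ - _)%E; apply: eq_integral => x _; rewrite ?funeposE ?funenegE.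
exact: (measurableT_comp (fine_measurable measurableT) hd).
Qed.

Lemma measurable_tdot2 : measurable_fun setT (fun z : V * V => tdot z.2 z.1).
Proof.
apply: measurable_sum => i; apply: measurable_funM.
  exact: (measurableT_comp (measurable_tnthR i) measurable_snd).
exact: (measurableT_comp (measurable_tnthR i) measurable_fst).
Qed.

Lemma cmeas_fourier u : cmeasurable u -> cmeasurable (fourier u).
Proof.
move=> mu; pose F (z : V * V) := ee (- tdot z.2 z.1) * u z.2.
have mF : cmeasurable F.
  apply: cmeasM; last exact: (cmeas_comp mu measurable_snd).
  by apply: cmeas_ee; apply: measurableT_comp => //; exact: measurable_tdot2.
have e : fourier u = fun xi => cintegral leb (fun x => F (xi, x)).
  by apply/funext => xi; rewrite fourierE.
rewrite e; split.
  exact: (measurable_Rintegral2 mF.1).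
exact: (measurable_Rintegral2 mF.2).
Qed.

End fourier_transform.

(** * Parseval's identity for bounded functions on the cube *)

Section cube_approximation.
Context {R : realType} {l : nat}.
Local Notation Z := (l.-tuple int).
Local Notation V := (Rspace R l).
Local Notation leb := (lebesgue_tuple l).

Definition cube1 (x : V) : R := \1_(@cube R l) x.

Lemma measurable_cube1 : measurable_fun setT cube1.
Proof. by apply: measurable_indic; exact: measurable_cube. Qed.

Lemma cube1_ge0 x : 0 <= cube1 x. Proof. by rewrite /cube1 indicE. Qed.

Lemma cube1_in x : cube x -> cube1 x = 1.
Proof. by move=> cx; rewrite /cube1 indicE mem_set. Qed.

Lemma cube1_out x : ~ cube x -> cube1 x = 0.
Proof. by move=> cx; rewrite /cube1 indicE memNset. Qed.

Lemma int_cube1 (h : V -> R) :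
  (\int[leb]_x (h x * cube1 x)%:E = \int[leb]_(x in @cube R l) (h x)%:E)%E.
Proof.
rewrite [RHS]integral_mkcond; apply: eq_integral => x _.
by rewrite patchE /cube1 indicE; case: ifP => _; rewrite ?mulr1 ?mulr0.
Qed.

Lemma int_cube1_cst (C : R) : 0 <= C -> (\int[leb]_x (C * cube1 x)%:E = C%:E)%E.
Proof.
move=> C0; rewrite int_cube1 integral_cst; last exact: measurable_cube.
rewrite [X in (_ * X)%E](_ : _ = 1%E) ?mule1//; exact: lebesgue_cube.
Qed.

Lemma cube1_fin : (\int[leb]_x (cube1 x)%:E < +oo)%E.
Proof.
have := @int_cube1_cst 1 ler01; under eq_integral do rewrite mul1r.
by move=> ->; exact: ltry.
Qed.

Lemma sum_thresholds (J : nat) (y : R) : 0 <= y <= J%:R ->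
  `|\sum_(j < J) (j.+1%:R <= y)%R%:R - y| <= 1.
Proof.
elim: J => [|J IH] /andP[y0 yJ].
  have -> : y = 0 by apply/eqP; rewrite eq_le y0 yJ.
  by rewrite big_ord0 subr0 normr0.
rewrite big_ord_recr /=; have [yJ'|yJ'] := leP y J%:R.
  have -> : (J.+1%:R <= y) = false.
    by apply/negbTE; rewrite -ltNge (le_lt_trans yJ')// ltr_nat.
  by rewrite addr0 IH// y0.
have -> : \sum_(j < J) (j.+1%:R <= y)%R%:R = J%:R :> R.
  rewrite (eq_bigr (fun=> 1)); first by rewrite sumr_const card_ord.
  by move=> j _; rewrite (le_trans _ (ltW yJ'))// ler_nat.
rewrite -natr1 in yJ *.
case: (leP (J%:R + 1) y) => h /=; rewrite ler_norml; apply/andP; split; lra.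
Qed.

(** By [sum_thresholds], f is uniformly within 1/n of an affine function of a sum of indicators of
    superlevel sets. Each indicator is approximable, as it agrees on the cube with its
    periodization. *)
Lemma approx_cube_bounded (f : V -> R) (C : R) : measurable_fun setT f ->
  (forall x, `|f x| <= C) -> trig_approx cube1 f.
Proof.
move=> mf fC; have mw := measurable_cube1; have w0 := cube1_ge0; have iw := cube1_fin.
have C0 : 0 <= C by apply: le_trans (fC point).
have ind (E : set V) : measurable E -> trig_approx cube1 (fun x => \1_E x : R).
  move=> mE; have mE1 : measurable_fun setT (fun x : V => \1_E x : R) by exact: measurable_indic.
  have [_ gE] := good_measurable mw w0 iw mE.
  have h := gE (fun=> 1) 1 (approx_trig cube1 (trig_cst 1)).
  apply: (approx_close mw w0 mE1) => e e0.
  exists (fun x => 1 * (\1_E (tfrac x) : R)); split; first by apply: h; move=> x; rewrite normr1.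
  rewrite (_ : (\int[leb]_x _)%E = 0%E) ?lte_fin//; apply: integral0_eq => x _.
  have [cx|cx] := pselect (cube x); first by rewrite frac_id// mul1r subrr expr0n mul0r.
  by rewrite cube1_out// mulr0.
have add (f1 f2 : V -> R) : trig_approx cube1 f1 -> trig_approx cube1 f2 -> trig_approx cube1 (fun x => f1 x + f2 x).
  move=> a1 a2; have := approxB mw w0 a1 (approxB mw w0 (approx_trig cube1 (trig_cst 0)) a2).
  by congr trig_approx; apply/funext => x; ring.
apply: (approx_close mw w0 mf) => e e0.
pose n := (Num.truncn e^-1).+1; have n0 : 0 < n%:R :> R by rewrite ltr0n.
have en : n%:R^-1 < e by rewrite invf_plt ?posrE//; exact: truncnS_gt.
pose y x := n%:R * (f x + C).
pose J := (Num.truncn (2 * n%:R * C)).+1.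
have yJ x : 0 <= y x <= J%:R.
  have := fC x; rewrite ler_norml => /andP[h1 h2]; apply/andP; split.
    by apply: mulr_ge0 (ltW n0) _; lra.
  apply: le_trans (ltW (truncnS_gt _)).
  by have := ler_wpM2l (ltW n0) h2; rewrite /y mulrDr; lra.
pose E j : set V := [set x | j.+1%:R <= y x].
have my : measurable_fun setT y by apply: measurable_funM => //; exact: measurable_funD.
have mE j : measurable (E j).
  rewrite (_ : E j = y @^-1` `[j.+1%:R, +oo[); last by apply/seteqP; split => x /=; rewrite in_itv/= andbT.
  by rewrite -[X in measurable X]setTI; exact: my.
pose F J' x : R := \sum_(j < J') (\1_(E j) x : R).
have aF J' : trig_approx cube1 (F J').
  elim: J' => [|J' IH].
    by have := approx_trig cube1 (trig_cst 0); congr trig_approx; apply/funext => x; rewrite /F big_ord0.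
  by have := add _ _ IH (ind _ (mE J')); congr trig_approx; apply/funext => x; rewrite /F big_ord_recr.
exists (fun x => n%:R^-1 * F J x - C); split.
  have a1 := approxM_trig mw w0 (trig_cst n%:R^-1) (aF J).
  exact: (approxB mw w0 a1 (approx_trig cube1 (trig_cst C))).
have mF : measurable_fun setT (F J) by case: (aF J).
have n1 : n%:R^-1 <= 1 :> R by rewrite invf_le1// ler1n.
apply: (@le_lt_trans _ _ (\int[leb]_x (n%:R^-1 * cube1 x)%:E)%E); last first.
  by rewrite int_cube1_cst ?lte_fin// invr_ge0 (ltW n0).
apply: ge0_int_le => //.
- apply: measurable_funM => //; apply: measurable_funX; apply: measurable_funB => //.
  by apply: measurable_funB => //; exact: measurable_funM.
- exact: measurable_funM.
- by move=> x; exact: mulr_ge0 (sqr_ge0 _) (w0 x).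
move=> x _; apply: (ler_wpM2r (w0 x)).
have FE : F J x = \sum_(j < J) (j.+1%:R <= y x)%R%:R.
  apply: eq_bigr => j _; rewrite indicE; congr (_%:R); congr nat_of_bool.
  by apply/idP/idP; rewrite inE.
have h := sum_thresholds (yJ x); rewrite -FE in h.
have -> : f x - (n%:R^-1 * F J x - C) = - (n%:R^-1 * (F J x - y x)).
  by rewrite /y; field; rewrite gt_eqF.
rewrite sqrrN -(real_normK (num_real (_ * _))) normrM gtr0_norm ?invr_gt0//.
have q0 : 0 <= n%:R^-1 :> R by rewrite invr_ge0 ltW.
have q1 : n%:R^-1 * `|F J x - y x| <= n%:R^-1 by rewrite ler_piMr.
have q2 : 0 <= n%:R^-1 * `|F J x - y x| by rewrite mulr_ge0.
by rewrite expr2 -[leRHS]mulr1 ler_pM// (le_trans q1).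
Qed.

End cube_approximation.

Section cube_parseval_L2.
Context {R : realType} {l : nat}.
Local Notation Z := (l.-tuple int).
Local Notation V := (Rspace R l).
Local Notation leb := (lebesgue_tuple l).
Variables (v : V -> R[i]) (C : R).
Hypotheses (mv : cmeasurable v) (vC : forall x, normc (v x) <= C).
Hypothesis v0 : forall x, ~ cube x -> v x = 0.

Let C0 : 0 <= C. Proof. exact: le_trans (normc_ge0 _) (vC point). Qed.

Let vC1 x : normc (v x) <= C * cube1 x.
Proof.
have [cx|cx] := pselect (cube x); first by rewrite cube1_in// mulr1.
by rewrite v0// cube1_out// mulr0 ComplexField.Normc.normc0.
Qed.

Lemma integrable_cube (h : V -> R) (D : R) : measurable_fun setT h ->
  (forall x, `|h x| <= D * cube1 x) -> leb.-integrable setT (EFin \o h).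
Proof.
move=> mh hD; apply/integrableP; split; first exact/measurable_EFinP.
have D0 : 0 <= D.
  have [c|c] := pselect (exists x : V, cube x).
    by case: c => x cx; have := le_trans (normr_ge0 (h x)) (hD x); rewrite cube1_in// mulr1.
  have pt : cube ([tuple (0 : R) | _ < l] : V) by move=> i; rewrite tnth_mktuple lexx ltr01.
  by case: c; exists [tuple (0 : R) | _ < l].
apply: (@le_lt_trans _ _ (\int[leb]_x (D * cube1 x)%:E)%E); last by rewrite int_cube1_cst// ltry.
apply: ge0_int_le => //.
- by apply: measurableT_comp; [exact: normr_measurable|].
- by apply: measurable_funM => //; exact: measurable_cube1.
Qed.

Lemma L1fun_cube : L1fun leb v.
Proof.
apply: (L1fun_le mv (h := fun x => C * cube1 x)) => //.
  by apply: measurable_funM => //; exact: measurable_cube1.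
by rewrite int_cube1_cst// ltry.
Qed.

Let coef (n : Z) := fourier v (tint n).
Let energy := Rintegral leb setT (fun x => nsq (v x)).

Let nsq_le (z : R[i]) (b : R) (x : V) : 0 <= b -> normc z <= b * cube1 x -> `|nsq z| <= b ^+ 2 * cube1 x.
Proof.
move=> b0 h; rewrite ger0_norm ?nsq_ge0//.
have w : cube1 x ^+ 2 = cube1 x by rewrite /cube1 indicE; case: (_ \in _); rewrite ?expr1n ?expr0n.
by rewrite -w -exprMn ler_pXn2r ?nnegrE ?normc_ge0// mulr_ge0// cube1_ge0.
Qed.

Let i_nsqv : leb.-integrable setT (EFin \o (fun x => nsq (v x))).
Proof. by apply: (integrable_cube (D := C ^+ 2)) => [|x]; [exact: measurable_nsq|exact: nsq_le]. Qed.

Lemma energyE : (\int[leb]_x (nsq (v x))%:E = energy%:E)%E.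
Proof. by rewrite /energy /Rintegral fineK//; exact: (integrable_fin_num measurableT i_nsqv). Qed.

(** Expanding the square, the cross terms are Fourier coefficients of v; completing the square in
    [d] shows [coef] as the minimizer. *)
Lemma bessel_identity (s : seq Z) (d : Z -> R[i]) : uniq s ->
  (\int[leb]_x (nsq (v x - (cube1 x)%:C%C * \sum_(n <- s) d n * ee (tdot (tint n) x)))%:E =
   (energy - \sum_(n <- s) nsq (coef n) + \sum_(n <- s) nsq (coef n - d n))%:E)%E.
Proof.
move=> us; pose P (x : V) := \sum_(n <- s) d n * ee (tdot (tint n) x).
pose P' x := (cube1 x)%:C%C * P x.
have mP : cmeasurable P by apply: cmeas_sum => n; apply: cmeasM; [exact: cmeas_cst|exact: cmeas_ee_tdot].
have mP' : cmeasurable P' by apply: cmeasM => //; apply: cmeas_real; exact: measurable_cube1.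
pose D := \sum_(n <- s) normc (d n).
have D0 : 0 <= D by apply: sumr_ge0 => n _; exact: normc_ge0.
have PD x : normc (P x) <= D.
  apply: le_trans (normc_sum_le _ _) _; apply: ler_sum => n _.
  by rewrite ComplexField.Normc.normcM normc_ee mulr1.
have P'D x : normc (P' x) <= D * cube1 x.
  by rewrite ComplexField.Normc.normcM normc_real ?cube1_ge0// mulrC ler_wpM2r// cube1_ge0.
have i_P : leb.-integrable setT (EFin \o (fun x => nsq (P' x))).
  by apply: (integrable_cube (D := D ^+ 2)) => [|x]; [exact: measurable_nsq|exact: nsq_le].
have vP x : v x * (P' x)^*%C = \sum_(n <- s) (d n)^*%C * (ee (- tdot x (tint n)) * v x).
  have -> : v x * (P' x)^*%C = v x * (P x)^*%C.
    have [cx|cx] := pselect (cube x); first by rewrite /P' cube1_in// mul1r.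
    by rewrite v0// !mul0r.
  rewrite /P conjc_sum mulr_sumr; apply: eq_bigr => n _.
  by rewrite conjcM -eeN tdotC; ring.
have L1n n : L1fun leb (fun x => (d n)^*%C * (ee (- tdot x (tint n)) * v x)).
  by apply: L1funZ; apply: L1fun_char; exact: L1fun_cube.
have L1vP : L1fun leb (fun x => v x * (P' x)^*%C).
  have -> : (fun x => v x * (P' x)^*%C) = fun x => \sum_(n <- s) (d n)^*%C * (ee (- tdot x (tint n)) * v x).
    exact/funext.
  exact: L1fun_sum.
have cvP : cintegral leb (fun x => v x * (P' x)^*%C) = \sum_(n <- s) (d n)^*%C * coef n.
  rewrite (eq_cintegral _ vP) cintegral_sum//; apply: eq_bigr => n _.
  by rewrite cintegralZ ?/coef ?fourierE//; apply: L1fun_char; exact: L1fun_cube.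
have i_Re := L1fun_Re L1vP.
have i_2Re : leb.-integrable setT (EFin \o (fun x => 2 * complex.Re (v x * (P' x)^*%C))).
  exact: (integrableZl measurableT 2 i_Re).
have i_sum : leb.-integrable setT (EFin \o (fun x => nsq (v x) + nsq (P' x))).
  exact: (integrableD measurableT i_nsqv i_P).
have i_all : leb.-integrable setT (EFin \o (fun x => nsq (v x) + nsq (P' x) - 2 * complex.Re (v x * (P' x)^*%C))).
  exact: (integrableB measurableT i_sum i_2Re).
have eP : Rintegral leb setT (fun x => nsq (P' x)) = \sum_(n <- s) nsq (d n).
  apply: EFin_inj; rewrite /Rintegral fineK; last exact: (integrable_fin_num measurableT i_P).
  have := cube_parseval (R := R) d us; rewrite lebesgue_cube mule1 -int_cube1 => <-.
  apply: eq_integral => x _; rewrite /P' nsqM nsq_real mulrC; congr (_ * _)%:E.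
  by rewrite /cube1 indicE; case: (_ \in _); rewrite ?expr1n ?expr0n.
transitivity (Rintegral leb setT (fun x => nsq (v x) + nsq (P' x) - 2 * complex.Re (v x * (P' x)^*%C)))%:E.
  rewrite /Rintegral fineK; last exact: (integrable_fin_num measurableT i_all).
  by apply: eq_integral => x _; congr EFin; exact: nsqB.
congr EFin; rewrite RintegralB// RintegralD// eP RintegralZl//.
have -> : Rintegral leb setT (fun x => complex.Re (v x * (P' x)^*%C)) =
    \sum_(n <- s) complex.Re (coef n * (d n)^*%C).
  rewrite -[LHS]/(complex.Re (cintegral leb (fun x => v x * (P' x)^*%C))) cvP Re_sum.
  by apply: eq_bigr => n _; rewrite mulrC.
rewrite -/energy (eq_bigr (fun n => nsq (coef n) + nsq (d n) - 2 * complex.Re (coef n * (d n)^*%C)) (P := xpredT) (F1 := fun n => nsq (coef n - d n))); last first.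
  by move=> n _; exact: nsqB.
rewrite sumrB big_split /= -mulr_sumr; ring.
Qed.

Lemma cube_plancherel : zser (fun n => (nsq (fourier v (tint n)))%:E) = (\int[leb]_x (nsq (v x))%:E)%E.
Proof.
have f0 n : (0 <= (nsq (fourier v (tint n)))%:E)%E by rewrite lee_fin nsq_ge0.
apply/eqP; rewrite eq_le energyE; apply/andP; split.
  rewrite zser_esum//; apply: ge_ereal_sup => _ [X [finX _] <-].
  have [s us ->] : exists2 s : seq Z, uniq s & X = [set` s].
    have /finite_seqP[s ->] := finX; exists (undup s); first exact: undup_uniq.
    by apply/seteqP; split => n /=; rewrite mem_undup.
  rewrite -(fsbig_seq _ _ us) sumEFin lee_fin.
  have := bessel_identity coef us.
  rewrite [X in _ + X]big1; last by move=> n _; rewrite subrr nsq0.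
  rewrite addr0 => h; rewrite -subr_ge0 -lee_fin -h.
  by apply: int_ge0 => x; exact: nsq_ge0.
apply/lee_addgt0Pr => e e0; have e2 : 0 < e / 2 by rewrite divr_gt0.
have hR x : `|complex.Re (v x)| <= C by apply: le_trans (Re_le_normc _) (vC x).
have hI x : `|complex.Im (v x)| <= C by apply: le_trans (Im_le_normc _) (vC x).
have [_ aR] := approx_cube_bounded mv.1 hR; have [_ aI] := approx_cube_bounded mv.2 hI.
have [p [tp hp]] := aR _ e2; have [q [tq hq]] := aI _ e2.
have [s1 hs1] := tp; have [s2 hs2] := tq.
have [s [d [us hs]]] := merge_frequencies (s1 ++ [seq (t.1, 'i%C * t.2) | t <- s2]) (R := R).
have PE x : \sum_(n <- s) d n * ee (tdot (tint n) x) = Complex (p x) (q x).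
  rewrite -hs big_cat big_map /= -hs1.
  rewrite (eq_bigr (fun t => 'i%C * (t.2 * ee (tdot (tint t.1) x)))); last by move=> t _; rewrite mulrA.
  by rewrite -mulr_sumr -hs2; apply/eqP; rewrite eq_complex /= !(mul0r, mulr0, mul1r, add0r, addr0, subr0) !eqxx.
have small : (\int[leb]_x (nsq (v x - (cube1 x)%:C%C * \sum_(n <- s) d n * ee (tdot (tint n) x)))%:E <= e%:E)%E.
  have mp := trig_measurable tp; have mq := trig_measurable tq.
  have m1 : measurable_fun setT (fun x => (complex.Re (v x) - p x) ^+ 2 * cube1 x).
    by apply: measurable_funM measurable_cube1; apply: measurable_funX; exact: measurable_funB mv.1 mp.
  have m2 : measurable_fun setT (fun x => (complex.Im (v x) - q x) ^+ 2 * cube1 x).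
    by apply: measurable_funM measurable_cube1; apply: measurable_funX; exact: measurable_funB mv.2 mq.
  have -> : e = e / 2 + e / 2 by field.
  rewrite EFinD; apply: le_trans (leeD (ltW hp) (ltW hq)).
  rewrite -ge0_intD//; last 2 first.
  - by move=> x; exact: mulr_ge0 (sqr_ge0 _) (cube1_ge0 _).
  - by move=> x; exact: mulr_ge0 (sqr_ge0 _) (cube1_ge0 _).
  rewrite le_eqVlt; apply/orP; left; apply/eqP; apply: eq_integral => x _; congr EFin.
  rewrite PE; have [cx|cx] := pselect (cube x); last first.
    by rewrite cube1_out// v0// mul0r subrr nsq0 !mulr0 addr0.
  by rewrite cube1_in// !mulr1 mul1r nsqE; case: (v x).
have := zser_ge_sum us f0; rewrite sumEFin => h.
apply: (@le_trans _ _ ((\sum_(n <- s) nsq (coef n))%:E + e%:E)%E); last by rewrite leeD2r.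
rewrite -EFinD lee_fin; move: small; rewrite bessel_identity// lee_fin.
have : 0 <= \sum_(n <- s) nsq (coef n - d n) by apply: sumr_ge0 => n _; exact: nsq_ge0.
lra.
Qed.

End cube_parseval_L2.

Section bounded_plancherel.
Context {R : realType} {l : nat}.
Local Notation Z := (l.-tuple int).
Local Notation V := (Rspace R l).
Local Notation leb := (lebesgue_tuple l).
Variables (u : V -> R[i]) (C : R) (X : nat).
Hypotheses (mu : cmeasurable u) (uC : forall x, normc (u x) <= C).
Local Notation s := (zbox (- X%:Z) (2 * X + 1) : seq Z).
Hypothesis usupp : forall x, u x != 0 -> tfloor x \in s.

Let C0 : 0 <= C. Proof. exact: le_trans (normc_ge0 _) (uC point). Qed.
Let piece (b : Z) (x : V) : R[i] := (cube1 x)%:C%C * u (tadd x (tint b)).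
(** The periodization of u(x) e(-x.t), seen on the cube: its Fourier coefficient at n is the
    transform of u at t + n. *)
Let fold (t x : V) : R[i] := \sum_(b <- s) ee (- tdot (tadd x (tint b)) t) * piece b x.

Let mpiece b : cmeasurable (piece b).
Proof. by apply: cmeasM; [apply: cmeas_real; exact: measurable_cube1|exact: cmeas_shift]. Qed.

Let piece_le b x : normc (piece b x) <= C.
Proof.
rewrite -[C]mul1r; apply: normcM_le => //; rewrite normc_real ?cube1_ge0//.
by rewrite /cube1 indicE; case: (_ \in _).
Qed.

Let piece_out b x : ~ cube x -> piece b x = 0.
Proof. by move=> cx; rewrite /piece cube1_out// mul0r. Qed.

Let L1piece b : L1fun leb (piece b).
Proof. exact: L1fun_cube (mpiece b) (piece_le b) (piece_out b). Qed.

Let u_pieces x : u x = \sum_(b <- s) piece b (tadd x (topp (tint b))).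
Proof.
have back b : tadd (tadd x (topp (tint b))) (tint b) = x.
  by apply: tuple_ext => i; rewrite !tnth_mktuple subrK.
have inb b : cube (tadd x (topp (tint b))) -> tfloor x = b.
  move=> c; have := tfloor_cube c.
  rewrite -[in X in _ -> X](back b) tfloor_add => ->.
  by apply: tuple_ext => i; rewrite !tnth_mktuple add0r.
have cb : cube (tadd x (topp (tint (tfloor x)))) by rewrite -tsubE; exact: frac_cube.
have [xs|xs] := boolP (tfloor x \in s); last first.
  rewrite big_seq big1; first by apply/eqP; apply: contraNT xs; exact: usupp.
  move=> b bs; rewrite piece_out// => /inb e; by move: xs; rewrite e bs.
rewrite (big_rem (tfloor x))//= /piece cube1_in// mul1r back big_seq big1 ?addr0// => b bs.
rewrite cube1_out ?mul0r// => /inb e; move: bs; rewrite -e mem_rem_uniq ?zbox_uniq// inE /= eqxx//.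
Qed.

Let mfold t : cmeasurable (fold t).
Proof.
apply: cmeas_sum => b; apply: cmeasM => //.
apply: cmeas_ee; apply: measurableT_comp => //.
have -> : (fun x : V => tdot (tadd x (tint b)) t) = (fun x => tdot t (tadd x (tint b))).
  by apply/funext => x; rewrite tdotC.
exact: (measurableT_comp (measurable_tdotl t) (measurable_tadd (tint b))).
Qed.

Let fold_le t x : normc (fold t x) <= (size s)%:R * C.
Proof.
apply: le_trans (normc_sum_le _ _) _.
apply: (@le_trans _ _ (\sum_(b <- s) C)).
  by apply: ler_sum => b _; rewrite normc_eeM.
by rewrite big_const_seq count_predT iter_addr_0 mulr_natl.
Qed.

Let fold_out t x : ~ cube x -> fold t x = 0.
Proof. by move=> cx; rewrite /fold big1// => b _; rewrite piece_out// mulr0. Qed.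

Let fourier_fold t n : fourier u (tadd t (tint n)) = fourier (fold t) (tint n).
Proof.
transitivity (\sum_(b <- s) ee (- tdot (tint b) t) * fourier (piece b) (tadd t (tint n))).
  have -> : fourier u (tadd t (tint n)) =
     fourier (fun x => \sum_(b <- s) piece b (tadd x (topp (tint b)))) (tadd t (tint n)).
    by congr (fourier _ (tadd t (tint n))); apply/funext.
  rewrite fourier_sum; last by move=> b; apply: L1fun_shift; exact: L1piece.
  apply: eq_bigr => b _; rewrite (fourier_shift _ _ (L1piece b)); congr (_ * _).
  have -> : tdot (topp (tint b)) (tadd t (tint n)) = - tdot (tint b) t + tdot (tint (zopp b)) (tint n).
    rewrite tdotDr; congr (_ + _).
      by rewrite /tdot -sumrN; apply: eq_bigr => i _; rewrite !tnth_mktuple mulNr.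
    by apply: eq_bigr => i _; rewrite !tnth_mktuple rmorphN.
  by rewrite eeD ee_tdot_int mulr1.
rewrite fourierE.
under eq_bigr do rewrite fourierE.
have hL b : L1fun leb (fun x => ee (- tdot x (tadd t (tint n))) * piece b x) by exact: L1fun_char.
have -> : \sum_(b <- s) ee (- tdot (tint b) t) * cintegral leb (fun x => ee (- tdot x (tadd t (tint n))) * piece b x) =
   \sum_(b <- s) cintegral leb (fun x => ee (- tdot (tint b) t) * (ee (- tdot x (tadd t (tint n))) * piece b x)).
  by apply: eq_bigr => b _; rewrite cintegralZ.
rewrite -cintegral_sum; last by move=> b; exact: L1funZ.
apply: eq_cintegral => x; rewrite /fold mulr_sumr; apply: eq_bigr => b _.
rewrite [LHS]mulrA [RHS]mulrA -!eeD; congr (ee _ * _).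
by rewrite tdotDl tdotDr; ring.
Qed.

Let nsq_fold t x : nsq (fold t x) = cube1 x *
  nsq (\sum_(b <- s) (u (tadd x (tint b)))^*%C * ee (tdot (tint b) t)).
Proof.
have [cx|cx] := pselect (cube x); last by rewrite fold_out// nsq0 cube1_out// mul0r.
rewrite cube1_in// mul1r -[RHS]nsq_conj conjc_sum.
have -> : fold t x = ee (- tdot x t) * \sum_(b <- s) ((u (tadd x (tint b)))^*%C * ee (tdot (tint b) t))^*%C.
  rewrite /fold mulr_sumr; apply: eq_bigr => b _.
  by rewrite /piece cube1_in// mul1r conjcM conjcK -eeN tdotDl opprD eeD; ring.
by rewrite nsqM nsq_ee mul1r.
Qed.

(** Tile the frequency space by t + n. For fixed t, Parseval on the cube turns the sum over n into
    the integral of |fold t|^2; after Tonelli, for fixed x, this is a trigonometric polynomial in t,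
    to which [cube_parseval] applies. *)
Lemma plancherel_boxed : (\int[leb]_xi (nsq (fourier u xi))%:E = \int[leb]_x (nsq (u x))%:E)%E.
Proof.
have mF := cmeas_fourier mu.
have mc := @measurable_cube R l.
rewrite integral_tiling; [|exact: emeasurable_nsq|by move=> x; rewrite lee_fin nsq_ge0].
rewrite -zser_integral//; last 2 first.
- by move=> b; apply: measurable_funTS; apply: emeasurable_nsq; exact: cmeas_shift.
- by move=> b x; rewrite lee_fin nsq_ge0.
have inner t : zser (fun b => (nsq (fourier u (tadd t (tint b))))%:E) = (\int[leb]_x (nsq (fold t x))%:E)%E.
  rewrite -(cube_plancherel (mfold t) (fold_le t) (@fold_out t)).
  by apply: zser_eq => n; rewrite fourier_fold.
under eq_integral do rewrite inner.
pose Phi (z : V * V) : R := cube1 z.1 * (cube1 z.2 *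
  nsq (\sum_(b <- s) (u (tadd z.2 (tint b)))^*%C * ee (tdot (tint b) z.1))).
have mPhi : measurable_fun setT Phi.
  apply: measurable_funM; first exact: (measurableT_comp measurable_cube1 measurable_fst).
  apply: measurable_funM; first exact: (measurableT_comp measurable_cube1 measurable_snd).
  apply: measurable_nsq; apply: cmeas_sum => b; apply: cmeasM.
    have [m1 m2] := cmeas_comp (cmeas_shift (tint b) mu) (@measurable_snd _ _ V V).
    split => /=.
      by apply: eq_measurable_fun m1 => z _; case: (u _).
    by apply: eq_measurable_fun (measurableT_comp (@oppr_measurable R setT) m2) => z _ /=; case: (u _).
  apply: cmeas_ee; exact: (measurableT_comp (measurable_tdotl (tint b)) measurable_fst).
have Phi0 z : (0 <= (Phi z)%:E)%E.
  by rewrite lee_fin mulr_ge0 ?cube1_ge0// mulr_ge0 ?cube1_ge0 ?nsq_ge0.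
have mPhiE : measurable_fun setT (fun z => (Phi z)%:E) by exact/measurable_EFinP.
transitivity (\int[leb]_t \int[leb]_x (Phi (t, x))%:E)%E.
  rewrite integral_mkcond; apply: eq_integral => t _; rewrite patchE; case: ifPn => ct.
    apply: eq_integral => x _; rewrite /Phi /= cube1_in; last by move: ct; rewrite inE.
    by rewrite mul1r nsq_fold.
  symmetry; apply: integral0_eq => x _; rewrite /Phi /= cube1_out ?mul0r//.
  by move: ct; rewrite notin_setE.
rewrite (@fubini_tonelli _ _ _ _ R leb leb _ mPhiE Phi0).
transitivity (\int[leb]_x (cube1 x * \sum_(b <- s) nsq (u (tadd x (tint b))))%:E)%E.
  apply: eq_integral => x _.
  pose d (b : Z) := (u (tadd x (tint b)))^*%C.
  have m1 : measurable_fun setT (fun t => nsq (\sum_(b <- s) d b * ee (tdot (tint b) t)) * cube1 t).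
    apply: measurable_funM; last exact: measurable_cube1.
    by apply: measurable_nsq; apply: cmeas_sum => b; apply: cmeasM; [exact: cmeas_cst|exact: cmeas_ee_tdot].
  transitivity (\int[leb]_t (cube1 x * (nsq (\sum_(b <- s) d b * ee (tdot (tint b) t)) * cube1 t))%:E)%E.
    by apply: eq_integral => t _; congr EFin; rewrite /Phi /=; ring.
  rewrite ge0_intZ ?cube1_ge0//; last by move=> t; exact: mulr_ge0 (nsq_ge0 _) (cube1_ge0 _).
  rewrite int_cube1 (cube_parseval d (zbox_uniq _ _)) lebesgue_cube mule1 EFinM; congr (_ * _%:E)%E.
  by apply: eq_bigr => b _; rewrite nsq_conj.
rewrite [RHS]integral_tiling; [|exact: emeasurable_nsq|by move=> x; rewrite lee_fin nsq_ge0].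
rewrite (zser_finsupp (s := s)) ?zbox_uniq//.
- have mb (b : Z) : measurable_fun (@cube R l) (fun x => nsq (u (tadd x (tint b)))).
    by apply: measurable_funTS; apply: measurable_nsq; exact: cmeas_shift.
  rewrite -ge0_int_sum//; [|by move=> b x; exact: nsq_ge0].
  by rewrite -int_cube1; apply: eq_integral => x _; rewrite mulrC.
- by move=> b; apply: int_ge0 => x; exact: nsq_ge0.
move=> b bs; apply: integral0_eq => x cx.
have [->|/usupp] := eqVneq (u (tadd x (tint b))) 0; first by rewrite nsq0.
rewrite tfloor_add tfloor_cube// => h; case/negP: bs.
suff <- : zadd [tuple (0 : int) | _ < l] b = b by [].
by apply: tuple_ext => i; rewrite !tnth_mktuple add0r.
Qed.

End bounded_plancherel.

Section nsq_convergence.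
Context {R : realType}.

Lemma nsq_cvg (z : nat -> R[i]) (a b : R[i]) : nsq (z n - a) @[n --> \oo] --> (0 : R) ->
  nsq (z n - b) @[n --> \oo] --> nsq (a - b).
Proof.
move=> za.
have cn : Num.sqrt (nsq (z n - a)) @[n --> \oo] --> (0 : R).
  by rewrite -sqrtr0; apply: (continuous_cvg _ (@sqrt_continuous R 0)).
have key n : nsq (z n - b) - nsq (a - b) = nsq (z n - a) + 2 * complex.Re ((z n - a) * (a - b)^*%C).
  have -> : z n - b = (z n - a) + (a - b) by rewrite addrA subrK.
  by rewrite nsqD; ring.
have up : nsq (z n - a) + 2 * (normc (a - b) * Num.sqrt (nsq (z n - a))) @[n --> \oo] --> (0 : R).
  suff : nsq (z n - a) + 2 * (normc (a - b) * Num.sqrt (nsq (z n - a)))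
      @[n --> \oo] --> 0 + 2 * (normc (a - b) * 0) by rewrite !mulr0 addr0.
  by apply: cvgD => //; apply: cvgMl_tmp; exact: cvgMl_tmp.
have lim0 : nsq (z n - b) - nsq (a - b) @[n --> \oo] --> (0 : R).
  apply/norm_cvg0P; apply: (squeeze_cvgr _ _ up); last exact: (cvg_cst (0 : R)).
  near=> n; rewrite normr_ge0 key (le_trans (ler_normD _ _))// ger0_norm ?nsq_ge0// lerD2l normrM ger0_norm// ler_wpM2l//.
  apply: le_trans (Re_le_normc _) _; rewrite ComplexField.Normc.normcM mulrC /nsq sqrtr_sqr ger0_norm ?normc_ge0//.
  by rewrite ler_wpM2r ?normc_ge0//; case: (a - b) => p q /=; rewrite sqrrN.
exact/subr_cvg0.
Unshelve. all: by end_near. Qed.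

Lemma int_nsqD_le d (T : measurableType d) (mu : {measure set T -> \bar R}) (f g : T -> R[i]) :
  cmeasurable f -> cmeasurable g ->
  (\int[mu]_x (nsq (f x + g x))%:E <= 2%:E * \int[mu]_x (nsq (f x))%:E + 2%:E * \int[mu]_x (nsq (g x))%:E)%E.
Proof.
move=> mf mg; have m1 := measurable_nsq mf; have m2 := measurable_nsq mg.
have n0 (h : T -> R[i]) x : 0 <= nsq (h x) by exact: nsq_ge0.
rewrite -(ge0_intZ mu measurableT (ler0n _ 2) m1 (n0 f)) -(ge0_intZ mu measurableT (ler0n _ 2) m2 (n0 g)).
have p0 (h : T -> R[i]) x : 0 <= 2 * nsq (h x) by exact: mulr_ge0 (ler0n _ _) (nsq_ge0 _).
have q1 : measurable_fun setT (fun x => 2 * nsq (f x)) by exact: measurable_funM.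
have q2 : measurable_fun setT (fun x => 2 * nsq (g x)) by exact: measurable_funM.
rewrite -(ge0_intD mu measurableT q1 q2 (p0 f) (p0 g)); apply: ge0_int_le => //.
- by apply: measurable_nsq; exact: cmeasD.
- exact: measurable_funD.
- by move=> x; exact: nsq_ge0.
by move=> x _; exact: nsqD_le.
Qed.

End nsq_convergence.

Section plancherel_inequality.
Context {R : realType} {l : nat}.
Local Notation Z := (l.-tuple int).
Local Notation V := (Rspace R l).
Local Notation leb := (lebesgue_tuple l).
Variable v : V -> R[i].
Hypotheses (L1v : L1fun leb v) (L2v : (\int[leb]_x (nsq (v x))%:E < +oo)%E).
Let mv : cmeasurable v. Proof. by case: L1v. Qed.

(** Cutting height and support at once brings the function within reach of [plancherel_boxed].
    Monotonicity in n makes every difference of two cut-offs equal to v or 0 at each point, so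
    differences are covered too. *)
Let keep (n : nat) (x : V) : R :=
  ((normc (v x) <= n%:R) && (tfloor x \in zbox (- n%:Z) (2 * n + 1)))%:R.
Let cut n (x : V) : R[i] := (keep n x)%:C%C * v x.

Let keep01 n x : (keep n x == 0) || (keep n x == 1).
Proof. by rewrite /keep; case: (_ && _); rewrite eqxx ?orbT. Qed.

Let keep_mono n m x : (n <= m)%N -> keep n x = 1 -> keep m x = 1.
Proof.
move=> nm; rewrite /keep; case: andP => [[h1 h2] _|_ /eqP]; last by rewrite eq_sym oner_eq0.
have -> : normc (v x) <= m%:R by rewrite (le_trans h1)// ler_nat.
have h2' : forall i, - n%:Z <= tnth (tfloor x) i < - n%:Z + (2 * n + 1)%:Z by apply/forallP; rewrite -mem_zbox.
rewrite (_ : _ \in _ = true)// mem_zbox; apply/forallP => i; move: (h2' i).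
by set a : int := tnth _ i; move: a nm => a; clear; lia.
Qed.

Let keep_ev x : exists N, forall n, (N <= n)%N -> keep n x = 1.
Proof.
pose N := ((Num.truncn (normc (v x))).+1 + \sum_(j < l) `|tnth (tfloor x) j|)%N.
exists N => n Nn; rewrite /keep.
have -> : normc (v x) <= n%:R.
  apply: le_trans (ltW (truncnS_gt _)) _; rewrite ler_nat (leq_trans _ Nn)// /N leq_addr//.
rewrite (_ : _ \in _ = true)// mem_zbox; apply/forallP => i.
have : (`|tnth (tfloor x) i| <= n)%N.
  by apply: leq_trans Nn; rewrite /N (bigD1 i)//= addnCA leq_addr.
by set a : int := tnth _ i; move: a => a; clear; lia.
Qed.

Let mkeep n : measurable_fun setT (keep n).
Proof.
pose E := [set x : V | normc (v x) <= n%:R] `&` [set x : V | tfloor x \in zbox (- n%:Z) (2 * n + 1)].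
have mE : measurable E.
  apply: measurableI; last exact: (measurable_tfloor_set [set b | b \in zbox (- n%:Z) (2 * n + 1)]).
  rewrite (_ : [set x : V | _] = (fun x => normc (v x)) @^-1` `]-oo, n%:R]); last first.
    by apply/seteqP; split => x /=; rewrite in_itv.
  by rewrite -[X in measurable X]setTI; exact: measurable_normc.
have mE1 : measurable_fun setT (\1_E : V -> R) by exact: measurable_indic.
apply: eq_measurable_fun mE1 => x _; rewrite indicE /keep; congr (_%:R); congr nat_of_bool.
by apply/idP/idP; [rewrite inE => -[h1 h2]; apply/andP|move=> /andP[h1 h2]; rewrite inE].
Qed.

Let mcut n : cmeasurable (cut n).
Proof. by apply: cmeasM => //; exact: cmeas_real. Qed.

Let cut_sub_cases n m x : (n <= m)%N -> cut m x - cut n x = 0 \/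
  [/\ cut m x - cut n x = v x, keep m x = 1 & keep n x = 0].
Proof.
move=> nm; rewrite /cut; have /orP[/eqP kn|/eqP kn] := keep01 n x; last first.
  by left; rewrite kn (keep_mono nm kn) subrr.
have /orP[/eqP km|/eqP km] := keep01 m x; first by left; rewrite kn km subrr.
by right; rewrite km kn mul1r mul0r subr0.
Qed.

Let keep1P n x : keep n x = 1 -> normc (v x) <= n%:R /\ tfloor x \in zbox (- n%:Z) (2 * n + 1).
Proof.
rewrite /keep; case: andP => // _ /eqP; by rewrite eq_sym oner_eq0.
Qed.

Let sub_boxed n m : (n <= m)%N ->
  (\int[leb]_xi (nsq (fourier (cut m) xi - fourier (cut n) xi))%:E =
   \int[leb]_x (nsq (cut m x - cut n x))%:E)%E.
Proof.
move=> nm.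
have L1cut k : L1fun leb (cut k).
  apply: (L1funM (C := 1) L1v); first exact: cmeas_real.
  by move=> x; rewrite normc_real /keep ?ler0n// lern1 leq_b1.
have mc := cmeasB (mcut m) (mcut n).
rewrite -(@plancherel_boxed _ _ (fun x => cut m x - cut n x) m%:R m)//.
- by apply: eq_integral => xi _; rewrite fourierB.
- move=> x; have [->|[-> km _]] := cut_sub_cases x nm.
    by rewrite ComplexField.Normc.normc0.
  by case: (keep1P km).
move=> x; have [->|[_ km _]] := cut_sub_cases x nm; first by rewrite eqxx.
by case: (keep1P km).
Qed.

Let cut_boxed n : (\int[leb]_xi (nsq (fourier (cut n) xi))%:E = \int[leb]_x (nsq (cut n x))%:E)%E.
Proof.
apply: (@plancherel_boxed _ _ (cut n) n%:R n) => // x.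
  have /orP[/eqP kn|/eqP kn] := keep01 n x.
    by rewrite /cut kn mul0r ComplexField.Normc.normc0.
  by rewrite /cut kn mul1r; case: (keep1P kn).
have /orP[/eqP kn|/eqP kn] := keep01 n x; first by rewrite /cut kn mul0r eqxx.
by case: (keep1P kn).
Qed.

Let cut_cvg xi : nsq (fourier (cut n) xi - fourier v xi) @[n --> \oo] --> (0 : R).
Proof.
have L1c := L1fun_char xi L1v.
rewrite (_ : (fun n => _) = (fun n => nsq (cintegral leb (fun x => ee (- tdot x xi) * cut n x) -
    cintegral leb (fun x => ee (- tdot x xi) * v x)))); last first.
  by apply/funext => n; rewrite !fourierE.
apply: (cintegral_cvg (F := fun n x => ee (- tdot x xi) * cut n x)) => //.
- by move=> n; apply: cmeasM => //; exact: cmeas_char.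
- move=> n x; rewrite !normc_eeM /cut -[leRHS]mul1r; apply: normcM_le => //.
  by rewrite normc_real /keep ?ler0n// lern1 leq_b1.
- move=> x; have [N hN] := keep_ev x; exists N => n Nn.
  by rewrite /cut hN// mul1r.
Qed.

(** Plancherel holds for the differences cut (m + n) - cut n, all dominated by v - cut n; their
    transforms converge pointwise as m grows, and Fatou passes to the limit. *)
Let cut_tail n : (\int[leb]_xi (nsq (fourier v xi - fourier (cut n) xi))%:E <=
  \int[leb]_x (nsq (v x - cut n x))%:E)%E.
Proof.
pose f m xi := (nsq (fourier (cut (m + n)) xi - fourier (cut n) xi))%:E.
have mf m : measurable_fun setT (f m).
  by apply: emeasurable_nsq; apply: cmeasB; exact: cmeas_fourier.
have f0 m xi : (0 <= f m xi)%E by rewrite lee_fin nsq_ge0.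
have fc xi : f m xi @[m --> \oo] --> (nsq (fourier v xi - fourier (cut n) xi))%:E.
  apply: cvg_EFin; first exact: nearW.
  have cs : nsq (fourier (cut (m + n)) xi - fourier v xi) @[m --> \oo] --> (0 : R).
    exact: (cvg_comp _ _ (@cvg_addnr n) (@cut_cvg xi)).
  exact: nsq_cvg cs.
have := @fatou _ _ _ leb _ measurableT f mf (fun m xi _ => f0 m xi).
have -> : (\int[leb]_xi limn_einf (f^~ xi) = \int[leb]_xi (nsq (fourier v xi - fourier (cut n) xi))%:E)%E.
  by apply: eq_integral => xi _; rewrite (cvg_limn_einf_sup (fc xi)).1.
move=> h; apply: le_trans h _.
have bound m : (\int[leb]_xi f m xi <= \int[leb]_x (nsq (v x - cut n x))%:E)%E.
  rewrite /f sub_boxed ?leq_addl//; apply: ge0_int_le => //.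
  - by apply: measurable_nsq; exact: cmeasB.
  - by apply: measurable_nsq; exact: cmeasB.
  - by move=> x; exact: nsq_ge0.
  move=> x _; have [->|[-> _ kn]] := cut_sub_cases x (leq_addl m n); first by rewrite nsq0 nsq_ge0.
  by rewrite /cut kn mul0r subr0.
rewrite limn_einf_lim; apply: lime_le; first exact: is_cvg_einfs.
near=> m; apply: le_trans (bound m).
by apply: ereal_inf_lbound; exists m => /=.
Unshelve. all: by end_near. Qed.

(* The cut-offs of v obey Plancherel exactly; the constant 2 absorbs the error
   of the cut-off, which Fatou's lemma controls on the Fourier side. *)
Lemma plancherel_le : (\int[leb]_x (nsq (v x))%:E <= 2%:E * \int[leb]_xi (nsq (fourier v xi))%:E)%E.
Proof.
have mFv := cmeas_fourier mv.
have mFc n := cmeas_fourier (mcut n).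
have n0 (f : V -> R[i]) x : 0 <= nsq (f x) by exact: nsq_ge0.
have mtail n : measurable_fun setT (fun x => nsq (v x - cut n x)) by apply: measurable_nsq; exact: cmeasB.
have split_n n : (\int[leb]_x (nsq (v x))%:E =
    \int[leb]_x (nsq (cut n x))%:E + \int[leb]_x (nsq (v x - cut n x))%:E)%E.
  rewrite -ge0_intD//; first apply: eq_integral => x _.
    rewrite /cut; have /orP[/eqP ->|/eqP ->] := keep01 n x.
      by rewrite mul0r nsq0 subr0 add0r.
    by rewrite mul1r subrr nsq0 addr0.
  - exact: measurable_nsq.
  - by move=> x; exact: nsq_ge0.
have bnd n : (\int[leb]_x (nsq (cut n x))%:E <= 2%:E * \int[leb]_xi (nsq (fourier v xi))%:E +
    2%:E * \int[leb]_x (nsq (v x - cut n x))%:E)%E.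
  rewrite -cut_boxed; apply: (@le_trans _ _ (2%:E * \int[leb]_xi (nsq (fourier v xi))%:E +
    2%:E * \int[leb]_xi (nsq (fourier v xi - fourier (cut n) xi))%:E)%E); last first.
    by apply: leeD => //; apply: lee_wpmul2l => //; exact: cut_tail.
  have := int_nsqD_le leb mFv (cmeasB (mFc n) mFv).
  have -> : (\int[leb]_x (nsq (fourier (cut n) x - fourier v x))%:E =
      \int[leb]_x (nsq (fourier v x - fourier (cut n) x))%:E)%E.
    by apply: eq_integral => x _; rewrite -nsqN opprB.
  by under eq_integral do rewrite addrC subrK.
apply/lee_addgt0Pr => e e0; have e3 : 0 < e / 3 by rewrite divr_gt0.
have h01 n x : 0 <= nsq (v x - cut n x) <= nsq (v x).
  rewrite nsq_ge0 /cut; have /orP[/eqP ->|/eqP ->] := keep01 n x.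
    by rewrite mul0r subr0 lexx.
  by rewrite mul1r subrr nsq0 nsq_ge0.
have hc x : nsq (v x - cut n x) @[n --> \oo] --> (0 : R).
  apply: (@cvg_trans _ ((fun=> 0 : R) @ \oo)); last exact: cvg_cst.
  have [N hN] := keep_ev x; apply: near_eq_cvg; exists N => // n /= Nn.
  by rewrite /cut hN// mul1r subrr nsq0.
have [N hN] := dominated_small mtail h01 (measurable_nsq mv) L2v hc e3.
rewrite (split_n N); have hn := ltW (hN N (leqnn _)).
apply: le_trans (leeD (bnd N) (lexx _)) _; rewrite -addeA leeD2l//.
apply: (@le_trans _ _ (2%:E * (e / 3)%:E + (e / 3)%:E)%E).
  by apply: leeD => //; exact: lee_wpmul2l.
by rewrite -EFinM -EFinD lee_fin; lra.
Qed.

End plancherel_inequality.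

Section translates_plancherel.
Context {R : realType} {l : nat}.
Local Notation V := (Rspace R l).
Local Notation leb := (lebesgue_tuple l).
Variables (k : 'I_l) (K M' N : nat).

Let mult (xi : V) : R[i] := fvp M' N K (tnth xi k) - 1.

Lemma L1fun_translates (u : V -> R[i]) : L1fun leb u -> L1fun leb (translates k K M' N u).
Proof.
move=> hu; apply: L1fun_sum => s; apply: L1fun_sum => s'; apply: L1funZ.
exact: L1fun_shift.
Qed.

Lemma fourier_translates u xi : L1fun leb u ->
  fourier (fun x => translates k K M' N u x - u x) xi = mult xi * fourier u xi.
Proof.
move=> hu; rewrite fourierB//; last exact: L1fun_translates.
rewrite /mult mulrBl mul1r; congr (_ - _).
have L1s t : L1fun leb (fun x => u (tadd x (pos k K t))) by exact: L1fun_shift.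
rewrite fourier_sum; last by move=> s; apply: L1fun_sum => s'; exact: L1funZ.
rewrite /fvp mulr_suml; apply: eq_bigr => s _.
rewrite fourier_sum; last by move=> s'; exact: L1funZ.
rewrite mulr_suml; apply: eq_bigr => s' _.
rewrite fourierZ// fourier_shift// mulrA; congr (_ * ee _ * _).
rewrite /pos /tdot (bigD1 k)//= big1 ?addr0 => [|i ik]; last first.
  by rewrite tnth_mktuple (negbTE ik) mul0r.
by rewrite tnth_mktuple eqxx rmorphB /=; ring.
Qed.

Lemma cmeas_mult : cmeasurable mult.
Proof.
apply: cmeasB; last exact: cmeas_cst.
apply: cmeas_sum => s; apply: cmeas_sum => s'; apply: cmeasM; first exact: cmeas_cst.
apply: cmeas_ee; apply: measurableT_comp => //.
apply: measurable_funM => //; apply: measurable_funM => //; exact: measurable_tnthR.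
Qed.

Lemma mult_bounded : exists2 D : R, 0 <= D & forall xi, nsq (mult xi) <= D.
Proof.
pose F : R := \sum_(s < N) \sum_(s' < N) normc (fvp_weight M' N (s%:Z - s'%:Z) : R[i]).
exists ((F + 1) ^+ 2); first exact: sqr_ge0.
move=> xi; have F0 : 0 <= F by apply: sumr_ge0 => s _; apply: sumr_ge0 => s' _; exact: normc_ge0.
rewrite -normc_le; last by rewrite addr_ge0.
apply: le_trans (normcB_le _ _) _; apply: lerD; last by rewrite normc_real.
apply: le_trans (normc_sum_le _ _) _; apply: ler_sum => s _.
apply: le_trans (normc_sum_le _ _) _; apply: ler_sum => s' _.
by rewrite mulrC normc_eeM.
Qed.

Lemma int_translatesB_le (f : V -> R[i]) (e : R) : cmeasurable f ->
  (\int[leb]_x (nsq (f x))%:E <= e%:E)%E ->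
  (\int[leb]_x (nsq (translates k K M' N f x - f x))%:E <= (2 * (fvp_energy M' N * e) + 2 * e)%:E)%E.
Proof.
move=> mf he; apply: le_trans (int_nsqD_le _ (cmeas_translates k K M' N mf) (cmeasN mf)) _.
rewrite [leRHS]EFinD; apply: leeD; rewrite [leRHS]EFinM; apply: lee_wpmul2l => //.
  exact: int_translates_le.
by under eq_integral do rewrite nsqN.
Qed.

Lemma L2_small (u : nat -> V -> R[i]) g (e : R) : 0 < e ->
  L2sqdist leb (u n) g @[n --> \oo] --> 0%E ->
  \forall n \near \oo, (\int[leb]_x (nsq (u n x - g x))%:E <= e%:E)%E.
Proof.
move=> e0 h; have := h _ (@nbhs_open_ereal_lt R 0 (fun=> e) e0).
by move=> hn; near=> n; apply: ltW; near: n.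
Unshelve. all: by end_near. Qed.

(** The multiplier identity needs integrable functions, so g is replaced by some u_n close to it on
    both sides. The constant 8 is 2 for this replacement, 2 from [plancherel_le], and 2 for
    returning from the transform of u_n to ghat. *)
Lemma translates_plancherel g ghat : L2_fourier g ghat ->
  (\int[leb]_x (nsq (translates k K M' N g x - g x))%:E <=
   8%:E * \int[leb]_xi (nsq (mult xi) * nsq (ghat xi))%:E)%E.
Proof.
move=> [[mg g2] [mh h2] [u [hu cu ch]]].
have [D D0 hD] := mult_bounded.
have mm := measurable_nsq cmeas_mult.
have W0 (f : V -> R[i]) x : 0 <= nsq (mult x) * nsq (f x) by exact: mulr_ge0 (nsq_ge0 _) (nsq_ge0 _).
have mW (f : V -> R[i]) : cmeasurable f -> measurable_fun setT (fun x => nsq (mult x) * nsq (f x)).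
  by move=> mf; apply: measurable_funM => //; exact: measurable_nsq.
set I := (\int[leb]_xi (nsq (mult xi) * nsq (ghat xi))%:E)%E.
have E0 : 0 <= fvp_energy M' N :> R.
  by apply: mulr_ge0 => //; apply: sumr_ge0 => s _; apply: sumr_ge0 => s' _; exact: nsq_ge0.
set E := fvp_energy M' N in E0.
(* The total coefficient of the error d: 8D on the frequency side, 4E + 4 from applying the
   translates to u_n - g. *)
pose tot := 8 * D + 4 * (E + 1).
have tot0 : 0 < tot by rewrite /tot; lra.
apply/lee_addgt0Pr => e e0; have e1 : 0 < e / tot by exact: divr_gt0.
have [n [an bn]] : exists n, (\int[leb]_x (nsq (u n x - g x))%:E <= (e / tot)%:E)%E /\
    (\int[leb]_x (nsq (fourier (u n) x - ghat x))%:E <= (e / tot)%:E)%E.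
  have := filterI (L2_small e1 cu) (L2_small e1 ch); case=> N0 _ hN0.
  by exists N0; apply: hN0 => /=.
move: an bn; set d := e / tot => an bn.
have [L1u [mu _]] := hu n; set un := u n in an bn L1u mu.
have mFu := cmeas_fourier mu.
have mw : cmeasurable (fun x => u n x - g x) by exact: cmeasB.
pose v (x : V) : R[i] := translates k K M' N un x - un x.
have mtr (f : V -> R[i]) : cmeasurable f -> cmeasurable (translates k K M' N f) by exact: cmeas_translates.
have mv : cmeasurable v by apply: cmeasB => //; exact: mtr.
have L1v : L1fun leb v.
  by have := L1funD (L1fun_translates L1u) (L1funZ (-1) L1u); congr (L1fun _); apply/funext => x; rewrite mulN1r.
pose w (x : V) : R[i] := un x - g x.
have bw : (\int[leb]_x (nsq (translates k K M' N w x - w x))%:E <= (2 * (E * d) + 2 * d)%:E)%E.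
  exact: int_translatesB_le.
have bFu : (\int[leb]_x (nsq (mult x) * nsq (fourier un x))%:E <= 2%:E * I + (2 * (D * d))%:E)%E.
  have mdf := cmeasB mFu mh.
  apply: (@le_trans _ _ (\int[leb]_x (2 * (nsq (mult x) * nsq (ghat x)) + 2 * (D * nsq (fourier un x - ghat x)))%:E)%E).
    apply: ge0_int_le => //; first exact: mW.
    - apply: measurable_funD; apply: measurable_funM => //; first exact: mW.
      by apply: measurable_funM => //; exact: measurable_nsq.
    move=> x _.
    have h1 : nsq (fourier un x) <= 2 * nsq (ghat x) + 2 * nsq (fourier un x - ghat x).
      by apply: le_trans (nsqD_le _ _); rewrite addrC subrK.
    have h3 := ler_wpM2l (nsq_ge0 (mult x)) h1.
    have h4 := ler_wpM2r (nsq_ge0 (fourier un x - ghat x)) (hD x).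
    move: h3 h4; clear; lra.
  have m1 := measurable_nsq mdf; have n1 x : 0 <= nsq (fourier un x - ghat x) by exact: nsq_ge0.
  have m2 : measurable_fun setT (fun x => D * nsq (fourier un x - ghat x)) by exact: measurable_funM.
  have n2 x : 0 <= D * nsq (fourier un x - ghat x) by exact: mulr_ge0 D0 (nsq_ge0 _).
  rewrite ge0_intD//; last 4 first.
  - by apply: measurable_funM => //; exact: mW.
  - exact: measurable_funM.
  - by move=> x; exact: mulr_ge0.
  - by move=> x; exact: mulr_ge0.
  rewrite (ge0_intZ _ measurableT (ler0n _ 2) (mW _ mh) (W0 _)) -/I.
  rewrite (ge0_intZ _ measurableT (ler0n _ 2) m2 n2) (ge0_intZ _ measurableT D0 m1 n1).
  by apply: leeD => //; rewrite [leRHS]EFinM; apply: lee_wpmul2l => //; rewrite EFinM; apply: lee_wpmul2l.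
have v2 : (\int[leb]_x (nsq (v x))%:E < +oo)%E.
  have [_ [_ u2]] := hu n.
  have [r r0 hr] : exists2 r : R, 0 <= r & (\int[leb]_x (nsq (un x))%:E <= r%:E)%E.
    have u0 : (0 <= \int[leb]_x (nsq (un x))%:E)%E by apply: int_ge0 => x; exact: nsq_ge0.
    have f : (\int[leb]_x (nsq (un x))%:E)%E \is a fin_num by rewrite ge0_fin_numE.
    by exists (fine (\int[leb]_x (nsq (un x))%:E)%E); rewrite ?fine_ge0// fineK.
  apply: (@le_lt_trans _ _ (2 * (E * r) + 2 * r)%:E); last exact: ltry.
  exact: int_translatesB_le.
have := plancherel_le L1v v2.
under [X in (_ <= 2%:E * X)%E]eq_integral do rewrite (fourier_translates _ L1u) nsqM.
move=> pv.
have split x : translates k K M' N g x - g x = v x + - (translates k K M' N w x - w x).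
  have -> : translates k K M' N w x = translates k K M' N un x - translates k K M' N g x.
    rewrite /translates -sumrB; apply: eq_bigr => s _.
    by rewrite -sumrB; apply: eq_bigr => s' _; rewrite mulrBr.
  by rewrite /v /w; ring.
have mww : cmeasurable (fun x => translates k K M' N w x - w x) by apply: cmeasB => //; exact: mtr.
under eq_integral do rewrite split.
apply: le_trans (int_nsqD_le _ mv (cmeasN mww)) _.
under [X in (_ + 2%:E * X <= _)%E]eq_integral do rewrite nsqN.
apply: (@le_trans _ _ (2%:E * (2%:E * (2%:E * I + (2 * (D * d))%:E)) + 2%:E * (2 * (E * d) + 2 * d)%:E)%E).
  apply: leeD; apply: lee_wpmul2l => //; apply: le_trans pv _; exact: lee_wpmul2l.
have I0 : (0 <= I)%E by apply: int_ge0 => x; exact: W0.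
have finI : I \is a fin_num.
  rewrite ge0_fin_numE// /I.
  apply: (@le_lt_trans _ _ (\int[leb]_x (D * nsq (ghat x))%:E)%E).
    apply: ge0_int_le => //; [exact: mW|by apply: measurable_funM => //; exact: measurable_nsq|].
    by move=> x _; apply: ler_wpM2r; [exact: nsq_ge0|exact: hD].
  rewrite ge0_intZ//; [|exact: measurable_nsq|by move=> x; exact: nsq_ge0].
  by rewrite lte_mul_pinfty.
move: finI; case: I I0 {bFu} => // r _ _.
rewrite -[leLHS]/((2 * (2 * (2 * r + 2 * (D * d))) + 2 * (2 * (E * d) + 2 * d))%:E) -[leRHS]/((8 * r + e)%:E) lee_fin.
have -> : e = d * tot by rewrite /d divfK// gt_eqF.
rewrite /tot; lra.
Qed.

End translates_plancherel.

(** * Summation over dyadic scales *)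

Section dyadic_scales.
Context {R : realType}.

(** A dyadic layer-cake formula: the powers 2^j with 2^(j+1) <= v add up to less than the largest
    such 2^(j+1). *)
Lemma sum_dyadic_le (v T : R) (J : nat) : 0 <= v -> 2 ^+ J <= T ->
  \sum_(j < J) 2 ^+ j * (2 ^+ j.+1 <= v)%R%:R <= Num.min v T.
Proof.
move=> v0 JT; apply: (@le_trans _ _ (Num.min v (2 ^+ J))); last first.
  by rewrite le_min !ge_min lexx JT orbT.
elim: J {JT} => [|J IH]; first by rewrite big_ord0 le_min v0 expr0 ler01.
have h : (2 : R) ^+ J.+1 = 2 ^+ J + 2 ^+ J by rewrite exprS mulr_natl mulr2n.
have p0 : 0 <= (2 : R) ^+ J by exact: exprn_ge0.
move: IH; rewrite big_ord_recr /= !le_min => /andP[h1 h2].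
have [hv|hv] := leP (2 ^+ J.+1) v; last by rewrite mulr0 addr0 h1 (le_trans h2)// h lerDl.
by rewrite mulr1 [X in _ && (_ <= X)]h lerD2r h2 andbT (le_trans _ hv)// h lerD2r.
Qed.

Lemma one_sub_powR_le (s : R) : 0 <= s -> 1 - 2 `^ (- s) <= s.
Proof.
move=> s0; have l2 : ln (2 : R) <= 1.
  by have := @le_ln1Dx R 1; rewrite -natr1 => -> //; lra.
have := expR_ge1Dx (- s * ln 2); rewrite /powR pnatr_eq0 /=.
have : s * ln 2 <= s * 1 by exact: ler_wpM2l.
lra.
Qed.

Lemma dyadic_bounds (T : R) : 2 <= T -> exists2 J : nat, (0 < J)%N & 2 ^+ J <= T < 2 ^+ J.+1.
Proof.
move=> T2; have T0 : 0 <= T by lra.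
pose m := Num.truncn T; have /andP[mT Tm] : m%:R <= T < m.+1%:R by exact: truncn_itv.
have m2 : (2 <= m)%N by rewrite -ltnS -(ltr_nat R); exact: le_lt_trans Tm.
have /andP[h1 h2] := trunc_log_bounds (isT : (1 < 2)%N) (ltnW m2).
exists (trunc_log 2 m); first by case: (trunc_log 2 m) h2 => //; rewrite expn1 ltnNge m2.
rewrite -!natrX (le_trans _ mT) ?ler_nat//=.
by apply: lt_le_trans Tm _; rewrite ler_nat.
Qed.

Section weighted_energy.
Variables (l : nat) (k : 'I_l) (f : Rspace R l -> R[i]) (p : R).
Local Notation V := (Rspace R l).
Local Notation leb := (lebesgue_tuple l).
Hypotheses (p1 : 1 <= p) (mf : cmeasurable f).
Let p0 : 0 < p. Proof. exact: lt_le_trans ltr01 p1. Qed.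

Lemma measurable_weight : measurable_fun setT (fun x : V => `|tnth x k : R| `^ p).
Proof.
apply: (measurableT_comp (measurable_realfun.measurable_powR p)).
by apply: measurableT_comp; [exact: normr_measurable|exact: measurable_tnthR].
Qed.

Lemma measurable_min_weight (T : R) : measurable_fun setT (fun x : V => Num.min (`|tnth x k : R| `^ p) T * nsq (f x)).
Proof.
apply: measurable_funM; last exact: measurable_nsq.
by apply: measurable_minr => //; exact: measurable_weight.
Qed.

(** The threshold |x_k| >= 2^((j+1)/p) reads |x_k|^p >= 2^(j+1), so [sum_dyadic_le] applies
    pointwise. *)
Lemma weighted_energy_ge (J : nat) (T : R) : 2 ^+ J <= T ->
  (\sum_(j < J) (2 ^+ j)%:E * tail_energy k f (2 `^ (j.+1%:R / p)) <=
   \int[leb]_x (Num.min (`|tnth x k : R| `^ p) T * nsq (f x))%:E)%E.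
Proof.
move=> JT.
have T0 : 0 <= T by apply: le_trans JT; exact: exprn_ge0.
have e0 (j : 'I_J) x : 0 <= (2 `^ (j.+1%:R / p) <= `|tnth x k : R|)%R%:R * nsq (f x).
  by exact: mulr_ge0 (ler0n _ _) (nsq_ge0 _).
have me (j : 'I_J) := measurable_tail k (2 `^ (j.+1%:R / p)) mf.
have n0 (j : 'I_J) : 0 <= (2 : R) ^+ j by exact: exprn_ge0.
rewrite (eq_bigr (fun j : 'I_J => \int[leb]_x (2 ^+ j * ((2 `^ (j.+1%:R / p) <= `|tnth x k : R|)%R%:R * nsq (f x)))%:E)%E); last first.
  by move=> j _; rewrite (ge0_intZ leb measurableT (n0 j) (me j) (e0 j)).
rewrite -ge0_int_sum//; last 2 first.
- by move=> j; exact: measurable_funM.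
- by move=> j x; exact: mulr_ge0.
apply: ge0_int_le => //.
- by apply: measurable_sum => j; exact: measurable_funM.
- exact: measurable_min_weight.
- by move=> x; apply: sumr_ge0 => j _; exact: mulr_ge0.
move=> x _; under eq_bigr do rewrite mulrA.
rewrite -mulr_suml; apply: ler_wpM2r; first exact: nsq_ge0.
apply: le_trans (sum_dyadic_le (powR_ge0 _ _) JT).
apply: ler_sum => j _; apply: ler_wpM2l => //; rewrite ler_nat.
have [h|//] := leP; rewrite lt0b.
have h1 : (2 `^ (j.+1%:R / p)) `^ p <= `|tnth x k : R| `^ p.
  by apply: ge0_ler_powR; rewrite ?nnegrE ?powR_ge0// ltW.
by move: h1; rewrite -powRrM divfK ?gt_eqF// powR_mulrn// => ->.
Qed.

End weighted_energy.

Lemma dyadic_scale_product (c p q : R) (j : nat) : 0 < p -> 0 < q ->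
  2 ^+ j * (c / (2 `^ (j.+1%:R / p) * 2 `^ (j.+1%:R / q))) =
  c / 2 * 2 `^ ((1 - (p^-1 + q^-1)) * j.+1%:R).
Proof.
move=> p0 q0; have t0 : (2 : R) != 0 by rewrite pnatr_eq0.
have D (r s : R) : (2 : R) `^ (r + s) = 2 `^ r * 2 `^ s by rewrite powRD// t0 implybT.
rewrite -D -mulrDr mulrBl mul1r D powR_mulrn// [_ * j.+1%:R]mulrC powRN exprS.
by field; rewrite gt_eqF ?powR_gt0.
Qed.

Lemma energy_sum_ge (c : R) (l : nat) (g ghat : Rspace R l -> R[i]) (k : 'I_l) (p q : R) :
  1 <= p -> 1 <= q -> cmeasurable g -> cmeasurable ghat ->
  (forall Q P : R, 1 <= Q -> 1 <= P ->
    ((c / (Q * P))%:E <= tail_energy k g Q + tail_energy k ghat P)%E) ->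
  forall (J : nat) (T : R), 2 ^+ J <= T ->
  ((c / 2 * \sum_(j < J) 2 `^ ((1 - (p^-1 + q^-1)) * j.+1%:R))%:E <=
    (\int[lebesgue_tuple l]_x (Num.min (`|tnth x k : R| `^ p) T * nsq (g x))%:E) +
    (\int[lebesgue_tuple l]_xi (Num.min (`|tnth xi k : R| `^ q) T * nsq (ghat xi))%:E))%E.
Proof.
move=> p1 q1 mg mh bl J T JT.
have p0 : 0 < p by lra. have q0 : 0 < q by lra.
apply: le_trans (leeD (weighted_energy_ge k p1 mg JT) (weighted_energy_ge k q1 mh JT)).
rewrite -big_split /= mulr_sumr -sumEFin; apply: lee_sum => j _.
rewrite -dyadic_scale_product// EFinM -ge0_muleDr; last 2 first.
- by apply: int_ge0 => x; exact: mulr_ge0 (ler0n _ _) (nsq_ge0 _).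
- by apply: int_ge0 => x; exact: mulr_ge0 (ler0n _ _) (nsq_ge0 _).
apply: lee_wpmul2l; first by rewrite lee_fin exprn_ge0.
have one (r : R) : 0 < r -> 1 <= 2 `^ (j.+1%:R / r).
  by move=> r0; rewrite -[leLHS](powRr0 2) ler_powR// ?ler1n// divr_ge0// ltW.
by apply: bl; exact: one.
Qed.

(** The last scale alone suffices: T^s <= 2^(s(J+1)) <= 2 * 2^(sJ), while (1 - 2^(-s))/s <= 1. *)
Lemma dyadic_sum_subcritical (s T : R) (J : nat) : 0 < s <= 1 -> 0 <= T -> (0 < J)%N -> T < 2 ^+ J.+1 ->
  (1 - 2 `^ (- s)) / s * T `^ s <= 4 * \sum_(j < J) 2 `^ (s * j.+1%:R).
Proof.
move=> /andP[s0 s1] T0 J0 TJ; have t0 : (2 : R) != 0 by rewrite pnatr_eq0.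
have S : 2 `^ (s * J%:R) <= \sum_(j < J) 2 `^ (s * j.+1%:R).
  case: J J0 {TJ} => // J _; rewrite big_ord_recr /= lerDr.
  by apply: sumr_ge0 => j _; exact: powR_ge0.
have h1 : T `^ s <= 2 * 2 `^ (s * J%:R).
  apply: (@le_trans _ _ ((2 ^+ J.+1) `^ s)).
    by apply: ge0_ler_powR; rewrite ?nnegrE ?exprn_ge0// ltW.
  have -> : (2 ^+ J.+1) `^ s = 2 `^ s * 2 `^ (s * J%:R).
    by rewrite -(powR_mulrn J.+1)// -powRrM -powRD ?t0 ?implybT// -(natr1 J); congr powR; ring.
  apply: ler_wpM2r; first exact: powR_ge0.
  by rewrite -[leRHS](@powRr1 _ 2)//; apply: ler_powR; rewrite ?ler1n.
have hT : 0 <= T `^ s by exact: powR_ge0.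
have h3 : (1 - 2 `^ (- s)) / s * T `^ s <= T `^ s.
  by rewrite ler_piMl// ler_pdivrMr// mul1r one_sub_powR_le// ltW.
have S0 : 0 <= \sum_(j < J) 2 `^ (s * j.+1%:R) by apply: sumr_ge0 => j _; exact: powR_ge0.
lra.
Qed.

Lemma ln_lt_dyadic (T : R) (J : nat) : 0 < T -> (0 < J)%N -> T < 2 ^+ J.+1 -> ln T <= 4 * J%:R.
Proof.
move=> T0 J0 TJ; have l2 : ln (2 : R) <= 1 by have := @le_ln1Dx R 1; rewrite -natr1 => -> //; lra.
apply: (@le_trans _ _ J.+1%:R); last by rewrite -natrM ler_nat; lia.
apply: (@le_trans _ _ (ln (2 ^+ J.+1))); first by rewrite ler_ln ?posrE ?exprn_gt0// ltW.
by rewrite lnXn// -[ln 2 *+ _]mulr_natr ler_piMl.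
Qed.

(** About 1/e scales carry half of the geometric series: r^n <= 1/2 and r >= 1/2 give r (1 - r^n) >=
    1/4, and dividing by 1 - r <= e yields 1/(4e). *)
Lemma dyadic_sum_supercritical (e : R) : 0 < e <= 1 ->
  exists n : nat, 1 <= 4 * e * \sum_(j < n) 2 `^ (- e * j.+1%:R).
Proof.
move=> /andP[e0 e1]; pose n := (Num.truncn e^-1).+1; exists n.
have ne : 1 <= e * n%:R by rewrite -ler_pdivrMl// mulr1; exact/ltW/truncnS_gt.
pose r : R := 2 `^ (- e).
have r0 : 0 < r by exact: powR_gt0.
have rn (m : nat) : 2 `^ (- e * m%:R) = r ^+ m by rewrite powRrM powR_mulrn// ltW.
have hr : r ^+ n <= 2^-1.
  rewrite -rn -powR_inv1// ; apply: ler_powR; first by rewrite ler1n.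
  by rewrite mulNr lerN2.
have r12 : 2^-1 <= r by rewrite /r -powR_inv1// ler_powR ?ler1n// lerN2.
under eq_bigr do rewrite rn.
have geo : (1 - r) * \sum_(j < n) r ^+ j.+1 = r * (1 - r ^+ n).
  under eq_bigr do rewrite exprS.
  by rewrite -mulr_sumr mulrCA -opprB mulNr -subrX1 opprB.
have h1 : 1 - r <= e by exact: one_sub_powR_le (ltW e0).
have sp : 0 <= \sum_(j < n) r ^+ j.+1 by apply: sumr_ge0 => j _; rewrite exprn_ge0 ?ltW.
have := ler_wpM2r sp h1; rewrite geo.
have : 2^-1 * 2^-1 <= r * (1 - r ^+ n) by apply: ler_pM => //; lra.
lra.
Qed.

End dyadic_scales.

Theorem theorem1p12 (R : realType) (A B : R) :
  exists C : R, 0 < C /\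
  forall (l : nat) (p q : R) (g ghat : Rspace R l -> R[i]),
    1 <= p -> 1 <= q ->
    L2fun (lebesgue_tuple l) g ->
    L2_fourier g ghat ->
    L2_riesz_basis (lebesgue_tuple l) (gabor g) A B ->
    let tau := p^-1 + q^-1 in
    forall (k : 'I_l) (T : R), 2 <= T ->
    [/\ tau < 1 ->
        ((C * (1 - 2 `^ (tau - 1)) / (1 - tau) * T `^ (1 - tau))%:E <=
         (\int[lebesgue_tuple l]_x
           (Num.min (`|tnth x k : R| `^ p) T * normc (g x) ^+ 2)%:E) +
         (\int[lebesgue_tuple l]_xi
           (Num.min (`|tnth xi k : R| `^ q) T * normc (ghat xi) ^+ 2)%:E))%E,
        tau = 1 ->
        ((C * ln T)%:E <=
         (\int[lebesgue_tuple l]_x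
           (Num.min (`|tnth x k : R| `^ p) T * normc (g x) ^+ 2)%:E) +
         (\int[lebesgue_tuple l]_xi
           (Num.min (`|tnth xi k : R| `^ q) T * normc (ghat xi) ^+ 2)%:E))%E &
        1 < tau ->
        ((C / (tau - 1))%:E <=
         (\int[lebesgue_tuple l]_x
           (`|tnth x k : R| `^ p * normc (g x) ^+ 2)%:E) +
         (\int[lebesgue_tuple l]_xi
           (`|tnth xi k : R| `^ q * normc (ghat xi) ^+ 2)%:E))%E].
Proof.
(* C is chosen before g. If A and B are not ordered positive numbers, no Riesz basis has these
   bounds and any C will do. *)
have [/andP[A0 AB]|nAB] := boolP ((0 < A) && (A <= B)); last first.
  exists 1; split=> [|l p q g ghat _ _ _ _ [_ _ A0 AB _]]; first exact: ltr01.
  by case/negP: nAB; rewrite A0 AB.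
have [c c0 bl] := balian_low A0 (lt_le_trans A0 AB).
exists (c / 8); split=> [|l p q g ghat p1 q1 [mg g2] Fg rb tau k T T2]; first exact: divr_gt0.
have [_ [mh gh2] _] := Fg.
have rf := riesz_basis_finite mg rb.
have plan K M' N : (0 < K)%N -> _ := fun _ => @translates_plancherel _ _ k K M' N _ _ Fg.
have {}bl := energy_sum_ge p1 q1 mg mh (bl l g ghat k mg g2 mh gh2 rf plan).
rewrite -/tau in bl.
have [J J0 /andP[JT TJ]] := dyadic_bounds T2.
have T0 : 0 < T by exact: lt_le_trans T2.
have [/andP[ip0 ip1] /andP[iq0 iq1]] : (0 < p^-1 <= 1) /\ (0 < q^-1 <= 1).
  by rewrite !invr_gt0 !invf_le1 ?p1 ?q1 ?(lt_le_trans ltr01)//.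
split=> ht.
- apply: le_trans (bl _ _ JT); rewrite lee_fin.
  have s1 : 0 < 1 - tau <= 1 by rewrite /tau; move: ht; rewrite /tau => ht; apply/andP; split; lra.
  have := dyadic_sum_subcritical s1 (ltW T0) J0 TJ; rewrite opprB => h.
  move: h; set S := \sum_(j < J) _; set X := 1 - _; set Y := T `^ _ => h.
  have -> : c / 8 * X / (1 - tau) * Y = c / 8 * (X / (1 - tau) * Y) by rewrite !mulrA.
  have -> : c / 2 * S = c / 8 * (4 * S) by field.
  by apply: ler_wpM2l => //; exact/ltW/divr_gt0.
(* At the critical exponent every scale contributes equally, so the sum is J, comparable to log
   T. *)
- apply: le_trans (bl _ _ JT); rewrite lee_fin ht subrr.
  under eq_bigr do rewrite mul0r powRr0.
  rewrite sumr_const card_ord.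
  have -> : c / 2 * J%:R = c / 8 * (4 * J%:R) by field.
  by apply: ler_wpM2l; [exact/ltW/divr_gt0|exact: ln_lt_dyadic].
have e1 : 0 < tau - 1 <= 1 by rewrite /tau; move: ht; rewrite /tau => ht; apply/andP; split; lra.
have [n hn] := dyadic_sum_supercritical e1.
(* The untruncated weight dominates every truncation, so the level 2^n can be adapted to tau - 1
   instead of the given T. *)
have wint (f : Rspace R l -> R[i]) (a : R) : 1 <= a -> cmeasurable f ->
    (\int[lebesgue_tuple l]_x (Num.min (`|tnth x k : R| `^ a) (2 ^+ n) * nsq (f x))%:E <=
     \int[lebesgue_tuple l]_x (`|tnth x k : R| `^ a * nsq (f x))%:E)%E.
  move=> a1 mf; apply: ge0_int_le => //.
  - exact: measurable_min_weight.
  - by apply: measurable_funM; [exact: measurable_weight|exact: measurable_nsq].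
  - move=> x; apply: mulr_ge0 (nsq_ge0 _); by rewrite le_min powR_ge0 exprn_ge0.
  - by move=> x _; apply: ler_wpM2r; rewrite ?nsq_ge0// ge_min lexx.
apply: le_trans (leeD (wint g p p1 mg) (wint ghat q q1 mh)).
apply: le_trans (bl _ _ (lexx _)); rewrite lee_fin -(opprB tau 1).
move: e1 hn; set e := tau - 1; set S := \sum_(j < n) _ => /andP[e0 _] hn.
rewrite ler_pdivrMr//; have -> : c / 2 * S * e = c / 8 * (4 * e * S) by field.
by rewrite ler_peMr// ltW// divr_gt0.
Qed.
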